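(* For every real $\theta<\frac34$ there exists $\epsilon>0$ (depending only on $\theta$) such that for every $F\in\mathrm{Ker}(\mathbf L+3\,\mathbf{Id})$ (an element of the third Wiener chaos) with $\mathbb E(F^2)=1$, $$\kappa_4(F)<\epsilon\quad\Longrightarrow\quad\frac{1}{\Gamma[F,F]^{\theta}}\in L^1(\Omega,\mathcal F,\mathbb P).$$
   Context: Let $(X_i)_{i\ge1}$ be an i.i.d. sequence of standard Gaussian random variables on a probability space $(\Omega,\mathcal F,\mathbb P)$ with $\mathcal F=\sigma(X_i; i\ge 1)$. The Ornstein–Uhlenbeck operator $\mathbf L$ is (the closure in $L^2$ of) the operator acting on smooth functions of finitely many $X_i$ by $$\mathbf L[f(X_1,\dots,X_d)]=\Delta f(X_1,\dots,X_d)-\sum_{i=1}^d X_i\,\partial_i f(X_1,\dots,X_d),$$ and the square field operator $\Gamma$ (the squared norm of the Malliavin derivative) is the (closed extension of the) quadratic operator $$\Gamma[f(X_1,\dots,X_d),f(X_1,\dots,X_d)]=\sum_{i=1}^d \big(\partial_i f(X_1,\dots,X_d)\big)^2 .$$ For an integer $k\ge1$, the $k$-th Wiener chaos is $\mathrm{Ker}(\mathbf L+k\,\mathbf{Id})\subset L^2(\Omega,\mathcal F,\mathbb P)$, equivalently the closed linear span in $L^2$ of the products $\prod_i H_{k_i}(X_i)$ with $\sum_i k_i=k$, where $H_m$ is the $m$-th Hermite polynomial. For $F$ in a Wiener chaos, $\Gamma[F,F]=\sum_{i\ge1}(D_iF)^2$, where $D_i$ is the closure of the partial derivative with respect to $X_i$.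 For $F$ in such a chaos with $\mathbb E(F^2)=1$, the fourth cumulant is $\kappa_4(F)=\mathbb E(F^4)-3$. *)

(* Defs.v *)
From HB Require Import structures.
From mathcomp Require Import all_boot all_order all_algebra finmap.
From mathcomp Require Import all_classical all_reals all_analysis.

Set Implicit Arguments.
Unset Strict Implicit.
Unset Printing Implicit Defensive.

Import Order.TTheory GRing.Theory Num.Theory.
Import numFieldNormedType.Exports.

Local Open Scope classical_set_scope.
Local Open Scope ring_scope.

Section SmoothFunctions.
Context {R : realType} {n : nat}.
Implicit Types (f : 'rV[R]_n -> R) (i : 'I_n) (x : 'rV[R]_n).

Definition partial i f : 'rV[R]_n -> R := fun x => 'D_(delta_mx 0 i) f x.

Definition iter_partial (s : seq 'I_n) f : 'rV[R]_n -> R := foldr partial f s.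

(* C^oo functions all of whose partial derivatives (of every order, 0 included)
   have at most polynomial growth, so that everything below is square
   integrable for the Gaussian measure. *)
Definition smooth f := forall s : seq 'I_n,
  [/\ continuous (iter_partial s f),
      forall i x, derivable (iter_partial s f) x (delta_mx 0 i) &
      exists (C : R) (N : nat),
        forall x, `|iter_partial s f x| <= C * (1 + `|x|) ^+ N].

Definition ornstein_uhlenbeck f : 'rV[R]_n -> R := fun x =>
  \sum_(i < n) partial i (partial i f) x - \sum_(i < n) x 0 i * partial i f x.

(* The derivative along the k-th coordinate of R^oo of a function of the first
   n coordinates; it vanishes when k is not one of those. *)
Definition partial_nat (k : nat) f : 'rV[R]_n -> R := fun x =>
  if insub k is Some i then partial i f x else 0.

End SmoothFunctions.

Section WienerChaos.
Context {d : measure_display} {Omega : measurableType d} {R : realType}.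
Variable P : probability Omega R.
Implicit Types (X : nat -> {RV P >-> R}) (F G : Omega -> R).

Definition mutually_independent X :=
  forall (I : {fset nat}) (B : nat -> set R), (forall i, measurable (B i)) ->
    P (\bigcap_(i in [set` I]) (X i @^-1` B i)) =
    (\prod_(i <- I) P (X i @^-1` B i))%E.

Definition iid_standard_gaussian X :=
  mutually_independent X /\
  forall i (A : set R), measurable A ->
    distribution P (X i) A = normal_prob 0 1 A.

Definition generates_sigma_algebra X :=
  @measurable d Omega =
  <<s \bigcup_i preimage_set_system [set: Omega] (X i) measurable >>.

Definition coordinates X n (w : Omega) : 'rV[R]_n := \row_(i < n) X i w.

Definition cvg_L2 (U : nat -> Omega -> R) F :=
  'N[P]_2%:E[(fun w => (U k w - F w)%:E)]%E @[k --> \oo] --> 0%E.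

(* (F, G) is in the L^2-closure of the graph of the operator mapping f(X) to
   (T n f)(X), where f runs over the smooth functions of n variables, n >= 0. *)
Definition closure_L2
    (T : forall n, ('rV[R]_n -> R) -> ('rV[R]_n -> R)) X F G :=
  [/\ F \in Lfun P 2%:E, G \in Lfun P 2%:E &
    exists (n : nat -> nat) (f : forall k, 'rV[R]_(n k) -> R),
      [/\ forall k, smooth (f k),
          cvg_L2 (fun k => f k \o coordinates X (n k)) F &
          cvg_L2 (fun k => T (n k) (f k) \o coordinates X (n k)) G]].

(* L is the L^2-closure, given by its graph: is_OU X F G means that F is in
   the domain and that G is a representative of L F. *)
Definition is_OU X F G := closure_L2 (@ornstein_uhlenbeck R) X F G.

(* Ker (L + k Id), on representatives *)
Definition wiener_chaos X (k : nat) F :=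
  exists2 G, is_OU X F G & {ae P, forall w, G w + k%:R * F w = 0}.

(* A representative of D_i F, which is unique up to P-a.s. equality as the
   partial derivatives are closable; it is 0 if F is not in the domain. *)
Definition malliavinD X (i : nat) F : Omega -> R :=
  xget (fun=> 0) [set G | closure_L2 (fun n => @partial_nat R n i) X F G].

Definition Gamma X F (w : Omega) : \bar R :=
  (\sum_(i <oo) (malliavinD X i F w ^+ 2)%:E)%E.

(* The fourth cumulant of a centered F such that E[F^2] = 1 *)
Definition kappa4 F : \bar R := ('E_P[fun w => (F w ^+ 4)%R] - 3%:E)%E.

End WienerChaos.

(* 1 / x^theta for 0 <= x <= +oo, with 1 / 0 = +oo and 1 / +oo = 0.  The case
   theta <= 0 is separate because the library sets 0 `^ r = 0 and
   +oo `^ r = +oo for r < 0. *)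
Definition inv_power {R : realType} (x : \bar R) (theta : R) : \bar R :=
  (if (theta <= 0)%R then x `^ (- theta)%R else (x `^ theta)^-1)%E.

(* Main.v *)
Require Import Defs.
From HB Require Import structures.
From mathcomp Require Import all_boot all_order all_algebra finmap.
From mathcomp Require Import all_classical all_reals all_analysis.
From mathcomp Require Import measurable_realfun complex ring lra zify.

(* Let F^l be the projection of F on the functions of X_1, ..., X_l, a cubic
   Hermite form with symmetric tensor a^l.  Then F^l -> F and D_i F^l -> D_i F in
   L^2, so it suffices to bound P(sum_(i < m) (D_i F^l)^2 <= t) uniformly in l for
   a well chosen m.  The quadratic forms D_i F^l have matrices A_i = a^l(i, ., .).
   For a unit vector v, 8 (E (D_v S)^2)^2 <= 3 E S^4 - 9 (E S^2)^2 with S = F^l, so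
   a small fourth cumulant makes all contractions a(v, ., .) small although the
   norm of a is bounded below: some contraction A_g = sum_i g_i A_i must have rank
   at least N.  The indicator of sum_i q_i^2 <= xi^-2 is dominated by a Gaussian
   average over G of cos (xi sum_i G_i q_i); decoupling bounds its expectation by
   (xi^N |det|)^(-1/2) for an N x N minor of A_G, which is rarely small because it
   is a polynomial in G with the nonzero minor of A_g as leading coefficient.  This
   gives P(Gamma <= z^(8 N)) = O(z^(6 N - 15)), whose exponent ratio tends to 3/4.
   For theta <= 0 the moments of Gamma are bounded by hypercontractivity. *)

Set Implicit Arguments.
Unset Strict Implicit.
Unset Printing Implicit Defensive.

Import Order.TTheory GRing.Theory Num.Theory.
Import numFieldNormedType.Exports.

Local Open Scope classical_set_scope.
Local Open Scope ring_scope.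

(** * Gaussian integrals on the line *)

(** The exponent 3/4 is a trade-off. Put xi = z^(-4N), so that Gamma <= z^(8N) is the natural event
    at frequency xi. Where the minor of A_G exceeds h^N, with h about xi^(-1), the oscillatory
    integral is O(z^(6N)). The minor is smaller than that with probability O(h), about z^(4N), and
    the trivial bound 1 on this bad event would only give the ratio 1/2. There one large entry of
    the row e A_G, for a fixed vector e, is used instead: it gains xi^(-1/2) = z^(2N), and z^(4N)
    z^(2N) = z^(6N) up to the loss of 15.

    Uniformity in l holds because all tensors a^l are restrictions of one infinite tensor: a nonzero
    minor found at level m survives at every level l >= m. Hence epsilon depends on N only, while
    the other constants may depend on F.

    Membership in the chaos only provides smooth approximations of F, so that the projections of F
    are cubic forms has to be proved: the difference is a weak solution of the eigenvalue equation
    orthogonal to cubic forms, and a Fourier argument makes it orthogonal to all functions of the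
    first n coordinates that are continuous with polynomial growth. *)

Section RealIntegral.
Context d (T : measurableType d) (R : realType) (mu : {measure set T -> \bar R}).
Implicit Types f g : T -> R.

Lemma le_integrableR f g : measurable_fun setT f -> (forall x, `|f x| <= `|g x|) ->
  mu.-integrable setT (EFin \o g) -> mu.-integrable setT (EFin \o f).
Proof.
move=> mf fg; apply: le_integrable => //; first exact/measurable_EFinP.
by move=> x _ /=; rewrite lee_fin.
Qed.

Lemma measurable_integrable f : mu.-integrable setT (EFin \o f) ->
  measurable_fun setT f.
Proof. by move=> /measurable_int/measurable_EFinP. Qed.

Lemma integrable_norm f : mu.-integrable setT (EFin \o f) ->
  mu.-integrable setT (EFin \o (fun x => `|f x|)).
Proof.
move=> fi; apply: (le_integrableR _ _ fi) => [|x]; last by rewrite normr_id.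
by apply: measurableT_comp => //; exact: measurable_integrable.
Qed.

Lemma EFin_Rintegral f : mu.-integrable setT (EFin \o f) ->
  ((\int[mu]_x f x)%:E = \int[mu]_x (f x)%:E)%E.
Proof. by move=> fi; rewrite /Rintegral fineK//; exact: integrable_fin_num. Qed.

Lemma cvg_Rintegral (f_ : nat -> T -> R) f g :
  (forall n, measurable_fun setT (f_ n)) -> measurable_fun setT f ->
  (forall x, f_ n x @[n --> \oo] --> f x) -> (forall n x, `|f_ n x| <= g x) ->
  mu.-integrable setT (EFin \o g) ->
  \int[mu]_x f_ n x @[n --> \oo] --> \int[mu]_x f x.
Proof.
move=> mf_ mf ff fg gi.
have [|||||fi _ h] := @dominated_convergence _ _ _ mu _ measurableT
  (fun n x => (f_ n x)%:E) (fun x => (f x)%:E) (EFin \o g).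
- by move=> n; exact/measurable_EFinP.
- exact/measurable_EFinP.
- by apply: aeW => x _; apply: cvg_EFin; [exact: nearW|exact: ff].
- exact: gi.
- by apply: aeW => x n _; rewrite /= lee_fin.
by apply: fine_cvg; rewrite EFin_Rintegral.
Qed.

End RealIntegral.

Lemma Rintegral_cst_probability d (T : measurableType d) (R : realType)
  (P : probability T R) (c : R) : \int[P]_x c = c.
Proof. by rewrite /Rintegral integral_cst// [X in (_ * X)%E]probability_setT mule1. Qed.

Section Density.
Context d (T : measurableType d) (R : realType).
Import HBNNSimple.

(** The usual extension from indicators to simple functions to monotone limits. *)
Lemma ge0_integral_density (mu nu : {measure set T -> \bar R}) (h : T -> R)
    (f : T -> \bar R) :
  measurable_fun setT h -> (forall x, 0 <= h x) ->
  (forall A, measurable A -> nu A = \int[mu]_(x in A) (h x)%:E)%E ->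
  measurable_fun setT f -> (forall x, 0 <= f x)%E ->
  (\int[nu]_x f x = \int[mu]_x (f x * (h x)%:E))%E.
Proof.
move=> mh0 h0 nuE mf f0.
have mh : measurable_fun setT (fun x => (h x)%:E) by exact/measurable_EFinP.
have eh0 x : (0 <= (h x)%:E)%E by rewrite lee_fin.
have hind (E : set T) : measurable E ->
    (\int[nu]_x (\1_E x)%:E = \int[mu]_x ((\1_E x)%:E * (h x)%:E))%E.
  move=> mE; rewrite integral_indic//= setIT nuE// integral_mkcond.
  by apply: eq_integral => x _; rewrite patchE indicE; case: ifPn => _;
    rewrite ?mul1e ?mul0e.
have hs (g : {nnsfun T >-> R}) :
    (\int[nu]_x (g x)%:E = \int[mu]_x ((g x)%:E * (h x)%:E))%E.
  under eq_integral do rewrite fimfunE -fsumEFin//.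
  rewrite ge0_integral_fsum//; last 2 first.
  - by move=> r; exact/measurable_EFinP/measurableT_comp.
  - by move=> n x _; rewrite EFinM nnfun_muleindic_ge0.
  under [RHS]eq_integral.
    move=> x _; rewrite fimfunE -fsumEFin// ge0_mule_fsuml; last first.
      by move=> r; rewrite EFinM nnfun_muleindic_ge0.
    over.
  rewrite ge0_integral_fsum//; last 2 first.
  - by move=> r; apply: emeasurable_funM => //; exact/measurable_EFinP/measurableT_comp.
  - by move=> n x _; rewrite mule_ge0// EFinM nnfun_muleindic_ge0.
  apply: eq_fsbigr => r _; rewrite integralZl_indic_nnsfun//= hind//.
  have [r0|r0] := leP 0 r.
    rewrite -ge0_integralZl//.
    - by apply: eq_integral => x _; rewrite EFinM muleA.
    - by apply: emeasurable_funM => //; apply/measurable_EFinP/measurable_indic.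
    - by move=> x _; rewrite mule_ge0// lee_fin.
  rewrite preimage_nnfun0// !integral0_eq ?mule0// => x _.
  - by rewrite indicE in_set0 mulr0 mul0e.
  - by rewrite indicE in_set0 mul0e.
pose f_ := nnsfun_approx measurableT mf.
transitivity (lim (\int[nu]_x (f_ n x)%:E @[n --> \oo])%E).
  rewrite -monotone_convergence//=.
  - apply: eq_integral => x _; apply/esym/cvg_lim => //=.
    exact: cvg_nnsfun_approx.
  - by move=> n; exact/measurable_EFinP/measurable_funTS.
  - by move=> n x _; rewrite lee_fin.
  - by move=> x _ m n mn; rewrite lee_fin; exact/lefP/nd_nnsfun_approx.
under eq_fun do rewrite hs.
rewrite -monotone_convergence//=.
- apply: eq_integral => x _; apply/cvg_lim => //=.
  by apply: cvgeMr => //; exact: cvg_nnsfun_approx.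
- by move=> n; apply: emeasurable_funM => //; exact/measurable_EFinP/measurable_funTS.
- by move=> n x _; rewrite mule_ge0// lee_fin.
- move=> x _ m n mn; rewrite lee_wpmul2r// lee_fin.
  exact/lefP/nd_nnsfun_approx.
Qed.

End Density.

Section Gaussian1.
Context {R : realType}.
Local Notation mu := (@lebesgue_measure R).
Local Notation gam := (@normal_prob R 0 1).
Local Notation phi := (@normal_pdf R 0 1).

Lemma ge0_integral_normal_prob (f : R -> \bar R) :
  measurable_fun [set: R] f -> (forall x, 0 <= f x)%E ->
  (\int[gam]_x f x = \int[mu]_x (f x * (phi x)%:E))%E.
Proof.
move=> mf f0; apply: ge0_integral_density => //.
- exact: measurable_normal_pdf.
- by move=> x; exact: normal_pdf_ge0.
Qed.

Lemma normal_pdf01E x : phi x = normal_peak 1 * expR (- (x ^+ 2 / 2)).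
Proof.
by rewrite normal_pdfE ?oner_neq0// /normal_fun subr0 expr1n mulNr.
Qed.

Lemma normal_peak1_gt0 : 0 < normal_peak 1 :> R.
Proof. by apply: normal_peak_gt0; rewrite oner_neq0. Qed.

Lemma normal_peak1_le1 : normal_peak 1 <= 1 :> R.
Proof.
have p2 : 2 <= pi :> R := pi_ge2 R.
rewrite /normal_peak expr1n mul1r invf_le1; last by rewrite sqrtr_gt0 mulr2n; lra.
by rewrite -[leLHS]sqrtr1 ler_wsqrtr// mulr2n; lra.
Qed.

Definition poly_growth (f : R -> R) :=
  exists C (N : nat), forall x, `|f x| <= C * (1 + `|x|) ^+ N.

(** Half of the Gaussian decay is spent on the polynomial: [expR (x ^+ 2 / 4)] is an (N + 1)-st
    power, and by 1 + u <= exp u each factor dominates (1 + |x|)^2 up to a constant. The other half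
    keeps the product with the density integrable. *)
Lemma growth_expR (N : nat) :
  exists2 K : R, 0 < K & forall x : R, (1 + `|x|) ^+ N <= K * expR (x ^+ 2 / 4).
Proof.
exists ((N.+1%:R * 8) ^+ N.+1); first by rewrite exprn_gt0// mulr_gt0.
move=> x.
have x1 : 1 <= 1 + `|x| by rewrite lerDl.
apply: (@le_trans _ _ (((1 + `|x|) ^+ 2) ^+ N.+1)).
  rewrite -exprM; apply: ler_weXn2l => //.
  by lia.
have -> : expR (x ^+ 2 / 4) = expR (x ^+ 2 / (4 * N.+1%:R)) ^+ N.+1.
  rewrite -expRM_natl; congr expR.
  have : N.+1%:R != 0 :> R by rewrite pnatr_eq0.
  by move: (N.+1%:R) => n n0; field.
rewrite -exprMn lerXn2r ?nnegrE ?mulr_ge0 ?exprn_ge0 ?expR_ge0 ?addr_ge0//.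
have N0 : 1 <= N.+1%:R :> R by rewrite ler1n.
apply: (@le_trans _ _ (N.+1%:R * 8 * (1 + x ^+ 2 / (4 * N.+1%:R)))).
  have -> : N.+1%:R * 8 * (1 + x ^+ 2 / (4 * N.+1%:R)) = N.+1%:R * 8 + 2 * x ^+ 2.
    have : N.+1%:R != 0 :> R by rewrite pnatr_eq0.
    by move: (N.+1%:R) => n n0; field.
  have : `|x| ^+ 2 = x ^+ 2 by rewrite real_normK ?num_real.
  have := sqr_ge0 (`|x| - 1).
  nra.
by rewrite ler_pM2l ?expR_ge1Dx// mulr_gt0.
Qed.

Lemma integrable_expR_quarter : mu.-integrable setT (fun x : R => (expR (- (x ^+ 2 / 4)))%:E).
Proof.
have s2 : Num.sqrt 2 != 0 :> R by rewrite gt_eqF// sqrtr_gt0.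
have p0 : normal_peak (Num.sqrt 2) != 0 :> R by rewrite gt_eqF// normal_peak_gt0.
have := integrableZl measurableT (normal_peak (Num.sqrt 2))^-1
  (@integrable_normal_pdf R 0 (Num.sqrt 2)).
apply: eq_integrable => // x _; rewrite normal_pdfE// -EFinM mulKf//.
rewrite /normal_fun subr0 sqr_sqrtr// mulNr; congr (expR (- (_ / _)))%:E.
by rewrite mulr2n; lra.
Qed.

Lemma poly_growth_pdf (f : R -> R) : poly_growth f ->
  exists2 K : R, 0 <= K & forall x, `|f x| * phi x <= K * expR (- (x ^+ 2 / 4)).
Proof.
move=> [C [N fC]]; have [K K0 hK] := growth_expR N.
have C0 : 0 <= C.
  by have := le_trans (normr_ge0 _) (fC 0); rewrite normr0 addr0 expr1n mulr1.
exists (C * K); first by rewrite mulr_ge0// ltW.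
move=> x; rewrite normal_pdf01E.
apply: (@le_trans _ _ (C * (K * expR (x ^+ 2 / 4)) * (1 * expR (- (x ^+ 2 / 2))))).
  apply: ler_pM => //; first by rewrite mulr_ge0 ?expR_ge0// ltW// normal_peak1_gt0.
    by rewrite (le_trans (fC x))// ler_wpM2l.
  by rewrite ler_wpM2r ?expR_ge0// normal_peak1_le1.
have -> : - (x ^+ 2 / 4) = x ^+ 2 / 4 - x ^+ 2 / 2 by field.
by rewrite expRD mul1r !mulrA.
Qed.

Lemma integrable_gauss (f : R -> R) : measurable_fun [set: R] f -> poly_growth f ->
  gam.-integrable setT (EFin \o f).
Proof.
move=> mf /poly_growth_pdf[K K0 hK].
have mphi : measurable_fun [set: R] (fun x => (phi x)%:E).
  by apply/measurable_EFinP; exact: measurable_normal_pdf.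
apply/integrableP; split; first exact/measurable_EFinP.
rewrite ge0_integral_normal_prob//; last first.
  by apply/measurable_EFinP/measurableT_comp.
have /integrableP[_] := integrableZl measurableT K integrable_expR_quarter.
apply: le_lt_trans; apply: ge0_le_integral => //.
- by move=> x _; rewrite mule_ge0// lee_fin normal_pdf_ge0.
- by apply: emeasurable_funM => //; apply/measurable_EFinP/measurableT_comp.
- apply/measurableT_comp => //.
  by have /integrableP[] := integrableZl measurableT K integrable_expR_quarter.
- move=> x _; rewrite -EFinM lee_fin /= (le_trans (hK x))// ler_norm//.
Qed.

Lemma integral_normal_prob (g : R -> R) : gam.-integrable setT (EFin \o g) ->
  (\int[gam]_x (g x)%:E = \int[mu]_x (g x * phi x)%:E)%E.
Proof.
move=> ig; have mg := measurable_int _ ig.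
rewrite integralE [RHS]integralE; congr (_ - _)%E.
- rewrite ge0_integral_normal_prob//; last exact: measurable_funepos.
  apply: eq_integral => x _; rewrite !funeposE EFinM.
  by rewrite maxe_pMl ?lee_fin ?normal_pdf_ge0// mul0e.
- rewrite ge0_integral_normal_prob//; last exact: measurable_funeneg.
  apply: eq_integral => x _; rewrite !funenegE EFinM -mulNe.
  by rewrite maxe_pMl ?lee_fin ?normal_pdf_ge0// mul0e.
Qed.

(** The derivative of u = f e^(-x^2/2) is (f' - x f) e^(-x^2/2). The fundamental theorem of calculus
    on growing symmetric intervals reduces the identity to vanishing boundary terms and dominated
    convergence. *)
Lemma gauss_ibp (f : R -> R) : (forall x, derivable f x 1) ->
  continuous (derive1 f) -> poly_growth f -> poly_growth (derive1 f) ->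
  \int[gam]_x (x * f x) = \int[gam]_x (derive1 f) x.
Proof.
move=> df cf' pf pf'.
have cf : continuous f.
  by move=> x; exact/differentiable_continuous/derivable1_diffP/df.
have mf : measurable_fun [set: R] f by exact: continuous_measurable_fun.
have mf' : measurable_fun [set: R] (derive1 f) by exact: continuous_measurable_fun.
have pxf : poly_growth (fun x => x * f x).
  have [C [N fC]] := pf; exists C, N.+1 => x.
  rewrite normrM exprSr mulrA mulrC ler_pM// ?lerDr//.
have ixf : gam.-integrable setT (EFin \o (fun x => x * f x)).
  by apply: integrable_gauss => //; exact: measurable_funM.
have if' : gam.-integrable setT (EFin \o (derive1 f)) by exact: integrable_gauss.
apply/eqP; rewrite eq_sym -subr_eq0 -RintegralB//; apply/eqP.
have iw : gam.-integrable setT (EFin \o (fun x => (derive1 f) x - x * f x)).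
  exact: integrableB if' ixf.
pose e (x : R) : R := expR (- (x ^+ 2 / 2)).
pose u (x : R) : R := f x * e x.
pose w (x : R) : R := ((derive1 f) x - x * f x) * e x.
have de (x : R) : is_derive x 1 e (- x * e x).
  rewrite /e; apply: is_derive_eq.
  by rewrite /GRing.scale /=; field.
have du (x : R) : is_derive x 1 u (w x).
  have dfx : is_derive x 1 f ((derive1 f) x) by apply: DeriveDef; rewrite // derive1E.
  rewrite /u /w; apply: is_derive_eq; rewrite /GRing.scale /=; ring.
have ce : continuous e.
  by move=> x; apply/differentiable_continuous/derivable1_diffP; case: (de x).
have cw : continuous w.
  by move=> x; apply: cvgM; [apply: cvgB; [exact: cf'|apply: cvgM; [exact: cvg_id|exact: cf]]|exact: ce].
have mw : measurable_fun [set: R] w by exact: continuous_measurable_fun.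
have FTC (n : nat) : (\int[mu]_(x in `[(- n.+1%:R)%R, (n.+1%:R)%R]) (w x)%:E =
    (u n.+1%:R - u (- n.+1%:R))%R%:E)%E.
  have n0 : (0 : R) < n.+1%:R by [].
  rewrite (@continuous_FTC2 _ w u)//.
  - lra.
  - exact: continuous_subspaceT.
  - split=> [x _||]; first by case: (du x).
    + apply: cvg_at_right_filter; apply/differentiable_continuous/derivable1_diffP.
      by case: (du (- n.+1%:R)).
    + apply: cvg_at_left_filter; apply/differentiable_continuous/derivable1_diffP.
      by case: (du n.+1%:R).
  - by move=> x _; rewrite derive1E; have [_ ->] := du x.
have p0 : normal_peak 1 != 0 :> R by rewrite gt_eqF// normal_peak1_gt0.
have [K K0 hK] := poly_growth_pdf pf.
have hu x : `|u x| <= K / normal_peak 1 * expR (- (x ^+ 2 / 4)).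
  have := hK x; rewrite normal_pdf01E -/(e x) /u normrM (ger0_norm (expR_ge0 _)) => h.
  rewrite (mulrAC K) ler_pdivlMr ?normal_peak1_gt0// -mulrA.
  by rewrite (mulrC (expR _) (normal_peak 1)).
(* The boundary terms are at most a constant over n + 1, using e^(-y^2/4) <= 4/y. *)
have u0 (n : nat) : `|u n.+1%:R - u (- n.+1%:R)| <= 8 * K / normal_peak 1 * n.+1%:R^-1.
  have n0 : (1 : R) <= n.+1%:R by rewrite ler1n.
  have ex : expR (- (n.+1%:R ^+ 2 / 4)) <= 4 * n.+1%:R^-1 :> R.
    move: (n.+1%:R : R) n0 => y y1.
    rewrite ler_pdivlMr ?(lt_le_trans ltr01)// expRN mulrC ler_pdivrMr ?expR_gt0//.
    by have := expR_ge1Dx (y ^+ 2 / 4); nra.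
  have KP : 0 <= K / normal_peak 1 by rewrite divr_ge0// ltW// normal_peak1_gt0.
  rewrite (le_trans (ler_normB _ _))//.
  have -> : 8 * K / normal_peak 1 * n.+1%:R^-1 = K / normal_peak 1 * (4 * n.+1%:R^-1) *+ 2.
    by ring.
  by rewrite mulr2n lerD// (le_trans (hu _))// ?sqrrN ler_wpM2l.
pose g (x : R) : R := (derive1 f) x - x * f x.
pose g_ (n : nat) (x : R) : R := g x * \1_(`[- n.+1%:R, n.+1%:R]) x.
have mg_ n : measurable_fun [set: R] (g_ n).
  apply: measurable_funM; last exact: measurable_indic.
  by apply: measurable_funB => //; exact: measurable_funM.
have g_le n x : `|g_ n x| <= `|g x|.
  by rewrite normrM ler_piMr// indicE; case: (_ \in _); rewrite ?normr1 ?normr0.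
have ig_ n : gam.-integrable setT (EFin \o g_ n).
  exact: (@le_integrableR _ _ _ gam (g_ n) g (mg_ n) (g_le n) iw).
have gphi x : g x * phi x = normal_peak 1 * w x.
  by rewrite /w normal_pdf01E mulrCA.
have intg_ n : (\int[gam]_x (g_ n x)%:E =
    (normal_peak 1 * (u n.+1%:R - u (- n.+1%:R)))%R%:E)%E.
  rewrite integral_normal_prob// EFinM -FTC -integralZl//; last first.
    apply: continuous_compact_integrable; first exact: segment_compact.
    exact: continuous_subspaceT.
  rewrite [in RHS]integral_mkcond.
  apply: eq_integral => x _; rewrite restrict_EFin/= /g_ mulrAC gphi patchE indicE.
  by case: (x \in _); rewrite ?mulr1 ?mulr0.
have cvgg x : g_ n x @[n --> \oo] --> g x.
  apply: cvg_near_cst; exists (Num.truncn `|x|).+1 => // n /= xn.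
  rewrite /g_ indicE mem_set ?mulr1// /= in_itv/= -ler_norml.
  rewrite (le_trans (ltW (truncnS_gt _)))// ler_nat.
  by apply: leq_trans xn _.
have cvg1 : \int[gam]_x g_ n x @[n --> \oo] --> \int[gam]_x g x.
  apply: (@cvg_Rintegral _ _ _ gam g_ g _ mg_ _ cvgg g_le); last exact: integrable_norm.
  exact: measurable_integrable iw.
have cvg2 : \int[gam]_x g_ n x @[n --> \oo] --> 0.
  rewrite (_ : (fun n => _) = (fun n : nat =>
    normal_peak 1 * (u n.+1%:R - u (- n.+1%:R)))); last first.
    by apply/funext => n; rewrite /Rintegral intg_.
  rewrite -(mulr0 (normal_peak 1)); apply: cvgMr; apply: norm_cvg0.
  apply: (@squeeze_cvgr _ _ _ _ (cst 0) (fun n => 8 * K / normal_peak 1 * harmonic n)).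
  - by apply: nearW => n; rewrite normr_ge0 u0.
  - exact: cvg_cst.
  - by rewrite -(mulr0 (8 * K / normal_peak 1)); apply: cvgMr; exact: cvg_harmonic.
exact: cvg_unique cvg1 cvg2.
Qed.

(** As a function of the frequency s, differentiation under the integral and [gauss_ibp] give chi' =
    - s chi, so chi(s) e^(s^2/2) is constant. The phase c covers cosine and sine at once. *)
Lemma integral_normal_cos (c t : R) :
  \int[gam]_y cos (c + t * y) = cos c * expR (- (t ^+ 2 / 2)).
Proof.
pose h (s y : R) : R := cos (c + s * y).
have dh (s y : R) : is_derive (s : R) 1 (h ^~ y) (- (y * sin (c + s * y))).
  rewrite /h; apply: is_derive_eq; rewrite /GRing.scale /=; ring.
have dh2 (s y : R) : is_derive y 1 (h s) (- (s * sin (c + s * y))).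
  rewrite /h; apply: is_derive_eq; rewrite /GRing.scale /=; ring.
have pg1 (f : R -> R) : (forall x, `|f x| <= 1) -> poly_growth f.
  by move=> f1; exists 1, 0%N => x; rewrite expr0 mulr1.
have cont s : continuous (h s).
  by move=> y; apply/differentiable_continuous/derivable1_diffP; case: (dh2 s y).
have csin s : continuous (fun y : R => sin (c + s * y)).
  move=> y; apply: continuous_comp; last exact: continuous_sin.
  by apply: cvgD; [exact: cvg_cst|apply: cvgMr; exact: cvg_id].
have ih s : gam.-integrable setT (EFin \o h s).
  apply: integrable_gauss; first exact: continuous_measurable_fun.
  by apply: pg1 => x; exact: cos_max.
have iid : gam.-integrable setT (EFin \o (fun x : R => `|x|)).
  apply: integrable_gauss; first exact: measurableT_comp.
  by exists 1, 1%N => x; rewrite mul1r expr1 normr_id lerDr.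
pose chi (s : R) : R := \int[gam]_y h s y.
have dchi (s : R) : is_derive s 1 chi (- s * chi s).
  have I0 : ([set` `]s - 1, s + 1[] : set R) s by rewrite /= in_itv/=; lra.
  have der (x y : R) : ([set` `]s - 1, s + 1[] : set R) x -> (setT : set R) y -> derivable (h ^~ y) x 1.
    by move=> _ _; case: (dh x y).
  have ub (x y : R) : ([set` `]s - 1, s + 1[] : set R) x -> (setT : set R) y ->
      `|partial1of2 h x y| <= `|y|.
    move=> _ _; rewrite partial1of2E; have [_ ->] := dh x y.
    by rewrite normrN normrM ler_piMr// sin_max.
  have D := @differentiation_under_integral _ _ _ gam h setT measurableT s _ _
    I0 (fun x _ => ih x) der (fun y => `|y|) (fun y => normr_ge0 y) iid ub.
  have D' := @derivable_under_integral _ _ _ gam h setT measurableT s _ _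
    I0 (fun x _ => ih x) der (fun y => `|y|) (fun y => normr_ge0 y) iid ub.
  apply: DeriveDef; first exact: D'.
  rewrite -derive1E D.
  have -> : partial1of2 h s = (fun y => -1 * (y * sin (c + s * y))).
    by apply/funext => y; rewrite partial1of2E; have [_ ->] := dh s y; rewrite mulN1r.
  have dsin (y : R) : is_derive y 1 (fun y : R => sin (c + s * y)) (s * h s y).
    by rewrite /h; apply: is_derive_eq; rewrite /GRing.scale /=; ring.
  have d1sin : derive1 (fun y : R => sin (c + s * y)) = (fun y => s * h s y).
    by apply/funext => y; rewrite derive1E; have [_ ->] := dsin y.
  have := @gauss_ibp (fun y : R => sin (c + s * y)).
  rewrite d1sin => ibp.
  rewrite RintegralZl//; last first.
    apply: integrable_gauss; first by apply: measurable_funM => //; exact: continuous_measurable_fun.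
    exists 1, 1%N => x; rewrite mul1r expr1 normrM (@le_trans _ _ `|x|)//.
      by rewrite ler_piMr// sin_max.
    by rewrite lerDr.
  rewrite ibp; first by rewrite RintegralZl// mulN1r mulNr.
  - by move=> x; case: (dsin x).
  - by move=> x; apply: cvgMr; exact: cont.
  - by apply: pg1 => x; exact: sin_max.
  - exists `|s|, 0%N => x; rewrite expr0 mulr1 normrM ler_piMr//.
    exact: cos_max.
have dG (s : R) : is_derive s 1 (fun s => chi s * expR (s ^+ 2 / 2)) 0.
  by apply: is_derive_eq; rewrite /GRing.scale /=; field.
have := @is_derive_0_is_cst _ (fun s => chi s * expR (s ^+ 2 / 2)) t 0 dG.
have h0 : h 0 = (fun=> cos c) by apply/funext => y; rewrite /h mul0r addr0.
rewrite expr0n mul0r expR0 mulr1 /chi h0.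
rewrite (@Rintegral_cst_probability _ _ _ gam) => <-.
by rewrite -mulrA -expRD addrN expR0 mulr1.
Qed.

(** The exact value would involve 1 + s. Bounding the standard density by its peak replaces it by s,
    which is what makes the bound multiply along Schur complements of a Gram matrix. *)
Lemma gauss_quadratic_le (s b c : R) : 0 < s ->
  (\int[gam]_y (expR (- ((s * y ^+ 2 + 2 * b * y + c) / 2)))%:E <=
   ((Num.sqrt s)^-1 * expR (- ((c - b ^+ 2 / s) / 2)))%:E)%E.
Proof.
move=> s0; have q0 : 0 < Num.sqrt s by rewrite sqrtr_gt0.
have qq : Num.sqrt s ^+ 2 = s by rewrite sqr_sqrtr// ltW.
set k := _ * expR (- ((c - _) / 2)).
pose sg := (Num.sqrt s)^-1.
have sg0 : sg != 0 by rewrite invr_eq0 gt_eqF.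
have k0 : 0 <= k by rewrite mulr_ge0 ?expR_ge0// invr_ge0 ltW.
have mf : measurable_fun [set: R] (fun y : R => expR (- ((s * y ^+ 2 + 2 * b * y + c) / 2))).
  apply: continuous_measurable_fun => y.
  by apply/differentiable_continuous/derivable1_diffP; exact: ex_derive.
have mpdf : measurable_fun [set: R] (fun y => (normal_pdf (- (b / s)) sg y)%:E).
  by apply/measurable_EFinP; exact: measurable_normal_pdf.
have pk : normal_peak sg = Num.sqrt s * normal_peak 1.
  rewrite /normal_peak expr1n mul1r /sg exprVn qq -mulrnAr sqrtrM ?invr_ge0 1?ltW//.
  by rewrite sqrtrV ?ltW// invfM invrK.
have E (y : R) : k * normal_pdf (- (b / s)) sg y =
    expR (- ((s * y ^+ 2 + 2 * b * y + c) / 2)) * normal_peak 1.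
  rewrite normal_pdfE// pk /k /normal_fun /sg exprVn qq.
  have aux (q p e1 e2 : R) : q != 0 -> q^-1 * e1 * (q * p * e2) = e1 * e2 * p.
    by move=> q1; field.
  rewrite aux ?gt_eqF// -expRD; congr (expR _ * _).
  by field; rewrite gt_eqF.
rewrite ge0_integral_normal_prob//; last exact/measurable_EFinP.
apply: (@le_trans _ _ (\int[mu]_y (k%:E * (normal_pdf (- (b / s)) sg y)%:E))%E).
  apply: ge0_le_integral => //.
  - by move=> y _; rewrite -EFinM lee_fin mulr_ge0 ?expR_ge0 ?normal_pdf_ge0.
  - apply: emeasurable_funM; apply/measurable_EFinP => //.
    exact: measurable_normal_pdf.
  - exact: emeasurable_funM.
  - move=> y _; rewrite -!EFinM lee_fin E ler_wpM2l ?expR_ge0//.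
    by rewrite normal_pdf_ub// oner_neq0.
rewrite ge0_integralZl//; first by rewrite integral_normal_pdf mule1.
by move=> y _; rewrite lee_fin normal_pdf_ge0.
Qed.

Lemma normal_prob_small (z rho : R) : 0 <= rho ->
  (gam [set y | `|y - z| <= rho]%R <= (2 * rho)%:E)%E.
Proof.
move=> rho0.
have -> : [set y | `|y - z| <= rho] = [set` `[z - rho, z + rho]].
  by apply/seteqP; split=> y; rewrite /= in_itv/= ler_distl.
rewrite /normal_prob.
apply: (@le_trans _ _ (\int[mu]_(x in [set` `[(z - rho)%R, (z + rho)%R]]) 1%E)%E).
  apply: ge0_le_integral => //.
  - by move=> y _; rewrite lee_fin normal_pdf_ge0.
  - by apply/measurable_EFinP/measurable_funTS; exact: measurable_normal_pdf.
  - move=> y _; rewrite lee_fin (le_trans (normal_pdf_ub _ _ _)) ?oner_neq0//.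
    exact: normal_peak1_le1.
rewrite (integral_cst mu (measurable_itv _)) mul1e.
rewrite [X in (X <= _)%E](@lebesgue_measure_itv R `[z - rho, z + rho]) /= lte_fin.
case: ifPn => _; last by rewrite lee_fin mulr_ge0.
by rewrite -EFinD lee_fin; lra.
Qed.

Lemma ge0_integral_affine (G : R -> R) (a b : R) : 0 < a -> continuous G ->
  (forall x, 0 <= G x) ->
  (\int[mu]_x (G x)%:E = \int[mu]_x (G (a * x + b) * a)%:E)%E.
Proof.
move=> a0 cG G0.
pose F (x : R) : R := (x + b / a) * a.
have FE x : F x = a * x + b by rewrite /F mulrDl divfK ?gt_eqF// mulrC.
have dF (x : R) : is_derive x 1 F a.
  by apply: is_derive_eq; rewrite /GRing.scale /=; ring.
have d1 : derive1 F = cst a.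
  by apply/funext => y; rewrite derive1E; have [_ ->] := dF y.
rewrite (@increasing_ge0_integration_by_substitutionT _ F)//.
- by rewrite d1; apply: eq_integral => x _; rewrite -FE.
- by move=> x y xy; rewrite ltr_pM2r// ltrD2r.
- by rewrite d1 => x; exact: cvg_cst.
- by rewrite d1; exact: is_cvg_cst.
- by rewrite d1; exact: is_cvg_cst.
- by apply/gt0_cvgMlNy; last exact: cvg_addrr_Ny.
- by apply/gt0_cvgMly; last exact: cvg_addrr.
Qed.

(** The rotation is factored into two affine substitutions on the line, y = x + sqrt 2 u and then x
    = s (v - u), with Tonelli in between. Each substitution asks for continuity along the
    corresponding line, hence the two continuity hypotheses. *)
Lemma gauss_rotation (Phi : R -> R -> R) :
  measurable_fun setT (fun z : R * R => Phi z.1 z.2) ->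
  (forall x y, 0 <= Phi x y) -> (forall x, continuous (Phi x)) ->
  (forall u, continuous (fun x => Phi x (x + u))) ->
  let s := (Num.sqrt 2)^-1 in
  (\int[gam]_x \int[gam]_y (Phi x y)%:E =
   \int[gam]_u \int[gam]_v (Phi (s * (v - u)) (s * (v + u)))%:E)%E.
Proof.
move=> mP P0 cP cPd s.
pose r : R := Num.sqrt 2.
have r0 : 0 < r by rewrite sqrtr_gt0.
have rr : r ^+ 2 = 2 by rewrite sqr_sqrtr.
have s0 : 0 < s by rewrite invr_gt0.
have rs : r = 2 * s by rewrite -rr expr2 -mulrA mulfV ?mulr1// gt_eqF.
have sr : s * r = 1 by rewrite mulVf// gt_eqF.
have cphi : continuous phi by apply: continuous_normal_pdf; rewrite oner_neq0.
have mphi : measurable_fun [set: R] phi by exact: measurable_normal_pdf.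
have phi0 x : 0 <= phi x by exact: normal_pdf_ge0.
pose A (z : R * R) : R := Phi z.1 (z.1 + r * z.2) * phi (z.1 + r * z.2) * r * phi z.1.
have mxu : measurable_fun setT (fun z : R * R => z.1 + r * z.2).
  by apply: measurable_funD => //; apply: measurable_funM.
have mA : measurable_fun setT A.
  apply: measurable_funM; last exact: measurableT_comp.
  apply: measurable_funM => //; apply: measurable_funM; last exact: measurableT_comp.
  have mp : measurable_fun setT (fun z : R * R => (z.1, z.1 + r * z.2)).
    exact: measurable_fun_pair.
  exact: (measurableT_comp mP mp).
have A0 z : 0 <= A z by rewrite !mulr_ge0// ltW.
have mPx x : measurable_fun [set: R] (fun y => (Phi x y)%:E).
  by apply/measurable_EFinP; exact: continuous_measurable_fun (cP x).
have mFx (f : R * R -> R) : measurable_fun setT f -> (forall z, 0 <= f z) ->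
    measurable_fun [set: R] (fun x => \int[gam]_y (f (x, y))%:E)%E.
  move=> mf f0; apply: (@measurable_fun_fubini_tonelli_F _ _ _ _ _ gam (EFin \o f)).
  - exact/measurable_EFinP.
  - by move=> z; rewrite lee_fin.
transitivity (\int[mu]_x \int[mu]_u (A (x, u))%:E)%E.
  rewrite ge0_integral_normal_prob//; last 2 first.
  - exact: (mFx (fun z => Phi z.1 z.2)).
  - by move=> x; apply: integral_ge0 => y _; rewrite lee_fin.
  apply: eq_integral => x _.
  rewrite ge0_integral_normal_prob//; last by move=> y; rewrite lee_fin.
  under eq_integral do rewrite -EFinM.
  rewrite (@ge0_integral_affine (fun y => Phi x y * phi y) r x)//; last 2 first.
  - by move=> y; apply: cvgM; [exact: cP|exact: cphi].
  - by move=> y; rewrite mulr_ge0.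
  rewrite -(@ge0_integralZr _ _ _ mu _ measurableT
    (fun u : R => (Phi x (r * u + x) * phi (r * u + x) * r)%:E) _ (phi x)%:E).
  - by apply: eq_integral => u _; rewrite -EFinM /A/= (addrC (r * u)).
  - apply/measurable_EFinP; apply: measurable_funM => //.
    apply: continuous_measurable_fun => y.
    apply: (@continuous_comp _ _ _ (fun u => r * u + x) (fun y => Phi x y * phi y)).
      by apply: cvgD; [apply: cvgMr; exact: cvg_id|exact: cvg_cst].
    by apply: cvgM; [exact: cP|exact: cphi].
  - by move=> u _; rewrite lee_fin !mulr_ge0// ltW.
  - by rewrite lee_fin.
rewrite (@fubini_tonelli _ _ _ _ _ mu mu (EFin \o A))//; last exact/measurable_EFinP.
pose B (z : R * R) : R := Phi (s * (z.2 - z.1)) (s * (z.2 + z.1)).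
have mB : measurable_fun setT B.
  have mp : measurable_fun setT (fun z : R * R => (s * (z.2 - z.1), s * (z.2 + z.1))).
    apply: measurable_fun_pair; apply: measurable_funM => //.
      exact: measurable_funB.
    exact: measurable_funD.
  exact: (measurableT_comp mP mp).
rewrite [RHS]ge0_integral_normal_prob//; last 2 first.
- exact: (mFx B mB (fun z => P0 _ _)).
- by move=> x; apply: integral_ge0 => y _; rewrite lee_fin.
apply: eq_integral => u _.
have mBu : measurable_fun [set: R] (fun v => (B (u, v))%:E).
  by apply/measurable_EFinP; exact: (measurableT_comp mB (measurable_pair1 u)).
rewrite [in RHS]ge0_integral_normal_prob//; last by move=> y; rewrite lee_fin.
rewrite /= (@ge0_integral_affine (fun x => A (x, u)) s (- (s * u)))//; last first.
- move=> x; rewrite /A/=; apply: cvgM; last exact: cphi.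
  apply: cvgM; last exact: cvg_cst.
  apply: cvgM; first exact: cPd.
  apply: (@continuous_comp _ _ _ (fun x => x + r * u) phi); last exact: cphi.
  by apply: cvgD; [exact: cvg_id|exact: cvg_cst].
rewrite -(@ge0_integralZr _ _ _ mu _ measurableT
    (fun v : R => (B (u, v))%:E * (phi v)%:E)%E _ (phi u)%:E); last 3 first.
- apply: emeasurable_funM => //; apply/measurable_EFinP => //.
- by move=> y _; rewrite -EFinM lee_fin mulr_ge0//; exact: P0.
- by rewrite lee_fin.
apply: eq_integral => v _; rewrite -!EFinM; congr EFin; rewrite /A/=.
have -> : s * v + - (s * u) = s * (v - u) by rewrite mulrBr.
have -> : s * (v - u) + r * u = s * (v + u) by rewrite rs; ring.
have ss : s ^+ 2 = 2^-1 by rewrite exprVn rr.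
rewrite mulrAC -!mulrA (mulrA r) (mulrC r s) sr mul1r; congr *%R.
rewrite !normal_pdf01E mulrACA -expRD [RHS]mulrACA -expRD; congr (_ * expR _).
by rewrite !exprMn ss; field.
Qed.
End Gaussian1.

(** * Gaussian vectors *)

Section MeasurableRow.
Context {R : realType}.

(* 'rV_n carries no sigma-algebra in the library, so measurability is tested
   against all row vectors of measurable functions. *)
Definition measurable_rV n d' (U : measurableType d') (h : 'rV[R]_n -> U) :=
  forall d (T : measurableType d) (Z : T -> 'rV[R]_n),
    (forall i, measurable_fun setT (fun w => Z w 0 i)) ->
    measurable_fun setT (fun w => h (Z w)).

(** The open set where h > a is a countable union of boxes with rational centre and half-width 1/(k
    + 1), and a box is measurable coordinate by coordinate. *)
Lemma continuous_measurable_rV n (h : 'rV[R]_n -> R) :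
  continuous h -> measurable_rV h.
Proof.
move=> ch d T Z mZ.
apply: (measurability _ (RGenOInfty.measurableE R)) => _ [_ [a ->] <-].
rewrite setTI.
pose B (p : 'rV[rat]_n * nat) : set T :=
  if `[< forall x : 'rV[R]_n, (forall i, `|x 0 i - ratr (p.1 0 i)| < p.2.+1%:R^-1) -> a < h x >]
  then \bigcap_(i in [set: 'I_n]) [set w | `|Z w 0 i - ratr (p.1 0 i)| < p.2.+1%:R^-1]
  else set0.
have -> : (fun w => h (Z w)) @^-1` `]a, +oo[ = \bigcup_p B p.
  apply/seteqP; split=> w; last first.
    move=> [p _]; rewrite /B; case: asboolP => // hp wp.
    by rewrite /= in_itv/= andbT; apply: hp => i; exact: wp.
  rewrite /= in_itv/= andbT => ahw.
  have /nbhs_ballP[e /= e0 he] : nbhs (Z w) [set x | a < h x].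
    exact: (cvgr_gt (h (Z w)) (ch (Z w))).
  have [k ke] : exists k : nat, k.+1%:R^-1 < e / 2.
    have e20 : 0 < e / 2 by lra.
    exists (Num.truncn (e / 2)^-1).
    rewrite invf_plt ?posrE//.
    exact: truncnS_gt.
  have k0 : 0 < k.+1%:R^-1 :> R by rewrite invr_gt0.
  have /choice[q hq] : forall i, exists q : rat, `|Z w 0 i - ratr q| < k.+1%:R^-1.
    move=> i.
    have [|q] := @rat_in_itvoo R (Z w 0 i - k.+1%:R^-1) (Z w 0 i + k.+1%:R^-1).
      by rewrite ltrBlDr -addrA ltrDl addr_gt0.
    by rewrite in_itv/= => hq; exists q; rewrite distrC ltr_distl.
  exists (\row_i q i, k) => //; rewrite /B asboolT.
    by move=> i _ /=; rewrite mxE.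
  move=> x hx; apply: he; split=> // i j; rewrite ord1.
  have := hq j; have := hx j; rewrite /= mxE /ball/= => h1 h2.
  rewrite (le_lt_trans (ler_distD (ratr (q j)) _ _))//.
  rewrite [ltRHS]splitr; apply: ltrD; first exact: lt_trans h2 ke.
  by rewrite distrC; exact: lt_trans h1 ke.
apply: countable_bigcupT_measurable => //.
move=> p; rewrite /B; case: ifP => _ //.
apply: fin_bigcap_measurable => // i _.
rewrite -[X in measurable X]setTI.
apply: (measurable_fun_ltr _ _ _) => //.
by apply: measurableT_comp => //; exact: measurable_funB.
Qed.

Lemma measurable_rV_comp n d1 (U1 : measurableType d1) d2 (U2 : measurableType d2)
    (h : 'rV[R]_n -> U1) (g : U1 -> U2) :
  measurable_fun setT g -> measurable_rV h -> measurable_rV (fun x => g (h x)).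
Proof. by move=> mg mh d T Z mZ; apply: (measurableT_comp mg); exact: mh. Qed.

Lemma measurable_rV_EFin n (h : 'rV[R]_n -> R) :
  measurable_rV h -> measurable_rV (fun x => (h x)%:E).
Proof. by move=> mh d T Z mZ; apply/measurable_EFinP; exact: mh. Qed.

Definition upd n (i : 'I_n) (y : R) (x : 'rV[R]_n) : 'rV[R]_n :=
  \row_j (if j == i then y else x 0 j).

Lemma updE n (i : 'I_n) y x j : upd i y x 0 j = if j == i then y else x 0 j.
Proof. by rewrite mxE. Qed.

Lemma measurable_upd n d (T : measurableType d) (Z : T -> 'rV[R]_n) (f : T -> R) (i : 'I_n) :
  (forall i, measurable_fun setT (fun w => Z w 0 i)) -> measurable_fun setT f ->
  forall j, measurable_fun setT (fun w => upd i (f w) (Z w) 0 j).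
Proof.
move=> mZ mf j; under eq_fun do rewrite updE.
by case: (j == i); [exact: mf|exact: mZ].
Qed.

Local Notation gam := (@normal_prob R 0 1).

Lemma measurable_rV_gauss n (i : 'I_n) (h : 'rV[R]_n -> \bar R) :
  measurable_rV h -> (forall x, 0 <= h x)%E ->
  measurable_rV (fun x => \int[gam]_y h (upd i y x))%E.
Proof.
move=> mh h0 d T Z mZ.
apply: (@measurable_fun_fubini_tonelli_F _ _ T _ _ gam
  (fun z : T * R => h (upd i z.2 (Z z.1)))) => //.
apply: mh => j.
have mZ1 k : measurable_fun setT (fun z : T * R => Z z.1 0 k).
  exact: (measurableT_comp (mZ k)).
exact: (@measurable_upd n _ _ (fun z : T * R => Z z.1) snd i mZ1 measurable_snd j).
Qed.

End MeasurableRow.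

Section GaussianVector.
Context {R : realType}.
Local Notation gam := (@normal_prob R 0 1).

Definition gaussian_vector d (T : measurableType d) (Q : probability T R) n
    (Z : T -> 'rV[R]_n) :=
  (forall i, measurable_fun setT (fun w => Z w 0 i)) /\
  forall B : 'I_n -> set R, (forall i, measurable (B i)) ->
    Q (\bigcap_(i in [set: 'I_n]) [set w | B i (Z w 0 i)]) = (\prod_(i < n) gam (B i))%E.

Context d (T : measurableType d) (Q : probability T R) n (Z : T -> 'rV[R]_n).
Hypothesis GZ : gaussian_vector Q Z.

Let mZ : forall i, measurable_fun setT (fun w => Z w 0 i) := proj1 GZ.
Let pZ := proj2 GZ.

Let tup (x : 'rV[R]_n) : n.-tuple R := [tuple x 0 i | i < n].
Let row_of (t : n.-tuple R) : 'rV[R]_n := \row_i tnth t i.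
Let tupK x : row_of (tup x) = x.
Proof. by apply/rowP => i; rewrite mxE tnth_mktuple. Qed.

Let measurable_tup d' (U : measurableType d') (W : U -> 'rV[R]_n) :
  (forall i, measurable_fun setT (fun w => W w 0 i)) ->
  measurable_fun setT (fun w => tup (W w)).
Proof.
move=> mW; apply/measurable_fun_tnthP => i.
rewrite (_ : _ \o _ = fun w => W w 0 i)//.
by apply/funext => w; rewrite /= tnth_mktuple.
Qed.

Let rect := [set A : set (n.-tuple R) | exists2 B : 'I_n -> set R,
  (forall i, measurable (B i)) & A = \bigcap_(i in [set: 'I_n]) [set t | B i (tnth t i)]].

Let rectE : measurable = <<s rect >>.
Proof.
apply/seteqP; split.
  apply: smallest_sub; first exact: smallest_sigma_algebra.
  move=> A; rewrite -bigcup_seq => -[i _ [B mB <-]].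
  apply: sub_sigma_algebra; rewrite setTI.
  exists (fun j => if j == i then B else setT); first by move=> j; case: ifP.
  apply/seteqP; split=> t /=.
    by move=> Bt j _; case: eqP => // ->.
  by move=> /(_ i Logic.I); rewrite /= eqxx.
apply: smallest_sub; first exact: sigma_algebra_measurable.
move=> _ [B mB ->]; apply: fin_bigcap_measurable => // i _.
rewrite -[X in measurable X]setTI.
exact: (@measurable_tnth _ R n i measurableT _ (mB i)).
Qed.

Let upd2 (i : 'I_n) (z : T * R) : 'rV[R]_n := upd i z.2 (Z z.1).

Let mupd2 i j : measurable_fun setT (fun z => upd2 i z 0 j).
Proof.
apply: measurable_upd => // k.
exact: (measurableT_comp (mZ k)).
Qed.

(** Both laws agree on boxes, a system stable under intersection that generates the sigma-algebra of
    tuples. Rows are transported to tuples for that purpose. *)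
Let law_eq (i : 'I_n) (A : set (n.-tuple R)) : measurable A ->
  pushforward Q (fun w => tup (Z w)) A =
  pushforward (Q \x gam)%E (fun z => tup (upd2 i z)) A.
Proof.
have m1 : measurable_fun setT (fun w => tup (Z w)) by exact: measurable_tup.
have m2 : measurable_fun setT (fun z => tup (upd2 i z)) by exact: measurable_tup.
apply: (@measure_unique _ _ _ rect (fun=> setT) rectE _ _ _
  (pushforward Q (fun w => tup (Z w))) (pushforward (Q \x gam)%E (fun z => tup (upd2 i z)))) => //.
- move=> _ _ [B mB ->] [B' mB' ->]; exists (fun i => B i `&` B' i).
    by move=> j; exact: measurableI.
  by apply/seteqP; split=> t /= => [[h1 h2] j _|h]; [split; [exact: h1|exact: h2]|
    split=> j _; have [] := h j Logic.I].
- by move=> _; exists (fun=> setT) => //; apply/seteqP; split.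
- by rewrite bigcup_const.
- move=> _ [B mB ->].
  pose B' j := if j == i then setT else B j.
  transitivity (Q (\bigcap_(j in [set: 'I_n]) [set w | B j (Z w 0 j)])).
    congr (Q _).
    by apply/seteqP; split=> w h j _; have := h j Logic.I; rewrite /= tnth_mktuple.
  transitivity ((Q \x gam)%E ((\bigcap_(j in [set: 'I_n]) [set w | B' j (Z w 0 j)]) `*` B i)); last first.
    congr ((_ \x _)%E _).
    apply/seteqP; split=> -[w y] /=; last first.
      move=> h; split; last by have := h i Logic.I; rewrite /= tnth_mktuple updE eqxx.
      move=> j _; rewrite /= /B'; case: ifP => // ji.
      by have := h j Logic.I; rewrite /= tnth_mktuple updE ji.
    move=> [h1 h2] j _; rewrite /= tnth_mktuple updE; case: eqP => [->//|/eqP ji].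
    by have := h1 j Logic.I; rewrite /= /B' (negbTE ji).
  have mB' j : measurable (B' j) by rewrite /B'; case: ifP.
  have mA : measurable (\bigcap_(j in [set: 'I_n]) [set w | B' j (Z w 0 j)]).
    apply: fin_bigcap_measurable => // j _; rewrite -[X in measurable X]setTI.
    by apply: mZ => //; exact: mB'.
  apply: (eq_trans _ (esym (@product_measure1E _ _ _ _ _ Q gam _ _ mA (mB i)))).
  have g1 : gam setT = 1%E := @probability_setT _ _ _ gam.
  transitivity (\prod_(j < n) gam (B j))%E; first exact: pZ.
  transitivity ((\prod_(j < n) gam (B' j)) * gam (B i))%E; last first.
    by congr (_ * _)%E; apply/esym; exact: pZ.
  rewrite (bigD1 i)//= [in RHS](bigD1 i)//= {1}/B' eqxx g1 mul1e muleC.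
  by congr (_ * _)%E; apply: eq_bigr => j ji; rewrite /B' (negbTE ji).
- move=> _; apply: (@le_lt_trans _ _ 1%E); last exact: ltry.
  by apply: (@probability_le1 _ _ _ Q); rewrite preimage_setT.
Qed.

(** Replacing one coordinate by an independent standard Gaussian does not change the law. Every
    Gaussian integral below is computed through this, one coordinate at a time. *)
Lemma ge0_resample (i : 'I_n) (h : 'rV[R]_n -> \bar R) :
  measurable_rV h -> (forall x, 0 <= h x)%E ->
  (\int[Q]_w h (Z w) = \int[Q]_w \int[gam]_y h (upd i y (Z w)))%E.
Proof.
move=> mh h0.
have m1 : measurable_fun setT (fun w => tup (Z w)) by exact: measurable_tup.
have m2 : measurable_fun setT (fun z => tup (upd2 i z)) by exact: measurable_tup.
have mhr : measurable_fun setT (h \o row_of).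
  by apply: mh => j; under eq_fun do rewrite mxE; exact: measurable_tnth.
transitivity (\int[pushforward Q (fun w => tup (Z w))]_t h (row_of t))%E.
  rewrite ge0_integral_pushforward//=.
  by apply: eq_integral => w _; rewrite /= tupK.
rewrite (eq_measure_integral (pushforward (Q \x gam)%E (fun z => tup (upd2 i z)))); last first.
  by move=> A mA _; exact: law_eq.
rewrite ge0_integral_pushforward//=.
under eq_integral do rewrite /= tupK.
rewrite (@fubini_tonelli1 _ _ _ _ _ Q gam (fun z => h (upd2 i z)))//.
by apply: mh => j; exact: mupd2.
Qed.

Lemma integral_resample (i : 'I_n) (h : 'rV[R]_n -> R) :
  measurable_rV h -> Q.-integrable setT (fun w => (h (Z w))%:E) ->
  (forall x, gam.-integrable setT (EFin \o (fun y => h (upd i y x)))) ->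
  \int[Q]_w h (Z w) = \int[Q]_w \int[gam]_y h (upd i y (Z w)).
Proof.
move=> mh ih iy.
have m1 : measurable_fun setT (fun w => tup (Z w)) by exact: measurable_tup.
have m2 : measurable_fun setT (fun z => tup (upd2 i z)) by exact: measurable_tup.
have mhr : measurable_fun setT (h \o row_of).
  by apply: mh => j; under eq_fun do rewrite mxE; exact: measurable_tnth.
have mhz : measurable_fun setT (fun z => h (upd2 i z)).
  by apply: mh => j; exact: mupd2.
have izz : (Q \x gam)%E.-integrable setT (fun z => (h (upd2 i z))%:E).
  apply/integrableP; split; first exact/measurable_EFinP.
  have /integrableP[_] := ih.
  rewrite (ge0_resample i (h := fun x => `|(h x)%:E|%E)) //; last first.
    by move=> dd TT ZZ mZZ; apply/measurableT_comp => //; apply/measurable_EFinP; exact: mh.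
  rewrite -(@fubini_tonelli1 _ _ _ _ _ Q gam (fun z => `|(h (upd2 i z))%:E|%E))//.
  by apply/measurableT_comp => //; exact/measurable_EFinP.
rewrite /Rintegral; congr fine.
transitivity (\int[pushforward Q (fun w => tup (Z w))]_t (h (row_of t))%:E)%E.
  rewrite integral_pushforward//=.
  - by apply: eq_integral => w _; rewrite /= tupK.
  - exact/measurable_EFinP.
  - by apply: eq_integrable ih => // w _; rewrite /= tupK.
rewrite (eq_measure_integral (pushforward (Q \x gam)%E (fun z => tup (upd2 i z)))); last first.
  by move=> A mA _; exact: law_eq.
rewrite integral_pushforward//=; last 2 first.
- exact/measurable_EFinP.
- by apply: eq_integrable izz => // z _; rewrite /= tupK.
under eq_integral do rewrite /= tupK.
rewrite -integral12_prod_meas1//.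
apply: eq_integral => w _; rewrite /fubini_F -EFin_Rintegral//.
exact: (iy (Z w)).
Qed.

End GaussianVector.

Section RowContinuity.
Context {R : realType}.

Lemma rV_coord_le n (x : 'rV[R]_n) i : `|x 0 i| <= `|x|.
Proof.
rewrite -[leRHS]/(mx_norm x) mx_normrE.
exact: (le_bigmax _ (fun ij : 'I_1 * 'I_n => `|x ij.1 ij.2|) (0, i)).
Qed.

Lemma rV_norm_le n (x : 'rV[R]_n) C : 0 <= C -> (forall i, `|x 0 i| <= C) -> `|x| <= C.
Proof.
move=> C0 h; rewrite -[leLHS]/(mx_norm x) mx_normrE; apply: bigmax_le => // -[i j] _ /=.
by rewrite ord1; exact: h.
Qed.

Lemma continuous_rV (T : topologicalType) n (F : T -> 'rV[R]_n) :
  (forall j, continuous (fun t => F t 0 j)) -> continuous F.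
Proof.
move=> h t; apply/cvgrPdist_le => e e0.
have : \forall t' \near t, forall j, `|F t 0 j - F t' 0 j| <= e.
  apply: filter_forall => j; have /cvgrPdist_le := h j t.
  by apply.
apply: filterS => t' ht'; apply: rV_norm_le; first exact: ltW.
by move=> j; rewrite !mxE; exact: ht'.
Qed.

Lemma continuous_upd n (i : 'I_n) (T : topologicalType) (f : T -> R) (F : T -> 'rV[R]_n) :
  continuous f -> continuous F -> continuous (fun t => upd i (f t) (F t)).
Proof.
move=> cf cF; apply: continuous_rV => j.
have -> : (fun t => upd i (f t) (F t) 0 j) = (fun t => if j == i then f t else F t 0 j).
  by apply/funext => t; rewrite updE.
case: (j == i) => // t.
by apply: (@continuous_comp _ _ _ F (fun x : 'rV[R]_n => x 0 j)); [exact: cF|exact: coord_continuous].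
Qed.

Definition growth n (f : 'rV[R]_n -> R) :=
  exists (C : R) (N : nat), forall x, `|f x| <= C * (1 + `|x|) ^+ N.

End RowContinuity.

Section GaussianFacts.
Context {R : realType}.
Local Notation gam := (@normal_prob R 0 1).

Lemma gaussian_coordinates d (T : measurableType d) (P : probability T R)
  (X : nat -> {RV P >-> R}) n : iid_standard_gaussian X ->
  gaussian_vector P (coordinates X n).
Proof.
move=> [ind law]; split=> [i|B mB].
  have -> : (fun w => coordinates X n w 0 i) = X i by apply/funext => w; rewrite mxE.
  exact: measurable_funPT.
pose B' k : set R := if insub k is Some i then B i else setT.
have mB' k : measurable (B' k) by rewrite /B'; case: insubP.
have := ind [fset k in iota 0 n]%fset B' mB'.
have -> : \bigcap_(i in [set` [fset k in iota 0 n]%fset]) (X i @^-1` B' i) =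
    \bigcap_(i in [set: 'I_n]) [set w | B i (coordinates X n w 0 i)].
  apply/seteqP; split=> w h i.
    move=> _; have := h (val i); rewrite /= !inE mem_iota /= add0n ltn_ord => /(_ isT).
    by rewrite /B' valK mxE.
  rewrite /= !inE mem_iota/= add0n => ilt.
  rewrite /B' insubT; have := h (Ordinal ilt) Logic.I.
  by rewrite /= mxE.
move=> ->.
rewrite (perm_big (iota 0 n)) /=; last first.
  apply: uniq_perm; rewrite ?fset_uniq ?iota_uniq// => k.
  by rewrite !inE.
rewrite -{1}(subn0 n) -/(index_iota 0 n) big_mkord; apply: eq_bigr => i _.
by rewrite -(law i _ (mB i)) /B' valK.
Qed.

Lemma gaussian_pair d1 (T1 : measurableType d1) (Q1 : probability T1 R) n1 (Z1 : T1 -> 'rV[R]_n1)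
    d2 (T2 : measurableType d2) (Q2 : probability T2 R) n2 (Z2 : T2 -> 'rV[R]_n2) :
  gaussian_vector Q1 Z1 -> gaussian_vector Q2 Z2 ->
  gaussian_vector (Q1 \x Q2)%E (fun z : T1 * T2 => row_mx (Z1 z.1) (Z2 z.2)).
Proof.
move=> [m1 p1] [m2 p2]; split=> [i|B mB].
  case: (splitP i) => j ij.
  - have -> : i = lshift n2 j by exact/val_inj.
    under eq_fun do rewrite row_mxEl.
    exact: (measurableT_comp (m1 j)).
  - have -> : i = rshift n1 j by exact/val_inj.
    under eq_fun do rewrite row_mxEr.
    exact: (measurableT_comp (m2 j)).
pose A1 := \bigcap_(i in [set: 'I_n1]) [set w | B (lshift n2 i) (Z1 w 0 i)].
pose A2 := \bigcap_(i in [set: 'I_n2]) [set w | B (rshift n1 i) (Z2 w 0 i)].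
have mA1 : measurable A1.
  apply: fin_bigcap_measurable => // j _; rewrite -[X in measurable X]setTI.
  by apply: m1 => //; exact: mB.
have mA2 : measurable A2.
  apply: fin_bigcap_measurable => // j _; rewrite -[X in measurable X]setTI.
  by apply: m2 => //; exact: mB.
transitivity ((Q1 \x Q2)%E (A1 `*` A2)).
  congr ((_ \x _)%E _); apply/seteqP; split=> -[w1 w2] /=.
    move=> h; split=> j _ /=; [have := h (lshift n2 j) Logic.I|have := h (rshift n1 j) Logic.I].
      by rewrite /= row_mxEl.
    by rewrite /= row_mxEr.
  move=> [h1 h2] i _ /=; case: (splitP i) => j ij.
  - have -> : i = lshift n2 j by exact/val_inj.
    by rewrite row_mxEl; exact: h1.
  - have -> : i = rshift n1 j by exact/val_inj.
    by rewrite row_mxEr; exact: h2.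
apply: (eq_trans (@product_measure1E _ _ _ _ _ Q1 Q2 _ _ mA1 mA2)).
rewrite big_split_ord/=; congr (_ * _)%E.
- by apply: p1 => i; exact: mB.
- by apply: p2 => i; exact: mB.
Qed.

Section OneVector.
Context d (T : measurableType d) (Q : probability T R) n (Z : T -> 'rV[R]_n).
Hypothesis GZ : gaussian_vector Q Z.
Let mZ := proj1 GZ.

Lemma integrable_marginal (i : 'I_n) (g : R -> R) : measurable_fun [set: R] g ->
  poly_growth g -> Q.-integrable setT (EFin \o (fun w => g (Z w 0 i))).
Proof.
move=> mg pg.
have /integrableP[_ gi] := integrable_gauss mg pg.
apply/integrableP; split; first by apply/measurable_EFinP; exact: (measurableT_comp mg).
rewrite (ge0_resample GZ i (h := fun x => `|(g (x 0 i))%:E|%E))//.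
  under eq_integral do under eq_integral do rewrite updE eqxx.
  rewrite integral_cst//= [X in (_ * X)%E]probability_setT mule1.
  exact: gi.
move=> dd TT ZZ mZZ; apply: measurableT_comp => //; apply/measurable_EFinP.
exact: (measurableT_comp mg).
Qed.

(** The sup norm is attained at some coordinate, so (1 + |x|)^N is at most 1 + sum_i (1 + |x_i|)^N,
    and only one-dimensional marginals remain. *)
Lemma integrable_growth (f : 'rV[R]_n -> R) : measurable_rV f -> growth f ->
  Q.-integrable setT (EFin \o (fun w => f (Z w))).
Proof.
move=> mf [C [N hf]].
pose g (y : R) : R := (1 + `|y|) ^+ N.
have mg : measurable_fun [set: R] g.
  apply: measurable_funX; apply: measurable_funD => //; exact: measurableT_comp.
have pg : poly_growth g.
  by exists 1, N => x; rewrite mul1r ger0_norm// exprn_ge0// addr_ge0.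
have ig i := integrable_marginal i mg pg.
have isum : Q.-integrable setT (EFin \o (fun w => `|C| * (1 + \sum_i g (Z w 0 i)))).
  rewrite (_ : EFin \o _ = (fun w => `|C|%:E * (1 + \sum_i (g (Z w 0 i))%:E))%E); last first.
    by apply/funext => w; rewrite /= EFinM EFinD -sumEFin.
  apply: integrableZl => //; apply: integrableD => //; first exact: finite_measure_integrable_cst.
  by apply: integrable_sum => // i _; exact: ig.
apply: (le_integrableR _ _ isum); first exact: mf.
move=> w; rewrite (le_trans (hf _))//.
have s0 : 0 <= 1 + \sum_i g (Z w 0 i).
  by rewrite addr_ge0// sumr_ge0// => i _; rewrite exprn_ge0// addr_ge0.
rewrite ger0_norm ?mulr_ge0//.
apply: ler_pM; rewrite ?ler_norm ?exprn_ge0 ?addr_ge0//.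
  by rewrite (le_trans (normr_ge0 (f 0)))// (le_trans (hf 0))// normr0 addr0 expr1n mulr1.
have S0 : 0 <= \sum_i g (Z w 0 i).
  by apply: sumr_ge0 => i _; rewrite exprn_ge0 ?addr_ge0.
rewrite -/(mx_norm (Z w)); have [->|/mx_norm_neq0[[k i] /= ->]] := eqVneq (mx_norm (Z w)) 0.
  by rewrite addr0 expr1n lerDl.
rewrite ord1 (bigD1 i)//= -/(g (Z w 0 i)) addrCA lerDl addr_ge0//.
by apply: sumr_ge0 => j _; rewrite exprn_ge0 ?addr_ge0.
Qed.

Lemma growth_slice (f : 'rV[R]_n -> R) i x : growth f -> poly_growth (fun y => f (upd i y x)).
Proof.
move=> [C [N hf]].
have C0 : 0 <= C.
  by rewrite (le_trans (normr_ge0 (f 0)))// (le_trans (hf 0))// normr0 addr0 expr1n mulr1.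
exists (C * (1 + `|x|) ^+ N), N => y.
rewrite (le_trans (hf _))// -mulrA ler_wpM2l// -exprMn lerXn2r ?nnegrE ?mulr_ge0 ?addr_ge0//.
apply: (@le_trans _ _ (1 + (`|x| + `|y|))); last first.
  by rewrite mulrDl mul1r mulrDr mulr1 -!addrA lerD2l addrCA lerD2l lerDl mulr_ge0.
rewrite lerD2l; apply: rV_norm_le; first by rewrite addr_ge0.
move=> j; rewrite updE; case: ifP => _; first by rewrite lerDr.
by rewrite (le_trans (rV_coord_le x j))// lerDl.
Qed.

Lemma integrable_growth_slice (f : 'rV[R]_n -> R) i x : measurable_rV f -> growth f ->
  gam.-integrable setT (EFin \o (fun y => f (upd i y x))).
Proof.
move=> mf gf; apply: integrable_gauss; last exact: growth_slice.
by apply: mf => j; apply: measurable_upd => // k; exact: measurable_cst.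
Qed.

Lemma growth_resample (i : 'I_n) (h : 'rV[R]_n -> R) : measurable_rV h -> growth h ->
  \int[Q]_w h (Z w) = \int[Q]_w \int[gam]_y h (upd i y (Z w)).
Proof.
move=> mh gh; apply: (integral_resample GZ) => //; first exact: integrable_growth.
by move=> x; exact: integrable_growth_slice.
Qed.

Lemma growth_bounded (f : 'rV[R]_n -> R) C : (forall x, `|f x| <= C) -> growth f.
Proof. by move=> h; exists C, 0%N => x; rewrite expr0 mulr1. Qed.

Lemma continuous_linear_form (P : pred 'I_n) c (t : 'I_n -> R) :
  continuous (fun x : 'rV[R]_n => c + \sum_(i | P i) t i * x 0 i).
Proof.
have h (s : seq 'I_n) : continuous (fun x : 'rV[R]_n => \sum_(i <- s | P i) t i * x 0 i : R).
  elim: s => [|i s IH].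
    have -> : (fun x : 'rV[R]_n => \sum_(i <- [::] | P i) t i * x 0 i : R) = fun=> 0.
      by apply/funext => y; rewrite big_nil.
    exact: cst_continuous.
  have [Pi|Pi] := boolP (P i).
    have -> : (fun x : 'rV[R]_n => \sum_(i <- i :: s | P i) t i * x 0 i : R) =
       (fun x => t i * x 0 i + \sum_(i <- s | P i) t i * x 0 i).
      by apply/funext => y; rewrite big_cons Pi.
    move=> x.
    exact: (cvgD (cvgM (cvg_cst (t i)) (@coord_continuous R 1 n 0 i x)) (IH x)).
  have -> : (fun x : 'rV[R]_n => \sum_(i <- i :: s | P i) t i * x 0 i : R) =
     (fun x => \sum_(i <- s | P i) t i * x 0 i).
    by apply/funext => y; rewrite big_cons (negbTE Pi).
  exact: IH.
by move=> x; exact: (cvgD (cvg_cst c) (h _ x)).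
Qed.

(** Coordinates are integrated out one at a time; those not yet integrated are part of the phase of
    [integral_normal_cos]. *)
Lemma gaussian_cos (c : R) (t : 'I_n -> R) :
  \int[Q]_w cos (c + \sum_i t i * Z w 0 i) = cos c * expR (- ((\sum_i t i ^+ 2) / 2)).
Proof.
have mcos (P : pred 'I_n) : measurable_rV (fun x : 'rV[R]_n => cos (c + \sum_(i | P i) t i * x 0 i)).
  apply: continuous_measurable_rV => x.
  apply: (@continuous_comp _ _ _ (fun x : 'rV[R]_n => c + \sum_(i | P i) t i * x 0 i) cos).
    exact: continuous_linear_form.
  exact: continuous_cos.
have bcos (P : pred 'I_n) : growth (fun x : 'rV[R]_n => cos (c + \sum_(i | P i) t i * x 0 i)).
  by apply: (@growth_bounded _ 1) => x; exact: cos_max.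
suff H k : (k <= n)%N -> \int[Q]_w cos (c + \sum_i t i * Z w 0 i) =
    expR (- ((\sum_(i < n | (i < k)%N) t i ^+ 2) / 2)) *
    \int[Q]_w cos (c + \sum_(i < n | (k <= i)%N) t i * Z w 0 i).
  rewrite (H n)// mulrC.
  have -> : (fun w => cos (c + \sum_(i < n | (n <= i)%N) t i * Z w 0 i)) = fun=> cos c.
    apply/funext => w; rewrite big_pred0 ?addr0// => i.
    by apply/negbTE; rewrite -ltnNge.
  have -> : \sum_(i < n | (i < n)%N) t i ^+ 2 = \sum_i t i ^+ 2.
    by apply: eq_bigl => i; rewrite ltn_ord.
  by rewrite (@Rintegral_cst_probability _ _ _ Q).
elim: k => [_|k IH kn].
  rewrite [X in expR (- (X / 2))]big_pred0 ?mul0r ?oppr0 ?expR0 ?mul1r//.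
rewrite IH 1?ltnW//; pose i0 := Ordinal kn.
rewrite (growth_resample i0 (mcos _) (bcos _)).
have E (w : T) : \int[gam]_y cos (c + \sum_(i < n | (k <= i)%N) t i * upd i0 y (Z w) 0 i) =
    cos (c + \sum_(i < n | (k.+1 <= i)%N) t i * Z w 0 i) * expR (- (t i0 ^+ 2 / 2)).
  rewrite -integral_normal_cos; congr Rintegral; apply/funext => y.
  have -> : \sum_(i < n | (k <= i)%N) t i * upd i0 y (Z w) 0 i =
      t i0 * y + \sum_(i < n | (k.+1 <= i)%N) t i * Z w 0 i.
    rewrite (bigD1 i0)//= updE eqxx; apply: f_equal.
    apply: eq_big => [i|i /andP[_ ii0]]; last by rewrite updE (negbTE ii0).
    by rewrite -(inj_eq val_inj)/= ltn_neqAle eq_sym andbC.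
  by rewrite (addrC (t i0 * y)) addrA.
have -> : (fun w => \int[gam]_y cos (c + \sum_(i < n | (k <= i)%N) t i * upd i0 y (Z w) 0 i)) =
    (fun w => cos (c + \sum_(i < n | (k.+1 <= i)%N) t i * Z w 0 i) * expR (- (t i0 ^+ 2 / 2))).
  by apply/funext => w; exact: E.
rewrite RintegralZr//; last exact: (integrable_growth (mcos _) (bcos _)).
have -> : \sum_(i < n | (i < k.+1)%N) t i ^+ 2 =
    t i0 ^+ 2 + \sum_(i < n | (i < k)%N) t i ^+ 2.
  rewrite (bigD1 i0)//=; apply: f_equal.
  by apply: eq_bigl => i; rewrite -(inj_eq val_inj)/= [RHS]ltn_neqAle ltnS andbC.
have -> (a b : R) : - ((a + b) / 2) = - (b / 2) - a / 2 by field.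
by rewrite expRD -!mulrA; apply: f_equal; rewrite mulrC.
Qed.

Definition sqn M (v : 'rV[R]_M) : R := (v *m v^T) 0 0.

Lemma sqnE M (v : 'rV[R]_M) : sqn v = \sum_k v 0 k ^+ 2.
Proof. by rewrite /sqn mxE; apply: eq_bigr => k _; rewrite mxE expr2. Qed.

Lemma sqn_ge0 M (v : 'rV[R]_M) : 0 <= sqn v.
Proof. by rewrite sqnE sumr_ge0// => k _; rewrite sqr_ge0. Qed.

Lemma sqn_eq0 M (v : 'rV[R]_M) : sqn v = 0 -> v = 0.
Proof.
rewrite sqnE => /eqP; rewrite psumr_eq0; last by move=> k _; rewrite sqr_ge0.
move=> /allP h; apply/rowP => k; rewrite mxE; apply/eqP.
by have := h k (mem_index_enum _); rewrite sqrf_eq0.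
Qed.

Lemma mx11E (a : 'M[R]_1) : a = (a 0 0)%:M.
Proof. exact: mx11_scalar. Qed.

Lemma det_schur M (s : R) (u : 'rV[R]_M) (v : 'cV[R]_M) (W : 'M[R]_M) : s != 0 ->
  \det (block_mx s%:M u v W) = s * \det (W - s^-1 *: (v *m u)).
Proof.
move=> s0.
have -> : block_mx s%:M u v W =
    block_mx 1%:M 0 (s^-1 *: v) 1%:M *m block_mx s%:M u 0 (W - s^-1 *: (v *m u)).
  rewrite mulmx_block !mul1mx !mul0mx !addr0 mul_mx_scalar scalerA mulfV// scale1r.
  by rewrite -scalemxAl subrKC.
by rewrite det_mulmx det_lblock !det1 !mul1r det_ublock det_scalar1.
Qed.

Lemma continuous_affine M (B : 'M[R]_(n, M)) (r : 'rV[R]_M) :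
  continuous (fun x : 'rV[R]_n => x *m B + r).
Proof.
apply: continuous_rV => k.
have -> : (fun x : 'rV[R]_n => (x *m B + r) 0 k) =
    (fun x => r 0 k + \sum_(i | true) B i k * x 0 i).
  by apply/funext => x; rewrite !mxE addrC; apply: f_equal; apply: eq_bigr => i _; rewrite mulrC.
exact: continuous_linear_form.
Qed.

Lemma continuous_sqn M : continuous (@sqn M).
Proof.
have -> : @sqn M = fun v => \sum_(k <- index_enum _) v 0 k ^+ 2 by apply/funext => v; rewrite sqnE.
elim: (index_enum _) => [|k s IH].
  have -> : (fun v : 'rV[R]_M => \sum_(k <- [::]) v 0 k ^+ 2) = fun=> 0.
    by apply/funext => v; rewrite big_nil.
  exact: cst_continuous.
have -> : (fun v : 'rV[R]_M => \sum_(j <- k :: s) v 0 j ^+ 2) =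
    (fun v => v 0 k * v 0 k + \sum_(j <- s) v 0 j ^+ 2).
  by apply/funext => v; rewrite big_cons expr2.
move=> v; exact: (cvgD (cvgM (@coord_continuous R 1 M 0 k v) (@coord_continuous R 1 M 0 k v)) (IH v)).
Qed.

Lemma measurable_gauss_affine M (B : 'M[R]_(n, M)) (r : 'rV[R]_M) :
  measurable_rV (fun x : 'rV[R]_n => (expR (- (sqn (x *m B + r) / 2)))%:E).
Proof.
apply: measurable_rV_EFin.
apply: (measurable_rV_comp (g := fun t : R => expR (- (t / 2)))
   (h := fun x : 'rV[R]_n => sqn (x *m B + r))).
  apply: measurableT_comp => //; apply: measurableT_comp => //.
  exact: measurable_funM.
apply: continuous_measurable_rV => x.
apply: (@continuous_comp _ _ _ (fun x : 'rV[R]_n => x *m B + r) (@sqn M)).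
  exact: continuous_affine.
exact: continuous_sqn.
Qed.

Lemma sqn_shift M (b r : 'rV[R]_M) y : sqn (y *: b + r) =
  sqn b * y ^+ 2 + 2 * (r *m b^T) 0 0 * y + sqn r.
Proof.
rewrite /sqn linearD/= linearZ/= mulmxDl !mulmxDr -!scalemxAl -!scalemxAr !mxE.
have -> : \sum_j b 0 j * r^T j 0 = \sum_j r 0 j * b^T j 0.
  by apply: eq_bigr => j _; rewrite !mxE mulrC.
ring.
Qed.

(* By induction on N, integrating out the coordinate f 0: completing the square
   divides the Gram determinant by its Schur complement. *)
Lemma gaussian_gram N M (B : 'M[R]_(n, M)) (f : 'I_N -> 'I_n) (r : 'rV[R]_M) :
  0 < \det (rowsub f B *m (rowsub f B)^T) ->
  (\int[Q]_w (expR (- (sqn (Z w *m B + r) / 2)))%:E <=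
   ((Num.sqrt (\det (rowsub f B *m (rowsub f B)^T)))^-1)%:E)%E.
Proof.
have mga (B' : 'M[R]_(n, M)) r' :
    measurable_fun setT (fun w => (expR (- (sqn (Z w *m B' + r') / 2)))%:E).
  by apply: (@measurable_gauss_affine _ B' r'); exact: mZ.
elim: N => [|N IH] in B f r *.
  move=> _; rewrite det_mx00 sqrtr1 invr1.
  apply: (@le_trans _ _ (\int[Q]_w (cst 1%E w))%E).
    apply: ge0_le_integral => //.
    move=> w _; rewrite lee_fin -expR0 ler_expR oppr_le0.
    by rewrite divr_ge0// sqn_ge0.
  by rewrite integral_cst// [X in (_ * X)%E]probability_setT mule1.
set j := f ord0; pose b := row j B; pose f' (i : 'I_N) : 'I_n := f (lift ord0 i).
pose C' := rowsub f' B; pose s := sqn b.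
have CE : rowsub f B = col_mx b C' :> 'M[R]_(1 + N, M).
  apply/matrixP => i k; rewrite mxE; case: (splitP i) => i' ii'.
  - have -> : i = lshift N i' by exact/val_inj.
    by rewrite col_mxEu mxE (ord1 i'); congr (B (f _) k); exact/val_inj.
  - have -> : i = rshift 1 i' by exact/val_inj.
    by rewrite col_mxEd mxE; congr (B (f _) k); exact/val_inj.
have GE : \det (rowsub f B *m (rowsub f B)^T) =
    \det (block_mx s%:M (b *m C'^T) (C' *m b^T) (C' *m C'^T)).
  transitivity (\det (col_mx b C' *m (col_mx b C')^T)); first by rewrite -CE.
  by rewrite tr_col_mx mul_col_row /s /sqn -mx11E.
have [s0|s0] := eqVneq s 0.
  have b0 : b = 0 by exact: sqn_eq0.
  by rewrite GE s0 b0 mul0mx det_lblock det_scalar1 mul0r ltxx.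
have sgt0 : 0 < s by rewrite lt_neqAle eq_sym s0 sqn_ge0.
(* P is the orthogonal projector on the complement of b. The Schur complement of the Gram matrix is
   the Gram matrix of the remaining rows multiplied by P, so the induction hypothesis applies to
   [B *m P]. *)
pose P : 'M[R]_M := 1%:M - s^-1 *: (b^T *m b).
have bbT : b *m b^T = s%:M by rewrite /s /sqn -mx11E.
have bP : b *m P = 0.
  rewrite mulmxBr mulmx1 -scalemxAr mulmxA bbT mul_scalar_mx scalerA mulVf// scale1r.
  exact: subrr.
have PT : P^T = P.
  by rewrite /P linearB/= trmx1 linearZ/= trmx_mul trmxK.
have PP : P *m P = P.
  by rewrite {1}/P mulmxBl mul1mx -scalemxAl -mulmxA bP mulmx0 scaler0 subr0.
have C'P : rowsub f' (B *m P) = C' *m P.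
  by rewrite -mul_rowsub_mx.
have detE : \det (rowsub f B *m (rowsub f B)^T) =
    s * \det (rowsub f' (B *m P) *m (rowsub f' (B *m P))^T).
  have PPC : C' *m P *m (C' *m P)^T = C' *m P *m C'^T.
    by rewrite trmx_mul PT !mulmxA -(mulmxA C' P P) PP.
  rewrite GE det_schur// C'P PPC; congr (_ * \det _); rewrite /P mulmxBr mulmx1 mulmxBl -scalemxAr -scalemxAl.
  by rewrite !mulmxA.
rewrite detE => det0.
have det'0 : 0 < \det (rowsub f' (B *m P) *m (rowsub f' (B *m P))^T).
  by rewrite -(pmulr_rgt0 _ sgt0).
rewrite (ge0_resample GZ j (@measurable_gauss_affine _ B r)); last first.
  by move=> x; rewrite lee_fin expR_ge0.
have inner w : (\int[gam]_y (expR (- (sqn (upd j y (Z w) *m B + r) / 2)))%:E <=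
    ((Num.sqrt s)^-1 * expR (- (sqn (Z w *m (B *m P) + r *m P) / 2)))%:E)%E.
  pose rho := upd j 0 (Z w) *m B + r.
  have updB y : upd j y (Z w) = y *: delta_mx 0 j + upd j 0 (Z w).
    apply/rowP => k; rewrite !mxE eqxx /=; case: (k == j); rewrite /= ?mulr1 ?addr0//.
    by rewrite mulr0 add0r.
  have E1 y : upd j y (Z w) *m B + r = y *: b + rho.
    by rewrite updB mulmxDl -scalemxAl -rowE addrA.
  (* As b P = 0, the exponent left after completing the square does not depend on coordinate j,
     which may be reset to 0. *)
  have E2 : Z w *m (B *m P) + r *m P = rho *m P.
    have -> : Z w = upd j (Z w 0 j) (Z w).
      by apply/rowP => k; rewrite mxE; case: eqP => // ->.
    by rewrite mulmxA -mulmxDl E1 mulmxDl -scalemxAl bP scaler0 add0r.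
  have E3 : sqn (rho *m P) = sqn rho - (rho *m b^T) 0 0 ^+ 2 / s.
    rewrite /sqn trmx_mul PT mulmxA -(mulmxA rho P P) PP /P mulmxBr mulmx1 mulmxBl.
    rewrite -scalemxAr -scalemxAl mulmxA -(mulmxA (rho *m b^T)).
    have -> : b *m rho^T = (rho *m b^T)^T by rewrite trmx_mul trmxK.
    move: (rho *m b^T) (rho *m rho^T) => k K.
    by rewrite !mxE big_ord1 !mxE; ring.
  rewrite E2 E3.
  under eq_integral do rewrite E1 sqn_shift.
  exact: gauss_quadratic_le.
apply: (@le_trans _ _ (\int[Q]_w ((Num.sqrt s)^-1%:E *
    (expR (- (sqn (Z w *m (B *m P) + r *m P) / 2)))%:E))%E).
  apply: ge0_le_integral => //.
  - by move=> w _; apply: integral_ge0 => y _; rewrite lee_fin expR_ge0.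
  - apply: (@measurable_rV_gauss _ _ j _ (@measurable_gauss_affine _ B r) _ _ _ _ mZ).
    by move=> x; rewrite lee_fin expR_ge0.
  - by apply: emeasurable_funM => //; exact: mga.
rewrite ge0_integralZl//.
rewrite sqrtrM ?(ltW sgt0)// invfM EFinM.
rewrite lee_wpmul2l//; last exact: IH.
Qed.

End OneVector.

Section Rotation.
Context d (T : measurableType d) (Q : probability T R) n (Z : T -> 'rV[R]_(n + n)).
Hypothesis GZ : gaussian_vector Q Z.
Let s : R := (Num.sqrt 2)^-1.

Definition rot1 (i : 'I_n) (z : 'rV[R]_(n + n)) : 'rV[R]_(n + n) :=
  let a := lshift n i in let b := rshift n i in
  upd a (s * (z 0 a + z 0 b)) (upd b (s * (z 0 a - z 0 b)) z).

Lemma continuous_rot1 i : continuous (rot1 i).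
Proof.
apply: continuous_upd; last apply: continuous_upd.
- move=> z; exact: (cvgM (cvg_cst s) (cvgD (@coord_continuous R 1 (n + n) 0 (lshift n i) z)
    (@coord_continuous R 1 (n + n) 0 (rshift n i) z))).
- move=> z; exact: (cvgM (cvg_cst s) (cvgB (@coord_continuous R 1 (n + n) 0 (lshift n i) z)
    (@coord_continuous R 1 (n + n) 0 (rshift n i) z))).
- by move=> z; exact: cvg_id.
Qed.

(** Only the pair of coordinates i and n + i is touched: both are resampled, b in the outer integral
    and a in the inner one, so that [gauss_rotation] produces exactly [rot1]. *)
Lemma integral_rot1 i (Psi : 'rV[R]_(n + n) -> R) : continuous Psi ->
  (forall z, 0 <= Psi z) ->
  (\int[Q]_w (Psi (Z w))%:E = \int[Q]_w (Psi (rot1 i (Z w)))%:E)%E.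
Proof.
move=> cP P0.
set a := lshift n i; set b := rshift n i.
have ab : (a == b) = false by apply/negbTE; rewrite eq_lrshift.
have dbl (F : 'rV[R]_(n + n) -> R) : continuous F -> (forall z, 0 <= F z) ->
    (\int[Q]_w (F (Z w))%:E =
     \int[Q]_w \int[gam]_x \int[gam]_y (F (upd a y (upd b x (Z w))))%:E)%E.
  move=> cF F0.
  have mF : measurable_rV (fun z => (F z)%:E).
    exact/measurable_rV_EFin/continuous_measurable_rV.
  have F0' z : (0 <= (F z)%:E)%E by rewrite lee_fin.
  rewrite (ge0_resample GZ a mF F0').
  by rewrite (ge0_resample GZ b (measurable_rV_gauss a mF F0'))// => z; exact: integral_ge0.
have cPr : continuous (fun z => Psi (rot1 i z)).
  by move=> z; apply: (@continuous_comp _ _ _ (rot1 i) Psi); [exact: continuous_rot1|exact: cP].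
apply: (eq_trans (dbl Psi cP P0)).
apply: (eq_trans _ (esym (dbl (fun z => Psi (rot1 i z)) cPr (fun z => P0 _)))).
apply: eq_integral => w _.
apply: (eq_trans (@gauss_rotation _ (fun x y => Psi (upd a y (upd b x (Z w)))) _ _ _ _)).
- apply: continuous_measurable_rV => // k.
  by apply: measurable_upd => // j; apply: measurable_upd => // l.
- by move=> x y; exact: P0.
- move=> x y; apply: (@continuous_comp R _ _ (fun y : R => upd a y (upd b x (Z w))) Psi); last exact: cP.
  by apply: continuous_upd => [t|t]; [exact: cvg_id|exact: cvg_cst].
- move=> u x; apply: (@continuous_comp R _ _ (fun x : R => upd a (x + u) (upd b x (Z w))) Psi); last exact: cP.
  apply: continuous_upd => y; first exact: (cvgD cvg_id (cvg_cst u)).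
  by move: y; apply: continuous_upd => t; [exact: cvg_id|exact: cvg_cst].
- apply: eq_integral => u _; apply: eq_integral => v _; congr (Psi _)%:E.
  apply/rowP => k; rewrite /= /rot1 -/a -/b -/s !updE eqxx (eq_sym b a) ab eqxx.
  by case: (k == a) => //; case: (k == b).
Qed.

Lemma gaussian_rotation (Psi : 'rV[R]_(n + n) -> R) : continuous Psi ->
  (forall z, 0 <= Psi z) ->
  (\int[Q]_w (Psi (Z w))%:E =
   \int[Q]_w (Psi (row_mx (s *: (lsubmx (Z w) + rsubmx (Z w)))
                          (s *: (lsubmx (Z w) - rsubmx (Z w)))))%:E)%E.
Proof.
move=> cP P0.
pose RL := foldr (fun i (F : 'rV[R]_(n + n) -> 'rV[R]_(n + n)) z => F (rot1 i z)) id.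
have cRL r : continuous (RL r).
  elim: r => [|i r IH] /=; first by move=> z; exact: cvg_id.
  by move=> z; apply: (@continuous_comp _ _ _ (rot1 i) (RL r)); [exact: continuous_rot1|exact: IH].
have H r : (\int[Q]_w (Psi (Z w))%:E = \int[Q]_w (Psi (RL r (Z w)))%:E)%E.
  elim: r => [//|i r IH] /=.
  rewrite IH (integral_rot1 i (Psi := Psi \o RL r))//.
  - by move=> z; apply: (@continuous_comp _ _ _ (RL r) Psi); [exact: cRL|exact: cP].
  - by move=> z; exact: P0.
(* Uniqueness of the list guarantees that each pair is transformed only once. *)
have RLE r z (j : 'I_n) : uniq r ->
    (RL r z 0 (lshift n j) = if j \in r then s * (z 0 (lshift n j) + z 0 (rshift n j)) else z 0 (lshift n j)) /\
    (RL r z 0 (rshift n j) = if j \in r then s * (z 0 (lshift n j) - z 0 (rshift n j)) else z 0 (rshift n j)).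
  elim: r z => [//|i r IH] z /= /andP[ir ur].
  have [-> ->] := IH (rot1 i z) ur.
  rewrite in_cons /rot1 !updE !eq_lshift !eq_rshift !eq_lrshift !eq_rlshift.
  have [->|ji] := eqVneq j i; last by [].
  by rewrite (negbTE ir).
rewrite (H (enum 'I_n)); apply: eq_integral => w _; congr (Psi _)%:E.
apply/rowP => k.
case: (splitP k) => j kj.
- have -> : k = lshift n j by exact/val_inj.
  have [-> _] := RLE (enum 'I_n) (Z w) j (enum_uniq _).
  by rewrite mem_enum row_mxEl !mxE.
- have -> : k = rshift n j by exact/val_inj.
  have [_ ->] := RLE (enum 'I_n) (Z w) j (enum_uniq _).
  by rewrite mem_enum row_mxEr !mxE.
Qed.

End Rotation.
End GaussianFacts.

(** * Differential calculus with polynomial growth *)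

Section Calculus.
Context {R : realType}.
Local Notation gam := (@normal_prob R 0 1).

Section Growth.
Context {n : nat}.
Implicit Types f g : 'rV[R]_n -> R.

Lemma growthP f : growth f -> exists (C : R) (N : nat),
  0 <= C /\ forall x, `|f x| <= C * (1 + `|x|) ^+ N.
Proof.
move=> [C [N h]]; exists C, N; split=> //.
by rewrite (le_trans (normr_ge0 (f 0)))// (le_trans (h 0))// normr0 addr0 expr1n mulr1.
Qed.

Lemma growthD f g : growth f -> growth g -> growth (fun x => f x + g x).
Proof.
move=> /growthP[C [N [C0 hf]]] /growthP[D [M [D0 hg]]]; exists (C + D), (N + M)%N => x.
have x1 : 1 <= 1 + `|x| by rewrite lerDl.
rewrite (le_trans (ler_normD _ _))// mulrDl; apply: lerD.
- by rewrite (le_trans (hf x))// ler_wpM2l// ler_weXn2l// leq_addr.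
- by rewrite (le_trans (hg x))// ler_wpM2l// ler_weXn2l// leq_addl.
Qed.

Lemma growthM f g : growth f -> growth g -> growth (fun x => f x * g x).
Proof.
move=> /growthP[C [N [C0 hf]]] /growthP[D [M [D0 hg]]]; exists (C * D), (N + M)%N => x.
by rewrite normrM exprD mulrACA ler_pM.
Qed.

Lemma growth_cst (c : R) : growth (fun _ : 'rV[R]_n => c).
Proof. exact: (@growth_bounded _ _ _ `|c|). Qed.

Lemma growth_coord i : growth (fun x : 'rV[R]_n => x 0 i).
Proof.
by exists 1, 1%N => x; rewrite mul1r expr1 (le_trans (rV_coord_le x i))// lerDr.
Qed.

Definition cgrowth f := continuous f /\ growth f.

Lemma cgrowth_cst (c : R) : cgrowth (fun=> c).
Proof. by split; [exact: cst_continuous|exact: growth_cst]. Qed.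

Lemma cgrowth_coord i : cgrowth (fun x => x 0 i).
Proof. by split; [exact: coord_continuous|exact: growth_coord]. Qed.

Lemma cgrowthD f g : cgrowth f -> cgrowth g -> cgrowth (fun x => f x + g x).
Proof.
move=> [cf gf] [cg gg]; split; last exact: growthD.
by move=> x; exact: (cvgD (cf x) (cg x)).
Qed.

Lemma cgrowthM f g : cgrowth f -> cgrowth g -> cgrowth (fun x => f x * g x).
Proof.
move=> [cf gf] [cg gg]; split; last exact: growthM.
by move=> x; exact: (cvgM (cf x) (cg x)).
Qed.

Lemma cgrowthZ (c : R) f : cgrowth f -> cgrowth (fun x => c * f x).
Proof. by move=> hf; apply: cgrowthM => //; exact: cgrowth_cst. Qed.

Lemma cgrowthN f : cgrowth f -> cgrowth (fun x => - f x).
Proof.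
move=> hf; rewrite (_ : (fun x => - f x) = fun x => -1 * f x); first exact: cgrowthZ.
by apply/funext => x; rewrite mulN1r.
Qed.

Lemma cgrowthB f g : cgrowth f -> cgrowth g -> cgrowth (fun x => f x - g x).
Proof. by move=> hf hg; apply: cgrowthD => //; exact: cgrowthN. Qed.

Lemma cgrowth_sum (I : Type) (s : seq I) (P : pred I) (F : I -> 'rV[R]_n -> R) :
  (forall i, P i -> cgrowth (F i)) -> cgrowth (fun x => \sum_(i <- s | P i) F i x).
Proof.
move=> h; elim: s => [|i s IH].
  rewrite (_ : (fun x => _) = fun=> 0); first exact: cgrowth_cst.
  by apply/funext => x; rewrite big_nil.
rewrite (_ : (fun x => _) = fun x => (if P i then F i x else 0) + \sum_(i <- s | P i) F i x).
  by case: (boolP (P i)) => Pi; apply: cgrowthD => //; [exact: h|exact: cgrowth_cst].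
by apply/funext => x; rewrite big_cons; case: ifP; rewrite ?add0r.
Qed.

Lemma cgrowthX f k : cgrowth f -> cgrowth (fun x => f x ^+ k).
Proof.
move=> hf; elim: k => [|k IH]; first exact: cgrowth_cst.
rewrite (_ : (fun x => _) = fun x => f x * f x ^+ k); first exact: cgrowthM.
by apply/funext => x; rewrite exprS.
Qed.

End Growth.

Section Partial.
Context {n : nat}.
Implicit Types (f g : 'rV[R]_n -> R) (i j : 'I_n).

Definition C1growth f := [/\ cgrowth f, (forall i x, derivable f x (delta_mx 0 i)) &
  forall i, cgrowth (partial i f)].

Lemma smooth_partial f i : smooth f -> smooth (partial i f).
Proof. by move=> h s; have := h (rcons s i); rewrite /iter_partial foldr_rcons. Qed.

Lemma smooth_C1 f : smooth f -> C1growth f.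
Proof.
move=> h; have [c d g] := h [::]; split=> // i.
by have [c' _ g'] := h [:: i].
Qed.

Lemma is_derive_coord j (x v : 'rV[R]_n) : is_derive x v (fun x : 'rV[R]_n => x 0 j) (v 0 j).
Proof.
have H : (fun h : R => h^-1 *: (((fun x : 'rV[R]_n => x 0 j) \o shift x) (h *: v) - x 0 j)) @ 0^' --> v 0 j.
  apply: cvg_near_cst; near=> h.
  have h0 : h != 0 by near: h; exact: nbhs_dnbhs_neq.
  by rewrite /= !mxE addrK scalerA mulVf// scale1r.
by split; [apply/cvg_ex; exists (v 0 j)|exact: cvg_lim H].
Unshelve. all: by end_near. Qed.

Lemma partial_coord i j : partial i (fun x : 'rV[R]_n => x 0 j) = fun=> (j == i)%:R.
Proof.
apply/funext => x; rewrite /partial (@derive_val _ _ _ _ _ _ _ (is_derive_coord _ _ _)).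
by rewrite mxE eqxx.
Qed.

Lemma partial_cst i (c : R) : partial i (fun _ : 'rV[R]_n => c) = fun=> 0.
Proof. by apply/funext => x; exact: derive_cst. Qed.

Lemma partialD i f g : C1growth f -> C1growth g ->
  partial i (fun x => f x + g x) = fun x => partial i f x + partial i g x.
Proof. by move=> [_ df _] [_ dg _]; apply/funext => x; exact: deriveD. Qed.

Lemma partialM i f g : C1growth f -> C1growth g ->
  partial i (fun x => f x * g x) = fun x => f x * partial i g x + g x * partial i f x.
Proof. by move=> [_ df _] [_ dg _]; apply/funext => x; exact: deriveM. Qed.

Lemma C1growth_cst (c : R) : C1growth (fun _ : 'rV[R]_n => c).
Proof.
split=> [|i x|i]; [exact: cgrowth_cst|exact: derivable_cst|].
by rewrite partial_cst; exact: cgrowth_cst.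
Qed.

Lemma C1growth_coord i : C1growth (fun x : 'rV[R]_n => x 0 i).
Proof.
split=> [|j x|j]; [exact: cgrowth_coord|exact: (@ex_derive _ _ _ _ _ _ _ (is_derive_coord _ _ _))|].
by rewrite partial_coord; exact: cgrowth_cst.
Qed.

Lemma C1growthD f g : C1growth f -> C1growth g -> C1growth (fun x => f x + g x).
Proof.
move=> hf hg; have [cf df pf] := hf; have [cg dg pg] := hg.
split=> [|i x|i]; [exact: cgrowthD|exact: derivableD|].
by rewrite partialD//; exact: cgrowthD.
Qed.

Lemma C1growthM f g : C1growth f -> C1growth g -> C1growth (fun x => f x * g x).
Proof.
move=> hf hg; have [cf df pf] := hf; have [cg dg pg] := hg.
split=> [|i x|i]; [exact: cgrowthM|exact: derivableM|].
by rewrite partialM//; apply: cgrowthD; exact: cgrowthM.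
Qed.

Lemma partialZ i (c : R) f : C1growth f -> partial i (fun x => c * f x) = fun x => c * partial i f x.
Proof.
move=> hf; rewrite (partialM _ (C1growth_cst c))// partial_cst.
by apply/funext => x; rewrite mulr0 addr0.
Qed.

Lemma C1growthZ (c : R) f : C1growth f -> C1growth (fun x => c * f x).
Proof. by move=> hf; apply: C1growthM => //; exact: C1growth_cst. Qed.

Lemma partialE i f x : partial i f x = 'D_(delta_mx 0 i) f x.
Proof. by []. Qed.

Lemma slice_shift i (h y : R) (x : 'rV[R]_n) :
  upd i (h + y) x = h *: delta_mx 0 i + upd i y x.
Proof.
apply/rowP => j; rewrite !mxE eqxx/=.
by case: ifP => _; rewrite ?mulr1// mulr0 add0r.
Qed.

Lemma derivable_slice i f (x : 'rV[R]_n) (y : R) : C1growth f ->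
  derivable (fun y => f (upd i y x)) y 1.
Proof.
move=> [_ df _]; have := df i (upd i y x); rewrite /derivable.
set u := (fun h : R => _); set v := (fun h : R => _).
suff -> : u = v by [].
by apply/funext => h; rewrite /u /v /= [h%:A](mulr1) slice_shift.
Qed.

Lemma derive1_slice i f (x : 'rV[R]_n) :
  derive1 (fun y => f (upd i y x)) = fun y => partial i f (upd i y x).
Proof.
apply/funext => y; rewrite derive1E /partial /derive.
set u := (fun h : R => _); set v := (fun h : R => _).
suff -> : u = v by [].
by apply/funext => h; rewrite /u /v /= [h%:A](mulr1) slice_shift.
Qed.

End Partial.

Opaque partial.

Section Expectation.
Context d (T : measurableType d) (Q : probability T R) n (Z : T -> 'rV[R]_n).
Hypothesis GZ : gaussian_vector Q Z.
Implicit Types (f g : 'rV[R]_n -> R).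
Local Notation E f := (\int[Q]_w f (Z w)).

Lemma cgrowth_measurable f : cgrowth f -> measurable_fun setT (fun w => f (Z w)).
Proof. by move=> [/continuous_measurable_rV cf _]; exact: cf (proj1 GZ). Qed.

Lemma cgrowth_integrable f : cgrowth f -> Q.-integrable setT (EFin \o (fun w => f (Z w))).
Proof. by move=> [/continuous_measurable_rV cf gf]; exact: integrable_growth. Qed.

Lemma expectD f g : cgrowth f -> cgrowth g ->
  \int[Q]_w (f (Z w) + g (Z w)) = E f + E g.
Proof. by move=> cf cg; rewrite RintegralD//; exact: cgrowth_integrable. Qed.

Lemma expectZ (c : R) f : cgrowth f -> \int[Q]_w (c * f (Z w)) = c * E f.
Proof. by move=> cf; rewrite RintegralZl//; exact: cgrowth_integrable. Qed.

Lemma expectB f g : cgrowth f -> cgrowth g ->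
  \int[Q]_w (f (Z w) - g (Z w)) = E f - E g.
Proof. by move=> cf cg; rewrite RintegralB//; exact: cgrowth_integrable. Qed.

Lemma expect_cst (c : R) : \int[Q]_w c = c.
Proof. exact: (@Rintegral_cst_probability _ _ _ Q). Qed.

Lemma expect_sum (I : Type) (s : seq I) (P : pred I) (F : I -> 'rV[R]_n -> R) :
  (forall i, P i -> cgrowth (F i)) ->
  \int[Q]_w (\sum_(i <- s | P i) F i (Z w)) = \sum_(i <- s | P i) E (F i).
Proof.
move=> h; elim: s => [|i s IH].
  rewrite big_nil (_ : (fun w => _) = fun=> 0) ?expect_cst//.
  by apply/funext => w; rewrite big_nil.
rewrite big_cons; case: (boolP (P i)) => Pi; last first.
  rewrite -IH; congr Rintegral; apply/funext => w; by rewrite big_cons (negbTE Pi).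
rewrite -IH -(@expectD (F i) (fun x => \sum_(i <- s | P i) F i x)); [|exact: h|exact: cgrowth_sum].
by congr Rintegral; apply/funext => w; rewrite big_cons Pi.
Qed.

Lemma expect_le f g : cgrowth f -> cgrowth g -> (forall x, f x <= g x) -> E f <= E g.
Proof.
move=> cf cg h; apply: le_Rintegral => //.
- exact: cgrowth_integrable.
- exact: cgrowth_integrable.
Qed.

Lemma expect_ge0 f : (forall x, 0 <= f x) -> 0 <= E f.
Proof. by move=> h; apply: Rintegral_ge0. Qed.

Lemma expect_ibp f (i : 'I_n) : C1growth f -> \int[Q]_w (Z w 0 i * f (Z w)) = E (partial i f).
Proof.
move=> hf; have [cf df pf] := hf.
have cxf : cgrowth (fun x => x 0 i * f x) by apply: cgrowthM => //; exact: cgrowth_coord.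
have [c1 g1] := cxf; have [c2 g2] := pf i.
have H (u : R -> R) (v : R -> R) : u = v -> \int[gam]_y u y = \int[gam]_y v y by move=> ->.
rewrite (growth_resample GZ i (continuous_measurable_rV c1) g1).
rewrite (growth_resample GZ i (continuous_measurable_rV c2) g2).
congr Rintegral; apply/funext => w.
have -> : (fun y : R => upd i y (Z w) 0 i * f (upd i y (Z w))) = fun y => y * f (upd i y (Z w)).
  by apply/funext => y; rewrite updE eqxx.
rewrite gauss_ibp; last first.
- by rewrite derive1_slice; apply: growth_slice; exact: g2.
- by apply: growth_slice; case: cf.
- rewrite derive1_slice => y; apply: (@continuous_comp R _ _ (fun y : R => upd i y (Z w)) (partial i f)); last exact: c2.
  by move: y; apply: continuous_upd => t; [exact: cvg_id|exact: cvg_cst].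
- by move=> y; exact: derivable_slice.
by rewrite derive1_slice.
Qed.

(** The product rule inside [expect_ibp]: the adjoint of the i-th partial derivative is g -> x_i g -
    d_i g. *)
Lemma expect_partialM f g (i : 'I_n) : C1growth f -> C1growth g ->
  \int[Q]_w (partial i f (Z w) * g (Z w)) =
  \int[Q]_w (f (Z w) * (Z w 0 i * g (Z w) - partial i g (Z w))).
Proof.
move=> hf hg; have [cf _ pf] := hf; have [cg _ pg] := hg.
have := expect_ibp i (C1growthM hf hg); rewrite partialM//.
rewrite (expectD (f := fun x => f x * partial i g x) (g := fun x => g x * partial i f x)); [|exact: cgrowthM..].
move=> e.
have -> : (fun w => f (Z w) * (Z w 0 i * g (Z w) - partial i g (Z w))) =
  (fun w => Z w 0 i * (f (Z w) * g (Z w)) - f (Z w) * partial i g (Z w)).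
  by apply/funext => w; ring.
rewrite (expectB (f := fun x => x 0 i * (f x * g x)) (g := fun x => f x * partial i g x)); last 2 first.
- by apply: cgrowthM; [exact: cgrowth_coord|exact: cgrowthM].
- exact: cgrowthM.
rewrite e addrAC subrr add0r; congr Rintegral; apply/funext => w; exact: mulrC.
Qed.

End Expectation.

Section Polyfun.
Context {n : nat}.
Implicit Types (f g : 'rV[R]_n -> R) (i j : 'I_n).

Lemma C1growth_sum (I : Type) (s : seq I) (P : pred I) (F : I -> 'rV[R]_n -> R) :
  (forall k, P k -> C1growth (F k)) -> C1growth (fun x => \sum_(k <- s | P k) F k x).
Proof.
move=> h; elim: s => [|k s IH].
  rewrite (_ : (fun x => _) = fun=> 0); first exact: C1growth_cst.
  by apply/funext => x; rewrite big_nil.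
rewrite (_ : (fun x => _) = fun x => (if P k then F k x else 0) + \sum_(k <- s | P k) F k x).
  by case: (boolP (P k)) => Pk; apply: C1growthD => //; [exact: h|exact: C1growth_cst].
by apply/funext => x; rewrite big_cons; case: ifP; rewrite ?add0r.
Qed.

Lemma partial_sum i (I : Type) (s : seq I) (P : pred I) (F : I -> 'rV[R]_n -> R) :
  (forall k, P k -> C1growth (F k)) ->
  partial i (fun x => \sum_(k <- s | P k) F k x) =
  fun x => \sum_(k <- s | P k) partial i (F k) x.
Proof.
move=> h; elim: s => [|k s IH].
  rewrite (_ : (fun x => _) = fun=> 0); first by rewrite partial_cst; apply/funext => x; rewrite big_nil.
  by apply/funext => x; rewrite big_nil.
have [Pk|Pk] := boolP (P k); last first.
  rewrite (_ : (fun x => _) = fun x => \sum_(k <- s | P k) F k x).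
    by rewrite IH; apply/funext => x; rewrite big_cons (negbTE Pk).
  by apply/funext => x; rewrite big_cons (negbTE Pk).
rewrite (_ : (fun x => _) = fun x => F k x + \sum_(k <- s | P k) F k x).
  by rewrite partialD ?IH; [apply/funext => x; rewrite big_cons Pk|exact: h|exact: C1growth_sum].
by apply/funext => x; rewrite big_cons Pk.
Qed.

Lemma C1growthN f : C1growth f -> C1growth (fun x => - f x).
Proof.
move=> hf; rewrite (_ : (fun x => _) = fun x => -1 * f x); first exact: C1growthZ.
by apply/funext => x; rewrite mulN1r.
Qed.

Lemma C1growthB f g : C1growth f -> C1growth g -> C1growth (fun x => f x - g x).
Proof. by move=> hf hg; apply: C1growthD => //; exact: C1growthN. Qed.

Lemma partialN i f : C1growth f -> partial i (fun x => - f x) = fun x => - partial i f x.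
Proof.
move=> hf; rewrite (_ : (fun x => _) = fun x => -1 * f x).
  by rewrite partialZ//; apply/funext => x; rewrite mulN1r.
by apply/funext => x; rewrite mulN1r.
Qed.

Lemma partialB i f g : C1growth f -> C1growth g ->
  partial i (fun x => f x - g x) = fun x => partial i f x - partial i g x.
Proof.
by move=> hf hg; rewrite (partialD i hf (C1growthN hg)) partialN.
Qed.

Lemma C1growthX f k : C1growth f -> C1growth (fun x => f x ^+ k).
Proof.
move=> hf; elim: k => [|k IH]; first exact: C1growth_cst.
rewrite (_ : (fun x => _) = fun x => f x * f x ^+ k); first exact: C1growthM.
by apply/funext => x; rewrite exprS.
Qed.

Lemma partialX i f k : C1growth f ->
  partial i (fun x => f x ^+ k.+1) = fun x => k.+1%:R * f x ^+ k * partial i f x.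
Proof.
move=> hf; elim: k => [|k IH].
  rewrite (_ : (fun x => _) = f); first by apply/funext => x; rewrite expr0 !mul1r.
  by apply/funext => x; rewrite expr1.
rewrite (_ : (fun x => _) = fun x => f x * f x ^+ k.+1).
  rewrite partialM//; last exact: C1growthX.
  by rewrite IH; apply/funext => x; rewrite -[in RHS]natr1 exprS; ring.
by apply/funext => x; rewrite exprS.
Qed.

Definition C2growth f := C1growth f /\ forall i, C1growth (partial i f).

Lemma smooth_C2 f : smooth f -> C2growth f.
Proof. by move=> hf; split=> [|i]; apply: smooth_C1 => //; exact: smooth_partial. Qed.

Local Notation L := (@ornstein_uhlenbeck R n).

Lemma cgrowth_OU f : C2growth f -> cgrowth (L f).
Proof.
move=> [[_ _ h1] h2]; apply: cgrowthB; apply: cgrowth_sum => i _.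
- by have [_ _] := h2 i.
- by apply: cgrowthM; [exact: cgrowth_coord|exact: h1].
Qed.

(* Polynomial functions, given syntactically because their partial derivatives
   commute by induction on the expression. *)
Inductive polyfun : ('rV[R]_n -> R) -> Prop :=
| polyfun_cst c : polyfun (fun=> c)
| polyfun_coord i : polyfun (fun x => x 0 i)
| polyfunD f g : polyfun f -> polyfun g -> polyfun (fun x => f x + g x)
| polyfunM f g : polyfun f -> polyfun g -> polyfun (fun x => f x * g x).

Lemma polyfun_C1_partial f : polyfun f -> C1growth f /\ forall i, polyfun (partial i f).
Proof.
elim=> [c|i|{}f g _ [cf pf] pg' [cg pg]|{}f g hf [cf pf] hg [cg pg]].
- by split=> [|i]; [exact: C1growth_cst|rewrite partial_cst; exact: polyfun_cst].
- by split=> [|j]; [exact: C1growth_coord|rewrite partial_coord; exact: polyfun_cst].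
- by split=> [|i]; [exact: C1growthD|rewrite partialD//; exact: polyfunD].
- split=> [|i]; first exact: C1growthM.
  by rewrite partialM//; apply: polyfunD; exact: polyfunM.
Qed.

Lemma polyfun_C1 f : polyfun f -> C1growth f.
Proof. by case/polyfun_C1_partial. Qed.

Lemma polyfun_partial f i : polyfun f -> polyfun (partial i f).
Proof. by case/polyfun_C1_partial. Qed.

Lemma polyfun_C2 f : polyfun f -> C2growth f.
Proof. by move=> hf; split=> [|i]; apply: polyfun_C1 => //; exact: polyfun_partial. Qed.

Lemma polyfun_cgrowth f : polyfun f -> cgrowth f.
Proof. by move=> /polyfun_C1[]. Qed.

Lemma polyfun_smooth f : polyfun f -> smooth f.
Proof.
move=> hf s; have : polyfun (iter_partial s f) by elim: s => //= i s; exact: polyfun_partial.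
by move=> /polyfun_C1[[c g] df _]; split.
Qed.

Lemma polyfunZ (c : R) f : polyfun f -> polyfun (fun x => c * f x).
Proof. by move=> hf; apply: polyfunM => //; exact: polyfun_cst. Qed.

Lemma polyfunN f : polyfun f -> polyfun (fun x => - f x).
Proof.
move=> hf; rewrite (_ : (fun x => _) = fun x => -1 * f x); first exact: polyfunZ.
by apply/funext => x; rewrite mulN1r.
Qed.

Lemma polyfunB f g : polyfun f -> polyfun g -> polyfun (fun x => f x - g x).
Proof. by move=> hf hg; apply: polyfunD => //; exact: polyfunN. Qed.

Lemma polyfun_sum (I : Type) (s : seq I) (P : pred I) (F : I -> 'rV[R]_n -> R) :
  (forall k, P k -> polyfun (F k)) -> polyfun (fun x => \sum_(k <- s | P k) F k x).
Proof.
move=> h; elim: s => [|k s IH].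
  rewrite (_ : (fun x => _) = fun=> 0); first exact: polyfun_cst.
  by apply/funext => x; rewrite big_nil.
rewrite (_ : (fun x => _) = fun x => (if P k then F k x else 0) + \sum_(k <- s | P k) F k x).
  by case: (boolP (P k)) => Pk; apply: polyfunD => //; [exact: h|exact: polyfun_cst].
by apply/funext => x; rewrite big_cons; case: ifP; rewrite ?add0r.
Qed.

Lemma polyfunX f k : polyfun f -> polyfun (fun x => f x ^+ k).
Proof.
move=> hf; elim: k => [|k IH]; first exact: polyfun_cst.
rewrite (_ : (fun x => _) = fun x => f x * f x ^+ k); first exact: polyfunM.
by apply/funext => x; rewrite exprS.
Qed.

Lemma polyfun_OU f : polyfun f -> polyfun (L f).
Proof.
move=> hf; apply: polyfunB; apply: polyfun_sum => i _.
- by do 2 apply: polyfun_partial.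
- by apply: polyfunM; [exact: polyfun_coord|exact: polyfun_partial].
Qed.

Lemma partial_comm f i j : polyfun f -> partial i (partial j f) = partial j (partial i f).
Proof.
elim=> [c|k|{}f g hf ef hg eg|{}f g hf ef hg eg].
- by rewrite !partial_cst.
- by rewrite !partial_coord !partial_cst.
- have [cf pf] := polyfun_C2 hf; have [cg pg] := polyfun_C2 hg.
  by rewrite (partialD j cf cg) (partialD i (pf j) (pg j)) (partialD i cf cg) (partialD j (pf i) (pg i)) ef eg.
- have [cf pf] := polyfun_C2 hf; have [cg pg] := polyfun_C2 hg.
  have H k l : partial k (fun x => f x * partial l g x + g x * partial l f x) = fun x =>
      (f x * partial k (partial l g) x + partial l g x * partial k f x) +
      (g x * partial k (partial l f) x + partial l f x * partial k g x).
    rewrite (partialD k (C1growthM cf (pg l)) (C1growthM cg (pf l))).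
    by rewrite (partialM k cf (pg l)) (partialM k cg (pf l)).
  rewrite (partialM j cf cg) (partialM i cf cg) !H ef eg.
  have comb (u b c v e h : R) : u + b * c + (v + e * h) = u + h * e + (v + c * b) by ring.
  by apply/funext => x; exact: comb.
Qed.

(** The commutator comes from differentiating the drift coefficient x_i; second derivatives commute
    for polynomial functions. *)
Lemma partial_OU f i : polyfun f ->
  partial i (L f) = fun x => L (partial i f) x - partial i f x.
Proof.
move=> hf; have hp j := polyfun_partial j hf.
have hpp j k := polyfun_partial k (hp j).
rewrite /ornstein_uhlenbeck partialB; last 2 first.
- by apply: C1growth_sum => j _; exact: polyfun_C1.
- by apply: C1growth_sum => j _; apply: C1growthM; [exact: C1growth_coord|exact: polyfun_C1].
rewrite !partial_sum; last 2 first.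
- by move=> j _; apply: C1growthM; [exact: C1growth_coord|exact: polyfun_C1].
- by move=> j _; exact: polyfun_C1.
apply/funext => x; rewrite -[RHS]addrA -opprD; apply: (f_equal2 (fun u v : R => u - v)).
  by apply: eq_bigr => j _; rewrite (partial_comm i j (hp j)) (partial_comm i j hf).
transitivity (\sum_j (x 0 j * partial j (partial i f) x + partial j f x * (j == i)%:R)).
  apply: eq_bigr => j _; rewrite (partialM i (C1growth_coord j) (polyfun_C1 (hp j))) partial_coord.
  by rewrite (partial_comm i j hf).
rewrite big_split/=; apply: f_equal.
rewrite (bigD1 i)//= eqxx mulr1 big1 ?addr0// => j ji.
by rewrite (negbTE ji) mulr0.
Qed.

Lemma OUM f g : C2growth f -> C2growth g ->
  L (fun x => f x * g x) = fun x => f x * L g x + g x * L f x + 2 * \sum_i partial i f x * partial i g x.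
Proof.
move=> [cf pf] [cg pg]; apply/funext => x; rewrite /ornstein_uhlenbeck.
transitivity (\sum_(i < n) ((f x * partial i (partial i g) x + g x * partial i (partial i f) x
    + 2 * (partial i f x * partial i g x)) - x 0 i * (f x * partial i g x + g x * partial i f x))).
  rewrite sumrB; apply: (f_equal2 (fun u v : R => u - v)); apply: eq_bigr => i _; last by rewrite (partialM i cf cg).
  rewrite (partialM i cf cg) (partialD i (C1growthM cf (pg i)) (C1growthM cg (pf i))).
  rewrite (partialM i cf (pg i)) (partialM i cg (pf i)).
  have comb (u v b c : R) : u + b * c + (v + c * b) = u + v + 2 * (c * b) by ring.
  exact: comb.
rewrite -[X in _ = f x * X + _ + _]sumrB -[X in _ = _ + g x * X + _]sumrB !mulr_sumr -!big_split/=.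
apply: eq_bigr => i _.
have comb (a b c h p q y : R) : a * c + b * h + 2 * (p * q) - y * (a * q + b * p) =
  a * (c - y * q) + b * (h - y * p) + 2 * (p * q) by ring.
exact: comb.
Qed.

End Polyfun.

Section OUExpectation.
Context d (T : measurableType d) (Q : probability T R) n (Z : T -> 'rV[R]_n).
Hypothesis GZ : gaussian_vector Q Z.
Implicit Types (f g : 'rV[R]_n -> R).
Local Notation E f := (\int[Q]_w f (Z w)).
Local Notation L := (@ornstein_uhlenbeck R n).

Lemma expect_OU f g : C2growth f -> C1growth g ->
  \int[Q]_w (L f (Z w) * g (Z w)) = - \sum_i \int[Q]_w (partial i f (Z w) * partial i g (Z w)).
Proof.
move=> [hf hpf] hg; have [cf _ pf] := hf; have [cg _ pg] := hg.
have [c1 c2 c3 c4] : [/\ forall i, cgrowth (fun x => partial i (partial i f) x * g x),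
   forall i, cgrowth (fun x => partial i f x * (x 0 i * g x - partial i g x)),
   forall i, cgrowth (fun x => x 0 i * partial i f x * g x) &
   forall i, cgrowth (fun x => partial i f x * partial i g x)].
  split=> i; have [? _ ?] := hpf i; have ? := @cgrowth_coord n i;
    do ?[apply: cgrowthM => //|apply: cgrowthB => //].
transitivity (\int[Q]_w (\sum_i (partial i (partial i f) (Z w) * g (Z w) - Z w 0 i * partial i f (Z w) * g (Z w)))).
  by congr Rintegral; apply/funext => w; rewrite mulrBl !mulr_suml -sumrN -big_split.
rewrite (@expect_sum d T Q n Z GZ _ _ _ (fun i x => partial i (partial i f) x * g x - x 0 i * partial i f x * g x)); last first.
  by move=> i _; exact: cgrowthB.
rewrite -sumrN; apply: eq_bigr => i _.
rewrite (expectB GZ (f := fun x => partial i (partial i f) x * g x) (g := fun x => x 0 i * partial i f x * g x))//.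
rewrite (expect_partialM GZ)//.
rewrite -(expectB GZ (f := fun x => partial i f x * (x 0 i * g x - partial i g x)) (g := fun x => x 0 i * partial i f x * g x))//.
transitivity (\int[Q]_w (-1 * (partial i f (Z w) * partial i g (Z w)))).
  congr Rintegral; apply/funext => w.
  have comb (u y v p : R) : u * (y * v - p) - y * u * v = -1 * (u * p) by ring.
  exact: comb.
by rewrite (@expectZ d T Q n Z GZ (-1) (fun x => partial i f x * partial i g x))// mulN1r.
Qed.

Lemma expect_OU_sym f g : C2growth f -> C2growth g ->
  \int[Q]_w (L f (Z w) * g (Z w)) = \int[Q]_w (f (Z w) * L g (Z w)).
Proof.
move=> hf hg; rewrite (expect_OU hf (proj1 hg)).
transitivity (\int[Q]_w (L g (Z w) * f (Z w))); last first.
  by congr Rintegral; apply/funext => w; exact: mulrC.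
rewrite (expect_OU hg (proj1 hf)); apply: f_equal; apply: eq_bigr => i _.
by congr Rintegral; apply/funext => w; exact: mulrC.
Qed.

End OUExpectation.

(** * Functions of n variables viewed as functions of N variables *)

Section Lift.

(* For n <= N this is the projection on the first n coordinates. *)
Definition prj n N (x : 'rV[R]_N) : 'rV[R]_n :=
  \row_(i < n) if insub (val i) is Some j then x 0 j else 0.

Lemma prjP n N h (v x : 'rV[R]_N) : prj n (h *: v + x) = h *: prj n v + prj n x.
Proof.
by apply/rowP => i; rewrite !mxE; case: insubP => [j _ _|_]; rewrite ?mxE// mulr0 addr0.
Qed.

Lemma prj_delta n N (i : 'I_N) : (n <= N)%N ->
  prj n (delta_mx 0 i) = if insub (val i) is Some j then delta_mx 0 j else 0.
Proof.
move=> nN; apply/rowP => k; rewrite !mxE.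
have kN : (k < N)%N by rewrite (leq_trans (ltn_ord k)).
rewrite insubT/=; case: insubP => [j jn ji|jn]; rewrite !mxE/= -(inj_eq val_inj)/=.
  by rewrite -(inj_eq val_inj)/= ji.
by case: eqP => // ki; rewrite -ki ltn_ord in jn.
Qed.

Lemma prj_norm n N (x : 'rV[R]_N) : `|prj n x| <= `|x|.
Proof.
apply: rV_norm_le => // i; rewrite mxE; case: insubP => [j _ _|_]; last by rewrite normr0.
exact: rV_coord_le.
Qed.

Lemma continuous_prj n N : continuous (@prj n N).
Proof.
apply: continuous_rV => i; rewrite (_ : (fun x => _) = fun x : 'rV[R]_N => if insub (val i) is Some j then x 0 j else 0).
  by case: insubP => [j _ _|_]; [exact: coord_continuous|exact: cst_continuous].
by apply/funext => x; rewrite mxE.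
Qed.

(** Lifting brings functions of different numbers of coordinates under one Gaussian vector, where
    they can be added, multiplied and integrated by parts together. *)
Definition lft n N (f : 'rV[R]_n -> R) : 'rV[R]_N -> R := fun x => f (prj n x).

Variables (n N : nat) (nN : (n <= N)%N).
Implicit Types f : 'rV[R]_n -> R.

Lemma lft_coordinates d (Om : measurableType d) (P : probability Om R) (X : nat -> {RV P >-> R}) f w :
  lft f (coordinates X N w) = f (coordinates X n w).
Proof.
rewrite /lft; congr f; apply/rowP => i; rewrite !mxE insubT ?mxE//=.
  by rewrite (leq_trans (ltn_ord i)).
by move=> h; rewrite mxE.
Qed.

Lemma cgrowth_lft f : cgrowth f -> cgrowth (lft (N := N) f).
Proof.
move=> [cf /growthP[C [M [C0 h]]]]; split.
  by move=> x; apply: (@continuous_comp _ _ _ (@prj n N) f); [exact: continuous_prj|exact: cf].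
exists C, M => x; rewrite (le_trans (h _))// ler_wpM2l// lerXn2r ?nnegrE ?addr_ge0//.
by rewrite lerD2l prj_norm.
Qed.

Lemma derive_lft f (x v : 'rV[R]_N) : 'D_v (lft f) x = 'D_(prj n v) f (prj n x).
Proof.
rewrite /derive; set u := (fun h : R => _); set w := (fun h : R => _).
suff -> : u = w by [].
by apply/funext => h; rewrite /u /w /= /lft prjP.
Qed.

Lemma derivable_lft f (x v : 'rV[R]_N) : derivable f (prj n x) (prj n v) -> derivable (lft f) x v.
Proof.
rewrite /derivable; set u := (fun h : R => _); set w := (fun h : R => _).
suff -> : u = w by [].
by apply/funext => h; rewrite /u /w /= /lft prjP.
Qed.

Lemma partial_lft f (i : 'I_N) : partial i (lft f) = lft (partial_nat i f).
Proof.
apply/funext => x; rewrite partialE derive_lft prj_delta// /lft /partial_nat.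
by case: insubP => [j _ _|_]; rewrite ?derive0// partialE.
Qed.

Lemma partial_nat_C1 f (k : nat) : (forall i, cgrowth (partial i f)) -> cgrowth (partial_nat k f).
Proof. by rewrite /partial_nat => h; case: insubP => [j _ _|_] //; exact: cgrowth_cst. Qed.

Lemma C1growth_lft f : C1growth f -> C1growth (lft (N := N) f).
Proof.
move=> [cf df pf]; split=> [|i x|i]; first exact: cgrowth_lft.
  apply: derivable_lft; rewrite prj_delta//; case: insubP => [j _ _//|_].
  exact: derivable0.
by rewrite partial_lft; apply: cgrowth_lft; exact: partial_nat_C1.
Qed.

Lemma C2growth_lft f : C2growth f -> C2growth (lft (N := N) f).
Proof.
move=> [cf pf]; split=> [|i]; first exact: C1growth_lft.
rewrite partial_lft; apply: C1growth_lft; rewrite /partial_nat.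
by case: insubP => [j _ _//|_]; exact: C1growth_cst.
Qed.

Lemma polyfun_lft f : polyfun f -> polyfun (lft (N := N) f).
Proof.
elim=> [c|i|{}f g _ hf _ hg|{}f g _ hf _ hg].
- exact: polyfun_cst.
- rewrite (_ : lft _ = fun x => x 0 (widen_ord nN i)); first exact: polyfun_coord.
  apply/funext => x; rewrite /lft mxE insubT/= ?(leq_trans (ltn_ord i))// => h.
  by congr (x 0 _); exact: val_inj.
- exact: polyfunD hf hg.
- exact: polyfunM hf hg.
Qed.

Lemma sum_lft (G : nat -> R) : (forall k, (n <= k)%N -> G k = 0) ->
  \sum_(i < N) G i = \sum_(i < n) G i.
Proof.
move=> h; rewrite (big_ord_widen N G nN) [RHS]big_mkcond/=; apply: eq_bigr => i _.
by case: ltnP => // /h.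
Qed.

Lemma partial_natE f (i : 'I_n) : partial_nat i f = partial i f.
Proof. by apply/funext => x; rewrite /partial_nat valK. Qed.

Lemma partial_nat0 f k : (n <= k)%N -> partial_nat k f = fun=> 0.
Proof. by move=> nk; apply/funext => x; rewrite /partial_nat insubF// ltnNge nk. Qed.

Lemma OU_lft f : ornstein_uhlenbeck (lft (N := N) f) = lft (ornstein_uhlenbeck f).
Proof.
apply/funext => x; rewrite /ornstein_uhlenbeck [RHS]/lft.
transitivity (\sum_(i < N) lft (partial_nat i (partial_nat i f)) x -
  \sum_(i < N) (if insub (val i) is Some j then (prj n x) 0 j else 0) * lft (partial_nat i f) x).
  apply: (f_equal2 (fun u v : R => u - v)); apply: eq_bigr => i _; first by rewrite partial_lft partial_lft.
  rewrite partial_lft; case: insubP => [j jn ji|jn]; rewrite ?mxE.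
    by rewrite ji valK.
  have -> : partial_nat i f = fun=> 0 by apply: partial_nat0; rewrite leqNgt.
  by rewrite /lft mulr0 mul0r.
rewrite (sum_lft (G := fun i => lft (partial_nat i (partial_nat i f)) x)); last first.
  by move=> k nk; rewrite (@partial_nat0 (partial_nat k f) k nk).
rewrite (sum_lft (G := fun i => (if insub i is Some j then (prj n x) 0 j else 0) * lft (partial_nat i f) x)); last first.
  by move=> k nk; rewrite (@partial_nat0 f k nk) /lft mulr0.
apply: (f_equal2 (fun u v : R => u - v)); apply: eq_bigr => i _; first by rewrite !partial_natE.
by rewrite valK partial_natE.
Qed.

End Lift.
End Calculus.

(** * Square-integrable functions *)

Section SquareIntegrable.
Context {R : realType} {d : measure_display} {T : measurableType d}.
Variable P : probability T R.
Implicit Types f g h : T -> R.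

Definition sq_integrable f :=
  measurable_fun setT f /\ P.-integrable setT (EFin \o (fun w => f w ^+ 2)).

Local Notation E f := (\int[P]_w f w).

Lemma sq_integrableM f g : sq_integrable f -> sq_integrable g ->
  P.-integrable setT (EFin \o (fun w => f w * g w)).
Proof.
move=> [mf f2] [mg g2].
have i2 : P.-integrable setT (EFin \o (fun w => f w ^+ 2 + g w ^+ 2)).
  exact: (integrableD measurableT f2 g2).
apply: (le_integrableR _ _ i2); first exact: measurable_funM.
move=> w; rewrite [leRHS]ger0_norm ?addr_ge0 ?sqr_ge0// ler_norml.
have := sqr_ge0 (f w - g w); have := sqr_ge0 (f w + g w).
have := sqr_ge0 (f w); have := sqr_ge0 (g w) => h1 h2 h3 h4.
by apply/andP; split; nra.
Qed.

Lemma sq_integrable_bounded f (C : R) : measurable_fun setT f -> (forall w, `|f w| <= C) -> sq_integrable f.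
Proof.
move=> mf h; split=> //.
have iC : P.-integrable setT (EFin \o (fun=> C ^+ 2)).
  exact: finite_measure_integrable_cst.
apply: (le_integrableR _ _ iC); first exact: measurable_funX.
move=> w; rewrite !normrX lerXn2r ?nnegrE//.
by rewrite (le_trans (h w))// ler_norm.
Qed.

Lemma sq_integrable_cst (c : R) : sq_integrable (fun=> c).
Proof. exact: (@sq_integrable_bounded _ `|c|). Qed.

Lemma sq_integrable_int f : sq_integrable f -> P.-integrable setT (EFin \o f).
Proof.
move=> hf; have := sq_integrableM hf (sq_integrable_cst 1).
by apply: eq_integrable => // w _ /=; rewrite mulr1.
Qed.

Lemma sq_integrableZ (c : R) f : sq_integrable f -> sq_integrable (fun w => c * f w).
Proof.
move=> [mf f2]; split; first by apply: measurable_funM => //; exact: measurable_cst.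
have := integrableZl measurableT (c ^+ 2) f2.
by apply: eq_integrable => // w _ /=; rewrite exprMn EFinM.
Qed.

Lemma sq_integrableD f g : sq_integrable f -> sq_integrable g -> sq_integrable (fun w => f w + g w).
Proof.
move=> hf hg; have [mf f2] := hf; have [mg g2] := hg.
split; first exact: measurable_funD.
have fg := sq_integrableM (sq_integrableZ 2 hf) hg.
have := integrableD measurableT (integrableD measurableT f2 fg) g2.
by apply: eq_integrable => // w _ /=; rewrite -!EFinD; congr EFin; ring.
Qed.

Lemma sq_integrableB f g : sq_integrable f -> sq_integrable g -> sq_integrable (fun w => f w - g w).
Proof.
move=> hf hg; have := sq_integrableD hf (sq_integrableZ (-1) hg).
by congr sq_integrable; apply/funext => w; rewrite mulN1r.
Qed.

Lemma cauchy_schwarz f g : sq_integrable f -> sq_integrable g ->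
  (\int[P]_w (f w * g w)) ^+ 2 <= (\int[P]_w (f w ^+ 2)) * (\int[P]_w (g w ^+ 2)).
Proof.
move=> hf hg; have [mf f2] := hf; have [mg g2] := hg.
have fg := sq_integrableM hf hg.
set a := \int[P]_w (f w ^+ 2); set b := \int[P]_w (f w * g w); set c := \int[P]_w (g w ^+ 2).
have a0 : 0 <= a by apply: Rintegral_ge0 => w _; exact: sqr_ge0.
have c0 : 0 <= c by apply: Rintegral_ge0 => w _; exact: sqr_ge0.
have H (s t : R) : 0 <= s ^+ 2 * a + 2 * s * t * b + t ^+ 2 * c.
  have -> : s ^+ 2 * a + 2 * s * t * b + t ^+ 2 * c = \int[P]_w ((s * f w + t * g w) ^+ 2).
    rewrite -!RintegralZl// -RintegralD//; last 2 first.
    - by apply: (@integrableZl _ _ _ P _ _ _ (EFin \o (fun w => f w ^+ 2))).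
    - by apply: (@integrableZl _ _ _ P _ _ _ (EFin \o (fun w => f w * g w))).
    rewrite -RintegralD//; last 2 first.
    - apply: (@integrableD _ _ _ P _ _ (EFin \o (fun w => s ^+ 2 * f w ^+ 2)) (EFin \o (fun w => 2 * s * t * (f w * g w)))) => //.
      + by apply: (@integrableZl _ _ _ P _ _ _ (EFin \o (fun w => f w ^+ 2))).
      + by apply: (@integrableZl _ _ _ P _ _ _ (EFin \o (fun w => f w * g w))).
    - by apply: (@integrableZl _ _ _ P _ _ _ (EFin \o (fun w => g w ^+ 2))).
    by congr Rintegral; apply/funext => w /=; ring.
  by apply: Rintegral_ge0 => w _; exact: sqr_ge0.
have h1 := H c (- b); have h2 := H b (- a); have h3 := H 1 (- b); have h4 := H 1 (-1); have h5 := H 1 1.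
have [c00|cn0] := eqVneq c 0; last first.
  have cp : 0 < c by rewrite lt_neqAle eq_sym cn0.
  have : 0 <= c * (a * c - b ^+ 2) by nra.
  by rewrite pmulr_rge0// subr_ge0.
(* For c = 0 the test at (b, -a) gives a b^2 <= 0 and the test at (1, -b (a + 1)) then gives 2 b^2
   <= a; together they force b = 0. *)
rewrite c00 mulr0; rewrite c00 in h1 h2 h3 h4 h5.
have h6 := H 1 (- b * (a + 1)); rewrite c00 in h6.
have b2 := sqr_ge0 b.
nra.
Qed.

Lemma sq_norm_triangle f g : sq_integrable f -> sq_integrable g ->
  \int[P]_w ((f w + g w) ^+ 2) <= 2 * \int[P]_w (f w ^+ 2) + 2 * \int[P]_w (g w ^+ 2).
Proof.
move=> hf hg; have [mf f2] := hf; have [mg g2] := hg.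
have [_ fg2] := sq_integrableD hf hg.
rewrite -!RintegralZl// -RintegralD//; last 2 first.
- by apply: (@integrableZl _ _ _ P _ _ _ (EFin \o (fun w => f w ^+ 2))).
- by apply: (@integrableZl _ _ _ P _ _ _ (EFin \o (fun w => g w ^+ 2))).
apply: le_Rintegral => //.
  apply: (@integrableD _ _ _ P _ _ (EFin \o (fun w => 2 * f w ^+ 2)) (EFin \o (fun w => 2 * g w ^+ 2))) => //.
  - by apply: (@integrableZl _ _ _ P _ _ _ (EFin \o (fun w => f w ^+ 2))).
  - by apply: (@integrableZl _ _ _ P _ _ _ (EFin \o (fun w => g w ^+ 2))).
by move=> w _; have := sqr_ge0 (f w - g w); nra.
Qed.

Lemma Lfun2P f : f \in Lfun P 2%:E <-> sq_integrable f.
Proof.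
split=> [h|[mf f2]].
  split; last exact: Lfun2_integrable_sqr.
  by move: h; rewrite inE => /andP[]; rewrite inE.
rewrite inE; apply/andP; split; first by rewrite inE.
rewrite inE /finite_norm /=; have /integrableP[_] := f2.
move=> lt; rewrite unlock; apply: poweR_lty.
apply: le_lt_trans lt; rewrite le_eqVlt; apply/orP; left; apply/eqP.
by apply: eq_integral => w _ /=; rewrite powR_mulrn// normrX.
Qed.

Lemma Lnorm2E f : sq_integrable f ->
  'N[P]_2%:E[EFin \o f]%E = (Num.sqrt (\int[P]_w (f w ^+ 2)))%:E.
Proof.
move=> [mf f2]; rewrite unlock -powR12_sqrt; last by apply: Rintegral_ge0 => w _; exact: sqr_ge0.
rewrite -poweR_EFin (EFin_Rintegral f2); congr (_ `^ _)%E.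
apply: eq_integral => w _ /=; rewrite powR_mulrn//.
by rewrite real_normK ?num_real.
Qed.

Lemma cvg_L2P (U : nat -> T -> R) F : (forall k, sq_integrable (fun w => U k w - F w)) ->
  cvg_L2 P U F <-> \int[P]_w ((U k w - F w) ^+ 2) @[k --> \oo] --> (0 : R).
Proof.
move=> h.
have -> : cvg_L2 P U F = ((Num.sqrt (\int[P]_w ((U k w - F w) ^+ 2)))%:E @[k --> \oo] --> 0%E).
  by rewrite /cvg_L2 (_ : (fun k => _) = (fun k => (Num.sqrt (\int[P]_w ((U k w - F w) ^+ 2)))%:E))//; apply/funext => k; exact: (Lnorm2E (h k)).
have p k : 0 <= \int[P]_w ((U k w - F w) ^+ 2) by apply: Rintegral_ge0 => w _; exact: sqr_ge0.
split=> [/fine_cvgP[_ H]|H].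
  have -> : (fun k => \int[P]_w ((U k w - F w) ^+ 2)) =
      (fun k => Num.sqrt (\int[P]_w ((U k w - F w) ^+ 2)) * Num.sqrt (\int[P]_w ((U k w - F w) ^+ 2))).
    by apply/funext => k; rewrite -expr2 sqr_sqrtr.
  rewrite -[X in _ --> X](mulr0 (0 : R)); exact: (cvgM H H).
apply/fine_cvgP; split; first by near=> k.
rewrite -[X in _ --> X]sqrtr0.
exact: (continuous_cvg _ (@sqrt_continuous R 0) H).
Unshelve. all: by end_near. Qed.

End SquareIntegrable.

(** * Rank of the contractions of a symmetric tensor *)

Section RankKernel.
Context {R : realFieldType}.

Lemma poly_eq0_punctured (p : {poly R}) : (forall t, t != 0 -> p.[t] = 0) -> p = 0.
Proof.
move=> h; apply/eqP/negPn/negP => p0.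
have := max_poly_roots p0 (rs := [seq i.+1%:R | i <- iota 0 (size p)]).
rewrite size_map size_iota ltnn => H; suff: false by []; apply: H.
  by apply/allP => _ /mapP[i _ ->]; apply/rootP; apply: h; rewrite pnatr_eq0.
by rewrite map_inj_uniq ?iota_uniq// => i j /eqP; rewrite eqr_nat eqSS => /eqP.
Qed.

Lemma det_line n (M0 M1 : 'M[R]_n) :
  exists p : {poly R}, forall t, p.[t] = \det (M0 + t *: M1).
Proof.
exists (\det (map_mx polyC M0 + 'X *: map_mx polyC M1)) => t.
rewrite -[LHS]/(horner_eval t _) -det_map_mx; congr (\det _).
by apply/matrixP => i j; rewrite !mxE /= /horner_eval !hornerE.
Qed.

(** If the rank of A + t H never exceeds r, every bordered minor of size r + 1 vanishes identically
    in t. Bordering an invertible r x r compression of A by the kernel vectors u and v, this minor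
    is t (u H v) to first order. *)
Lemma max_rank_kernel n (A H : 'M[R]_n) : (forall t, (\rank (A + t *: H)%R <= \rank A)%N) ->
  forall (u : 'rV_n) (v : 'cV_n), u *m A = 0 -> A *m v = 0 -> u *m H *m v = 0.
Proof.
move=> hr u v uA Av; pose r : nat := \rank A.
pose Rw : 'M[R]_(r, n) := pid_mx r *m invmx (col_ebase A).
pose Cl : 'M[R]_(n, r) := invmx (row_ebase A) *m pid_mx r.
have rn : (r <= n)%N := rank_leq_row A.
have RAC : Rw *m A *m Cl = 1%:M.
  rewrite -{1}(mulmx_ebase A) /Rw /Cl !mulmxA mulmxKV ?col_ebase_unit//.
  rewrite -!mulmxA (mulmxA (row_ebase A)) mulmxV ?row_ebase_unit// mul1mx.
  rewrite !pid_mx_id// -/r; apply/matrixP => i j; rewrite !mxE ltn_ord andbT.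
  by [].
(* M0 + t M1 is the bordered matrix with its last column divided by t. Its determinant is a
   polynomial vanishing for t != 0, hence at 0 too, where it equals u H v. *)
pose M0 := block_mx (1%:M : 'M[R]_r) (Rw *m H *m v) 0 (u *m H *m v).
pose M1 := block_mx (Rw *m H *m Cl) 0 (u *m H *m Cl) (0 : 'M[R]_1).
have [p hp] := det_line M0 M1.
have p0 : p = 0.
  apply: poly_eq0_punctured => t t0; rewrite hp.
  pose D : 'M[R]_(r + 1) := block_mx 1%:M 0 0 (t%:M).
  have E : (M0 + t *: M1) *m D = col_mx Rw u *m (A + t *: H) *m row_mx Cl v.
    rewrite mul_col_mx mul_col_row /M0 /M1 scale_block_mx add_block_mx mulmx_block.
    rewrite !mulmx1 !mulmx0 !addr0 !scaler0 !add0r !addr0 !mul_mx_scalar.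
    rewrite !mulmxDr !mulmxDl !(=^~scalemxAr, =^~scalemxAl) RAC uA !mul0mx !add0r.
    by rewrite -!mulmxA Av !mulmx0 !add0r !mulmxA.
  have dB : \det (col_mx Rw u *m (A + t *: H) *m row_mx Cl v) = 0.
    apply/eqP/negPn/negP; rewrite -unitfE -[_ \is a _]/(_ \in unitmx) -row_free_unit.
    rewrite /row_free => /eqP e.
    have : (\rank (col_mx Rw u *m (A + t *: H) *m row_mx Cl v) <= r)%N.
      apply: leq_trans (hr t); apply: leq_trans (mxrankM_maxl _ _) _.
      exact: mxrankM_maxr.
    by rewrite e addn1 ltnn.
  move: dB; rewrite -E det_mulmx => /eqP; rewrite mulf_eq0 => /orP[/eqP//|].
  by rewrite det_ublock det1 det_scalar1 mul1r (negbTE t0).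
have := hp 0; rewrite p0 horner0 scale0r addr0 /M0 det_ublock det1 mul1r => /esym d0.
by apply/matrixP => i j; rewrite !ord1 [RHS]mxE -det_mx11 d0.
Qed.

End RankKernel.

(** The orthogonal projector C^T (C C^T)^(-1) C on the row space. C C^T is invertible since u C C^T
    = 0 makes the squared norm of u C vanish. *)
Lemma row_free_projector {R : realType} r n (C : 'M[R]_(r, n)) : row_free C ->
  exists Pi : 'M[R]_n, [/\ Pi^T = Pi, Pi *m Pi = Pi, \tr Pi = r%:R & C *m Pi = C].
Proof.
move=> fC; have CC : C *m C^T \in unitmx.
  rewrite -row_free_unit -kermx_eq0; apply/eqP/row_matrixP => i; rewrite row0.
  set u := row i _.
  have u0 : u *m (C *m C^T) = 0 by apply/sub_kermxP; exact: row_sub.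
  have uC : u *m C = 0.
    by apply: sqn_eq0; rewrite /sqn trmx_mul mulmxA -(mulmxA u) u0 mul0mx mxE.
  have /row_freeP[B CB] := fC.
  by rewrite -[u]mulmx1 -CB mulmxA uC mul0mx.
exists (C^T *m invmx (C *m C^T) *m C); split.
- by rewrite !trmx_mul ?trmx_inv ?trmx_mul !trmxK mulmxA.
- by rewrite !mulmxA -(mulmxA _ C C^T) mulmxKV.
- by rewrite mxtrace_mulC mulmxA mulmxV// mxtrace1.
- by rewrite !mulmxA mulmxV// mul1mx.
Qed.

Section SymmetricTensor.
Context {R : realType} {n : nat}.
Variable a : 'I_n -> 'I_n -> 'I_n -> R.
Hypotheses (a12 : forall i j k, a i j k = a j i k) (a23 : forall i j k, a i j k = a i k j).

Definition contraction (g : 'rV[R]_n) : 'M[R]_n := \matrix_(j, k) \sum_i g 0 i * a i j k.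

Lemma contractionP g h t : contraction (g + t *: h) = contraction g + t *: contraction h.
Proof.
apply/matrixP => j k; rewrite !mxE mulr_sumr -big_split/=; apply: eq_bigr => i _.
by rewrite !mxE mulrDl mulrA.
Qed.

Lemma contraction_sym g : (contraction g)^T = contraction g.
Proof. by apply/matrixP => j k; rewrite !mxE; apply: eq_bigr => i _; rewrite a23. Qed.

Lemma row_space_projector (A : 'M[R]_n) : exists Pi : 'M[R]_n,
  [/\ Pi^T = Pi, Pi *m Pi = Pi, \tr Pi = (\rank A)%:R & A *m Pi = A].
Proof.
have [Pi [h1 h2 h3 h4]] := row_free_projector (row_base_free A).
exists Pi; split=> //.
have /submxP[D AD] : (A <= row_base A)%MS by rewrite eq_row_base.
by rewrite {1}AD -mulmxA h4 -AD.
Qed.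

Lemma max_rank_contraction : exists g, forall h, (\rank (contraction h) <= \rank (contraction g))%N.
Proof.
pose Pr r := `[< exists g, \rank (contraction g) = r >].
have ex : exists r, Pr r by exists (\rank (contraction 0)); apply/asboolP; exists 0.
have ub r : Pr r -> (r <= n)%N by move=> /asboolP[g <-]; exact: rank_leq_row.
have [r /asboolP[g gr] mx] := ex_maxnP ex ub.
exists g => h; rewrite gr; apply: mx; apply/asboolP; by exists h.
Qed.

(* By maximality of the rank, a vanishes on h (x) u (x) v for u, v in the kernel
   of A = contraction g, so that the norm of a is controlled by that of its
   contractions with a basis of the row space of A. *)
Lemma frobenius_le_rank (K : R) (g : 'rV[R]_n) :
  (forall v : 'rV[R]_n, \sum_j \sum_k (contraction v j k) ^+ 2 <= K * sqn v) ->
  (forall h, (\rank (contraction h) <= \rank (contraction g))%N) ->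
  \sum_i \sum_j \sum_k (a i j k) ^+ 2 <= 2 * K * (\rank (contraction g))%:R.
Proof.
move=> hK hg; set A := contraction g.
have [Pi [PiT PiPi trPi APi]] := row_space_projector A.
have AT : A^T = A := contraction_sym g.
pose Hm i : 'M[R]_n := \matrix_(j, k) a i j k.
have HmE i : Hm i = contraction (delta_mx 0 i).
  apply/matrixP => j k; rewrite !mxE (bigD1 i)//= !mxE !eqxx mul1r big1 ?addr0// => l li.
  by rewrite mxE (negbTE li) andbF mul0r.
have HT i : (Hm i)^T = Hm i by rewrite HmE contraction_sym.
pose Pc := 1%:M - Pi.
have APc : A *m Pc = 0 by rewrite /Pc mulmxBr mulmx1 APi subrr.
have PcT : Pc^T = Pc by rewrite /Pc linearB/= trmx1 PiT.
have PcA : Pc *m A = 0 by rewrite -[LHS]trmxK trmx_mul AT PcT APc trmx0.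
have PHP i : Pc *m Hm i *m Pc = 0.
  apply/matrixP => j k; rewrite [RHS]mxE.
  have h : row j Pc *m Hm i *m col k Pc = 0.
    apply: (@max_rank_kernel _ n A).
    - by move=> t; rewrite HmE; have := hg (g + t *: delta_mx 0 i); rewrite contractionP.
    - by rewrite -row_mul PcA row0.
    - by rewrite colE mulmxA APc mul0mx.
  transitivity ((row j Pc *m Hm i *m col k Pc) 0 0); last by rewrite h mxE.
  rewrite -row_mul [LHS]mxE [RHS]mxE; apply: eq_bigr => l _.
  by rewrite [(row _ _) _ _]mxE [(col _ _) _ _]mxE.
have tr2 i : \sum_j \sum_k (a i j k) ^+ 2 = \tr (Hm i *m Hm i).
  apply: eq_bigr => j _; rewrite mxE; apply: eq_bigr => k _.
  by rewrite !mxE expr2 (a23 i k j).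
(* Split Hm = Pi Hm + Pc Hm. As Pc Hm Pc = 0, the trace of the second part is tr (Pi Hm Hm) - tr (Pi
   Hm Pi Hm), and the subtracted term is a squared norm. This is the origin of the factor 2. *)
have bnd i : \tr (Hm i *m Hm i) <= 2 * \tr (Pi *m Hm i *m Hm i).
  have e1 : \tr (Hm i *m Hm i) = \tr (Pi *m Hm i *m Hm i) + \tr (Pc *m Hm i *m Hm i).
    by rewrite -mxtraceD -!mulmxA -mulmxDl /Pc addrC subrK mul1mx.
  have e2 : \tr (Pc *m Hm i *m Hm i) = \tr (Pi *m Hm i *m Hm i) - \tr (Pi *m Hm i *m Pi *m Hm i).
    have -> : Pc *m Hm i *m Hm i = Pc *m Hm i *m Pi *m Hm i.
      have /eqP := PHP i; rewrite {2}/Pc mulmxBr mulmx1 subr_eq0 => /eqP e.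
      by rewrite {1}e.
    rewrite {1}/Pc !mulmxBl mul1mx raddfB/=; congr (_ - _).
    by rewrite mxtrace_mulC mulmxA mxtrace_mulC mulmxA.
  have e3 : \tr (Pi *m Hm i *m Pi *m Hm i) = \tr ((Pi *m Hm i *m Pi) *m (Pi *m Hm i *m Pi)^T).
    rewrite !trmx_mul PiT HT !mulmxA -[X in \tr (X *m Hm i *m Pi)]mulmxA PiPi.
    by rewrite [RHS]mxtrace_mulC !mulmxA PiPi.
  have e4 : 0 <= \tr (Pi *m Hm i *m Pi *m Hm i).
    rewrite e3; apply: sumr_ge0 => j _; rewrite mxE; apply: sumr_ge0 => k _.
    by rewrite [X in _ * X]mxE -expr2 sqr_ge0.
  by rewrite e1 e2; lra.
under eq_bigr do rewrite tr2.
apply: le_trans (ler_sum _ (fun i _ => bnd i)) _.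
rewrite -mulr_sumr -mulrA ler_pM2l//.
(* Symmetry of a in its first two indices turns row j of Pi times the slices into the contraction of
   a with that row. *)
have -> : \sum_i \tr (Pi *m Hm i *m Hm i) = \sum_j \sum_i \sum_k (contraction (row j Pi) i k) ^+ 2.
  rewrite [RHS]exchange_big/=; apply: eq_bigr => i _.
  have -> : \tr (Pi *m Hm i *m Hm i) = \tr ((Pi *m Hm i) *m (Pi *m Hm i)^T).
    by rewrite trmx_mul PiT HT -{1}PiPi -!mulmxA mxtrace_mulC !mulmxA.
  apply: eq_bigr => j _; rewrite mxE; apply: eq_bigr => k _.
  rewrite [X in _ * X]mxE -expr2 !mxE; congr (_ ^+ 2); apply: eq_bigr => l _.
  by rewrite !mxE (a12 i l k).
apply: (@le_trans _ _ (\sum_j K * sqn (row j Pi))).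
  by apply: ler_sum => j _; exact: hK.
(* The squared norms of the rows of a projector add up to its trace, here the rank. *)
rewrite -mulr_sumr -trPi -{2}PiPi -{3}PiT /mxtrace le_eqVlt; apply/orP; left; apply/eqP; congr (_ * _).
apply: eq_bigr => j _; rewrite sqnE mxE; apply: eq_bigr => k _.
by rewrite !mxE expr2.
Qed.

End SymmetricTensor.

Lemma rank_minor {R : realType} m n N (A : 'M[R]_(m, n)) : (N <= \rank A)%N ->
  exists (f : 'I_N -> 'I_m) (f' : 'I_N -> 'I_n), \det (mxsub f f' A) != 0.
Proof.
move=> NA; pose f := maxrankfun A \o widen_ord NA.
have fr : row_free (rowsub f A).
  have /row_freeP[B AB] := maxrowsub_free A.
  apply/row_freeP; exists (B *m (rowsub (widen_ord NA) 1%:M)^T).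
  have -> : rowsub f A = rowsub (widen_ord NA) (rowsub (maxrankfun A) A).
    by apply/matrixP => i j; rewrite !mxE.
  rewrite mulmxA mul_rowsub_mx AB.
  apply/matrixP => i j; rewrite !mxE (bigD1 (widen_ord NA i))//= !mxE eqxx mul1r big1 ?addr0.
    by rewrite -(inj_eq val_inj)/= eq_sym.
  by move=> k ki; rewrite !mxE eq_sym (negbTE ki) mul0r.
have fl : row_full (rowsub f A)^T by rewrite /row_full mxrank_tr; exact: fr.
exists f, (fullrankfun fl).
have := fullrowsub_unit fl; rewrite unitmxE unitfE -det_tr; apply: contra_neq => <-.
by congr (\det _); apply/matrixP => i j; rewrite !mxE.
Qed.

(** * Polynomial chaoses and hypercontractivity *)

Section Chaos.
Context {R : realType}.

(** Convexity: b^(p+1) lies above its tangent at a. *)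
Lemma tangent_ineq (p : nat) (a b : R) : 0 <= a -> 0 <= b ->
  p.+1%:R * a ^+ p * b <= p%:R * a ^+ p.+1 + b ^+ p.+1.
Proof.
move=> a0 b0; elim: p => [|p IH]; first by rewrite expr0 mulr1 mul1r mul0r add0r expr1.
have h : a ^+ p.+1 * b + a * b ^+ p.+1 <= a ^+ p.+2 + b ^+ p.+2.
  rewrite -subr_ge0.
  have -> : a ^+ p.+2 + b ^+ p.+2 - (a ^+ p.+1 * b + a * b ^+ p.+1) =
      (a ^+ p.+1 - b ^+ p.+1) * (a - b) by rewrite !(exprS _ p.+1); ring.
  have [ab|ba] := leP a b.
    by rewrite mulr_le0// subr_le0// lerXn2r.
  by rewrite mulr_ge0// subr_ge0 ?(ltW ba)// lerXn2r// ?nnegrE ?(ltW ba).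
have {}IH := ler_wpM2l a0 IH.
have -> : p.+2%:R * a ^+ p.+1 * b = a * (p.+1%:R * a ^+ p * b) + a ^+ p.+1 * b.
  by rewrite -[p.+2%:R]natr1 exprS; ring.
apply: (le_trans (lerD IH (lexx _))).
have -> : a * (p%:R * a ^+ p.+1 + b ^+ p.+1) + a ^+ p.+1 * b =
  p%:R * a ^+ p.+2 + (a ^+ p.+1 * b + a * b ^+ p.+1) by rewrite (exprS a p.+1); ring.
rewrite -natr1 mulrDl mul1r -addrA lerD2l; exact: h.
Qed.

Section Predicates.
Context {n : nat}.
Implicit Types (f g : 'rV[R]_n -> R) (i j : 'I_n).
Local Notation L := (@ornstein_uhlenbeck R n).

(* Eigenfunctions of L for -k all of whose partial derivatives are in the chaos
   of order k - 1: this makes induction on the order immediate. *)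
Fixpoint chaos (k : nat) f : Prop := polyfun f /\
  match k with
  | 0 => exists c, f = fun=> c
  | k'.+1 => L f = (fun x => - k%:R * f x) /\ forall i, chaos k' (partial i f)
  end.

(** Polynomial degree, encoded by iterated derivatives like [chaos], so that [reverse_poincare] is
    an induction on it. *)
Fixpoint degree_le (d : nat) f : Prop := polyfun f /\
  match d with
  | 0 => forall i, partial i f = fun=> 0
  | d'.+1 => forall i, degree_le d' (partial i f)
  end.

Lemma chaos_polyfun k f : chaos k f -> polyfun f.
Proof. by case: k => [|k] []. Qed.

Lemma degree_le_polyfun d f : degree_le d f -> polyfun f.
Proof. by case: d => [|d] []. Qed.

Lemma degree_le0 d : degree_le d (fun=> 0).
Proof.
elim: d => [|d IH]; split; try exact: polyfun_cst.
- by move=> i; rewrite partial_cst.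
- by move=> i; rewrite partial_cst.
Qed.

Lemma chaos_degree k f : chaos k f -> degree_le k f.
Proof.
elim: k f => [|k IH] f /= [pf].
  by move=> [c ->]; split=> [|i]; [exact: polyfun_cst|rewrite partial_cst].
by move=> [_ h]; split=> // i; exact: IH.
Qed.

Lemma degree_leD d f g : degree_le d f -> degree_le d g -> degree_le d (fun x => f x + g x).
Proof.
elim: d f g => [|d IH] f g /= [pf df] [pg dg]; split; try exact: polyfunD.
  move=> i; rewrite (partialD i (polyfun_C1 pf) (polyfun_C1 pg)) df dg.
  by apply/funext => x; rewrite addr0.
by move=> i; rewrite (partialD i (polyfun_C1 pf) (polyfun_C1 pg)); exact: IH.
Qed.

(** By the product rule, with induction on the total degree since either factor may lose a
    degree. *)
Lemma degree_leM d e f g : degree_le d f -> degree_le e g -> degree_le (d + e) (fun x => f x * g x).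
Proof.
move: {2}(d + e)%N (erefl (d + e)%N) => s; elim: s => [|s IH] in d e f g *.
  move/eqP; rewrite addn_eq0 => /andP[/eqP-> /eqP->] /= [pf df] [pg dg].
  split=> [|i]; first exact: polyfunM.
  rewrite (partialM i (polyfun_C1 pf) (polyfun_C1 pg)) df dg.
  by apply/funext => x; rewrite !mulr0 addr0.
move=> des hf hg; rewrite des /=.
have pf := degree_le_polyfun hf; have pg := degree_le_polyfun hg.
split=> [|i]; first exact: polyfunM.
rewrite (partialM i (polyfun_C1 pf) (polyfun_C1 pg)).
have des' : (e + d = s.+1)%N by rewrite addnC.
have H d' e' u v : (d' + e' = s.+1)%N -> degree_le d' u -> degree_le e' v ->
    degree_le s (fun x => u x * partial i v x).
  case: e' => [|e'] de hu /= [_ hv].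
    rewrite hv (_ : (fun x => _) = fun=> 0); first exact: degree_le0.
    by apply/funext => x; rewrite mulr0.
  have e1 : (d' + e' = s)%N by move: de; rewrite addnS => -[].
  by rewrite -e1; exact: IH.
by apply: degree_leD; [exact: (H d e)|exact: (H e d)].
Qed.

Lemma OU_lin (I : Type) (s : seq I) (v : I -> R) (F : I -> 'rV[R]_n -> R) :
  (forall k, polyfun (F k)) ->
  L (fun x => \sum_(k <- s) v k * F k x) = fun x => \sum_(k <- s) v k * L (F k) x.
Proof.
move=> pF; have p1 k := polyfun_C1 (polyfunZ (v k) (pF k)).
have D i : partial i (fun x => \sum_(k <- s) v k * F k x) =
    fun x => \sum_(k <- s) v k * partial i (F k) x.
  rewrite (partial_sum i s (P := xpredT) (F := fun k x => v k * F k x))//.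
  by apply/funext => x; apply: eq_bigr => k _; rewrite (partialZ i (v k) (polyfun_C1 (pF k))).
have D2 i : partial i (partial i (fun x => \sum_(k <- s) v k * F k x)) =
    fun x => \sum_(k <- s) v k * partial i (partial i (F k)) x.
  have pp k := polyfun_partial i (pF k).
  rewrite D (partial_sum i s (P := xpredT) (F := fun k x => v k * partial i (F k) x)); last first.
    by move=> k _; exact: polyfun_C1 (polyfunZ _ (pp k)).
  by apply/funext => x; apply: eq_bigr => k _; rewrite (partialZ i (v k) (polyfun_C1 (pp k))).
apply/funext => x; rewrite /ornstein_uhlenbeck.
transitivity (\sum_(i < n) \sum_(k <- s) (v k * partial i (partial i (F k)) x) -
    \sum_(i < n) \sum_(k <- s) (v k * (x 0 i * partial i (F k) x))).
  apply: (f_equal2 (fun a b : R => a - b)); apply: eq_bigr => i _; first by rewrite D2.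
  by rewrite D mulr_sumr; apply: eq_bigr => k _; rewrite mulrCA.
rewrite exchange_big [X in _ - X]exchange_big -sumrB; apply: eq_bigr => k _.
by rewrite -!mulr_sumr -mulrBr.
Qed.

Lemma partial_lin i (I : Type) (s : seq I) (v : I -> R) (F : I -> 'rV[R]_n -> R) :
  (forall k, polyfun (F k)) ->
  partial i (fun x => \sum_(k <- s) v k * F k x) = fun x => \sum_(k <- s) v k * partial i (F k) x.
Proof.
move=> pF; have p1 k := polyfun_C1 (polyfunZ (v k) (pF k)).
rewrite (partial_sum i s (P := xpredT) (F := fun k x => v k * F k x))//.
by apply/funext => x; apply: eq_bigr => k _; rewrite (partialZ i (v k) (polyfun_C1 (pF k))).
Qed.

Lemma chaos_lin k (I : Type) (s : seq I) (v : I -> R) (F : I -> 'rV[R]_n -> R) :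
  (forall l, chaos k (F l)) -> chaos k (fun x => \sum_(l <- s) v l * F l x).
Proof.
elim: k F => [|k IH] F hF.
  split; first by apply: polyfun_sum => l _; apply: polyfunZ; exact: chaos_polyfun (hF l).
  exists (\sum_(l <- s) v l * F l 0); apply/funext => x; apply: eq_bigr => l _.
  by have [_ [c ->]] := hF l.
have pF l := chaos_polyfun (hF l).
split; first by apply: polyfun_sum => l _; exact: polyfunZ.
split=> [|i].
  rewrite (OU_lin s v pF); apply/funext => x; rewrite mulr_sumr; apply: eq_bigr => l _.
  by have [_ [-> _]] := hF l; rewrite mulrCA.
by rewrite (partial_lin i s v pF); apply: IH => l; have [_ [_ h]] := hF l; exact: h.
Qed.

End Predicates.

Section Expect.
Context d (T : measurableType d) (Q : probability T R) n (Z : T -> 'rV[R]_n).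
Hypothesis GZ : gaussian_vector Q Z.
Implicit Types (f g S V : 'rV[R]_n -> R).
Local Notation L := (@ornstein_uhlenbeck R n).

Definition expect f : R := \int[Q]_w f (Z w).

Lemma exD f g : polyfun f -> polyfun g -> expect (fun x => f x + g x) = expect f + expect g.
Proof. by move=> /polyfun_cgrowth hf /polyfun_cgrowth hg; exact: expectD. Qed.

Lemma exZ (c : R) f : polyfun f -> expect (fun x => c * f x) = c * expect f.
Proof. by move=> /polyfun_cgrowth hf; exact: expectZ. Qed.

Lemma exB f g : polyfun f -> polyfun g -> expect (fun x => f x - g x) = expect f - expect g.
Proof. by move=> /polyfun_cgrowth hf /polyfun_cgrowth hg; exact: expectB. Qed.

Lemma ex_sum (I : Type) (s : seq I) (F : I -> 'rV[R]_n -> R) : (forall i, polyfun (F i)) ->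
  expect (fun x => \sum_(i <- s) F i x) = \sum_(i <- s) expect (F i).
Proof. by move=> h; apply: expect_sum => // i _; exact/polyfun_cgrowth/h. Qed.

Lemma ex_cst (c : R) : expect (fun=> c) = c.
Proof. exact: expect_cst. Qed.

Lemma ex_le f g : polyfun f -> polyfun g -> (forall x, f x <= g x) -> expect f <= expect g.
Proof. by move=> /polyfun_cgrowth hf /polyfun_cgrowth hg; exact: expect_le. Qed.

Lemma ex_ge0 f : (forall x, 0 <= f x) -> 0 <= expect f.
Proof. exact: expect_ge0. Qed.

Lemma ex_OU f g : polyfun f -> polyfun g ->
  expect (fun x => L f x * g x) = - \sum_i expect (fun x => partial i f x * partial i g x).
Proof. by move=> /polyfun_C2 hf /polyfun_C1 hg; exact: expect_OU. Qed.

Lemma ex_OU_sym f g : polyfun f -> polyfun g ->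
  expect (fun x => L f x * g x) = expect (fun x => f x * L g x).
Proof. by move=> /polyfun_C2 hf /polyfun_C2 hg; exact: expect_OU_sym. Qed.

Lemma ex_ibp f i : polyfun f -> expect (fun x => x 0 i * f x) = expect (partial i f).
Proof. by move=> /polyfun_C1 hf; exact: expect_ibp. Qed.

Lemma sq_integrable_polyfun f : polyfun f -> sq_integrable Q (fun w => f (Z w)).
Proof.
move=> pf; split; first exact: (cgrowth_measurable GZ (polyfun_cgrowth pf)).
exact: (cgrowth_integrable GZ (polyfun_cgrowth (polyfunX 2 pf))).
Qed.

Lemma ex_CS f g : polyfun f -> polyfun g ->
  (expect (fun x => f x * g x)) ^+ 2 <= expect (fun x => f x ^+ 2) * expect (fun x => g x ^+ 2).
Proof. by move=> pf pg; apply: cauchy_schwarz; exact: sq_integrable_polyfun. Qed.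

Lemma eq_ex f g : f =1 g -> expect f = expect g.
Proof. by move=> /funext ->. Qed.

Lemma chaos_energy k f : chaos k.+1 f ->
  \sum_i expect (fun x => partial i f x ^+ 2) = k.+1%:R * expect (fun x => f x ^+ 2).
Proof.
move=> [pf [Lf _]]; have := ex_OU pf pf; rewrite Lf.
rewrite (@eq_ex _ (fun x => - k.+1%:R * (f x ^+ 2))); last by move=> x; rewrite expr2 mulrA.
rewrite exZ; last exact: polyfunX.
by rewrite mulNr => /oppr_inj ->.
Qed.

Lemma chaos_orthogonal k l f g : k != l -> chaos k.+1 f -> chaos l.+1 g ->
  expect (fun x => f x * g x) = 0.
Proof.
move=> kl [pf [Lf _]] [pg [Lg _]]; have := ex_OU_sym pf pg; rewrite Lf Lg.
rewrite (@eq_ex (fun x => - k.+1%:R * f x * g x) (fun x => - k.+1%:R * (f x * g x))); last first.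
  by move=> x; rewrite mulrA.
rewrite (@eq_ex (fun x => f x * (- l.+1%:R * g x)) (fun x => - l.+1%:R * (f x * g x))); last first.
  by move=> x; rewrite mulrCA.
have pfg := polyfunM pf pg.
rewrite !exZ// => /eqP; rewrite -subr_eq0 -mulrBl mulf_eq0 => /orP[|/eqP//].
by rewrite opprK addrC subr_eq0 eqr_nat eqSS eq_sym (negbTE kl).
Qed.

(* For f of order k + 1, L gives (k + 1) E f^(2p+2) = (2p+1) sum_i E f^(2p) (d_i f)^2;
   tangent_ineq replaces Hoelder's inequality to separate f and d_i f. *)
Lemma hypercontractivity k f p b : chaos k f -> expect (fun x => f x ^+ 2) < b ->
  expect (fun x => f x ^+ (2 * p.+1)) <= (2 * p.+1)%:R ^+ (k * p.+1) * b ^+ p.+1.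
Proof.
elim: k f b => [|k IH] f b /= [pf].
  move=> [c ->]; rewrite !ex_cst mul0n expr0 mul1r exprM => cb.
  by rewrite lerXn2r ?nnegrE ?sqr_ge0 ?(ltW cb)// (le_trans (sqr_ge0 c) (ltW cb)).
move=> [Lf hf] fb.
set m := expect (fun x => f x ^+ 2) in fb.
have m0 : 0 <= m by apply: ex_ge0 => x; exact: sqr_ge0.
have b0 : 0 < b := le_lt_trans m0 fb.
pose e i := expect (fun x => partial i f x ^+ 2).
have en : \sum_i e i = k.+1%:R * m by apply: chaos_energy; split.
(* The slack b - m is shared among the coordinates, so that the induction hypothesis gets a strict
   bound and e_i + del is positive even when the i-th derivative vanishes. Dividing by n + 1 also
   covers n = 0. *)
pose del := k.+1%:R * (b - m) / n.+1%:R.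
have del0 : 0 < del by rewrite divr_gt0// mulr_gt0// subr_gt0.
have sume : \sum_i (e i + del) <= k.+1%:R * b.
  rewrite big_split/= en sumr_const card_ord -(mulr_natr del n) /del mulrAC -mulrA.
  apply: (@le_trans _ _ (k.+1%:R * m + k.+1%:R * (b - m))); last by rewrite -mulrDr addrC subrK.
  rewrite lerD2l ler_piMr// ?mulr_ge0 ?subr_ge0 ?(ltW fb)//.
  by rewrite ler_pdivrMr// mul1r ler_nat.
set M := expect (fun x => f x ^+ (2 * p.+1)).
set q : R := (2 * p.+1)%:R; set D := q ^+ p.+1 * b ^+ p.+1 * q ^+ (k * p.+1).
have q0 : 0 < q by rewrite ltr0n.
have pp i := polyfun_partial i pf.
pose X i := expect (fun x => f x ^+ (2 * p) * partial i f x ^+ 2).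
have MX : k.+1%:R * M = (2 * p).+1%:R * \sum_i X i.
  have := ex_OU pf (polyfunX (2 * p).+1 pf); rewrite Lf.
  rewrite (@eq_ex _ (fun x => - k.+1%:R * (f x ^+ (2 * p.+1)))); last first.
    by move=> x; rewrite -mulrA -exprS mulnS.
  rewrite exZ; last exact: polyfunX.
  rewrite mulNr => /oppr_inj ->; rewrite mulr_sumr; apply: eq_bigr => i _.
  rewrite -exZ; last by apply: polyfunM; apply: polyfunX.
  apply: eq_ex => x; rewrite (partialX i (2 * p) (polyfun_C1 pf)).
  have comb (u v w : R) : v * (w * u * v) = w * (u * v ^+ 2) by ring.
  exact: comb.
have XB i : p.+1%:R * q * b * X i <= (e i + del) * (p%:R * M + D).
  have ei0 : 0 < e i + del by rewrite ltr_wpDl//; apply: ex_ge0 => x; exact: sqr_ge0.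
  have h := IH (partial i f) (e i + del) (hf i); rewrite ltrDl in h; have {}h := h del0.
  (* This scale makes lam^(p+1) times the bound on the derivative equal to D, the same for all i. *)
  pose lam := q * b / (e i + del).
  have lam0 : 0 < lam by rewrite divr_gt0// mulr_gt0.
  have : p.+1%:R * lam * X i <= p%:R * M + lam ^+ p.+1 * expect (fun x => partial i f x ^+ (2 * p.+1)).
    rewrite -!exZ; try by do ?[apply: polyfunM|apply: polyfunX].
    rewrite -exD; try by do ?[apply: polyfunZ|apply: polyfunX].
    apply: ex_le.
    - by apply: polyfunZ; apply: polyfunM; apply: polyfunX.
    - by apply: polyfunD; apply: polyfunZ; apply: polyfunX.
    move=> x; have := @tangent_ineq p (f x ^+ 2) (lam * partial i f x ^+ 2) (sqr_ge0 _) (mulr_ge0 (ltW lam0) (sqr_ge0 _)).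
    rewrite -!exprM (exprMn p.+1 lam) -exprM.
    have comb (u v w t : R) : w * u * (t * v) = w * t * (u * v) by ring.
    by rewrite (comb (f x ^+ (2 * p)) _ p.+1%:R lam).
  move=> h2; have {}h2 := le_trans h2 (lerD (lexx _) (ler_wpM2l (exprn_ge0 p.+1 (ltW lam0)) h)).
  have e1 : lam ^+ p.+1 * (q ^+ (k * p.+1) * (e i + del) ^+ p.+1) = D.
    rewrite /lam /D mulrCA -exprMn divfK ?gt_eqF// exprMn mulrC//.
  rewrite e1 in h2; have := ler_wpM2l (ltW ei0) h2.
  congr (_ <= _); rewrite /lam; move: (gt_eqF ei0) => /negbT; move: (e i + del) => z z0.
  by move: (p.+1%:R) => P1; field.
have M0 : 0 <= M by apply: ex_ge0 => x; rewrite exprM; apply: exprn_ge0; exact: sqr_ge0.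
have D0 : 0 <= D by rewrite !mulr_ge0// exprn_ge0 ?(ltW q0) ?(ltW b0).
have pD : 0 <= p%:R * M + D by rewrite addr_ge0// mulr_ge0// ler0n.
have X0 i : 0 <= X i.
  by apply: ex_ge0 => x; rewrite mulr_ge0 ?sqr_ge0// exprM; apply: exprn_ge0; exact: sqr_ge0.
have SX : p.+1%:R * q * b * \sum_i X i <= k.+1%:R * b * (p%:R * M + D).
  rewrite mulr_sumr; apply: le_trans (ler_sum _ (fun i _ => XB i)) _.
  by rewrite -mulr_suml ler_wpM2r.
(* After removing the common factors, [SX] says (p + 1) M <= p M + D. *)
have : M <= D.
  have SX0 : 0 <= \sum_i X i by apply: sumr_ge0.
  have h3 : k.+1%:R * M <= q * \sum_i X i.
    by rewrite MX ler_wpM2r// ler_nat mulnS add2n ltnW.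
  have h4 : (p.+1%:R * b) * (k.+1%:R * M) <= (k.+1%:R * b) * (p%:R * M + D).
    apply: le_trans SX; apply: (@le_trans _ _ (p.+1%:R * b * (q * \sum_i X i))).
      by rewrite ler_pM2l// mulr_gt0// ltr0n.
    by rewrite le_eqVlt; apply/orP; left; apply/eqP; ring.
  have h5 : (k.+1%:R * b) * (p.+1%:R * M) <= (k.+1%:R * b) * (p%:R * M + D).
    by apply: le_trans h4; rewrite le_eqVlt; apply/orP; left; apply/eqP; ring.
  move: h5; rewrite ler_pM2l ?mulr_gt0// -natr1 mulrDl mul1r lerD2l//.
move=> /le_trans; apply; rewrite /D mulrAC -exprD mulSn//.
Qed.

End Expect.
End Chaos.

(** * Moment inequalities in a fixed chaos and the fourth moment bound *)

Section Moments.
Context {R : realType}.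
Context d (T : measurableType d) (Q : probability T R) n (Z : T -> 'rV[R]_n).
Hypothesis GZ : gaussian_vector Q Z.
Implicit Types (f g S V : 'rV[R]_n -> R).
Local Notation L := (@ornstein_uhlenbeck R n).
Local Notation ex := (expect Q Z).

(** Convexity of t^(p+1) with weights e_i / b, obtained by summing [tangent_ineq] at sum_i Y_i^2.
    The weights being proportional to the energy bounds, the constant does not depend on the number
    of summands. *)
Lemma moment_sum_sqr k p m (Y : 'I_m -> 'rV[R]_n -> R) (e : 'I_m -> R) (B : R) : (0 < m)%N ->
  (forall i, chaos k (Y i)) -> (forall i, ex (fun x => Y i x ^+ 2) < e i) -> \sum_i e i <= B ->
  ex (fun x => (\sum_i Y i x ^+ 2) ^+ p.+1) <= (2 * p.+1)%:R ^+ (k * p.+1) * B ^+ p.+1.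
Proof.
move=> m0 cY he hB; set C := (2 * p.+1)%:R ^+ _.
have C0 : 0 <= C by apply: exprn_ge0.
have e0 i : 0 < e i by apply: le_lt_trans (he i); apply: ex_ge0 => x; exact: sqr_ge0.
pose b := \sum_i e i.
have b0 : 0 < b.
  rewrite /b (bigD1 (Ordinal m0))//= ltr_wpDr//.
  by apply: sumr_ge0 => i _; exact: ltW.
have pY i := chaos_polyfun (cY i).
have bn0 : b != 0 by rewrite gt_eqF.
apply: (@le_trans _ _ (C * b ^+ p.+1)); last first.
  by rewrite ler_wpM2l// lerXn2r// nnegrE ?(ltW b0)// (le_trans (ltW b0)).
have key x : (\sum_i Y i x ^+ 2) ^+ p.+1 <= \sum_i (e i / b * (b / e i) ^+ p.+1) * Y i x ^+ (2 * p.+1).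
  set a := \sum_i Y i x ^+ 2.
  have a0 : 0 <= a by apply: sumr_ge0 => i _; exact: sqr_ge0.
  have h i : e i / b * (p.+1%:R * a ^+ p * (b / e i * Y i x ^+ 2)) <=
     e i / b * (p%:R * a ^+ p.+1 + (b / e i * Y i x ^+ 2) ^+ p.+1).
    by rewrite ler_pM2l ?divr_gt0// tangent_ineq// mulr_ge0 ?sqr_ge0// ltW// divr_gt0.
  have := ler_sum (index_enum 'I_m) (fun i (_ : xpredT i) => h i).
  have -> : \sum_i e i / b * (p.+1%:R * a ^+ p * (b / e i * Y i x ^+ 2)) = p.+1%:R * a ^+ p.+1.
    rewrite exprSr mulrA {3}/a mulr_sumr; apply: eq_bigr => i _.
    have ei : e i != 0 by rewrite gt_eqF.
    by rewrite [LHS]mulrCA; congr (_ * _); rewrite !mulrA divfK// divff// mul1r.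
  have -> : \sum_i e i / b * (p%:R * a ^+ p.+1 + (b / e i * Y i x ^+ 2) ^+ p.+1) =
     p%:R * a ^+ p.+1 + \sum_i (e i / b * (b / e i) ^+ p.+1) * Y i x ^+ (2 * p.+1).
    have es : \sum_i e i / b * (p%:R * a ^+ p.+1) = p%:R * a ^+ p.+1.
      by rewrite -mulr_suml -mulr_suml -/b divff// mul1r.
    transitivity (\sum_i e i / b * (p%:R * a ^+ p.+1) + \sum_i (e i / b * (b / e i) ^+ p.+1) * Y i x ^+ (2 * p.+1)).
      rewrite -big_split/=; apply: eq_bigr => i _.
      by rewrite mulrDr (exprMn p.+1 (b / e i)) -exprM [X in _ + X]mulrA.
    by rewrite es.
  by rewrite -natr1 mulrDl mul1r lerD2l.
have pS : polyfun (fun x => \sum_i Y i x ^+ 2) by apply: polyfun_sum => i _; exact: polyfunX.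
apply: le_trans (ex_le GZ (polyfunX p.+1 pS) _ key) _.
  by apply: polyfun_sum => i _; apply: polyfunZ; exact: polyfunX.
rewrite ex_sum//; last by move=> i; apply: polyfunZ; exact: polyfunX.
have -> : C * b ^+ p.+1 = \sum_i (e i / b) * (C * b ^+ p.+1) by rewrite -mulr_suml -mulr_suml -/b divff// mul1r.
apply: ler_sum => i _; rewrite exZ//; last exact: polyfunX.
rewrite -mulrA ler_pM2l ?divr_gt0//.
have := hypercontractivity GZ p (cY i) (he i); rewrite -/C => h.
apply: le_trans (ler_wpM2l (exprn_ge0 p.+1 (ltW (divr_gt0 b0 (e0 i)))) h) _.
rewrite mulrCA -exprMn divfK ?gt_eqF//.
Qed.

(** One integration by parts leaves d_i V against d_i (L V); the commutator of [partial_OU] yields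
    the first-order sum, a second integration by parts the other. *)
Lemma bochner V : polyfun V ->
  ex (fun x => L V x ^+ 2) = \sum_i ex (fun x => partial i V x ^+ 2) +
    \sum_i \sum_j ex (fun x => partial j (partial i V) x ^+ 2).
Proof.
move=> pV; have pp i := polyfun_partial i pV.
have -> : ex (fun x => L V x ^+ 2) = ex (fun x => L V x * L V x) by apply: eq_ex => x; rewrite expr2.
rewrite ex_OU//; last exact: polyfun_OU.
rewrite -big_split -sumrN /=; apply: eq_bigr => i _.
rewrite (partial_OU i pV).
have pL := polyfun_OU (pp i).
have -> : ex (fun x => partial i V x * (L (partial i V) x - partial i V x)) =
   ex (fun x => L (partial i V) x * partial i V x) - ex (fun x => partial i V x ^+ 2).
  rewrite -exB//; [|exact: polyfunM|exact: polyfunX].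
  by apply: eq_ex => x; rewrite mulrBr expr2 mulrC.
rewrite ex_OU// opprB opprK; congr (_ + _).
Qed.

(* By bochner and induction E (L V)^2 is at most dg times the energy of V, and the
   energy is - E (L V) V. *)
Lemma reverse_poincare dg V : degree_le dg V ->
  \sum_i ex (fun x => partial i V x ^+ 2) <= dg%:R * ex (fun x => V x ^+ 2).
Proof.
elim: dg V => [|dg IH] V /= [pV hV].
  rewrite mul0r big1// => i _; rewrite hV -[RHS](ex_cst Q Z 0); apply: eq_ex => x.
  by rewrite expr0n.
set D := \sum_i _; set v := ex _.
have D0 : 0 <= D by apply: sumr_ge0 => i _; apply: ex_ge0 => x; exact: sqr_ge0.
have v0 : 0 <= v by apply: ex_ge0 => x; exact: sqr_ge0.
have DE : D = - ex (fun x => L V x * V x).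
  by rewrite ex_OU// opprK; apply: eq_bigr => i _; apply: eq_ex => x; rewrite expr2.
have h1 : D ^+ 2 <= ex (fun x => L V x ^+ 2) * v.
  by rewrite DE sqrrN; apply: ex_CS => //; exact: polyfun_OU.
have h2 : ex (fun x => L V x ^+ 2) <= dg.+1%:R * D.
  rewrite bochner// -natr1 mulrDl mul1r addrC lerD2r mulr_sumr.
  by apply: ler_sum => i _; exact: IH.
have := le_trans h1 (ler_wpM2r v0 h2).
(* [h1] and [h2] give D^2 <= (dg + 1) D v; it remains to cancel D when it is nonzero. *)
have [->|Dn] := eqVneq D 0; first by move=> _; rewrite mulr_ge0.
have Dp : 0 < D by rewrite lt_neqAle eq_sym Dn.
by rewrite expr2 -mulrA mulrCA ler_pM2l.
Qed.

Section FourthMoment.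
Variables (S : 'rV[R]_n -> R) (v : 'I_n -> R).
Hypotheses (cS : chaos 3 S) (v1 : \sum_i v i ^+ 2 = 1).
Let pS := chaos_polyfun cS.
Let LS : L S = fun x => - 3 * S x := proj1 (proj2 cS).
Let pp i := polyfun_partial i pS.
(* The bound is Cauchy-Schwarz for G - E G against the second Hermite polynomial
   H of the unit direction v, with E G^2 <= 3 E S^4 from reverse_poincare. *)
Let G x := \sum_i partial i S x ^+ 2.
Let pG : polyfun G. Proof. by apply: polyfun_sum => i _; exact: polyfunX. Qed.
Let DvS x := \sum_i v i * partial i S x.
Let pDv : polyfun DvS. Proof. by apply: polyfun_sum => i _; exact: polyfunZ. Qed.
Let Y (x : 'rV[R]_n) := \sum_i v i * x 0 i.
Let pY : polyfun Y. Proof. by apply: polyfun_sum => i _; apply: polyfunZ; exact: polyfun_coord. Qed.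
Let H x := Y x ^+ 2 - 1.
Let pH : polyfun H. Proof. by apply: polyfunB; [exact: polyfunX|exact: polyfun_cst]. Qed.

Let partialY i : partial i Y = fun=> v i.
Proof.
rewrite /Y (partial_lin i _ v (fun k => polyfun_coord k)); apply/funext => x.
rewrite (bigD1 i)//= partial_coord eqxx mulr1 big1 ?addr0// => k ki.
by rewrite partial_coord (negbTE ki) mulr0.
Qed.

Let LY : L Y = fun x => - Y x.
Proof.
apply/funext => x; rewrite /ornstein_uhlenbeck big1 ?sub0r; last first.
  by move=> i _; rewrite partialY partial_cst.
by congr (- _); apply: eq_bigr => i _; rewrite partialY mulrC.
Qed.

Let partialH i : partial i H = fun x => 2 * v i * Y x.
Proof.
rewrite /H (partialB i (polyfun_C1 (polyfunX 2 pY)) (C1growth_cst 1)) partial_cst.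
rewrite (partialX i 1 (polyfun_C1 pY)) partialY; apply/funext => x.
by rewrite subr0 expr1 mulrAC.
Qed.

Let LH : L H = fun x => - 2 * H x.
Proof.
have LHx x : L H x = L (fun x => Y x * Y x) x.
  rewrite /ornstein_uhlenbeck; apply: (f_equal2 (fun a b : R => a - b)); apply: eq_bigr => i _.
    by rewrite partialH (partialM i (polyfun_C1 pY) (polyfun_C1 pY)) partialY; congr (partial i _ x); apply/funext => y; ring.
  by rewrite partialH (partialM i (polyfun_C1 pY) (polyfun_C1 pY)) partialY; congr (_ * _); ring.
apply/funext => x; rewrite LHx (OUM (polyfun_C2 pY) (polyfun_C2 pY)) LY.
have -> : \sum_i partial i Y x * partial i Y x = 1.
  by rewrite -v1; apply: eq_bigr => i _; rewrite partialY expr2.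
rewrite /H; ring.
Qed.

Let exY2 : ex (fun x => Y x ^+ 2) = 1.
Proof.
have := ex_OU GZ pY pY; rewrite LY.
have -> : ex (fun x => - Y x * Y x) = - ex (fun x => Y x ^+ 2).
  rewrite -mulN1r -exZ//; last exact: polyfunX.
  by apply: eq_ex => x; rewrite mulN1r mulNr expr2.
move=> /oppr_inj ->; rewrite -v1; apply: eq_bigr => i _; rewrite partialY -[RHS](ex_cst Q Z).
by apply: eq_ex => x; rewrite expr2.
Qed.

Let exH : ex H = 0.
Proof. by rewrite /H exB ?ex_cst ?exY2 ?subrr//; [exact: polyfunX|exact: polyfun_cst]. Qed.

Let exH2 : ex (fun x => H x ^+ 2) = 2.
Proof.
have := ex_OU GZ pH pH; rewrite LH.
have -> : ex (fun x => - 2 * H x * H x) = - 2 * ex (fun x => H x ^+ 2).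
  by rewrite -exZ//; [apply: eq_ex => x; rewrite expr2 mulrA|exact: polyfunX].
rewrite mulNr => /oppr_inj h.
have : 2 * ex (fun x => H x ^+ 2) = 4.
  transitivity (\sum_i 4 * v i ^+ 2); last by rewrite -mulr_sumr v1 mulr1.
  rewrite h; apply: eq_bigr => i _; rewrite partialH.
  transitivity (ex (fun x => (4 * v i ^+ 2) * Y x ^+ 2)); last by rewrite exZ ?exY2 ?mulr1//; exact: polyfunX.
  by apply: eq_ex => x; ring.
by move=> ?; lra.
Qed.

Let W x := S x * S x.
Let pW : polyfun W := polyfunM pS pS.
Let LW : L W = fun x => 2 * G x - 6 * W x.
Proof.
rewrite /W (OUM (polyfun_C2 pS) (polyfun_C2 pS)) LS; apply/funext => x.
have -> : \sum_i partial i S x * partial i S x = G x by apply: eq_bigr => i _; rewrite expr2.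
ring.
Qed.

Let partialW i : partial i W = fun x => 2 * (S x * partial i S x).
Proof.
by rewrite /W (partialM i (polyfun_C1 pS) (polyfun_C1 pS)); apply/funext => x; rewrite mulrDl mul1r.
Qed.

Let m4 := ex (fun x => S x ^+ 4).

(** In the energy identity for W = S^2 both sides involve E(W G): 2 E(W G) - 6 E S^4 = - 4 E(W
    G). *)
Let exWG : ex (fun x => W x * G x) = m4.
Proof.
have := ex_OU GZ pW pW; rewrite LW.
have -> : ex (fun x => (2 * G x - 6 * W x) * W x) = 2 * ex (fun x => W x * G x) - 6 * m4.
  rewrite -!exZ//; [|exact: polyfunX|exact: polyfunM].
  rewrite -exB//; [|by apply: polyfunZ; exact: polyfunM|by apply: polyfunZ; exact: polyfunX].
  by apply: eq_ex => x; rewrite /W; ring.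
have -> : \sum_i ex (fun x => partial i W x * partial i W x) = 4 * ex (fun x => W x * G x).
  rewrite -exZ//; last exact: polyfunM.
  rewrite (@eq_ex _ _ _ Q _ Z (fun x => 4 * (W x * G x)) (fun x => \sum_i 4 * (W x * partial i S x ^+ 2))); last first.
    by move=> x; rewrite /G !mulr_sumr.
  rewrite ex_sum//; last by move=> i; apply: polyfunZ; apply: polyfunM => //; exact: polyfunX.
  apply: eq_bigr => i _; apply: eq_ex => x; rewrite partialW /W.
  have comb (a b : R) : 2 * (a * b) * (2 * (a * b)) = 4 * (a * a * b ^+ 2) by ring.
  exact: comb.
by move=> ?; lra.
Qed.

(** The derivatives of W have degree at most 5, so [bochner] and [reverse_poincare] bound E(L W)^2
    by (1 + 5) 4 E S^4. Expanding L W = 2 G - 6 W with [exWG] turns this into the claim. *)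
Let exG2 : ex (fun x => G x ^+ 2) <= 3 * m4.
Proof.
have dW i : degree_le 5 (partial i W).
  have : degree_le 6 W by apply: (@degree_leM _ _ 3 3); exact: chaos_degree.
  by move=> /= [_]; apply.
have sW : \sum_i ex (fun x => partial i W x ^+ 2) = 4 * m4.
  rewrite -exWG -exZ//; last exact: polyfunM.
  rewrite (@eq_ex _ _ _ Q _ Z (fun x => 4 * (W x * G x)) (fun x => \sum_i 4 * (W x * partial i S x ^+ 2))); last first.
    by move=> x; rewrite /G !mulr_sumr.
  rewrite ex_sum//; last by move=> i; apply: polyfunZ; apply: polyfunM => //; exact: polyfunX.
  apply: eq_bigr => i _; apply: eq_ex => x; rewrite partialW /W.
  have comb (a b : R) : (2 * (a * b)) ^+ 2 = 4 * (a * a * b ^+ 2) by ring.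
  exact: comb.
have hb : ex (fun x => L W x ^+ 2) = 4 * m4 + \sum_i \sum_j ex (fun x => partial j (partial i W) x ^+ 2).
  exact: etrans (bochner pW) (congr1 (fun t => t + _) sW).
have h : \sum_i \sum_j ex (fun x => partial j (partial i W) x ^+ 2) <= 5 * (4 * m4).
  apply: (@le_trans _ _ (\sum_i 5 * ex (fun x => partial i W x ^+ 2))).
    by apply: ler_sum => i _; exact: reverse_poincare.
  have eqle (a b : R) : a = b -> a <= b by move=> ->.
  by rewrite -mulr_sumr ler_pM2l//; exact: eqle sW.
have e1 : ex (fun x => L W x ^+ 2) = 4 * ex (fun x => G x ^+ 2) - 24 * ex (fun x => W x * G x) + 36 * m4.
  transitivity (ex (fun x => 4 * (G x ^+ 2) - 24 * (W x * G x) + 36 * (S x ^+ 4))).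
    by apply: eq_ex => x; rewrite LW /W; ring.
  have p1 := polyfunZ 4 (polyfunX 2 pG); have p2 := polyfunZ 24 (polyfunM pW pG).
  rewrite (exD GZ (polyfunB p1 p2) (polyfunZ 36 (polyfunX 4 pS))) (exB GZ p1 p2).
  by rewrite (exZ GZ 4 (polyfunX 2 pG)) (exZ GZ 24 (polyfunM pW pG)) (exZ GZ 36 (polyfunX 4 pS)).
have := etrans (esym e1) hb; rewrite exWG; move: h.
move: (\sum_i \sum_j _) (ex (fun x => G x ^+ 2)) m4 => a b c h e.
by lra.
Qed.

Let exG : ex G = 3 * ex (fun x => S x ^+ 2).
Proof.
rewrite -(chaos_energy GZ cS) /G ex_sum// => i; exact: polyfunX.
Qed.

(** Write G = (L W)/2 + 3 W and move L onto H, an eigenfunction for -2; this leaves 2 E(W H). Two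
    integrations by parts along v give E(W H) = 2 E(D_v S)^2, because S is orthogonal to D_v D_v S,
    which lies in the first chaos. *)
Let exGH : ex (fun x => G x * H x) = 4 * ex (fun x => DvS x ^+ 2).
Proof.
have GE x : G x * H x = 2^-1 * (L W x * H x) + 3 * (W x * H x).
  by rewrite LW; field.
have -> : ex (fun x => G x * H x) = 2 * ex (fun x => W x * H x).
  rewrite (@eq_ex _ _ _ Q _ Z _ _ GE) (exD GZ); [|by apply: polyfunZ; apply: polyfunM => //; exact: polyfun_OU|by apply: polyfunZ; exact: polyfunM].
  rewrite (exZ GZ 2^-1 (polyfunM (polyfun_OU pW) pH)) (exZ GZ 3 (polyfunM pW pH)).
  rewrite ex_OU_sym// LH.
  have -> : ex (fun x => W x * (- 2 * H x)) = - 2 * ex (fun x => W x * H x).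
    by rewrite -(exZ GZ); [apply: eq_ex => x; rewrite mulrCA|exact: polyfunM].
  by field.
have pDD : polyfun (fun x => \sum_i v i * partial i DvS x).
  by apply: polyfun_sum => i _; apply: polyfunZ; exact: polyfun_partial.
have ibpY f : polyfun f -> ex (fun x => Y x * f x) = ex (fun x => \sum_i v i * partial i f x).
  move=> pf; rewrite ex_sum//; last by move=> i; apply: polyfunZ; exact: polyfun_partial.
  rewrite (@eq_ex _ _ _ Q _ Z _ (fun x => \sum_i v i * (x 0 i * f x))); last first.
    by move=> x; rewrite /Y mulr_suml; apply: eq_bigr => i _; rewrite mulrA.
  rewrite ex_sum//; last by move=> i; apply: polyfunZ; apply: polyfunM => //; exact: polyfun_coord.
  apply: eq_bigr => i _; rewrite (exZ GZ (v i) (polyfunM (polyfun_coord i) pf)).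
  by rewrite (exZ GZ (v i) (polyfun_partial i pf)) (ex_ibp GZ i pf).
have cDv : chaos 2 DvS by apply: chaos_lin => i; have [_ [_ h]] := cS; exact: h.
have cDD : chaos 1 (fun x => \sum_i v i * partial i DvS x).
  by apply: chaos_lin => i; have [_ [_ h]] := cDv; exact: h.
have -> : ex (fun x => W x * H x) = 2 * ex (fun x => DvS x ^+ 2).
  have -> : ex (fun x => W x * H x) = ex (fun x => Y x * (Y x * W x)) - ex W.
    rewrite -exB//; [|by do ?apply: polyfunM].
    by apply: eq_ex => x; rewrite /H; ring.
  rewrite ibpY; last exact: polyfunM.
  have -> : ex (fun x => \sum_i v i * partial i (fun x => Y x * W x) x) =
      ex W + 2 * ex (fun x => Y x * (S x * DvS x)).
    rewrite -(exZ GZ); last by do ?apply: polyfunM.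
    rewrite -exD//; last by apply: polyfunZ; do ?apply: polyfunM.
    apply: eq_ex => x.
    transitivity (\sum_i (v i ^+ 2 * W x + 2 * (Y x * (S x * (v i * partial i S x))))).
      apply: eq_bigr => i _; rewrite (partialM i (polyfun_C1 pY) (polyfun_C1 pW)) partialW partialY.
      have comb (a y s q w : R) : a * (y * (2 * (s * q)) + w * a) = a ^+ 2 * w + 2 * (y * (s * (a * q))) by ring.
      exact: comb.
    by rewrite big_split/= -mulr_suml v1 mul1r -!mulr_sumr.
  rewrite ibpY; last exact: polyfunM.
  have -> : ex (fun x => \sum_i v i * partial i (fun x => S x * DvS x) x) = ex (fun x => DvS x ^+ 2).
    have -> : ex (fun x => DvS x ^+ 2) = ex (fun x => DvS x ^+ 2) + ex (fun x => S x * (\sum_i v i * partial i DvS x)).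
      by rewrite (chaos_orthogonal GZ (k := 2) (l := 0)) ?addr0.
    rewrite -(exD GZ); [|exact: polyfunX|exact: polyfunM].
    apply: eq_ex => x.
    transitivity (\sum_i (DvS x * (v i * partial i S x) + S x * (v i * partial i DvS x))).
      apply: eq_bigr => i _; rewrite (partialM i (polyfun_C1 pS) (polyfun_C1 pDv)).
      have comb (a s q y t : R) : a * (s * y + q * t) = q * (a * t) + s * (a * y) by ring.
      exact: comb.
    by rewrite big_split/= -!mulr_sumr expr2.
  by rewrite addrAC subrr add0r.
ring.
Qed.

(** Here E G = 3 E S^2 and E H^2 = 2, hence the constants. When E S^2 = 1 the right-hand side is
    three times the fourth cumulant. *)
Lemma fourth_moment_bound :
  8 * (ex (fun x => DvS x ^+ 2)) ^+ 2 <= 3 * m4 - 9 * (ex (fun x => S x ^+ 2)) ^+ 2.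
Proof.
set s2 := ex (fun x => S x ^+ 2); set u := ex (fun x => DvS x ^+ 2).
have pGc : polyfun (fun x => G x - 3 * s2) by apply: polyfunB => //; exact: polyfun_cst.
have := ex_CS GZ pGc pH; rewrite exH2.
have -> : ex (fun x => (G x - 3 * s2) * H x) = 4 * u.
  rewrite -exGH (@eq_ex _ _ _ Q _ Z _ (fun x => G x * H x - 3 * s2 * H x)); last by move=> x; rewrite mulrBl.
  by rewrite exB ?exZ ?exH ?mulr0 ?subr0//; [exact: polyfunM|exact: polyfunZ].
have -> : ex (fun x => (G x - 3 * s2) ^+ 2) = ex (fun x => G x ^+ 2) - 9 * s2 ^+ 2.
  rewrite (@eq_ex _ _ _ Q _ Z _ (fun x => G x ^+ 2 - (6 * s2) * G x + 9 * s2 ^+ 2)); last by move=> x; ring.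
  rewrite exD ?exB ?exZ ?ex_cst ?exG//; try exact: polyfunX; try exact: polyfunZ; try exact: polyfun_cst.
    by rewrite -/s2; ring.
  by apply: polyfunB; [exact: polyfunX|exact: polyfunZ].
by move: exG2; move: (ex (fun x => G x ^+ 2)) m4 => a b h1 h2; nra.
Qed.

End FourthMoment.
End Moments.

(** * Small ball estimate for a sum of squares of quadratic forms *)

Section ProductIntegral.
Context {R : realType}.
Context d1 (T1 : measurableType d1) (P1 : probability T1 R)
        d2 (T2 : measurableType d2) (P2 : probability T2 R).
Variables (F : T1 -> T2 -> R) (g : T1 -> R).
Hypothesis mF : measurable_fun [set: T1 * T2] (fun z => F z.1 z.2).
Hypothesis Fg : forall x y, `|F x y| <= g x.
Hypothesis ig : P1.-integrable setT (EFin \o g).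

Let mFE : measurable_fun [set: T1 * T2] (fun z => (F z.1 z.2)%:E).
Proof. exact/measurable_EFinP. Qed.

Let g0 x : 0 <= g x.
Proof. by rewrite (le_trans _ (Fg x point)). Qed.

Let iF : (P1 \x P2)%E.-integrable setT (fun z => (F z.1 z.2)%:E).
Proof.
apply/(integrable12ltyP P1 P2 mFE).
have /integrableP[mg] := ig; apply: le_lt_trans; apply: ge0_le_integral => //.
- by move=> x _; exact: integral_ge0.
- have mabs : measurable_fun setT (fun z => `|(F z.1 z.2)%:E|%E) by exact: measurableT_comp.
  exact: (@measurable_fun_fubini_tonelli_F _ _ _ _ _ P2 (fun z => `|(F z.1 z.2)%:E|%E)).
- exact: measurableT_comp.
move=> x _ /=.
apply: (@le_trans _ _ (\int[P2]_y (g x)%:E)%E).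
  apply: ge0_le_integral => //.
  - have mFx : measurable_fun setT (F x) := measurableT_comp mF (pair1_measurable x).
    by apply/measurable_EFinP; exact: measurableT_comp.
  - by move=> y _; rewrite lee_fin.
by rewrite integral_cst// [X in (_ * X)%E]probability_setT mule1 lee_fin ler_norm.
Qed.

Let iF1 x : P2.-integrable setT (EFin \o F x).
Proof.
have ic : P2.-integrable setT (EFin \o (fun=> g x)) by exact: finite_measure_integrable_cst.
apply: (le_integrableR _ _ ic); first exact: (measurableT_comp mF (pair1_measurable x)).
by move=> y; rewrite (le_trans (Fg x y))// ler_norm.
Qed.

Let iF2 y : P1.-integrable setT (EFin \o (F^~ y)).
Proof.
apply: (le_integrableR _ _ ig); first exact: (measurableT_comp mF (pair2_measurable y)).
by move=> x; rewrite (le_trans (Fg x y))// ler_norm.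
Qed.

Lemma Rintegral_prod1 :
  \int[(P1 \x P2)%E]_z F z.1 z.2 = \int[P1]_x \int[P2]_y F x y.
Proof.
rewrite /Rintegral -(integral12_prod_meas1 iF); congr fine; apply: eq_integral => x _.
by rewrite /fubini_F -(EFin_Rintegral (iF1 x)).
Qed.

Lemma Rintegral_prod2 :
  \int[(P1 \x P2)%E]_z F z.1 z.2 = \int[P2]_y \int[P1]_x F x y.
Proof.
rewrite /Rintegral -(integral21_prod_meas1 iF); congr fine; apply: eq_integral => y _.
by rewrite /fubini_G -(EFin_Rintegral (iF2 y)).
Qed.

Lemma Rintegral_swap : \int[P1]_x \int[P2]_y F x y = \int[P2]_y \int[P1]_x F x y.
Proof. by rewrite -Rintegral_prod1 Rintegral_prod2. Qed.

Lemma integrable_section2 : P2.-integrable setT (EFin \o (fun y => \int[P1]_x F x y)).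
Proof.
have ic : P2.-integrable setT (EFin \o (fun=> \int[P1]_x g x)) by exact: finite_measure_integrable_cst.
apply: (le_integrableR _ _ ic).
  apply/measurable_EFinP; have := measurable_fubini_G iF.
  congr measurable_fun; apply/funext => y.
  by rewrite /fubini_G /= -(EFin_Rintegral (iF2 y)).
move=> y; rewrite (le_trans _ (ler_norm _))// ler_norml; apply/andP; split.
  rewrite lerNl -[leLHS]mulN1r -RintegralZl//; apply: le_Rintegral => //.
    exact: (@integrableZl _ _ _ P1 _ _ _ (EFin \o (F^~ y))).
  by move=> x _; rewrite mulN1r lerNl; have := Fg x y; rewrite ler_norml => /andP[].
apply: le_Rintegral => //.
by move=> x _; rewrite (le_trans (ler_norm _)).
Qed.

End ProductIntegral.

Section Decoupling.
Context {R : realType}.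
Context d1 (T : measurableType d1) (Q : probability T R) n (Z : T -> 'rV[R]_n).
Hypothesis GZ : gaussian_vector Q Z.

Definition quadf (A : 'M[R]_n) (c : R) (x : 'rV[R]_n) : R := (x *m A *m x^T) 0 0 / 2 + c.

Lemma quadfE A c x : quadf A c x = (\sum_j (\sum_i x 0 i * A i j) * x 0 j) / 2 + c.
Proof. by rewrite /quadf mxE; congr (_ / 2 + c); apply: eq_bigr => j _; rewrite !mxE. Qed.

Lemma quadf_polyfun A c : polyfun (quadf A c).
Proof.
rewrite (_ : quadf A c = fun x => 2^-1 * (\sum_j (\sum_i A i j * x 0 i) * x 0 j) + c).
  apply: polyfunD; last exact: polyfun_cst.
  apply: polyfunZ; apply: polyfun_sum => j _; apply: polyfunM; last exact: polyfun_coord.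
  by apply: polyfun_sum => i _; apply: polyfunZ; exact: polyfun_coord.
apply/funext => x; rewrite quadfE mulrC; congr (_ * _ + _); apply: eq_bigr => j _; congr (_ * _).
by apply: eq_bigr => i _; exact: mulrC.
Qed.

Lemma continuous_cos_comp m (f : 'rV[R]_m -> R) : continuous f -> continuous (fun x => cos (f x)).
Proof. by move=> cf x; apply: (@continuous_comp _ _ _ f cos); [exact: cf|exact: continuous_cos]. Qed.

(* The square is an integral over two independent copies (x, y); rotating the
   pair by 45 degrees turns q x - q y into a bilinear form, and the Gaussian
   integral over one variable is explicit. *)
Lemma decoupling (A : 'M[R]_n) c (xi : R) : A^T = A ->
  (\int[Q]_w cos (xi * quadf A c (Z w))) ^+ 2 <=
  \int[Q]_w expR (- (xi ^+ 2 * sqn (Z w *m A) / 2)).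
Proof.
move=> AT; set q := quadf A c.
have cq : continuous q by have [] := polyfun_cgrowth (quadf_polyfun A c).
have mZ := proj1 GZ.
pose U := fun w => xi * q (Z w).
have mU : measurable_fun setT U.
  by apply: (continuous_measurable_rV (h := fun x => xi * q x)) => // x; exact: (cvgM (cvg_cst xi) (cq x)).
have GG := gaussian_pair GZ GZ.
(* The summand 1 makes the integrand nonnegative, as [gaussian_rotation] requires; it cancels at the
   end. *)
pose Psi (z : 'rV[R]_(n + n)) : R := 1 + cos (xi * q (lsubmx z) - xi * q (rsubmx z)).
have cl : continuous (fun z : 'rV[R]_(n + n) => lsubmx z).
  apply: continuous_rV => j; rewrite (_ : (fun z => _) = fun z : 'rV[R]_(n + n) => z 0 (lshift n j)); first exact: coord_continuous.
  by apply/funext => z; rewrite mxE.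
have cr : continuous (fun z : 'rV[R]_(n + n) => rsubmx z).
  apply: continuous_rV => j; rewrite (_ : (fun z => _) = fun z : 'rV[R]_(n + n) => z 0 (rshift n j)); first exact: coord_continuous.
  by apply/funext => z; rewrite mxE.
have cql : continuous (fun z : 'rV[R]_(n + n) => q (lsubmx z)).
  by move=> z; apply: (@continuous_comp _ _ _ (fun z : 'rV[R]_(n + n) => lsubmx z) q); [exact: cl|exact: cq].
have cqr : continuous (fun z : 'rV[R]_(n + n) => q (rsubmx z)).
  by move=> z; apply: (@continuous_comp _ _ _ (fun z : 'rV[R]_(n + n) => rsubmx z) q); [exact: cr|exact: cq].
have cPsi : continuous Psi.
  have cc : continuous (fun z : 'rV[R]_(n + n) => cos (xi * q (lsubmx z) - xi * q (rsubmx z))).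
    apply: (continuous_cos_comp (f := fun z : 'rV[R]_(n + n) => xi * q (lsubmx z) - xi * q (rsubmx z))) => z.
    exact: (cvgB (cvgM (cvg_cst xi) (cql z)) (cvgM (cvg_cst xi) (cqr z))).
  by move=> z; exact: (cvgD (cvg_cst (1 : R)) (cc z)).
have Psi0 z : 0 <= Psi z by rewrite /Psi -[X in X + _]opprK addrC subr_ge0 cos_geN1.
have rot := gaussian_rotation GG cPsi Psi0.
(* For independent copies, cos (U - U') has mean (E cos U)^2 + (E sin U)^2. *)
have LHS1 : \int[(Q \x Q)%E]_w Psi (row_mx (Z w.1) (Z w.2)) =
    1 + (\int[Q]_w cos (U w)) ^+ 2 + (\int[Q]_w sin (U w)) ^+ 2.
  rewrite (_ : (fun w => _) = fun w : T * T => 1 + cos (U w.1 - U w.2)); last first.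
    by apply/funext => w; rewrite /Psi row_mxKl row_mxKr.
  have m12 : measurable_fun [set: T * T] (fun w => 1 + cos (U w.1 - U w.2)).
    apply: measurable_funD => //; apply: measurableT_comp => //.
      exact: continuous_measurable_fun (@continuous_cos R).
    by apply: measurable_funB; apply: measurableT_comp.
  have bd x y : `|1 + cos (U x - U y)| <= 2.
    by rewrite (le_trans (ler_normD _ _))// normr1 -[2]/(1 + 1) lerD2l cos_max.
  rewrite (@Rintegral_prod1 _ _ _ Q _ _ Q (fun x y => 1 + cos (U x - U y)) (fun=> 2) m12 bd); last first.
    exact: finite_measure_integrable_cst.
  have icos : Q.-integrable setT (EFin \o (fun w => cos (U w))).
    have ic : Q.-integrable setT (EFin \o (fun=> 1 : R)) by exact: finite_measure_integrable_cst.
    apply: (le_integrableR _ _ ic) => [|w]; last by rewrite normr1 cos_max.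
    by apply: measurableT_comp => //; exact: continuous_measurable_fun (@continuous_cos R).
  have isin : Q.-integrable setT (EFin \o (fun w => sin (U w))).
    have ic : Q.-integrable setT (EFin \o (fun=> 1 : R)) by exact: finite_measure_integrable_cst.
    apply: (le_integrableR _ _ ic) => [|w]; last by rewrite normr1 sin_max.
    by apply: measurableT_comp => //; exact: continuous_measurable_fun (@continuous_sin R).
  have i1 : Q.-integrable setT (EFin \o (fun=> 1 : R)) by exact: finite_measure_integrable_cst.
  set Ic := \int[Q]_w cos (U w); set Is := \int[Q]_w sin (U w).
  have icZ (a : R) : Q.-integrable setT (EFin \o (fun y => a * cos (U y))).
    exact: (@integrableZl _ _ _ Q _ _ _ (EFin \o (fun y => cos (U y)))).
  have isZ (a : R) : Q.-integrable setT (EFin \o (fun y => a * sin (U y))).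
    exact: (@integrableZl _ _ _ Q _ _ _ (EFin \o (fun y => sin (U y)))).
  have icZ' (a : R) : Q.-integrable setT (EFin \o (fun y => cos (U y) * a)).
    by have := icZ a; apply: eq_integrable => // w _ /=; rewrite mulrC.
  have isZ' (a : R) : Q.-integrable setT (EFin \o (fun y => sin (U y) * a)).
    by have := isZ a; apply: eq_integrable => // w _ /=; rewrite mulrC.
  transitivity (\int[Q]_x (1 + (cos (U x) * Ic + sin (U x) * Is))).
    congr Rintegral; apply/funext => x.
    rewrite (_ : (fun y => _) = fun y => 1 + (cos (U x) * cos (U y) + sin (U x) * sin (U y))); last first.
      by apply/funext => y; rewrite cosB.
    rewrite RintegralD//; last exact: (@integrableD _ _ _ Q _ _ (EFin \o (fun y => cos (U x) * cos (U y))) (EFin \o (fun y => sin (U x) * sin (U y)))).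
    rewrite RintegralD// (@Rintegral_cst_probability _ _ _ Q); congr (_ + (_ + _)).
    - by rewrite RintegralZl.
    - by rewrite RintegralZl.
  rewrite RintegralD//; last exact: (@integrableD _ _ _ Q _ _ (EFin \o (fun y => cos (U y) * Ic)) (EFin \o (fun y => sin (U y) * Is))).
  rewrite RintegralD// (@Rintegral_cst_probability _ _ _ Q) -addrA; congr (_ + (_ + _)).
  - by rewrite RintegralZr// expr2.
  - by rewrite RintegralZr// expr2.
set s : R := (Num.sqrt 2)^-1 in rot.
have s2 : s * s = 2^-1 by rewrite /s -invfM -expr2 sqr_sqrtr.
(* After rotation the difference of the two quadratic forms is the bilinear form x A y^T and the
   constant c cancels; given x, the variable y is integrated by [gaussian_cos]. *)
have RHS1 : \int[(Q \x Q)%E]_w Psi (row_mx (s *: (lsubmx (row_mx (Z w.1) (Z w.2)) + rsubmx (row_mx (Z w.1) (Z w.2))))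
     (s *: (lsubmx (row_mx (Z w.1) (Z w.2)) - rsubmx (row_mx (Z w.1) (Z w.2))))) =
    1 + \int[Q]_w expR (- (xi ^+ 2 * sqn (Z w *m A) / 2)).
  rewrite (_ : (fun w => _) = fun w : T * T => 1 + cos (0 + \sum_i (xi * (Z w.1 *m A) 0 i) * Z w.2 0 i)); last first.
    apply/funext => w; rewrite /Psi row_mxKl row_mxKr row_mxKl row_mxKr; congr (1 + cos _).
    rewrite add0r; set x := Z w.1; set y := Z w.2.
    have -> : \sum_i xi * (x *m A) 0 i * y 0 i = xi * (x *m A *m y^T) 0 0.
      by rewrite mxE mulr_sumr; apply: eq_bigr => i _; rewrite [y^T _ _]mxE mulrA.
    have yx : (y *m A *m x^T) 0 0 = (x *m A *m y^T) 0 0.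
      have -> : y *m A *m x^T = (x *m A *m y^T)^T by rewrite !trmx_mul trmxK AT mulmxA.
      by rewrite mxE.
    rewrite -mulrBr; congr (_ * _).
    have comb (a b k : R) : a / 2 + k - (b / 2 + k) = (a - b) / 2 by field.
    rewrite /q /quadf comb.
    have bil (u : 'rV[R]_n) : (s *: u *m A *m (s *: u)^T) 0 0 = 2^-1 * (u *m A *m u^T) 0 0.
      by rewrite linearZ/= -!scalemxAl -scalemxAr scalerA s2 mxE.
    rewrite !bil.
    have e1 : (x + y) *m A *m (x + y)^T = x *m A *m x^T + x *m A *m y^T + (y *m A *m x^T + y *m A *m y^T).
      by rewrite linearD/= !mulmxDl !mulmxDr.
    have e2 : (x - y) *m A *m (x - y)^T = x *m A *m x^T - x *m A *m y^T - (y *m A *m x^T - y *m A *m y^T).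
      by rewrite linearB/= !mulmxBl !mulmxBr.
    rewrite e1 e2; move: yx; move: (x *m A *m x^T) (x *m A *m y^T) (y *m A *m x^T) (y *m A *m y^T) => a b c' e.
    by rewrite !mxE => ->; field.
  pose t x i := xi * (Z x *m A) 0 i.
  have mt i : measurable_fun setT (t^~ i).
    rewrite /t (_ : (fun x => _) = fun x => xi * \sum_j Z x 0 j * A j i); last by apply/funext => x; rewrite mxE.
    by apply: measurable_funM => //; apply: measurable_sum => j; exact: measurable_funM.
  have m12 : measurable_fun [set: T * T] (fun w => 1 + cos (0 + \sum_i t w.1 i * Z w.2 0 i)).
    apply: measurable_funD => //; apply: measurableT_comp; first exact: continuous_measurable_fun (@continuous_cos R).
    apply: measurable_funD => //; apply: measurable_sum => i; apply: measurable_funM.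
      exact: (measurableT_comp (mt i) measurable_fst).
    exact: (measurableT_comp (mZ i) measurable_snd).
  have bd x y : `|1 + cos (0 + \sum_i t x i * Z y 0 i)| <= 2.
    by rewrite (le_trans (ler_normD _ _))// normr1 -[2]/(1 + 1) lerD2l cos_max.
  have i2 : Q.-integrable setT (EFin \o (fun=> 2 : R)) by exact: finite_measure_integrable_cst.
  have i1 : Q.-integrable setT (EFin \o (fun=> 1 : R)) by exact: finite_measure_integrable_cst.
  rewrite (@Rintegral_prod1 _ _ _ Q _ _ Q (fun x y => 1 + cos (0 + \sum_i t x i * Z y 0 i)) (fun=> 2) m12 bd i2).
  have icos x : Q.-integrable setT (EFin \o (fun y => cos (0 + \sum_i t x i * Z y 0 i))).
    apply: (le_integrableR _ _ i1) => [|w]; last by rewrite normr1 cos_max.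
    apply: measurableT_comp; first exact: continuous_measurable_fun (@continuous_cos R).
    by apply: measurable_funD => //; apply: measurable_sum => i; exact: measurable_funM.
  transitivity (\int[Q]_x (1 + expR (- (xi ^+ 2 * sqn (Z x *m A) / 2)))).
    congr Rintegral; apply/funext => x; rewrite RintegralD// (@Rintegral_cst_probability _ _ _ Q).
    rewrite (gaussian_cos GZ 0 (t x)) cos0 mul1r sqnE mulr_sumr; congr (1 + expR (- (_ / 2))).
    by apply: eq_bigr => i _; rewrite exprMn.
  rewrite RintegralD// ?(@Rintegral_cst_probability _ _ _ Q)//.
  apply: (le_integrableR _ _ i1) => [|w].
    apply: measurableT_comp; first exact: measurable_expR.
    apply: measurableT_comp => //; apply: measurable_funM => //; apply: measurable_funM => //.
    rewrite (_ : (fun x => _) = fun x => \sum_k (\sum_j Z x 0 j * A j k) ^+ 2); last first.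
      by apply/funext => x; rewrite sqnE; apply: eq_bigr => k _; rewrite mxE.
    apply: measurable_sum => k; apply: measurable_funX; apply: measurable_sum => j.
    exact: measurable_funM.
  rewrite normr1 ger0_norm ?expR_ge0// -[leRHS]expR0 ler_expR oppr_le0.
  by rewrite divr_ge0// mulr_ge0 ?sqr_ge0 ?sqn_ge0.
have e12 : 1 + (\int[Q]_w cos (U w)) ^+ 2 + (\int[Q]_w sin (U w)) ^+ 2 =
    1 + \int[Q]_w expR (- (xi ^+ 2 * sqn (Z w *m A) / 2)).
  by rewrite -LHS1 -RHS1 /Rintegral rot.
have : (\int[Q]_w cos (U w)) ^+ 2 + (\int[Q]_w sin (U w)) ^+ 2 =
    \int[Q]_w expR (- (xi ^+ 2 * sqn (Z w *m A) / 2)).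
  by move/eqP: e12; rewrite -addrA (inj_eq (addrI 1)) => /eqP.
by move=> <-; rewrite lerDl sqr_ge0.
Qed.

End Decoupling.

Section SmallBall.
Context {R : realType}.
Local Notation gam := (@normal_prob R 0 1).

Lemma sqn_dot_le n (u v : 'rV[R]_n) : (u *m v^T) 0 0 ^+ 2 <= sqn u * sqn v.
Proof.
set t := (u *m v^T) 0 0.
have tE : t = \sum_k u 0 k * v 0 k by rewrite /t mxE; apply: eq_bigr => k _; rewrite mxE.
have H : sqn (sqn v *: u - t *: v) = sqn v * (sqn v * sqn u - t ^+ 2).
  transitivity (\sum_k (sqn v ^+ 2 * u 0 k ^+ 2 - (2 * sqn v * t) * (u 0 k * v 0 k) + t ^+ 2 * v 0 k ^+ 2)).
    rewrite sqnE; apply: eq_bigr => k _; rewrite !mxE; ring.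
  rewrite big_split/= sumrB -!mulr_sumr -tE -!sqnE; ring.
have [v0|vn0] := eqVneq (sqn v) 0.
  by rewrite v0 mulr0 /t (sqn_eq0 v0) trmx0 mulmx0 mxE expr0n.
have vp : 0 < sqn v by rewrite lt_neqAle eq_sym vn0 sqn_ge0.
by have := sqn_ge0 (sqn v *: u - t *: v); rewrite H pmulr_rge0// subr_ge0 mulrC.
Qed.

Lemma ltr_exp_prod (I : Type) (r : seq I) (g : I -> R) (h : R) : 0 <= h ->
  (0 < size r)%N -> (forall z, h < g z) -> h ^+ size r < \prod_(z <- r) g z.
Proof.
move=> h0 r0 hg; have gp z : 0 < g z := le_lt_trans h0 (hg z).
have pp (s : seq I) : 0 < \prod_(z <- s) g z by apply: prodr_gt0.
have le (s : seq I) : h ^+ size s <= \prod_(z <- s) g z.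
  elim: s => [|z s IH]; first by rewrite big_nil.
  by rewrite big_cons exprS ler_pM ?exprn_ge0// ltW.
case: r r0 => // z s _; rewrite big_cons exprS.
apply: (@le_lt_trans _ _ (h * \prod_(z <- s) g z)); first by rewrite ler_wpM2l.
by rewrite ltr_pM2r.
Qed.

(** |p(y)| is the product of the distances from y to the complex roots, and for real y each distance
    is at least |y - Re z|. If all of these exceed h, then |p(y)| > h^N. *)
Lemma monic_small_root (p : {poly R}) N (h : R) : p \is monic -> size p = N.+1 -> (0 < N)%N ->
  0 <= h -> exists r : seq R, size r = N /\
    forall y, `|p.[y]| <= h ^+ N -> exists2 c, c \in r & `|y - c| <= h.
Proof.
move=> mp sp N0 h0.
pose q := map_poly (real_complex R) p.
have [r qr] := closed_field_poly_normal q.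
have mq : q \is monic by rewrite map_monic.
rewrite (monicP mq) scale1r in qr.
have sr : size r = N.
  by have := size_prod_XsubC r id; rewrite -qr size_map_poly sp => -[].
exists [seq complex.Re z | z <- r]; rewrite size_map; split=> // y hy.
apply: contrapT => hn.
have hz z : z \in r -> h < `|y - complex.Re z|.
  move=> zr; rewrite ltNge; apply/negP => le; apply: hn.
  by exists (complex.Re z) => //; apply: map_f.
have e1 : `|p.[y]| = \prod_(z <- r) Normc.normc (y%:C%C - z).
  rewrite -(big_morph _ (@Normc.normcM R) (@Normc.normc1 R)).
  have -> : \prod_(z <- r) (y%:C%C - z) = q.[y%:C%C].
    by rewrite qr horner_prod; apply: eq_bigr => z _; rewrite hornerXsubC.
  by rewrite /q horner_map/= /Normc.normc/= expr0n addr0 sqrtr_sqr.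
have nR z : `|y - complex.Re z| <= Normc.normc (y%:C%C - z).
  case: z => a b; rewrite /Normc.normc/= -[leLHS]sqrtr_sqr ler_wsqrtr// lerDl sqr_ge0//.
(* Off the list r the factor is replaced by h + 1, because [ltr_exp_prod] asks for a strict bound at
   every point of the type. *)
have hr : \prod_(z <- r) Normc.normc (y%:C%C - z) =
    \prod_(z <- r) (if z \in r then Normc.normc (y%:C%C - z) else h + 1).
  by apply: eq_big_seq => z ->.
have := @ltr_exp_prod _ r (fun z => if z \in r then Normc.normc (y%:C%C - z) else h + 1) h h0.
rewrite sr N0 => /(_ isT); rewrite -hr -e1 => H.
suff : h ^+ N < `|p.[y]| by rewrite ltNge hy.
apply: H => z; case: ifP => [zr|_]; last by rewrite ltrDl.
exact: lt_le_trans (hz z zr) (nR z).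
Qed.

(* det (M0 + y M1) / det M1 is a monic polynomial of degree N in y: where it is at
   most h^N, y is within h of the real part of one of its N complex roots. *)
Lemma det_small N (M0 M1 : 'M[R]_N) (h : R) : (0 < N)%N -> \det M1 != 0 -> 0 <= h ->
  (gam [set y : R | (`|\det (M0 + y *: M1)| <= `|\det M1| * h ^+ N)%R] <= (2 * N%:R * h)%:E)%E.
Proof.
move=> N0 d0 h0; have M1u : M1 \in unitmx by rewrite unitmxE unitfE.
pose p := char_poly (- (invmx M1 *m M0)).
have pE y : \det (M0 + y *: M1) = \det M1 * p.[y].
  rewrite -[p.[y]]/(horner_eval y p) /p /char_poly -det_map_mx -det_mulmx; congr (\det _).
  have -> : map_mx (horner_eval y) (char_poly_mx (- (invmx M1 *m M0))) = y%:M + invmx M1 *m M0.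
    apply/matrixP => i j; rewrite !mxE /= /horner_eval !hornerE; case: (i == j); rewrite ?mulr1n ?mulr0n ?hornerX ?horner0 ?opprK//.
  by rewrite mulmxDr mulmxA mulmxV// mul1mx mul_mx_scalar addrC.
have [r [sr hr]] := @monic_small_root p N h (char_poly_monic _) (size_char_poly _) N0 h0.
have mS c : measurable [set y : R | (`|y - c| <= h)%R].
  have -> : [set y : R | `|y - c| <= h] = [set` `[(c - h), (c + h)]].
    by apply/seteqP; split=> y /=; rewrite in_itv/= ler_distl.
  exact: measurable_itv.
have mU (s : seq R) : measurable (\big[setU/set0]_(c <- s) [set y : R | (`|y - c| <= h)%R]).
  exact: bigsetU_measurable.
have bnd (s : seq R) : (gam (\big[setU/set0]_(c <- s) [set y : R | (`|y - c| <= h)%R]) <= (2 * (size s)%:R * h)%:E)%E.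
  elim: s => [|c s IH]; first by rewrite big_nil measure0 mulr0 mul0r.
  rewrite big_cons; apply: (le_trans (measureU2 gam (mS c) (mU s))).
  apply: (le_trans (leeD (normal_prob_small c h0) IH)).
  by rewrite -EFinD lee_fin/= -natr1; rewrite le_eqVlt; apply/orP; left; apply/eqP; ring.
have := bnd r; rewrite sr; apply: le_trans; apply: le_measure; rewrite ?inE//.
  have -> : [set y : R | (`|\det (M0 + y *: M1)| <= `|\det M1| * h ^+ N)%R] =
    (fun y : R => `|\det M1 * \sum_(i < size p) p`_i * y ^+ i|) @^-1` [set` `]-oo, (`|\det M1| * h ^+ N)]].
    by apply/seteqP; split=> y /=; rewrite in_itv/= pE horner_coef.
  rewrite -[X in measurable X]setTI; apply: (_ : measurable_fun setT _) => //.
  apply: measurableT_comp => //; apply: measurable_funM => //; apply: measurable_sum => i.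
  by apply: measurable_funM => //; exact: measurable_funX.
  exact: mU.
move=> y /=; rewrite pE normrM ler_pM2l ?normr_gt0// => /hr[c cr yc].
by rewrite -bigcup_seq; exists c.
Qed.

Lemma probability_le_Rintegral d (T : measurableType d) (Q : probability T R) (D : set T) (f : T -> R) :
  measurable D -> Q.-integrable setT (EFin \o f) -> (forall w, 0 <= f w) ->
  (forall w, D w -> 1 <= f w) -> (Q D <= (\int[Q]_w f w)%:E)%E.
Proof.
move=> mD fi f0 f1; have -> : Q D = (\int[Q]_x (\1_D x)%:E)%E by rewrite integral_indic// setIT.
rewrite (EFin_Rintegral fi).
apply: ge0_le_integral => //.
- by apply/measurable_EFinP; exact: measurable_indic.
- exact: measurable_int fi.
move=> w _; rewrite lee_fin indicE; case: (boolP (w \in D)) => [/set_mem/f1//|_]; exact: f0.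
Qed.

Section Bounds.
Context d1 (T : measurableType d1) (Q : probability T R) n (Z : T -> 'rV[R]_n).
Hypothesis GZ : gaussian_vector Q Z.

Lemma measurable_gauss_lin M (B : 'M[R]_(n, M)) :
  measurable_fun setT (fun w => expR (- (sqn (Z w *m B) / 2))).
Proof.
have := @measurable_gauss_affine R n M B 0 _ _ Z (proj1 GZ).
by move=> /measurable_EFinP; congr measurable_fun; apply/funext => w; rewrite addr0.
Qed.

Lemma gauss_lin_integrable M (B : 'M[R]_(n, M)) :
  Q.-integrable setT (EFin \o (fun w => expR (- (sqn (Z w *m B) / 2)))).
Proof.
have i1 : Q.-integrable setT (EFin \o (fun=> 1 : R)) by exact: finite_measure_integrable_cst.
apply: (le_integrableR _ _ i1) => [|w]; first exact: measurable_gauss_lin.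
rewrite normr1 ger0_norm ?expR_ge0// -expR0 ler_expR oppr_le0.
by rewrite mulr_ge0 ?sqn_ge0.
Qed.

(** For a square submatrix the Gram determinant of [gaussian_gram] is the square of the
    determinant. *)
Lemma gauss_minor N (B : 'M[R]_(n, N)) (f : 'I_N -> 'I_n) : \det (rowsub f B) != 0 ->
  \int[Q]_w expR (- (sqn (Z w *m B) / 2)) <= `|\det (rowsub f B)|^-1.
Proof.
move=> d0; set D := \det (rowsub f B) in d0 *.
have e : \det (rowsub f B *m (rowsub f B)^T) = D ^+ 2 by rewrite det_mulmx det_tr expr2.
have := @gaussian_gram R _ T Q n Z GZ N N B f 0; rewrite e sqrtr_sqr.
have D2 : 0 < D ^+ 2 by rewrite lt_neqAle sqr_ge0 andbT eq_sym sqrf_eq0.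
move=> /(_ D2); rewrite -lee_fin (EFin_Rintegral (gauss_lin_integrable B)).
by move=> h; apply: le_trans h; rewrite le_eqVlt; apply/orP; left; apply/eqP; apply: eq_integral => w _; rewrite /= addr0.
Qed.

(** After decoupling, xi A may be replaced by any matrix B that shortens vectors more. It is used
    with B a selection of columns and with B a single combination of columns. *)
Lemma oscillatory_le M (A : 'M[R]_n) (c xi : R) (B : 'M[R]_(n, M)) : A^T = A ->
  (forall x : 'rV[R]_n, sqn (x *m B) <= xi ^+ 2 * sqn (x *m A)) ->
  (\int[Q]_w cos (xi * quadf A c (Z w))) ^+ 2 <= \int[Q]_w expR (- (sqn (Z w *m B) / 2)).
Proof.
move=> AT h; apply: le_trans (decoupling GZ c xi AT) _.
have e : (fun w => expR (- (xi ^+ 2 * sqn (Z w *m A) / 2))) = (fun w => expR (- (sqn (Z w *m (xi *: A)) / 2))).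
  apply/funext => w; congr (expR (- (_ / 2))).
  by rewrite !sqnE mulr_sumr; apply: eq_bigr => k _; rewrite -scalemxAr [in RHS]mxE exprMn.
rewrite e; apply: le_Rintegral => //.
- exact: gauss_lin_integrable.
- exact: gauss_lin_integrable.
move=> w _; rewrite ler_expR lerN2 ler_pM2r//.
have -> : sqn (Z w *m (xi *: A)) = xi ^+ 2 * sqn (Z w *m A); last exact: h.
by rewrite !sqnE mulr_sumr; apply: eq_bigr => k _; rewrite -scalemxAr [in LHS]mxE exprMn.
Qed.

Lemma oscillatory_minor N (A : 'M[R]_n) (c xi : R) (I J : 'I_N -> 'I_n) : (0 < N)%N -> A^T = A -> 0 < xi ->
  \det (mxsub I J A) != 0 ->
  (\int[Q]_w cos (xi * quadf A c (Z w))) ^+ 2 <= N%:R ^+ N / (xi ^+ N * `|\det (mxsub I J A)|).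
Proof.
move=> N0 AT xi0 d0.
have NR : 0 < N%:R :> R by rewrite ltr0n.
(* The factor 1/N ensures [hB] without asking whether the column selection J repeats an index. *)
pose B : 'M[R]_(n, N) := (xi / N%:R) *: colsub J A.
have hB (x : 'rV[R]_n) : sqn (x *m B) <= xi ^+ 2 * sqn (x *m A).
  have -> : sqn (x *m B) = xi ^+ 2 * (N%:R^-1 ^+ 2 * \sum_k (x *m A) 0 (J k) ^+ 2).
    rewrite sqnE !mulr_sumr; apply: eq_bigr => k _.
    rewrite /B -scalemxAr mxE !exprMn -mulrA; congr (_ * (_ * _ ^+ 2)).
    by rewrite !mxE; apply: eq_bigr => j _; rewrite mxE.
  rewrite ler_wpM2l ?sqr_ge0//.
  have hk k : (x *m A) 0 (J k) ^+ 2 <= sqn (x *m A).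
    by rewrite sqnE (bigD1 (J k))//= lerDl sumr_ge0// => i _; exact: sqr_ge0.
  apply: (@le_trans _ _ (N%:R^-1 ^+ 2 * (N%:R * sqn (x *m A)))).
    rewrite ler_wpM2l ?sqr_ge0//; apply: le_trans (ler_sum _ (fun k _ => hk k)) _.
    by rewrite sumr_const card_ord mulr_natl.
  rewrite mulrA expr2 -(mulrA N%:R^-1) mulVf ?gt_eqF// mulr1 ler_piMl ?sqn_ge0//.
  by rewrite invf_le1 ?ler1n.
apply: le_trans (oscillatory_le c AT hB) _.
have e : rowsub I B = (xi / N%:R) *: mxsub I J A by apply/matrixP => i j; rewrite !mxE.
have dB : \det (rowsub I B) = (xi / N%:R) ^+ N * \det (mxsub I J A) by rewrite e detZ.
have dB0 : \det (rowsub I B) != 0.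
  by rewrite dB mulf_neq0// expf_neq0// mulf_neq0 ?invr_eq0 ?gt_eqF.
apply: le_trans (gauss_minor dB0) _.
rewrite dB normrM ger0_norm ?exprn_ge0 ?divr_ge0 ?(ltW xi0)//.
by rewrite exprMn exprVn mulrAC invfM invrK mulrC invfM.
Qed.

Lemma oscillatory_row (A : 'M[R]_n) (c xi kap r : R) (e : 'rV[R]_n) (j : 'I_n) : A^T = A -> 0 < xi ->
  0 < kap -> sqn e <= kap ^+ 2 -> 0 < r -> r <= `|(e *m A) 0 j| ->
  (\int[Q]_w cos (xi * quadf A c (Z w))) ^+ 2 <= kap / (xi * r).
Proof.
move=> AT xi0 k0 ek r0 rj.
pose B : 'M[R]_(n, 1) := (xi / kap) *: (A *m e^T).
have hB (x : 'rV[R]_n) : sqn (x *m B) <= xi ^+ 2 * sqn (x *m A).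
  have -> : sqn (x *m B) = xi ^+ 2 * (kap^-1 ^+ 2 * (x *m A *m e^T) 0 0 ^+ 2).
    rewrite sqnE big_ord1 /B -scalemxAr mulmxA mxE !exprMn -mulrA; by [].
  rewrite ler_wpM2l ?sqr_ge0// exprVn mulrC ler_pdivrMr ?exprn_gt0//.
  apply: le_trans (sqn_dot_le _ _) _.
  by rewrite ler_wpM2l ?sqn_ge0.
apply: le_trans (oscillatory_le c AT hB) _.
have lj : (A *m e^T) j 0 = (e *m A) 0 j.
  by have -> : A *m e^T = (e *m A)^T by [rewrite trmx_mul AT]; rewrite mxE.
have dB : \det (rowsub (fun=> j) B) = (xi / kap) * (e *m A) 0 j.
  by rewrite [X in \det X]mx11_scalar det_scalar1 [LHS]mxE /B [LHS]mxE lj.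
have ej : (e *m A) 0 j != 0 by rewrite -normr_gt0 (lt_le_trans r0).
have dB0 : \det (rowsub (fun=> j) B) != 0.
  have xk : xi / kap != 0 by rewrite gt_eqF// divr_gt0.
  by rewrite dB mulf_neq0.
apply: le_trans (gauss_minor dB0) _.
rewrite dB normrM ger0_norm ?divr_ge0 ?(ltW xi0) ?(ltW k0)// !invfM invrK mulrAC -mulrA.
rewrite [leRHS]mulrCA ler_wpM2l ?invr_ge0 ?(ltW xi0)// mulrC ler_wpM2l ?(ltW k0)//.
by rewrite lef_pV2 ?posrE// normr_gt0.
Qed.

Lemma measurable_mulmx M (B : 'M[R]_(n, M)) k : measurable_fun setT (fun w => (Z w *m B) 0 k).
Proof.
rewrite (_ : (fun w => _) = fun w => \sum_j Z w 0 j * B j k); last by apply/funext => w; rewrite mxE.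
by apply: measurable_sum => j; apply: measurable_funM => //; exact: (proj1 GZ).
Qed.

(** On the event, the squared norm of Z B / r is at most N, so its indicator is dominated by e^(N/2)
    times a Gaussian weight, which [gauss_minor] integrates. *)
Lemma row_small_prob N (B : 'M[R]_(n, N)) (f : 'I_N -> 'I_n) (r : R) : 0 < r ->
  \det (rowsub f B) != 0 ->
  (Q [set w | forall k, (`|(Z w *m B) 0 k| <= r)%R] <=
   (expR (N%:R / 2) * r ^+ N / `|\det (rowsub f B)|)%:E)%E.
Proof.
move=> r0 d0.
have mD : measurable [set w | forall k, (`|(Z w *m B) 0 k| <= r)%R].
  have -> : [set w | forall k, (`|(Z w *m B) 0 k| <= r)%R] =
    \bigcap_(k in [set: 'I_N]) ((fun w => `|(Z w *m B) 0 k|) @^-1` [set` `]-oo, r]]).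
    apply/seteqP; split=> w /= h k; first by move=> _; rewrite /= in_itv/=; exact: h.
    by have := h k Logic.I; rewrite /= in_itv.
  apply: fin_bigcap_measurable => // k _; rewrite -[X in measurable X]setTI.
  apply: (_ : measurable_fun setT _) => //; apply: measurableT_comp => //.
  exact: measurable_mulmx.
pose B' := r^-1 *: B.
have ZB' w : sqn (Z w *m B') = r^-1 ^+ 2 * \sum_k (Z w *m B) 0 k ^+ 2.
  by rewrite sqnE mulr_sumr; apply: eq_bigr => k _; rewrite -scalemxAr [in LHS]mxE exprMn.
have dB' : \det (rowsub f B') = r^-1 ^+ N * \det (rowsub f B).
  by rewrite -detZ; congr (\det _); apply/matrixP => i j; rewrite !mxE.
have iG := gauss_lin_integrable B'.
have iG2 : Q.-integrable setT (EFin \o (fun w => expR (N%:R / 2) * expR (- (sqn (Z w *m B') / 2)))).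
  exact: (@integrableZl _ _ _ Q _ _ _ (EFin \o (fun w => expR (- (sqn (Z w *m B') / 2))))).
have := @probability_le_Rintegral _ T Q _ (fun w => expR (N%:R / 2) * expR (- (sqn (Z w *m B') / 2))) mD iG2.
move=> /(_ _ _)/le_trans; apply.
- by move=> w; rewrite mulr_ge0 ?expR_ge0.
- move=> w /= hw; rewrite -expRD -[leLHS]expR0 ler_expR -mulrBl divr_ge0// subr_ge0.
  rewrite ZB' exprVn ler_pdivrMl ?exprn_gt0//.
  apply: (@le_trans _ _ (\sum_(k < N) r ^+ 2)); last by rewrite sumr_const card_ord mulr_natr.
  apply: ler_sum => k _; rewrite -[leLHS]real_normK ?num_real// lerXn2r ?nnegrE ?(ltW r0)//.
rewrite lee_fin RintegralZl// -mulrA ler_pM2l ?expR_gt0//.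
have dB'0 : \det (rowsub f B') != 0 by rewrite dB' mulf_neq0// expf_neq0// invr_eq0 gt_eqF.
apply: le_trans (gauss_minor dB'0) _.
by rewrite dB' normrM normrX ger0_norm ?invr_ge0 ?(ltW r0)// invfM exprVn invrK.
Qed.

End Bounds.
End SmallBall.

(** * The small ball estimate with explicit constant *)

Section SmallBallMain.
Context {R : realType}.
Local Notation gam := (@normal_prob R 0 1).
Context d1 (T1 : measurableType d1) (Q1 : probability T1 R) l (x : T1 -> 'rV[R]_l).
Hypothesis Gx : gaussian_vector Q1 x.
Context d2 (T2 : measurableType d2) (Q2 : probability T2 R) m (Z : T2 -> 'rV[R]_(m + 1)).
Hypothesis GZ : gaussian_vector Q2 Z.
Variables (A : 'I_m -> 'M[R]_l) (c : 'I_m -> R) (g0 : 'rV[R]_m) (e : 'rV[R]_l).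
Hypothesis AT : forall i, (A i)^T = A i.
Variable N : nat.
Hypothesis N4 : (4 <= N)%N.
Variables (I J I' : 'I_N -> 'I_l) (J' : 'I_N -> 'I_m) (kap : R).
Let AG (G : 'rV[R]_m) : 'M[R]_l := \sum_i G 0 i *: A i.
Let Me : 'M[R]_(m, l) := \matrix_(i, j) (e *m A i) 0 j.
Let dlt := \det (mxsub I J (AG g0)).
Let dlt' := \det (mxsub J' I' Me).
Hypotheses (dlt0 : dlt != 0) (dlt'0 : dlt' != 0) (kap1 : 1 <= kap) (ek : sqn e <= kap ^+ 2).
Let q i (y : 'rV[R]_l) := quadf (A i) (c i) y.

(** The exponential is the cost of dominating the indicator by a Gaussian average. The three
    summands are the contributions of the event A1, of the event A2 and of their complement. *)
Definition small_ball_cst : R := expR ((1 + sqn g0) / 2) *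
  (expR (N%:R / 2) / `|dlt'| + 2 * N%:R * kap + (N%:R ^+ N / `|dlt| + 1)).

(* The random contraction G + s g0, with (G, s) standard Gaussian in dimension
   m + 1: averaging cos (xi * sum_i (G + s g0)_i q_i) over (G, s) dominates, up to
   a constant, the indicator of sum_i q_i^2 <= xi^-2. *)
Let Kz (z : 'rV[R]_(m + 1)) : 'rV[R]_m := \row_i (z 0 (lshift 1 i) + z 0 (rshift m 0) * g0 0 i).

Let N0 : (0 < N)%N. Proof. exact: leq_trans N4. Qed.

Let AGT G : (AG G)^T = AG G.
Proof. by rewrite /AG linear_sum/=; apply: eq_bigr => i _; rewrite linearZ/= AT. Qed.

Let quadAG G y : quadf (AG G) (\sum_i G 0 i * c i) y = \sum_i G 0 i * q i y.
Proof.
rewrite /q /quadf /AG mulmx_sumr mulmx_suml summxE mulr_suml -big_split/=.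
apply: eq_bigr => i _; rewrite -scalemxAr -scalemxAl mxE; ring.
Qed.

Let gauss_avg (xi : R) (y : 'rV[R]_l) :
  \int[Q2]_w cos (xi * \sum_i Kz (Z w) 0 i * q i y) =
  expR (- (xi ^+ 2 * (\sum_i q i y ^+ 2 + (\sum_i g0 0 i * q i y) ^+ 2) / 2)).
Proof.
pose t (k : 'I_(m + 1)) : R := match fintype.split k with inl i => xi * q i y | inr _ => xi * \sum_i g0 0 i * q i y end.
have -> : (fun w => cos (xi * \sum_i Kz (Z w) 0 i * q i y)) = (fun w => cos (0 + \sum_k t k * Z w 0 k)).
  apply/funext => w; congr cos; rewrite add0r big_split_ord/= big_ord1.
  have tl i : t (lshift 1 i) = xi * q i y by rewrite /t (unsplitK (inl i)).
  have tr : t (rshift m 0) = xi * \sum_i g0 0 i * q i y by rewrite /t (unsplitK (inr 0)).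
  rewrite tr; under [X in _ = X + _]eq_bigr do rewrite tl.
  rewrite !mulr_sumr mulr_suml -big_split/=; apply: eq_bigr => i _.
  rewrite mxE; ring.
rewrite (gaussian_cos GZ 0 t) cos0 mul1r; congr (expR (- (_ / 2))).
rewrite big_split_ord/= big_ord1.
have tl i : t (lshift 1 i) = xi * q i y by rewrite /t (unsplitK (inl i)).
have tr : t (rshift m 0) = xi * \sum_i g0 0 i * q i y by rewrite /t (unsplitK (inr 0)).
rewrite tr; under [X in X + _ = _]eq_bigr do rewrite tl exprMn.
by rewrite -mulr_sumr exprMn mulrDr.
Qed.

Let mKz i : measurable_fun setT (fun w => Kz (Z w) 0 i).
Proof.
rewrite (_ : (fun w => _) = fun w => Z w 0 (lshift 1 i) + Z w 0 (rshift m 0) * g0 0 i); last first.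
  by apply/funext => w; rewrite mxE.
by apply: measurable_funD; [|apply: measurable_funM => //]; exact: (proj1 GZ).
Qed.

Let mq i : measurable_fun setT (fun w => q i (x w)).
Proof. exact: (cgrowth_measurable Gx (polyfun_cgrowth (quadf_polyfun (A i) (c i)))). Qed.

Let A1 (r : R) : set T2 := [set w | forall k, (`|(e *m AG (Kz (Z w))) 0 (I' k)| <= r)%R].
Let A2 (rho : R) : set T2 := [set w | (`|\det (mxsub I J (AG (Kz (Z w))))| <= rho)%R].

Let B1 : 'M[R]_(m + 1, N) := col_mx (colsub I' Me) (g0 *m colsub I' Me).

Let B1E w k : (Z w *m B1) 0 k = (e *m AG (Kz (Z w))) 0 (I' k).
Proof.
rewrite mxE big_split_ord/= big_ord1 /B1 col_mxEd.
under eq_bigr do rewrite col_mxEu mxE.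
rewrite [(g0 *m _) _ _]mxE mulr_sumr -big_split/= /AG mulmx_sumr summxE.
apply: eq_bigr => i _; rewrite -scalemxAr !mxE; ring.
Qed.

Let A1E r : A1 r = [set w | forall k, (`|(Z w *m B1) 0 k| <= r)%R].
Proof. by apply/seteqP; split=> w h k; have := h k; rewrite B1E. Qed.

Let PA1 r : 0 < r -> (Q2 (A1 r) <= (expR (N%:R / 2) * r ^+ N / `|dlt'|)%:E)%E.
Proof.
move=> r0; rewrite A1E.
have e1 : \det (rowsub (fun k => lshift 1 (J' k)) B1) = dlt'.
  by congr (\det _); apply/matrixP => i j; rewrite [LHS]mxE /B1 col_mxEu !mxE.
have := @row_small_prob _ _ _ Q2 _ Z GZ N B1 (fun k => lshift 1 (J' k)) r r0.
by rewrite e1 => /(_ dlt'0).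
Qed.

Let mA1 r : measurable (A1 r).
Proof.
rewrite A1E.
have -> : [set w | forall k, (`|(Z w *m B1) 0 k| <= r)%R] =
    \bigcap_(k in [set: 'I_N]) ((fun w => `|(Z w *m B1) 0 k|) @^-1` [set` `]-oo, r]]).
  apply/seteqP; split=> w /= h k; first by move=> _; rewrite /= in_itv/=; exact: h.
  by have := h k Logic.I; rewrite /= in_itv.
apply: fin_bigcap_measurable => // k _; rewrite -[X in measurable X]setTI.
apply: (_ : measurable_fun setT _) => //; apply: measurableT_comp => //.
exact: measurable_mulmx GZ _ _ _.
Qed.

Let polyfun_det n p (M : 'rV[R]_n -> 'M[R]_p) : (forall i j, polyfun (fun z => M z i j)) ->
  polyfun (fun z => \det (M z)).
Proof.
move=> h; rewrite /determinant; apply: polyfun_sum => s _; apply: polyfunZ.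
have H (t : 'I_p -> 'I_p) (r : seq 'I_p) : polyfun (fun z => \prod_(i <- r) M z i (t i)).
  elim: r => [|i r IH].
    rewrite (_ : (fun z => _) = fun=> 1); first exact: polyfun_cst.
    by apply/funext => z; rewrite big_nil.
  rewrite (_ : (fun z => _) = fun z => M z i (t i) * \prod_(i <- r) M z i (t i)); first exact: polyfunM.
  by apply/funext => z; rewrite big_cons.
exact: H.
Qed.

Let detK (z : 'rV[R]_(m + 1)) := \det (mxsub I J (AG (Kz z))).

Let detK_polyfun : polyfun detK.
Proof.
apply: polyfun_det => i j.
rewrite (_ : (fun z : 'rV[R]_(m + 1) => _) = fun z : 'rV[R]_(m + 1) => \sum_k A k (I i) (J j) * (z 0 (lshift 1 k) + g0 0 k * z 0 (rshift m 0))).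
  apply: polyfun_sum => k _; apply: polyfunZ; apply: polyfunD; first exact: polyfun_coord.
  by apply: polyfunZ; exact: polyfun_coord.
apply/funext => z; rewrite mxE /AG summxE; apply: eq_bigr => k _; rewrite !mxE; ring.
Qed.

Let cdetK : continuous detK. Proof. by have [] := polyfun_cgrowth detK_polyfun. Qed.

Let mA2 rho : measurable (A2 rho).
Proof.
have -> : A2 rho = (fun w => `|detK (Z w)|) @^-1` [set` `]-oo, rho]].
  by apply/seteqP; split=> w /=; rewrite in_itv.
rewrite -[X in measurable X]setTI; apply: (_ : measurable_fun setT _) => //.
apply: measurableT_comp => //; exact: (continuous_measurable_rV cdetK (proj1 GZ)).
Qed.

(** With G frozen and only s resampled, the minor is det (M0 + s M1) where M1 is the minor of A_g0,
    of determinant dlt; [det_small] applies. *)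
Let PA2 (h : R) : 0 <= h -> (Q2 (A2 (`|dlt| * h ^+ N)) <= (2 * N%:R * h)%:E)%E.
Proof.
move=> h0; set rho := `|dlt| * h ^+ N.
pose ind (t : R) : \bar R := (\1_[set` `]-oo, rho]] t)%:E.
have mind : measurable_fun setT ind.
  by apply/measurable_EFinP; exact: measurable_indic.
pose hh (z : 'rV[R]_(m + 1)) : \bar R := ind `|detK z|.
have mhh : measurable_rV hh.
  apply: (measurable_rV_comp (h := fun z => `|detK z|) (g := ind)) => //.
  apply: (continuous_measurable_rV (h := fun z : 'rV[R]_(m + 1) => `|detK z|)) => z.
  by apply: (@continuous_comp _ _ _ detK (fun t : R => `|t|)); [exact: cdetK|exact: norm_continuous].
have hh0 z : (0 <= hh z)%E by rewrite lee_fin.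
have -> : Q2 (A2 rho) = (\int[Q2]_w hh (Z w))%E.
  have -> : (fun w => hh (Z w)) = (fun w => (\1_(A2 rho) w)%:E).
    apply/funext => w; rewrite /hh /ind; congr EFin; rewrite !indicE; congr (_%:R); congr nat_of_bool.
  by rewrite integral_indic// setIT.
rewrite (ge0_resample GZ (rshift m 0) mhh hh0).
apply: (@le_trans _ _ (\int[Q2]_w (2 * N%:R * h)%:E)%E); last first.
  by rewrite integral_cst// [X in (_ * X)%E]probability_setT mule1.
apply: ge0_le_integral => //.
- by move=> w _; exact: integral_ge0.
- exact: (measurable_rV_gauss (rshift m 0) mhh hh0 (proj1 GZ)).
move=> w _.
pose M0 := mxsub I J (AG (\row_i Z w 0 (lshift 1 i))).
pose M1 := mxsub I J (AG g0).
have dE (y : R) : detK (upd (rshift m 0) y (Z w)) = \det (M0 + y *: M1).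
  congr (\det _); apply/matrixP => i j; rewrite !mxE /AG !summxE mulr_sumr -big_split/=.
  apply: eq_bigr => k _; rewrite !mxE eqxx eq_lrshift; ring.
have -> : (\int[gam]_y hh (upd (rshift m 0%R) y (Z w)) =
    gam [set y : R | (`|\det (M0 + y *: M1)| <= rho)%R])%E.
  have mS : measurable [set y : R | (`|\det (M0 + y *: M1)| <= rho)%R].
    have -> : [set y : R | (`|\det (M0 + y *: M1)| <= rho)%R] =
        (fun y : R => `|detK (upd (rshift m 0) y (Z w))|) @^-1` [set` `]-oo, rho]].
      by apply/seteqP; split=> y /=; rewrite in_itv/= dE.
    rewrite -[X in measurable X]setTI; apply: (_ : measurable_fun setT _) => //.
    apply: measurableT_comp => //; apply: (continuous_measurable_rV cdetK) => k.
    by apply: measurable_upd.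
  transitivity (\int[gam]_y (\1_[set y : R | (`|\det (M0 + y *: M1)| <= rho)%R] y)%:E)%E.
    apply: eq_integral => y _; rewrite /hh /ind dE; congr EFin; rewrite !indicE; congr (_%:R); congr nat_of_bool.
  by rewrite (@integral_indic _ _ _ gam)// setIT.
exact: det_small.
Qed.

Lemma small_ball (z : R) : 0 < z -> z <= 1 ->
  (Q1 [set w | (\sum_i quadf (A i) (c i) (x w) ^+ 2 <= z ^+ (8 * N))%R] <=
   (small_ball_cst * z ^+ (6 * N - 15))%:E)%E.
Proof.
move=> z0 z1.
have n1 : (4 * N = (4 * N - 6) + 6)%N by move: N4; lia.
have n2 : ((2 * N - 3) * 2 = 4 * N - 6)%N by move: N4; lia.
have n3 : (4 * N * N = 12 * N + 4 * (N - 3) * N)%N by move: N4; nia.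
have n4 : (6 * N * 2 = 12 * N)%N by lia.
have n5 : (4 * N * 2 = 8 * N)%N by lia.
have n6 : (6 * N - 15 <= 6 * N)%N by lia.
have n7 : (2 * N - 3 + 4 * (N - 3) = 6 * N - 15)%N by move: N4; lia.
(* A1: the row e A_G is small, of probability O(r^N) = O(z^(6 N)); A2: the minor
   of A_G is small, of probability O(h).  Off A1 the oscillatory integral is
   O((xi r)^(-1/2)) = O(z^(2 N - 3)), and off both it is O(z^(6 N)). *)
pose xi : R := (z ^+ (4 * N))^-1.
pose r : R := z ^+ 6.
(* Chosen so that xi h = z^(-12), whence (xi h)^(-N/2) = z^(6 N) off A1 and A2. On A2 the total is
   z^(2 N - 3) h = z^(6 N - 15), the bottleneck. *)
pose h : R := z ^+ (4 * (N - 3)).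
pose rho : R := `|dlt| * h ^+ N.
have zp k : 0 < z ^+ k by exact: exprn_gt0.
have zn k : z ^+ k != 0 by rewrite gt_eqF.
have xi0 : 0 < xi by rewrite invr_gt0.
have kap0 : 0 < kap by exact: lt_le_trans kap1.
have dl0 : 0 < `|dlt| by rewrite normr_gt0.
have dl'0 : 0 < `|dlt'| by rewrite normr_gt0.
pose b2 : R := kap * z ^+ (2 * N - 3).
pose b3 : R := (N%:R ^+ N / `|dlt| + 1) * z ^+ (6 * N).
have b20 : 0 < b2 by exact: mulr_gt0.
have b30 : 0 < b3 by rewrite mulr_gt0// ltr_wpDl// divr_ge0// exprn_ge0.
pose phi w := \int[Q1]_w1 cos (xi * \sum_i Kz (Z w) 0 i * q i (x w1)).
have i1 d (T : measurableType d) (P : probability T R) (a : R) : P.-integrable setT (EFin \o (fun=> a)).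
  exact: finite_measure_integrable_cst.
have phi1 w : phi w <= 1.
  have -> : (1 : R) = \int[Q1]_w1 1 by rewrite (@Rintegral_cst_probability _ _ _ Q1).
  have mc : measurable_fun setT (fun w1 => cos (xi * \sum_i Kz (Z w) 0 i * q i (x w1))).
    apply: measurableT_comp; first exact: continuous_measurable_fun (@continuous_cos R).
    by apply: measurable_funM => //; apply: measurable_sum => i; exact: measurable_funM.
  apply: le_Rintegral => //; [|exact: i1].
  apply: (le_integrableR mc _ (i1 _ _ Q1 1)) => w1.
  by rewrite normr1 cos_max.
have phiE w : phi w = \int[Q1]_w1 cos (xi * quadf (AG (Kz (Z w))) (\sum_i Kz (Z w) 0 i * c i) (x w1)).
  by congr Rintegral; apply/funext => w1; rewrite quadAG.
have phib w : phi w <= \1_(A1 r) w + b2 * \1_(A2 rho) w + b3.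
  have [w1|w1] := pselect (A1 r w).
    rewrite [\1_(A1 r) w]indicE mem_set// (le_trans (phi1 w))// -addrA lerDl.
    by rewrite addr_ge0 ?(ltW b30)// mulr_ge0// ltW.
  have /existsNP[k /negP] := w1; rewrite -ltNge => rk.
  have [w2|w2] := pselect (A2 rho w).
    rewrite [\1_(A2 rho) w]indicE mem_set// mulr1.
    apply: (@le_trans _ _ b2); last by rewrite -addrA addrCA lerDl addr_ge0 ?(ltW b30).
    have [p0|/ltW p0] := leP (phi w) 0; first by rewrite (le_trans p0)// ltW.
    rewrite -(@ler_pXn2r _ 2)// ?nnegrE ?(ltW b20)// phiE.
    apply: (le_trans (oscillatory_row Gx _ (AGT _) xi0 kap0 ek (zp 6) (ltW rk))).
    have -> : kap / (xi * z ^+ 6) = kap * z ^+ (4 * N - 6).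
      rewrite /xi invfM invrK; congr (_ * _).
      have e46 : z ^+ (4 * N) = z ^+ (4 * N - 6) * z ^+ 6 by rewrite {1}n1 exprD.
      by rewrite e46 mulfK.
    rewrite exprMn -exprM.
    rewrite n2.
    by rewrite ler_pM2r// expr2 ler_pMl.
  apply: (@le_trans _ _ b3); last by rewrite lerDr addr_ge0// mulr_ge0// ltW.
  have [p0|/ltW p0] := leP (phi w) 0; first by rewrite (le_trans p0)// ltW.
  rewrite -(@ler_pXn2r _ 2)// ?nnegrE ?(ltW b30)// phiE.
  have dr : rho < `|detK (Z w)| by rewrite ltNge; apply/negP.
  have rho0 : 0 < rho := mulr_gt0 dl0 (exprn_gt0 N (zp _)).
  have d0 : detK (Z w) != 0 by rewrite -normr_gt0 (lt_trans rho0).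
  apply: (le_trans (oscillatory_minor Gx _ N0 (AGT _) xi0 d0)).
  apply: (@le_trans _ _ (N%:R ^+ N / (xi ^+ N * rho))).
    rewrite ler_wpM2l ?exprn_ge0// lef_pV2 ?posrE ?mulr_gt0 ?exprn_gt0// ?normr_gt0//.
    by rewrite ler_pM2l ?exprn_gt0// ltW.
  have -> : N%:R ^+ N / (xi ^+ N * rho) = (N%:R ^+ N / `|dlt|) * z ^+ (12 * N).
    rewrite /xi /rho exprVn -!exprM !invfM invrK.
    rewrite n3 exprD.
    move: (zn (12 * N)%N) (zn (4 * (N - 3) * N)%N); move: (z ^+ (12 * N)) (z ^+ (4 * (N - 3) * N)) (N%:R ^+ N) => a b u a0 b0.
    have dn : `|dlt| != 0 by rewrite gt_eqF.
    by field; rewrite ?b0 ?dn.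
  rewrite exprMn -exprM.
  rewrite n4 ler_pM2r//; have : 0 <= N%:R ^+ N / `|dlt| by rewrite divr_ge0// exprn_ge0.
  by move: (N%:R ^+ N / `|dlt|) => a a0; nra.
have mF : measurable_fun [set: T1 * T2] (fun w => cos (xi * \sum_i Kz (Z w.2) 0 i * q i (x w.1))).
  apply: measurableT_comp; first exact: continuous_measurable_fun (@continuous_cos R).
  apply: measurable_funM => //; apply: measurable_sum => i; apply: measurable_funM.
    exact: (measurableT_comp (mKz i) measurable_snd).
  exact: (measurableT_comp (mq i) measurable_fst).
have bF w1 w2 : `|cos (xi * \sum_i Kz (Z w2) 0 i * q i (x w1))| <= 1 by exact: cos_max.
pose Fc w1 w2 := cos (xi * \sum_i Kz (Z w2) 0 i * q i (x w1)).
have sw := @Rintegral_swap R _ _ Q1 _ _ Q2 Fc (fun=> 1) mF bF (i1 _ _ Q1 1).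
set C0 := expR ((1 + sqn g0) / 2).
pose f w1 := C0 * expR (- (xi ^+ 2 * (\sum_i q i (x w1) ^+ 2 + (\sum_i g0 0 i * q i (x w1)) ^+ 2) / 2)).
have mf : measurable_fun setT f.
  apply: measurable_funM => //; apply: measurableT_comp; first exact: measurable_expR.
  apply: measurableT_comp => //; apply: measurable_funM => //; apply: measurable_funM => //.
  apply: measurable_funD; first by apply: measurable_sum => i; exact: measurable_funX.
  by apply: measurable_funX; apply: measurable_sum => i; exact: measurable_funM.
have fi : Q1.-integrable setT (EFin \o f).
  apply: (le_integrableR mf _ (i1 _ _ Q1 C0)) => w.
  rewrite !ger0_norm ?mulr_ge0 ?expR_ge0// ler_piMr ?expR_ge0// -[leRHS]expR0 ler_expR oppr_le0.
  by rewrite divr_ge0// mulr_ge0 ?sqr_ge0// addr_ge0 ?sqr_ge0// sumr_ge0// => i _; exact: sqr_ge0.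
set D := [set w | _].
have mD : measurable D.
  have -> : D = (fun w => \sum_i q i (x w) ^+ 2) @^-1` [set` `]-oo, (z ^+ (8 * N))]].
    by apply/seteqP; split=> w /=; rewrite in_itv.
  rewrite -[X in measurable X]setTI; apply: (_ : measurable_fun setT _) => //.
  by apply: measurable_sum => i; exact: measurable_funX.
(* Since xi^2 z^(8 N) = 1 and, by Cauchy-Schwarz, the g0 term adds at most a factor sqn g0, the
   exponent loses at most (1 + sqn g0)/2, which [C0] compensates. *)
have f1 w : D w -> 1 <= f w.
  move=> Dw; rewrite /f /C0 -expRD -[leLHS]expR0 ler_expR -mulrBl divr_ge0// subr_ge0.
  have cs : (\sum_i g0 0 i * q i (x w)) ^+ 2 <= sqn g0 * \sum_i q i (x w) ^+ 2.
    have := sqn_dot_le g0 (\row_i q i (x w)); rewrite [sqn (\row__ _)]sqnE mxE.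
    congr (_ ^+ 2 <= _ * _); first by apply: eq_bigr => i _; rewrite !mxE.
    by apply: eq_bigr => i _; rewrite !mxE.
  have D1 : \sum_i q i (x w) ^+ 2 <= z ^+ (8 * N) by exact: Dw.
  have xz : xi ^+ 2 * z ^+ (8 * N) = 1.
    by rewrite /xi exprVn -exprM n5 mulVf.
  apply: (@le_trans _ _ (xi ^+ 2 * ((1 + sqn g0) * z ^+ (8 * N)))); last by rewrite mulrCA xz mulr1.
  rewrite ler_wpM2l ?sqr_ge0// mulrDl mul1r lerD//.
  by apply: le_trans cs _; rewrite ler_wpM2l ?sqn_ge0.
apply: le_trans (probability_le_Rintegral mD fi _ f1) _.
  by move=> w; rewrite mulr_ge0 ?expR_ge0.
rewrite lee_fin.
(* By [gauss_avg], f is an average of cosines; exchanging the two integrals produces the oscillatory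
   integrals phi. *)
have -> : \int[Q1]_w f w = C0 * \int[Q2]_w phi w.
  rewrite /phi -sw -RintegralZl//.
    by congr Rintegral; apply/funext => w1; rewrite gauss_avg.
  apply: (@integrable_section2 R _ _ Q2 _ _ Q1 (fun w2 w1 => Fc w1 w2) (fun=> 1)); [|by move=> w2 w1; exact: bF|exact: i1].
  apply: measurableT_comp; first exact: continuous_measurable_fun (@continuous_cos R).
  apply: measurable_funM => //; apply: measurable_sum => i; apply: measurable_funM.
    exact: (measurableT_comp (mKz i) measurable_fst).
  exact: (measurableT_comp (mq i) measurable_snd).
rewrite /small_ball_cst -/C0 -mulrA ler_pM2l ?expR_gt0//.
have iphi : Q2.-integrable setT (EFin \o phi) by exact: (@integrable_section2 R _ _ Q1 _ _ Q2 Fc (fun=> 1) mF bF (i1 _ _ Q1 1)).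
have iind (D' : set T2) : measurable D' -> Q2.-integrable setT (EFin \o (\1_D' : T2 -> R)).
  move=> mD'; apply: (le_integrableR _ _ (i1 _ _ Q2 1)); first exact: measurable_indic.
  by move=> w; rewrite normr1 indicE ger0_norm// lern1 leq_b1.
have iind2 : Q2.-integrable setT (EFin \o (fun w => b2 * \1_(A2 rho) w)).
  exact: (@integrableZl _ _ _ Q2 _ _ _ (EFin \o (\1_(A2 rho) : T2 -> R)) (iind _ (mA2 rho))).
have iA1 := iind _ (mA1 r).
have isum : Q2.-integrable setT (EFin \o (fun w => \1_(A1 r) w + b2 * \1_(A2 rho) w)).
  exact: (@integrableD _ _ _ Q2 _ _ (EFin \o (\1_(A1 r) : T2 -> R)) (EFin \o (fun w => b2 * \1_(A2 rho) w))).
have ib3 := i1 _ _ Q2 b3.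
have isum3 : Q2.-integrable setT (EFin \o (fun w => \1_(A1 r) w + b2 * \1_(A2 rho) w + b3)).
  exact: (@integrableD _ _ _ Q2 _ _ (EFin \o (fun w => \1_(A1 r) w + b2 * \1_(A2 rho) w)) (EFin \o (fun=> b3))).
apply: (@le_trans _ _ (\int[Q2]_w (\1_(A1 r) w + b2 * \1_(A2 rho) w + b3))).
  by apply: le_Rintegral => // w _; exact: phib.
rewrite RintegralD// RintegralD// ?(iind _ (mA1 r))// RintegralZl ?(iind _ (mA2 rho))//.
rewrite (@Rintegral_cst_probability _ _ _ Q2).
have fineI (D' : set T2) (a : R) : measurable D' -> (Q2 D' <= a%:E)%E -> \int[Q2]_w \1_D' w <= a.
  move=> mD' h1; rewrite -lee_fin (EFin_Rintegral (iind _ mD')).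
  by rewrite (_ : (\int[Q2]_w (\1_D' w)%:E)%E = Q2 D')// integral_indic// setIT.
have h1 := fineI _ _ (mA1 r) (PA1 (zp 6)).
have h2 := fineI _ _ (mA2 rho) (PA2 (ltW (zp _))).
apply: (le_trans (lerD (lerD h1 (ler_wpM2l (ltW b20) h2)) (lexx b3))).
have z6 : z ^+ (6 * N) <= z ^+ (6 * N - 15) by rewrite ler_wiXn2l ?(ltW z0).
have dst (a b c' y : R) : (a + b + c') * y = a * y + b * y + c' * y by rewrite !mulrDl.
rewrite dst; apply: lerD; first apply: lerD.
- by rewrite -exprM mulrAC ler_wpM2l ?divr_ge0 ?expR_ge0.
- rewrite /b2 (_ : kap * z ^+ (2 * N - 3) * (2 * N%:R * z ^+ (4 * (N - 3))) =
    2 * N%:R * kap * (z ^+ (2 * N - 3) * z ^+ (4 * (N - 3)))).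
    by rewrite -exprD n7.
  by move: (z ^+ (2 * N - 3)) (z ^+ (4 * (N - 3))) (N%:R) => a b n; ring.
- by rewrite /b3 ler_wpM2l// addr_ge0// divr_ge0// exprn_ge0.
Qed.

End SmallBallMain.

(** * Cubic forms in the third chaos *)

Section CubicTensor.
Context {R : realType} {n : nat}.
Variable a : 'I_n -> 'I_n -> 'I_n -> R.
Hypotheses (a12 : forall i j k, a i j k = a j i k) (a23 : forall i j k, a i j k = a i k j).
Local Notation L := (@ornstein_uhlenbeck R n).

(* cubic_form a is the Hermite (Wick) version of sum a_ijk x_i x_j x_k / 6, and
   quad_form and lin_form are its successive partial derivatives. *)
Definition lin_form i j (x : 'rV[R]_n) : R := \sum_k a i j k * x 0 k.
Definition quad_form i (x : 'rV[R]_n) : R := 2^-1 * (\sum_j x 0 j * lin_form i j x) - 2^-1 * \sum_j a i j j.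
Definition cubic_form (x : 'rV[R]_n) : R :=
  6^-1 * (\sum_i x 0 i * (\sum_j x 0 j * lin_form i j x)) - 2^-1 * \sum_i x 0 i * \sum_j a i j j.

Lemma partial_dot l (F : 'I_n -> 'rV[R]_n -> R) : (forall i, polyfun (F i)) ->
  partial l (fun x => \sum_i x 0 i * F i x) = fun x => F l x + \sum_i x 0 i * partial l (F i) x.
Proof.
move=> pF; rewrite (partial_sum l (index_enum 'I_n) (P := xpredT) (F := fun i x => x 0 i * F i x)); last first.
  by move=> i _; apply: polyfun_C1; apply: polyfunM => //; exact: polyfun_coord.
apply/funext => x.
transitivity (\sum_i (F i x * (i == l)%:R + x 0 i * partial l (F i) x)).
  apply: eq_bigr => i _; rewrite (partialM l (C1growth_coord i) (polyfun_C1 (pF i))) partial_coord.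
  by rewrite addrC.
rewrite big_split/=; congr (_ + _); rewrite (bigD1 l)//= eqxx mulr1 big1 ?addr0// => i il.
by rewrite (negbTE il) mulr0.
Qed.

Lemma polyfun_dot (F : 'I_n -> 'rV[R]_n -> R) : (forall i, polyfun (F i)) ->
  polyfun (fun x => \sum_i x 0 i * F i x).
Proof. by move=> pF; apply: polyfun_sum => i _; apply: polyfunM => //; exact: polyfun_coord. Qed.

Lemma lin_form_polyfun i j : polyfun (lin_form i j).
Proof. by apply: polyfun_sum => k _; apply: polyfunZ; exact: polyfun_coord. Qed.

Lemma partial_lin_form l i j : partial l (lin_form i j) = fun=> a i j l.
Proof.
rewrite /lin_form (partial_lin l _ (a i j) (fun k => polyfun_coord k)); apply/funext => x.
rewrite (bigD1 l)//= partial_coord eqxx mulr1 big1 ?addr0// => k kl.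
by rewrite partial_coord (negbTE kl) mulr0.
Qed.

Let S2 i (x : 'rV[R]_n) : R := \sum_j x 0 j * lin_form i j x.
Let S2_polyfun i : polyfun (S2 i).
Proof. by apply: polyfun_dot => j; exact: lin_form_polyfun. Qed.

Let partial_S2 l i : partial l (S2 i) = fun x => 2 * lin_form i l x.
Proof.
rewrite (partial_dot l (F := lin_form i) (fun j => lin_form_polyfun i j)); apply/funext => x.
rewrite mulrDl mul1r; congr (_ + _); apply: eq_bigr => j _.
by rewrite partial_lin_form mulrC (a23 i j l).
Qed.

Lemma quad_form_polyfun i : polyfun (quad_form i).
Proof. by apply: polyfunB; [exact: (polyfunZ 2^-1 (S2_polyfun i))|exact: polyfun_cst]. Qed.

Lemma partial_quad_form l i : partial l (quad_form i) = lin_form i l.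
Proof.
rewrite (partialB l (polyfun_C1 (polyfunZ 2^-1 (S2_polyfun i))) (C1growth_cst _)) partial_cst.
rewrite (partialZ l 2^-1 (polyfun_C1 (S2_polyfun i))) partial_S2; apply/funext => x.
by rewrite subr0 mulrA mulVf// mul1r.
Qed.

Let S3_polyfun : polyfun (fun x : 'rV[R]_n => \sum_i x 0 i * S2 i x).
Proof. exact: polyfun_dot. Qed.

Let S1_polyfun : polyfun (fun x : 'rV[R]_n => \sum_i x 0 i * \sum_j a i j j).
Proof. by apply: (polyfun_dot (F := fun i _ => \sum_j a i j j)) => i; exact: polyfun_cst. Qed.

Lemma cubic_form_polyfun : polyfun cubic_form.
Proof. by apply: polyfunB; exact: polyfunZ. Qed.

Lemma partial_cubic_form l : partial l cubic_form = quad_form l.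
Proof.
rewrite (partialB l (polyfun_C1 (polyfunZ 6^-1 S3_polyfun)) (polyfun_C1 (polyfunZ 2^-1 S1_polyfun))).
rewrite (partialZ l 6^-1 (polyfun_C1 S3_polyfun)) (partialZ l 2^-1 (polyfun_C1 S1_polyfun)).
rewrite (partial_dot l (F := S2))// (partial_dot l (F := fun i _ => \sum_j a i j j)); last by move=> i; exact: polyfun_cst.
apply/funext => x.
have e1 : \sum_i x 0 i * partial l (S2 i) x = 2 * S2 l x.
  rewrite mulr_sumr; apply: eq_bigr => i _; rewrite partial_S2 mulrCA; congr (_ * (_ * _)).
  by apply: eq_bigr => k _; rewrite (a12 i l k).
have e2 : \sum_i x 0 i * partial l (fun _ : 'rV[R]_n => \sum_j a i j j) x = 0.
  by apply: big1 => i _; rewrite partial_cst mulr0.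
by rewrite e1 e2 addr0 /quad_form -/(S2 l x); field.
Qed.

Lemma OU_lin_form i j : L (lin_form i j) = fun x => - lin_form i j x.
Proof.
apply/funext => x; rewrite /ornstein_uhlenbeck big1 ?sub0r; last first.
  by move=> k _; rewrite partial_lin_form partial_cst.
by congr (- _); apply: eq_bigr => k _; rewrite partial_lin_form mulrC.
Qed.

Lemma OU_quad_form i : L (quad_form i) = fun x => - 2 * quad_form i x.
Proof.
apply/funext => x; rewrite /ornstein_uhlenbeck.
transitivity (\sum_j a i j j - S2 i x); last by rewrite /quad_form -/(S2 i x); field.
congr (_ - _); apply: eq_bigr => j _; rewrite partial_quad_form//.
by rewrite partial_lin_form.
Qed.

Lemma OU_cubic_form : L cubic_form = fun x => - 3 * cubic_form x.
Proof.
apply/funext => x; rewrite /ornstein_uhlenbeck.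
transitivity (\sum_i lin_form i i x - \sum_i x 0 i * quad_form i x).
  congr (_ - _); apply: eq_bigr => j _; rewrite partial_cubic_form//.
  by rewrite partial_quad_form.
have -> : \sum_i lin_form i i x = \sum_i x 0 i * \sum_j a i j j.
  rewrite /lin_form exchange_big/=; apply: eq_bigr => i _.
  by rewrite mulr_sumr; apply: eq_bigr => j _; rewrite mulrC a23 a12.
have -> : \sum_i x 0 i * quad_form i x =
    2^-1 * (\sum_i x 0 i * S2 i x) - 2^-1 * (\sum_i x 0 i * \sum_j a i j j).
  rewrite !mulr_sumr -sumrB; apply: eq_bigr => i _; rewrite /quad_form -/(S2 i x); ring.
rewrite /cubic_form.
have -> : \sum_i x 0 i * (\sum_j x 0 j * lin_form i j x) = \sum_i x 0 i * S2 i x by [].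
by move: (\sum_i x 0 i * S2 i x) (\sum_i x 0 i * \sum_j a i j j) => u v; field.
Qed.

Lemma chaos_lin_form i j : chaos 1 (lin_form i j).
Proof.
split; first exact: lin_form_polyfun.
split; first by rewrite OU_lin_form; apply/funext => x; rewrite mulN1r.
by move=> l; rewrite partial_lin_form; split; [exact: polyfun_cst|exists (a i j l)].
Qed.

Lemma chaos_quad_form i : chaos 2 (quad_form i).
Proof.
split; first exact: quad_form_polyfun.
split; first exact: OU_quad_form.
by move=> l; rewrite partial_quad_form; exact: chaos_lin_form.
Qed.

Lemma chaos_cubic_form : chaos 3 cubic_form.
Proof.
split; first exact: cubic_form_polyfun.
split; first exact: OU_cubic_form.
by move=> l; rewrite partial_cubic_form; exact: chaos_quad_form.
Qed.

Context d (T : measurableType d) (Q : probability T R) (Z : T -> 'rV[R]_n).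
Hypothesis GZ : gaussian_vector Q Z.
Local Notation ex := (expect Q Z).

Lemma ex_lin_form2 (i j : 'I_n) : ex (fun x => lin_form i j x ^+ 2) = \sum_k a i j k ^+ 2.
Proof.
have := chaos_energy GZ (chaos_lin_form i j); rewrite mul1r => <-.
by apply: eq_bigr => k _; rewrite partial_lin_form ex_cst.
Qed.

(** [chaos_energy] is applied at orders 3, 2 and 1, hence 6 = 3!; the third derivatives are the
    entries of a. *)
Lemma ex_cubic_form2 : 6 * ex (fun x => cubic_form x ^+ 2) = \sum_i \sum_j \sum_k a i j k ^+ 2.
Proof.
have -> : 6 * ex (fun x => cubic_form x ^+ 2) = 2 * (3 * ex (fun x => cubic_form x ^+ 2)) by ring.
rewrite -(chaos_energy GZ chaos_cubic_form) mulr_sumr; apply: eq_bigr => i _.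
rewrite partial_cubic_form -(chaos_energy GZ (chaos_quad_form i)); apply: eq_bigr => j _.
by rewrite partial_quad_form ex_lin_form2.
Qed.

(** [chaos_energy] at orders 2 and 1; the second derivatives of the directional derivative are the
    constants [contraction a v j k]. *)
Lemma ex_directional2 (v : 'rV[R]_n) :
  2 * ex (fun x => (\sum_i v 0 i * partial i cubic_form x) ^+ 2) =
  \sum_j \sum_k (contraction a v j k) ^+ 2.
Proof.
have c2 : chaos 2 (fun x => \sum_i v 0 i * partial i cubic_form x).
  by apply: chaos_lin => i; rewrite partial_cubic_form; exact: chaos_quad_form.
rewrite -(chaos_energy GZ c2); apply: eq_bigr => j _.
have c1 : chaos 1 (partial j (fun x => \sum_i v 0 i * partial i cubic_form x)).
  by have [_ [_ h]] := c2; exact: h.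
have := chaos_energy GZ c1; rewrite mul1r => <-; apply: eq_bigr => k _.
have pc i : polyfun (partial i cubic_form) by rewrite partial_cubic_form; exact: quad_form_polyfun.
rewrite (partial_lin j _ (fun i => v 0 i) pc).
have pc2 i : polyfun (partial j (partial i cubic_form)) by exact: polyfun_partial.
rewrite (partial_lin k _ (fun i => v 0 i) pc2) -[RHS](ex_cst Q Z); apply: eq_ex => x.
congr (_ ^+ 2); rewrite mxE; apply: eq_bigr => i _.
by rewrite partial_cubic_form partial_quad_form partial_lin_form.
Qed.

End CubicTensor.

Lemma quad_formE {R : realType} n (a : 'I_n -> 'I_n -> 'I_n -> R)
    (a23 : forall i j k, a i j k = a i k j) i (x : 'rV[R]_n) :
  quad_form a i x = quadf (\matrix_(j, k) a i j k) (- (2^-1 * \sum_j a i j j)) x.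
Proof.
rewrite quadfE /quad_form mulrC; congr (_ / 2 + _).
apply: eq_bigr => j _; rewrite mulrC; congr (_ * _); apply: eq_bigr => k _.
by rewrite mxE mulrC (a23 i j k).
Qed.

(** * Uniqueness of Fourier coefficients *)

Section TaylorCos.
Context {R : realType}.

Definition cos_poly (K : nat) (y : R) : R := \sum_(k < K) (-1) ^+ k * y ^+ (2 * k) / (2 * k)`!%:R.
Definition sin_poly (K : nat) (y : R) : R := \sum_(k < K) (-1) ^+ k * y ^+ (2 * k).+1 / (2 * k).+1`!%:R.

Lemma is_derive_pow_fact (k : nat) (x : R) :
  is_derive x (1 : R) (fun y : R => y ^+ k.+1 / k.+1`!%:R) (x ^+ k / k`!%:R).
Proof.
have kf : k.+1`!%:R != 0 :> R by rewrite pnatr_eq0 -lt0n fact_gt0.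
have kf' : k`!%:R != 0 :> R by rewrite pnatr_eq0 -lt0n fact_gt0.
have k0 : k.+1%:R != 0 :> R by rewrite pnatr_eq0.
have h : is_derive x (1 : R) (fun y : R => y ^+ k.+1) (k.+1%:R * x ^+ k).
  have -> : (fun y : R => y ^+ k.+1) = (@id R) ^+ k.+1 by apply/funext => y; rewrite exprfctE.
  by apply: is_derive_eq; rewrite /GRing.scale /= mulr1.
apply: is_derive_eq; rewrite /GRing.scale /= ?mulr0 ?addr0 ?add0r factS natrM.
by move: k0 kf'; move: (k.+1%:R : R) (k`!%:R : R) (x ^+ k) => u v w u0 v0; field; rewrite ?u0 ?v0.
Qed.

(** Both x^(k+1)/(k+1)! + f and x^(k+1)/(k+1)! - f are nondecreasing on the half-line, by the mean
    value theorem. *)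
Lemma bounded_by_integral (f df : R -> R) (k : nat) : (forall x : R, is_derive x (1 : R) f (df x)) ->
  f 0 = 0 -> (forall x, 0 <= x -> `|df x| <= x ^+ k / k`!%:R) ->
  forall x, 0 <= x -> `|f x| <= x ^+ k.+1 / k.+1`!%:R.
Proof.
move=> hf f0 hdf x x0.
pose p (y : R) : R := y ^+ k.+1 / k.+1`!%:R.
have dp (y : R) : is_derive y (1 : R) p (y ^+ k / k`!%:R) by exact: is_derive_pow_fact.
have mono (u du : R -> R) : (forall y : R, is_derive y (1 : R) u (du y)) ->
    (forall y, 0 <= y -> 0 <= du y) -> u 0 <= u x.
  move=> hu hdu; have [->//|xn0] := eqVneq x 0.
  have x00 : 0 < x by rewrite lt_neqAle eq_sym xn0.
  have [c c0x e] : exists2 c, c \in `]0, x[ & u x - u 0 = du c * (x - 0).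
    apply: MVT => //; apply: derivable_within_continuous => y _; exact: ex_derive.
  rewrite -subr_ge0 e subr0 mulr_ge0// hdu//.
  by move: c0x; rewrite in_itv/= => /andP[/ltW].
rewrite ler_norml; apply/andP; split.
- have h := mono (fun y => p y + f y) (fun y => y ^+ k / k`!%:R + df y).
  have := h _ _; rewrite /p f0 expr0n/= mul0r addr0 => h'.
  rewrite -subr_ge0 opprK addrC; apply: h' => y.
  by move=> y0; have := hdf y y0; rewrite ler_norml => /andP[]; rewrite -subr_ge0 opprK addrC.
- have h := mono (fun y => p y - f y) (fun y => y ^+ k / k`!%:R - df y).
  have := h _ _; rewrite /p f0 expr0n/= mul0r subr0 => h'.
  rewrite -subr_ge0; apply: h' => y.
  by move=> y0; have := hdf y y0; rewrite ler_norml => /andP[_]; rewrite -subr_ge0.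
Qed.

Lemma derive_sin_poly K (x : R) : is_derive x (1 : R) (sin_poly K) (cos_poly K x).
Proof.
elim: K => [|K IH].
  have -> : sin_poly 0 = cst 0 by apply/funext => y; rewrite /sin_poly big_ord0.
  by rewrite /cos_poly big_ord0; exact: is_derive_cst.
have -> : sin_poly K.+1 = (fun y => sin_poly K y + (-1) ^+ K * (y ^+ (2 * K).+1 / (2 * K).+1`!%:R)).
  by apply/funext => y; rewrite /sin_poly big_ord_recr/= mulrA.
have dp := is_derive_pow_fact (2 * K) x.
apply: is_derive_eq; rewrite /cos_poly big_ord_recr/= /GRing.scale /=; ring.
Qed.

Lemma derive_cos_poly K (x : R) : is_derive x (1 : R) (cos_poly K.+1) (- sin_poly K x).
Proof.
elim: K => [|K IH].
  have -> : cos_poly 1 = cst 1.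
    by apply/funext => y; rewrite /cos_poly big_ord1 muln0 !expr0 fact0 mul1r divr1.
  by rewrite /sin_poly big_ord0 oppr0; exact: is_derive_cst.
have -> : cos_poly K.+2 = (fun y => cos_poly K.+1 y + (-1) ^+ K.+1 * (y ^+ (2 * K).+2 / (2 * K).+2`!%:R)).
  by apply/funext => y; rewrite /cos_poly big_ord_recr/= mulrA mulnS add2n.
have dp := is_derive_pow_fact (2 * K).+1 x.
apply: is_derive_eq; rewrite /sin_poly big_ord_recr/= /GRing.scale /= exprS; ring.
Qed.

(** The remainders of sine and cosine are, up to sign, derivatives of one another, so
    [bounded_by_integral] is applied alternately, gaining one order each time. *)
Lemma taylor_cos_sin_pos K (x : R) : 0 <= x ->
  `|sin x - sin_poly K x| <= x ^+ (2 * K) / (2 * K)`!%:R /\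
  `|cos x - cos_poly K.+1 x| <= x ^+ (2 * K).+1 / (2 * K).+1`!%:R.
Proof.
have dc K' (sK : forall y, 0 <= y -> `|sin y - sin_poly K' y| <= y ^+ (2 * K') / (2 * K')`!%:R) y : 0 <= y ->
    `|cos y - cos_poly K'.+1 y| <= y ^+ (2 * K').+1 / (2 * K').+1`!%:R.
  apply: (@bounded_by_integral (fun y => cos y - cos_poly K'.+1 y) (fun y => - (sin y - sin_poly K' y))).
  - move=> t; have d1 := derive_cos_poly K' t; apply: is_derive_eq; ring.
  - rewrite cos0 /cos_poly big_ord_recl/= muln0 !expr0 fact0 mul1r divr1 big1 ?addr0 ?subrr// => i _.
    by rewrite /bump/= mulnS add2n exprS mul0r mulr0 mul0r.
  - by move=> t t0; rewrite normrN; exact: sK.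
elim: K x => [|K IH] x x0.
  have s0 y : 0 <= y -> `|sin y - sin_poly 0 y| <= y ^+ (2 * 0) / (2 * 0)`!%:R.
    by move=> _; rewrite /sin_poly big_ord0 subr0 muln0 expr0 fact0 divr1 sin_max.
  by split; [exact: s0|exact: dc].
have cK y : 0 <= y -> `|cos y - cos_poly K.+1 y| <= y ^+ (2 * K).+1 / (2 * K).+1`!%:R.
  by move=> y0; have [] := IH y y0.
have sK y : 0 <= y -> `|sin y - sin_poly K.+1 y| <= y ^+ (2 * K.+1) / (2 * K.+1)`!%:R.
  rewrite mulnS add2n.
  apply: (@bounded_by_integral (fun y => sin y - sin_poly K.+1 y) (fun y => cos y - cos_poly K.+1 y)) => //.
  - by move=> t; have d1 := derive_sin_poly K.+1 t; apply: is_derive_eq.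
  - by rewrite sin0 /sin_poly big1 ?subrr// => i _; rewrite exprS mul0r mulr0 mul0r.
by split; [exact: sK|exact: dc].
Qed.

Lemma taylor_sin K (x : R) : `|sin x - sin_poly K x| <= `|x| ^+ (2 * K) / (2 * K)`!%:R.
Proof.
have [x0|/ltW x0] := leP 0 x; first by rewrite (ger0_norm x0); have [] := taylor_cos_sin_pos K x0.
have x0' : 0 <= - x by rewrite oppr_ge0.
have [+ _] := taylor_cos_sin_pos K x0'.
rewrite sinN (ler0_norm x0) -normrN opprD opprK; congr (`|_ + _| <= _).
by rewrite opprK /sin_poly -sumrN; apply: eq_bigr => i _; rewrite !exprS !exprM sqrrN; ring.
Qed.

Lemma taylor_cos K (x : R) : `|cos x - cos_poly K.+1 x| <= `|x| ^+ (2 * K).+1 / (2 * K).+1`!%:R.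
Proof.
have [x0|/ltW x0] := leP 0 x; first by rewrite (ger0_norm x0); have [] := taylor_cos_sin_pos K x0.
have x0' : 0 <= - x by rewrite oppr_ge0.
have [_] := taylor_cos_sin_pos K x0'.
rewrite cosN (ler0_norm x0); congr (`|_ - _| <= _).
by rewrite /cos_poly; apply: eq_bigr => i _; rewrite !exprM sqrrN.
Qed.

End TaylorCos.

Section TrigonometricOrthogonality.
Context {R : realType}.
Local Notation gam := (@normal_prob R 0 1).
Context d (T : measurableType d) (Q : probability T R) n (Z : T -> 'rV[R]_n).
Hypothesis GZ : gaussian_vector Q Z.
Local Notation L := (@ornstein_uhlenbeck R n).
Local Notation ex := (expect Q Z).

Definition linear_form (v : 'I_n -> R) (x : 'rV[R]_n) : R := \sum_i v i * x 0 i.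

Lemma linear_form_polyfun v : polyfun (linear_form v).
Proof. by apply: polyfun_sum => i _; apply: polyfunZ; exact: polyfun_coord. Qed.

Lemma partial_linear_form v i : partial i (linear_form v) = fun=> v i.
Proof.
rewrite /linear_form (partial_lin i _ v (fun k => polyfun_coord k)); apply/funext => x.
rewrite (bigD1 i)//= partial_coord eqxx mulr1 big1 ?addr0// => k ki.
by rewrite partial_coord (negbTE ki) mulr0.
Qed.

Lemma OU_cst (c : R) : L (fun=> c) = fun=> 0.
Proof.
apply/funext => x; rewrite /ornstein_uhlenbeck !big1 ?subr0// => i _.
  by rewrite partial_cst mulr0.
by rewrite !partial_cst.
Qed.

Lemma OU_linear_form v : L (linear_form v) = fun x => - linear_form v x.
Proof.
apply/funext => x; rewrite /ornstein_uhlenbeck big1 ?sub0r; last first.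
  by move=> i _; rewrite partial_linear_form partial_cst.
by congr (- _); apply: eq_bigr => i _; rewrite partial_linear_form mulrC.
Qed.

Lemma OU_linear_formX v k : L (fun x => linear_form v x ^+ k.+2) =
  fun x => (k.+2%:R * k.+1%:R * \sum_i v i ^+ 2) * linear_form v x ^+ k - k.+2%:R * linear_form v x ^+ k.+2.
Proof.
have cY := polyfun_C1 (linear_form_polyfun v).
have D1 i : partial i (fun x => linear_form v x ^+ k.+2) = fun x => (k.+2%:R * v i) * linear_form v x ^+ k.+1.
  by rewrite (partialX i k.+1 cY) partial_linear_form; apply/funext => x; rewrite mulrAC.
have D2 i : partial i (partial i (fun x => linear_form v x ^+ k.+2)) =
    fun x => (k.+2%:R * k.+1%:R * linear_form v x ^+ k) * v i ^+ 2.
  rewrite D1 (partialZ i _ (polyfun_C1 (polyfunX k.+1 (linear_form_polyfun v)))).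
  rewrite (partialX i k cY) partial_linear_form; apply/funext => x.
  by move: (k.+2%:R) (k.+1%:R) => u w; ring.
apply/funext => x; rewrite /ornstein_uhlenbeck; apply: (f_equal2 (fun a b : R => a - b)).
  transitivity (\sum_i (k.+2%:R * k.+1%:R * linear_form v x ^+ k) * v i ^+ 2).
    by apply: eq_bigr => i _; rewrite D2.
  by rewrite -mulr_sumr mulrAC.
rewrite [in RHS](exprS _ k.+1) {2}/linear_form mulr_suml mulr_sumr; apply: eq_bigr => i _.
by rewrite D1; move: (k.+2%:R) => u; ring.
Qed.

Lemma ex_linear_formX v k : ex (fun x => linear_form v x ^+ (2 * k.+1)) =
  (2 * k).+1%:R * (\sum_i v i ^+ 2) * ex (fun x => linear_form v x ^+ (2 * k)).
Proof.
have pY := linear_form_polyfun v.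
rewrite (@eq_ex _ _ _ Q _ Z _ (fun x => \sum_i v i * (x 0 i * linear_form v x ^+ (2 * k).+1))); last first.
  by move=> x; rewrite mulnS add2n exprS {1}/linear_form mulr_suml; apply: eq_bigr => i _; rewrite mulrA.
rewrite (ex_sum GZ); last first.
  by move=> i; apply: polyfunZ; apply: polyfunM; [exact: polyfun_coord|exact: polyfunX].
rewrite mulr_sumr mulr_suml; apply: eq_bigr => i _.
rewrite (exZ GZ (v i) (polyfunM (polyfun_coord i) (polyfunX (2 * k).+1 pY))).
rewrite (ex_ibp GZ i (polyfunX (2 * k).+1 pY)) (partialX i (2 * k) (polyfun_C1 pY)) partial_linear_form.
rewrite -(exZ GZ (v i) (f := fun x => (2 * k).+1%:R * linear_form v x ^+ (2 * k) * v i)); last first.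
  by apply: polyfunM; [apply: polyfunZ; exact: polyfunX|exact: polyfun_cst].
rewrite -(exZ GZ _ (polyfunX (2 * k) pY)); apply: eq_ex => x.
by move: ((2 * k).+1%:R) => u; ring.
Qed.

(** The left side is E(Y^k / k!)^2, which controls a Taylor remainder in L^2. Each step multiplies
    the moment by (2k + 1) s, and 2k + 1 <= 2 (k + 1). *)
Lemma ex_linear_formX_le v k : ex (fun x => linear_form v x ^+ (2 * k)) / k`!%:R ^+ 2 <=
  (2 * \sum_i v i ^+ 2) ^+ k / k`!%:R.
Proof.
set s := \sum_i v i ^+ 2.
have s0 : 0 <= s by apply: sumr_ge0 => i _; exact: sqr_ge0.
have fk j : 0 < j`!%:R :> R by rewrite ltr0n fact_gt0.
elim: k => [|k IH].
  by rewrite muln0 fact0 !expr1n !expr0 ex_cst.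
rewrite ex_linear_formX -/s factS natrM.
have k1 : 0 < k.+1%:R :> R by rewrite ltr0n.
have k2 : (2 * k).+1%:R <= 2 * k.+1%:R :> R by rewrite -natrM ler_nat mulnS add2n ltnW.
have u0 : 0 <= ex (fun x => linear_form v x ^+ (2 * k)).
  by apply: Rintegral_ge0 => w _; rewrite exprM exprn_ge0// sqr_ge0.
move: IH u0; move: (ex _) => u; move: (fk k) k1 k2 s0; rewrite -/s (exprS (2 * s) k).
move: ((2 * s) ^+ k) (k`!%:R : R) (k.+1%:R : R) ((2 * k).+1%:R : R) => W f K D f0 K0 DK s0 h u0.
have f0' : f != 0 by rewrite gt_eqF.
rewrite ler_pdivrMr ?(exprn_gt0 2 f0)// in h.
have e1 : W / f * f ^+ 2 = W * f by rewrite expr2 mulrA divfK.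
rewrite e1 in h; rewrite ler_pdivrMr ?(exprn_gt0 2 (mulr_gt0 K0 f0))//.
have -> : 2 * s * W / (K * f) * (K * f) ^+ 2 = 2 * K * s * (W * f).
  by rewrite expr2 mulrA divfK ?gt_eqF ?mulr_gt0//; ring.
apply: (@le_trans _ _ (2 * K * s * u)); first by rewrite ler_wpM2r// ler_wpM2r.
by rewrite ler_wpM2l// mulr_ge0// mulr_ge0// ltW.
Qed.

Section Vanishing.
Variable r : T -> R.
Hypothesis hr : sq_integrable Q r.
Hypothesis hL : forall psi, polyfun psi -> \int[Q]_w (r w * (L psi (Z w) + 3 * psi (Z w))) = 0.
Hypothesis h3 : forall b : 'I_n -> 'I_n -> 'I_n -> R, (forall i j k, b i j k = b j i k) ->
  (forall i j k, b i j k = b i k j) -> \int[Q]_w (r w * cubic_form b (Z w)) = 0.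
Variable v : 'I_n -> R.
Let Y := linear_form v.
Let s := \sum_i v i ^+ 2.
Let pY : polyfun Y := linear_form_polyfun v.
Let mom k := \int[Q]_w (r w * Y (Z w) ^+ k).

Let irp f : polyfun f -> Q.-integrable setT (EFin \o (fun w => r w * f (Z w))).
Proof. by move=> pf; apply: sq_integrableM => //; exact: (sq_integrable_polyfun GZ). Qed.

Let intZ (c : R) f : polyfun f -> \int[Q]_w (r w * (c * f (Z w))) = c * \int[Q]_w (r w * f (Z w)).
Proof.
move=> pf; rewrite -RintegralZl//; last exact: irp.
by congr Rintegral; apply/funext => w; rewrite mulrCA.
Qed.

Let intD f g : polyfun f -> polyfun g ->
  \int[Q]_w (r w * (f (Z w) + g (Z w))) = \int[Q]_w (r w * f (Z w)) + \int[Q]_w (r w * g (Z w)).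
Proof.
move=> pf pg; rewrite -RintegralD//; try exact: irp.
by congr Rintegral; apply/funext => w; rewrite mulrDr.
Qed.

Let mom0 : mom 0 = 0.
Proof.
have := hL (polyfun_cst 1); rewrite OU_cst.
rewrite (_ : (fun w => _) = fun w => r w * (3 * 1)); last by apply/funext => w; rewrite add0r.
rewrite (intZ 3 (polyfun_cst 1)) => /eqP; rewrite mulf_eq0 pnatr_eq0/= => /eqP.
by move=> <-; congr Rintegral; apply/funext => w; rewrite expr0.
Qed.

Let mom1 : mom 1 = 0.
Proof.
have := hL pY; rewrite OU_linear_form.
rewrite (_ : (fun w => _) = fun w => r w * (2 * Y (Z w))); last first.
  by apply/funext => w; rewrite -/Y; ring.
rewrite (intZ 2 pY) => /eqP; rewrite mulf_eq0 pnatr_eq0/= => /eqP.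
by move=> <-; congr Rintegral; apply/funext => w; rewrite expr1.
Qed.

(** Test [hL] on Y^(k+2), where L + 3 multiplies the leading term by 3 - (k + 2) = 1 - k. *)
Let momS k : (1 - k%:R) * mom k.+2 + (k.+2%:R * k.+1%:R * s) * mom k = 0.
Proof.
have := hL (polyfunX k.+2 pY); rewrite OU_linear_formX.
rewrite (_ : (fun w => _) = fun w => r w * ((1 - k%:R) * Y (Z w) ^+ k.+2 + (k.+2%:R * k.+1%:R * s) * Y (Z w) ^+ k)).
  have pa := polyfunX k.+2 pY; have pb := polyfunX k pY.
  rewrite (@intD (fun x => (1 - k%:R) * Y x ^+ k.+2) (fun x => (k.+2%:R * k.+1%:R * s) * Y x ^+ k) (polyfunZ _ pa) (polyfunZ _ pb)).
  by rewrite (intZ (1 - k%:R) pa) (intZ (k.+2%:R * k.+1%:R * s) pb).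
apply/funext => w; rewrite -/s -/Y; congr (_ * _).
have -> : k.+2%:R = k%:R + 2 :> R by rewrite -addn2 natrD.
move: (k.+1%:R) (k%:R) => a b; ring.
Qed.

(** For b = v x v x v the cubic form is Y^3/6 - s Y/2, and the moment of Y is already known to
    vanish. *)
Let mom3 : mom 3 = 0.
Proof.
pose b i j k := v i * v j * v k.
have b1 i j k : b i j k = b j i k by rewrite /b (mulrC (v i)).
have b2 i j k : b i j k = b i k j by rewrite /b mulrAC.
have := h3 b1 b2.
rewrite (_ : (fun w => _) = fun w => r w * (6^-1 * Y (Z w) ^+ 3 + (- (2^-1 * s)) * Y (Z w))); last first.
  apply/funext => w; congr (_ * _); rewrite /cubic_form; set x := Z w.
  have l1 i j : lin_form b i j x = v i * v j * Y x.
    by rewrite /Y /linear_form mulr_sumr; apply: eq_bigr => k _; rewrite /b mulrA.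
  have l2 i : \sum_j x 0 j * lin_form b i j x = v i * Y x ^+ 2.
    rewrite expr2 mulrA {2}/Y /linear_form mulr_sumr; apply: eq_bigr => j _; rewrite l1; ring.
  have l3 : \sum_i x 0 i * (\sum_j x 0 j * lin_form b i j x) = Y x ^+ 3.
    rewrite exprS {1}/Y /linear_form mulr_suml; apply: eq_bigr => i _; rewrite l2; ring.
  have l4 : \sum_i x 0 i * (\sum_j b i j j) = s * Y x.
    rewrite mulrC /Y /linear_form mulr_suml; apply: eq_bigr => i _.
    have -> : \sum_j b i j j = v i * s by rewrite mulr_sumr; apply: eq_bigr => j _; rewrite /b; ring.
    ring.
  by rewrite l3 l4; ring.
have pa := polyfunX 3 pY.
rewrite (@intD (fun x => 6^-1 * Y x ^+ 3) (fun x => (- (2^-1 * s)) * Y x) (polyfunZ _ pa) (polyfunZ _ pY)).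
rewrite (intZ 6^-1 pa) (intZ (- (2^-1 * s)) pY).
have -> : \int[Q]_w (r w * Y (Z w)) = 0.
  by rewrite -mom1; congr Rintegral; apply/funext => w; rewrite expr1.
by rewrite mulr0 addr0 => /eqP; rewrite mulf_eq0 invr_eq0 pnatr_eq0/= => /eqP.
Qed.

Let mom_eq0 k : mom k = 0.
Proof.
suff : mom k = 0 /\ mom k.+1 = 0 by case.
elim: k => [|k [IH1 IH2]]; first by split; [exact: mom0|exact: mom1].
split=> //; have := momS k; rewrite IH1 mulr0 addr0 => /eqP; rewrite mulf_eq0 => /orP[|/eqP//].
rewrite subr_eq0 eq_sym (_ : (1 : R) = 1%:R)// eqr_nat => /eqP k1.
by rewrite k1 mom3.
Qed.

Let cvg0 : (fun k => (2 * s) ^+ k / k`!%:R) @ \oo --> (0 : R).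
Proof. exact: (cvg_series_cvg_0 (is_cvg_series_exp_coeff (2 * s))). Qed.

(** Cauchy-Schwarz against u(Y) - p_K(Y): the square of the integral is at most E r^2 times (2 s)^(e
    K) / (e K)!, a null sequence because e K >= K. *)
Let square_small (u : R -> R) (p : nat -> R -> R) (e : nat -> nat) :
  measurable_fun setT u -> (forall y, `|u y| <= 1) ->
  (forall K, (K <= e K)%N) ->
  (forall K y, `|u y - p K y| <= `|y| ^+ (e K) / (e K)`!%:R) ->
  (forall K, polyfun (fun x => p K (Y x))) ->
  (forall K, \int[Q]_w (r w * p K (Y (Z w))) = 0) ->
  \int[Q]_w (r w * u (Y (Z w))) = 0.
Proof.
move=> mu u1 eK up pp p0.
have mY : measurable_fun setT (fun w => Y (Z w)) := cgrowth_measurable GZ (polyfun_cgrowth pY).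
have hu : sq_integrable Q (fun w => u (Y (Z w))).
  apply: (@sq_integrable_bounded _ _ _ Q _ 1) => //; exact: (measurableT_comp mu).
set A := \int[Q]_w (r w ^+ 2); set I0 := \int[Q]_w (r w * u (Y (Z w))).
have A0 : 0 <= A by apply: Rintegral_ge0 => w _; exact: sqr_ge0.
have bound K : I0 ^+ 2 <= A * ((2 * s) ^+ (e K) / (e K)`!%:R).
  have hp : sq_integrable Q (fun w => p K (Y (Z w))) := sq_integrable_polyfun GZ (pp K).
  have hd := sq_integrableB hu hp.
  have -> : I0 = \int[Q]_w (r w * (u (Y (Z w)) - p K (Y (Z w)))).
    rewrite -[I0]subr0 -(p0 K) -RintegralB//; [|exact: sq_integrableM..].
    by congr Rintegral; apply/funext => w; rewrite mulrBr.
  apply: (le_trans (cauchy_schwarz hr hd)); rewrite ler_wpM2l//.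
  apply: le_trans (ex_linear_formX_le v (e K)).
  have pe := polyfunX (2 * e K) pY.
  rewrite mulrC -(exZ GZ _ pe); apply: le_Rintegral => //.
  - by case: hd.
  - have := sq_integrable_polyfun GZ (polyfunZ ((e K)`!%:R ^- 2) pe) => /sq_integrable_int.
    exact.
  move=> w _; rewrite -[leLHS]real_normK ?num_real//.
  have -> : (e K)`!%:R ^- 2 * Y (Z w) ^+ (2 * e K) = (`|Y (Z w)| ^+ e K / (e K)`!%:R) ^+ 2.
    rewrite expr_div_n mulrC; congr (_ / _).
    by rewrite exprAC real_normK ?num_real// -exprM.
  by rewrite lerXn2r ?nnegrE ?normr_ge0// divr_ge0// exprn_ge0.
have cA : A * ((2 * s) ^+ k / k`!%:R) @[k --> \oo] --> (0 : R).
  by rewrite -[X in _ --> X](mulr0 A); exact: (cvgM (cvg_cst A) cvg0).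
have ceK : (fun K => A * ((2 * s) ^+ (e K) / (e K)`!%:R)) @ \oo --> (0 : R).
  apply: (cvg_comp e (fun k => A * ((2 * s) ^+ k / k`!%:R)) _ cA).
  move=> S [N _ hN]; exists N => // K /= NK; apply: hN => /=.
  exact: (leq_trans NK (eK K)).
have : I0 ^+ 2 <= 0.
  rewrite -(cvg_lim _ ceK)//; apply: limr_ge; first by apply/cvg_ex; exists 0.
  by apply: nearW => K; exact: bound.
move=> h; apply/eqP; rewrite -sqrf_eq0 eq_le h sqr_ge0//.
Qed.

(* L (Y^(k+2)) only involves Y^(k+2) and Y^k, so r is orthogonal to all powers of
   Y by induction, Y^3 being the case where the recursion degenerates; the Taylor
   remainders of cos and sin are small in L^2. *)
Lemma trig_orthogonal (c : R) : \int[Q]_w (r w * cos (c + Y (Z w))) = 0.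
Proof.
have isum (I : Type) (l : seq I) (f : I -> 'rV[R]_n -> R) : (forall i, polyfun (f i)) ->
    (forall i, \int[Q]_w (r w * f i (Z w)) = 0) -> \int[Q]_w (r w * \sum_(i <- l) f i (Z w)) = 0.
  move=> pf f0; elim: l => [|i l IH].
    rewrite (_ : (fun w => _) = fun=> 0) ?(@Rintegral_cst_probability _ _ _ Q)//.
    by apply/funext => w; rewrite big_nil mulr0.
  rewrite (_ : (fun w => _) = fun w => r w * (f i (Z w) + \sum_(i <- l) f i (Z w))); last first.
    by apply/funext => w; rewrite big_cons.
  by rewrite (intD (pf i) (polyfun_sum _ (fun i _ => pf i))) f0 IH addr0.
have hcos : \int[Q]_w (r w * cos (Y (Z w))) = 0.
  apply: (@square_small cos (fun K => cos_poly K.+1) (fun K => (2 * K).+1)).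
  - exact: continuous_measurable_fun (@continuous_cos R).
  - exact: cos_max.
  - by move=> K; rewrite mul2n -addnn -addnS leq_addr.
  - exact: taylor_cos.
  - move=> K; apply: polyfun_sum => k _; apply: polyfunM; last exact: polyfun_cst.
    by apply: polyfunZ; exact: polyfunX.
  - move=> K; apply: (isum _ _ (fun (k : 'I_K.+1) x => (-1) ^+ k * Y x ^+ (2 * k) / (2 * k)`!%:R)) => k.
      by apply: polyfunM; [apply: polyfunZ; exact: polyfunX|exact: polyfun_cst].
    rewrite (_ : (fun w => _) = fun w => r w * (((-1) ^+ k / (2 * k)`!%:R) * Y (Z w) ^+ (2 * k))); last first.
      by apply/funext => w; rewrite mulrAC.
    by rewrite (intZ _ (polyfunX (2 * k) pY)) -/(mom _) mom_eq0 mulr0.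
have hsin : \int[Q]_w (r w * sin (Y (Z w))) = 0.
  apply: (@square_small sin sin_poly (fun K => (2 * K)%N)).
  - exact: continuous_measurable_fun (@continuous_sin R).
  - exact: sin_max.
  - by move=> K; rewrite mul2n -addnn leq_addr.
  - exact: taylor_sin.
  - move=> K; apply: polyfun_sum => k _; apply: polyfunM; last exact: polyfun_cst.
    by apply: polyfunZ; exact: polyfunX.
  - move=> K; apply: (isum _ _ (fun (k : 'I_K) x => (-1) ^+ k * Y x ^+ (2 * k).+1 / (2 * k).+1`!%:R)) => k.
      by apply: polyfunM; [apply: polyfunZ; exact: polyfunX|exact: polyfun_cst].
    rewrite (_ : (fun w => _) = fun w => r w * (((-1) ^+ k / (2 * k).+1`!%:R) * Y (Z w) ^+ (2 * k).+1)); last first.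
      by apply/funext => w; rewrite mulrAC.
    by rewrite (intZ _ (polyfunX (2 * k).+1 pY)) -/(mom _) mom_eq0 mulr0.
have mY : measurable_fun setT (fun w => Y (Z w)) := cgrowth_measurable GZ (polyfun_cgrowth pY).
have ic : Q.-integrable setT (EFin \o (fun w => r w * cos (Y (Z w)))).
  apply: sq_integrableM => //; apply: (@sq_integrable_bounded _ _ _ Q _ 1) => [|w]; last exact: cos_max.
  exact: (measurableT_comp (continuous_measurable_fun (@continuous_cos R)) mY).
have is_ : Q.-integrable setT (EFin \o (fun w => r w * sin (Y (Z w)))).
  apply: sq_integrableM => //; apply: (@sq_integrable_bounded _ _ _ Q _ 1) => [|w]; last exact: sin_max.
  exact: (measurableT_comp (continuous_measurable_fun (@continuous_sin R)) mY).
rewrite (_ : (fun w => _) = fun w => cos c * (r w * cos (Y (Z w))) - sin c * (r w * sin (Y (Z w)))); last first.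
  by apply/funext => w; rewrite cosD; ring.
rewrite RintegralB//; last 2 first.
- exact: (@integrableZl _ _ _ Q _ _ _ (EFin \o (fun w => r w * cos (Y (Z w))))).
- exact: (@integrableZl _ _ _ Q _ _ _ (EFin \o (fun w => r w * sin (Y (Z w))))).
by rewrite !RintegralZl// hcos hsin !mulr0 subr0.
Qed.

End Vanishing.
End TrigonometricOrthogonality.

(** * From cosines to arbitrary functions of polynomial growth *)

Section FourierUniqueness.
Context {R : realType}.
Local Notation gam := (@normal_prob R 0 1).
Local Notation mu := (@lebesgue_measure R).

(** The factor [expR (y ^+ 2 / 2)] undoes the Gaussian density: the left side is a Lebesgue
    convolution with a Gaussian of width s, and y -> x + s y turns it into the right side. *)
Lemma gauss_convolution (h : R -> R) (x s : R) : 0 < s -> continuous h -> (forall y, 0 <= h y) ->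
  (\int[gam]_y (h y * (expR (y ^+ 2 / 2) * expR (- ((s^-1 * (x - y)) ^+ 2 / 2))))%:E =
   \int[gam]_y (s * h (x + s * y))%:E)%E.
Proof.
move=> s0 ch h0.
pose G (y : R) := h y * (normal_peak 1 * expR (- ((s^-1 * (x - y)) ^+ 2 / 2))).
have cG : continuous G.
  move=> y; apply: cvgM; first exact: ch.
  apply: cvgM; first exact: cvg_cst.
  apply: (@continuous_comp _ _ _ (fun y => - ((s^-1 * (x - y)) ^+ 2 / 2)) expR); last exact: continuous_expR.
  apply: cvgN; apply: cvgM; last exact: cvg_cst.
  apply: (@continuous_comp _ _ _ (fun y => s^-1 * (x - y)) (fun t : R => t ^+ 2)); last exact: exprn_continuous.
  by apply: cvgM; [exact: cvg_cst|apply: cvgB; [exact: cvg_cst|exact: cvg_id]].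
have G0 y : 0 <= G y.
  by rewrite /G mulr_ge0// mulr_ge0 ?expR_ge0// ltW// normal_peak1_gt0.
have mh : measurable_fun setT h by exact: continuous_measurable_fun.
have me (f : R -> R) : continuous f -> measurable_fun setT f by exact: continuous_measurable_fun.
rewrite ge0_integral_normal_prob; last 2 first.
- apply/measurable_EFinP; apply: measurable_funM => //; apply: measurable_funM.
    by apply: measurableT_comp => //; apply: measurable_funM => //; exact: measurable_funX.
  apply: measurableT_comp => //; apply: measurableT_comp => //; apply: measurable_funM => //.
  by apply: measurable_funX; apply: measurable_funM => //; exact: measurable_funB.
- by move=> y; rewrite lee_fin mulr_ge0// mulr_ge0 ?expR_ge0.
rewrite ge0_integral_normal_prob; last 2 first.
- apply/measurable_EFinP; apply: measurable_funM => //; apply: (measurableT_comp mh).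
  by apply: measurable_funD => //; exact: measurable_funM.
- by move=> y; rewrite lee_fin mulr_ge0// ltW.
transitivity (\int[mu]_y (G y)%:E)%E.
  apply: eq_integral => y _; rewrite -EFinM; congr EFin; rewrite /G normal_pdf01E.
  have gen (a b c' p q : R) : a * b = 1 -> q * (a * c') * (p * b) = q * (p * c').
    by move=> ab; rewrite -[RHS]mulr1 -ab; ring.
  by apply: gen; rewrite -expRD subrr expR0.
rewrite (ge0_integral_affine x s0 cG G0); apply: eq_integral => y _; rewrite -EFinM; congr EFin.
rewrite /G normal_pdf01E (addrC (s * y)).
have -> : s^-1 * (x - (x + s * y)) = - y by rewrite opprD addrA subrr sub0r mulrN mulrA mulVf ?mul1r// gt_eqF.
by rewrite sqrrN; ring.
Qed.

Context d (T : measurableType d) (Q : probability T R) n (Z : T -> 'rV[R]_n).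
Hypothesis GZ : gaussian_vector Q Z.

Section Mollification.
Variables (psi : 'rV[R]_n -> R) (x : 'rV[R]_n) (s : R).
Hypotheses (cpsi : continuous psi) (psi0 : forall y, 0 <= psi y) (s0 : 0 < s).
Let wt (y : 'rV[R]_n) i := expR (y 0 i ^+ 2 / 2) * expR (- ((s^-1 * (x 0 i - y 0 i)) ^+ 2 / 2)).
(** [G k] interpolates between the two sides of [gaussian_mollification]: the first k coordinates
    are already substituted, the others still carry their weight. *)
Let mix k (y : 'rV[R]_n) : 'rV[R]_n := \row_i (if (i < k)%N then x 0 i + s * y 0 i else y 0 i).
Let G k (y : 'rV[R]_n) := s ^+ k * psi (mix k y) * \prod_(i < n | (k <= i)%N) wt y i.

Let wt0 y i : 0 <= wt y i. Proof. by rewrite /wt mulr_ge0 ?expR_ge0. Qed.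

Let G0 k y : (0 <= (G k y)%:E)%E.
Proof. by rewrite lee_fin mulr_ge0 ?mulr_ge0 ?exprn_ge0 ?(ltW s0)// prodr_ge0. Qed.

Let mG k : measurable_rV (fun y => (G k y)%:E).
Proof.
move=> d' T' Z' mZ'; apply/measurable_EFinP; apply: measurable_funM.
  apply: measurable_funM => //; apply: (continuous_measurable_rV cpsi) => i.
  rewrite (_ : (fun w => _) = if (i < k)%N then (fun w => x 0 i + s * Z' w 0 i) else (fun w => Z' w 0 i)).
    by case: ifP => // _; apply: measurable_funD => //; exact: measurable_funM.
  by apply/funext => w; rewrite mxE; case: ifP.
have H (l : seq 'I_n) : measurable_fun setT (fun w => \prod_(i <- l | (k <= i)%N) wt (Z' w) i).
  elim: l => [|i l IH].
    by rewrite (_ : (fun w => _) = fun=> 1)//; apply/funext => w; rewrite big_nil.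
  rewrite (_ : (fun w => _) = fun w => (if (k <= i)%N then wt (Z' w) i else 1) * \prod_(i <- l | (k <= i)%N) wt (Z' w) i).
    apply: measurable_funM => //; case: (k <= i)%N => //; apply: measurable_funM.
      by apply: measurableT_comp => //; apply: measurable_funM => //; exact: measurable_funX.
    apply: measurableT_comp => //; apply: measurableT_comp => //; apply: measurable_funM => //.
    by apply: measurable_funX; apply: measurable_funM => //; exact: measurable_funB.
  by apply/funext => w; rewrite big_cons; case: ifP => // _; rewrite mul1r.
exact: H.
Qed.

Let Gstep k : (k < n)%N -> (\int[Q]_w (G k (Z w))%:E = \int[Q]_w (G k.+1 (Z w))%:E)%E.
Proof.
move=> kn; pose i0 := Ordinal kn.
rewrite (ge0_resample GZ i0 (mG k) (G0 k)) (ge0_resample GZ i0 (mG k.+1) (G0 k.+1)).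
apply: eq_integral => w _; set z := Z w.
pose cst := s ^+ k * \prod_(i < n | (k < i)%N) wt z i.
have cst0 : 0 <= cst by rewrite mulr_ge0 ?exprn_ge0 ?(ltW s0)// prodr_ge0.
pose h t := cst * psi (upd i0 t (mix k z)).
have ch : continuous h.
  move=> t; apply: cvgM; first exact: cvg_cst.
  apply: (@continuous_comp _ _ _ (fun t => upd i0 t (mix k z)) psi); last exact: cpsi.
  by apply: continuous_upd => // u; [exact: cvg_id|exact: cvg_cst].
have := @gauss_convolution h (x 0 i0) s s0 ch (fun t => mulr_ge0 cst0 (psi0 _)).
have m1 t : mix k (upd i0 t z) = upd i0 t (mix k z).
  apply/rowP => j; rewrite !mxE; case: eqP => [->|//]; by rewrite ltnn.
have m2 t : mix k.+1 (upd i0 t z) = upd i0 (x 0 i0 + s * t) (mix k z).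
  apply/rowP => j; rewrite !mxE ltnS leq_eqVlt -[(j == k :> nat)]/(j == i0).
  by case: eqP => [->|//].
have pE t : \prod_(i < n | (k < i)%N) wt (upd i0 t z) i = \prod_(i < n | (k < i)%N) wt z i.
  apply: eq_bigr => i ki; rewrite /wt updE; case: eqP => // e; by move: ki; rewrite e /= ltnn.
have -> : (fun y : R => (h y * (expR (y ^+ 2 / 2) * expR (- ((s^-1 * (x 0 i0 - y)) ^+ 2 / 2))))%:E) =
    (fun y => (G k (upd i0 y z))%:E).
  apply/funext => t; congr EFin; rewrite /G m1 (bigD1 i0)//=.
  rewrite [in RHS](eq_bigl (fun i : 'I_n => (k < i)%N)); last first.
    by move=> i; rewrite [RHS]ltn_neqAle andbC eq_sym -val_eqE.
  rewrite pE /h /cst {2}/wt updE eqxx.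
  by move: (expR _ * expR _) (psi _) (s ^+ k) (\prod_(i < n | _) _) => a b c' p; ring.
have -> : (fun y : R => (s * h (x 0 i0 + s * y))%:E) = (fun y => (G k.+1 (upd i0 y z))%:E).
  apply/funext => t; congr EFin; rewrite /G m2 pE /h /cst exprS.
  by move: (psi _) (s ^+ k) (\prod_(i < n | _) _) => b c' p; ring.
done.
Qed.

Lemma gaussian_mollification :
  (\int[Q]_w (psi (Z w) * (expR (sqn (Z w) / 2) * expR (- ((s^-1) ^+ 2 * sqn (x - Z w) / 2))))%:E =
   \int[Q]_w (s ^+ n * psi (x + s *: Z w))%:E)%E.
Proof.
have H k : (k <= n)%N -> (\int[Q]_w (G 0 (Z w))%:E = \int[Q]_w (G k (Z w))%:E)%E.
  by elim: k => // k IH kn; rewrite IH ?(ltnW kn)// Gstep.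
have := H n (leqnn n).
have -> : (fun w => (G 0 (Z w))%:E) = fun w => (psi (Z w) * (expR (sqn (Z w) / 2) * expR (- ((s^-1) ^+ 2 * sqn (x - Z w) / 2))))%:E.
  apply/funext => w; congr EFin; rewrite /G expr0 mul1r.
  have -> : mix 0 (Z w) = Z w by apply/rowP => i; rewrite mxE.
  congr (_ * _); rewrite big_split/= -!expR_sum; congr (expR _ * expR _).
    by rewrite sqnE mulr_suml.
  by rewrite sumrN sqnE mulr_sumr mulr_suml; congr (- _); apply: eq_bigr => i _; rewrite exprMn !mxE.
have -> // : (fun w => (G n (Z w))%:E) = fun w => (s ^+ n * psi (x + s *: Z w))%:E.
apply/funext => w; congr EFin; rewrite /G big_pred0 ?mulr1; last by move=> i; rewrite leqNgt ltn_ord.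
by congr (_ * psi _); apply/rowP => i; rewrite !mxE ltn_ord.
Qed.

End Mollification.

Variable r : T -> R.
Hypothesis hr : sq_integrable Q r.
Hypothesis htrig : forall c v, \int[Q]_w (r w * cos (c + linear_form v (Z w))) = 0.

Let mr : measurable_fun setT r. Proof. by case: hr. Qed.
Let ir : Q.-integrable setT (EFin \o (fun w => `|r w|)).
Proof.
have i1 := sq_integrable_int hr.
apply: (le_integrableR _ _ i1) => [|w]; last by rewrite normr_id.
exact: measurableT_comp.
Qed.

Let mZ1 i : measurable_fun [set: T * T] (fun z => Z z.1 0 i).
Proof. exact: (measurableT_comp (proj1 GZ i) measurable_fst). Qed.
Let mZ2 i : measurable_fun [set: T * T] (fun z => Z z.2 0 i).
Proof. exact: (measurableT_comp (proj1 GZ i) measurable_snd). Qed.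

(** The kernel is the characteristic function of an independent Gaussian copy evaluated at s (Z -
    y), that is, an average of cosines of affine functions of Z. *)
Let gauss_orth (y : 'rV[R]_n) (s : R) : \int[Q]_w (r w * expR (- (s ^+ 2 * sqn (Z w - y) / 2))) = 0.
Proof.
pose F w1 w2 := r w1 * cos (0 + \sum_i (s * (Z w1 - y) 0 i) * Z w2 0 i).
have mF : measurable_fun [set: T * T] (fun z => F z.1 z.2).
  apply: measurable_funM; first exact: (measurableT_comp mr measurable_fst).
  apply: measurableT_comp; first exact: continuous_measurable_fun (@continuous_cos R).
  apply: measurable_funD => //; apply: measurable_sum => i; apply: measurable_funM => //.
  apply: measurable_funM => //.
  rewrite (_ : (fun z => _) = fun z : T * T => Z z.1 0 i - y 0 i); last by apply/funext => z; rewrite !mxE.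
  exact: measurable_funB.
have bF w1 w2 : `|F w1 w2| <= `|r w1| by rewrite normrM ler_piMr// cos_max.
have := @Rintegral_swap R _ _ Q _ _ Q F _ mF bF ir.
rewrite (_ : (fun w1 => \int[Q]_w2 F w1 w2) = fun w => r w * expR (- (s ^+ 2 * sqn (Z w - y) / 2))); last first.
  apply/funext => w1; rewrite /F RintegralZl//; last first.
    have i1 : Q.-integrable setT (EFin \o (fun=> 1 : R)) by exact: finite_measure_integrable_cst.
    apply: (le_integrableR _ _ i1) => [|w]; last by rewrite normr1 cos_max.
    apply: measurableT_comp; first exact: continuous_measurable_fun (@continuous_cos R).
    apply: measurable_funD => //; apply: measurable_sum => i; apply: measurable_funM => //; exact: (proj1 GZ).
  rewrite (gaussian_cos GZ 0 (fun i => s * (Z w1 - y) 0 i)) cos0 mul1r sqnE mulr_sumr.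
  by congr (_ * expR (- (_ / 2))); apply: eq_bigr => i _; rewrite exprMn.
move=> ->; rewrite (_ : (fun w2 => \int[Q]_w1 F w1 w2) = fun=> 0); first exact: (@Rintegral_cst_probability _ _ _ Q).
apply/funext => w2; rewrite /F -[RHS](htrig (- \sum_i s * y 0 i * Z w2 0 i) (fun i => s * Z w2 0 i)).
congr Rintegral; apply/funext => w1; congr (_ * cos _); rewrite add0r /linear_form -sumrN -big_split/=.
by apply: eq_bigr => i _; rewrite !mxE; ring.
Qed.

(** The hypothesis compensates the factor [expR (sqn y / 2)] of the mollification formula, so that
    Fubini applies with the integrable bound C |r|. *)
Let bounded_orth (psi : 'rV[R]_n -> R) (C : R) : continuous psi -> (forall y, 0 <= psi y) ->
  (forall y, psi y * expR (sqn y / 2) <= C) -> \int[Q]_w (r w * psi (Z w)) = 0.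
Proof.
move=> cpsi psi0 pC.
have e1 y : 1 <= expR (sqn y / 2) by rewrite -[leLHS]expR0 ler_expR divr_ge0// sqn_ge0.
have pC1 y : psi y <= C by apply: le_trans (pC y); rewrite ler_peMr.
have C0 : 0 <= C by apply: le_trans (pC1 0).
have mpsi := continuous_measurable_rV cpsi.
have ms1 (y : 'rV[R]_n) : continuous (fun x : 'rV[R]_n => sqn (x - y)).
  move=> x; rewrite (_ : (fun x => _) = fun x : 'rV[R]_n => \sum_i (x 0 i - y 0 i) ^+ 2); last first.
    by apply/funext => u; rewrite sqnE; apply: eq_bigr => i _; rewrite !mxE.
  have pf : polyfun (fun x : 'rV[R]_n => \sum_i (x 0 i - y 0 i) ^+ 2).
    apply: polyfun_sum => i _; apply: polyfunX; apply: polyfunB; [exact: polyfun_coord|exact: polyfun_cst].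
  by have [cf _] := polyfun_cgrowth pf; exact: cf.
have inn (s : R) : sq_integrable Q (fun w => \int[Q]_w1 psi (Z w + s *: Z w1)) /\
    forall w, `|\int[Q]_w1 psi (Z w + s *: Z w1)| <= C.
  have iC : Q.-integrable setT (EFin \o (fun=> C)) by exact: finite_measure_integrable_cst.
  have b w : `|\int[Q]_w1 psi (Z w + s *: Z w1)| <= C.
    have mp : measurable_fun setT (fun w1 => psi (Z w + s *: Z w1)).
      apply: mpsi => i; rewrite (_ : (fun z => _) = fun w1 => Z w 0 i + s * Z w1 0 i); last by apply/funext => z; rewrite !mxE.
      by apply: measurable_funD => //; apply: measurable_funM => //; exact: (proj1 GZ).
    rewrite ger0_norm; last exact: Rintegral_ge0.
    have -> : C = \int[Q]_w1 C by rewrite (@Rintegral_cst_probability _ _ _ Q).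
    apply: le_Rintegral => //.
    by apply: (le_integrableR mp _ iC) => w1; rewrite !ger0_norm.
  split=> //; apply: (@sq_integrable_bounded _ _ _ Q _ C) => //.
  have mF : measurable_fun [set: T * T] (fun z => psi (Z z.2 + s *: Z z.1)).
    apply: mpsi => i; rewrite (_ : (fun z => _) = fun z : T * T => Z z.2 0 i + s * Z z.1 0 i).
      by apply: measurable_funD => //; exact: measurable_funM.
    by apply/funext => z; rewrite !mxE.
  have bF w1 w2 : `|psi (Z w2 + s *: Z w1)| <= C by rewrite ger0_norm.
  have := @integrable_section2 R _ _ Q _ _ Q (fun w1 w => psi (Z w + s *: Z w1)) (fun=> C) mF bF iC.
  by move=> /measurable_int/measurable_EFinP.
(* For fixed Z w1 the kernel F is a multiple of a Gaussian kernel in Z w, hence orthogonal to r; for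
   fixed w, integrating over w1 gives s^n r times the mollification of psi. *)
have key (s : R) : 0 < s -> \int[Q]_w (r w * \int[Q]_w1 psi (Z w + s *: Z w1)) = 0.
  move=> s0; pose F w w1 := r w * (psi (Z w1) * (expR (sqn (Z w1) / 2) * expR (- ((s^-1) ^+ 2 * sqn (Z w - Z w1) / 2)))).
  have mF : measurable_fun [set: T * T] (fun z => F z.1 z.2).
    apply: measurable_funM; first exact: (measurableT_comp mr measurable_fst).
    apply: measurable_funM; first exact: mpsi.
    apply: measurable_funM; apply: measurableT_comp => //.
      apply: measurable_funM => //.
      rewrite (_ : (fun z => _) = fun z : T * T => \sum_i Z z.2 0 i ^+ 2); last by apply/funext => z; rewrite sqnE.
      by apply: measurable_sum => i; exact: measurable_funX.
    apply: measurableT_comp => //; apply: measurable_funM => //; apply: measurable_funM => //.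
    rewrite (_ : (fun z => _) = fun z : T * T => \sum_i (Z z.1 0 i - Z z.2 0 i) ^+ 2).
      by apply: measurable_sum => i; apply: measurable_funX; exact: measurable_funB.
    by apply/funext => z; rewrite sqnE; apply: eq_bigr => i _; rewrite !mxE.
  have el (u : R) : 0 <= u -> expR (- u) <= 1 by move=> u0; rewrite -[leRHS]expR0 ler_expR oppr_le0.
  have bF w w1 : `|F w w1| <= `|r w| * C.
    rewrite normrM ler_wpM2l// ger0_norm ?mulr_ge0 ?expR_ge0// mulrA (le_trans _ (pC (Z w1)))//.
    by rewrite ler_piMr ?mulr_ge0 ?expR_ge0// el// divr_ge0// mulr_ge0 ?sqr_ge0// sqn_ge0.
  have irC : Q.-integrable setT (EFin \o (fun w => `|r w| * C)).
    exact: (@integrableZr _ _ _ Q _ _ _ (EFin \o (fun w => `|r w|)) ir).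
  have := @Rintegral_swap R _ _ Q _ _ Q F _ mF bF irC.
  rewrite [RHS](_ : _ = 0); last first.
    rewrite (_ : (fun w2 => \int[Q]_w1 F w1 w2) = fun=> 0); first exact: (@Rintegral_cst_probability _ _ _ Q).
    apply/funext => w1; rewrite /F.
    rewrite (_ : (fun w => _) = fun w => (psi (Z w1) * expR (sqn (Z w1) / 2)) * (r w * expR (- ((s^-1) ^+ 2 * sqn (Z w - Z w1) / 2)))); last first.
      by apply/funext => w; ring.
    rewrite RintegralZl//; first by rewrite gauss_orth mulr0.
    apply: (le_integrableR _ _ ir) => [|w].
      apply: measurable_funM => //; apply: measurableT_comp => //; apply: measurableT_comp => //.
      apply: measurable_funM => //; apply: measurable_funM => //.
      exact: (continuous_measurable_rV (ms1 (Z w1)) (proj1 GZ)).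
    by rewrite normr_id normrM ler_piMr// ger0_norm ?expR_ge0// el// divr_ge0// mulr_ge0 ?sqr_ge0// sqn_ge0.
  have -> : (fun w1 => \int[Q]_w2 F w1 w2) = fun w => s ^+ n * (r w * \int[Q]_w1 psi (Z w + s *: Z w1)).
    apply/funext => w; rewrite /F.
    have mp : measurable_fun setT (fun w1 => psi (Z w + s *: Z w1)).
      apply: mpsi => i; rewrite (_ : (fun z => _) = fun w1 => Z w 0 i + s * Z w1 0 i); last by apply/funext => z; rewrite !mxE.
      by apply: measurable_funD => //; apply: measurable_funM => //; exact: (proj1 GZ).
    have iC : Q.-integrable setT (EFin \o (fun=> C)) by exact: finite_measure_integrable_cst.
    have ip : Q.-integrable setT (EFin \o (fun w1 => psi (Z w + s *: Z w1))).
      by apply: (le_integrableR mp _ iC) => w1; rewrite !ger0_norm.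
    have iq : Q.-integrable setT (EFin \o (fun w1 => psi (Z w1) * (expR (sqn (Z w1) / 2) * expR (- (s^-1 ^+ 2 * sqn (Z w - Z w1) / 2))))).
      apply: (le_integrableR _ _ iC) => [|w1].
        apply: measurable_funM; first exact: (mpsi _ _ _ (proj1 GZ)).
        have m2 (c : R) (y : 'rV[R]_n) : measurable_fun setT (fun w1 => expR (c * sqn (Z w1 - y))).
          by apply: measurableT_comp => //; apply: measurable_funM => //; exact: (continuous_measurable_rV (ms1 y) (proj1 GZ)).
        apply: measurable_funM.
          have := m2 2^-1 0; congr measurable_fun; apply/funext => w1; by rewrite subr0 mulrC.
        have := m2 (- (s^-1 ^+ 2 / 2)) (Z w); congr measurable_fun; apply/funext => w1.
        by rewrite (_ : sqn (Z w1 - Z w) = sqn (Z w - Z w1)) ?mulNr 1?mulrAC// !sqnE; apply: eq_bigr => i _; rewrite !mxE -sqrrN opprB.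
      rewrite ger0_norm ?mulr_ge0 ?expR_ge0// (ger0_norm C0) mulrA (le_trans _ (pC (Z w1)))//.
      by rewrite ler_piMr ?mulr_ge0 ?expR_ge0// el// divr_ge0// mulr_ge0 ?sqr_ge0// sqn_ge0.
    rewrite RintegralZl// mulrCA; congr (_ * _); rewrite -RintegralZl//.
    by apply: (f_equal fine); exact: gaussian_mollification.
  rewrite RintegralZl//; last exact: (sq_integrableM hr (proj1 (inn s))).
  by move=> /eqP; rewrite mulf_eq0 expf_eq0 (gt_eqF s0) andbF/= => /eqP.
have iC : Q.-integrable setT (EFin \o (fun=> C)) by exact: finite_measure_integrable_cst.
(* Letting the width s = 1/(k + 1) tend to 0 recovers psi pointwise. *)
have cinn w : \int[Q]_w1 psi (Z w + harmonic k *: Z w1) @[k --> \oo] --> psi (Z w).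
  rewrite -[psi (Z w)](@Rintegral_cst_probability _ _ _ Q).
  apply: (cvg_Rintegral (g := fun=> C)) => //.
  - move=> k; apply: mpsi => i; rewrite (_ : (fun z => _) = fun w1 => Z w 0 i + harmonic k * Z w1 0 i).
      by apply: measurable_funD => //; apply: measurable_funM => //; exact: (proj1 GZ).
    by apply/funext => z; rewrite !mxE.
  - move=> w1; have ct : continuous (fun t : R => psi (Z w + t *: Z w1)).
      move=> t; apply: (@continuous_comp _ _ _ (fun t : R => Z w + t *: Z w1) psi); last exact: cpsi.
      apply: cvgD; first exact: cvg_cst.
      by apply: cvgZr_tmp; exact: cvg_id.
    have := ct 0; rewrite /continuous_at scale0r addr0.
    exact: (@cvg_comp _ _ _ (@harmonic R) (fun t => psi (Z w + t *: Z w1)) _ _ _ cvg_harmonic).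
  - by move=> k w1; rewrite ger0_norm.
have lim : \int[Q]_w (r w * \int[Q]_w1 psi (Z w + harmonic k *: Z w1)) @[k --> \oo] --> \int[Q]_w (r w * psi (Z w)).
  apply: (cvg_Rintegral (g := fun w => `|r w| * C)).
  - by move=> k; apply: measurable_funM => //; exact: (proj1 (proj1 (inn _))).
  - by apply: measurable_funM => //; exact: (mpsi _ _ _ (proj1 GZ)).
  - by move=> w; apply: cvgM; [exact: cvg_cst|exact: cinn].
  - by move=> k w; rewrite normrM ler_wpM2l// (proj2 (inn _)).
  - exact: (@integrableZr _ _ _ Q _ _ _ (EFin \o (fun w => `|r w|)) ir).
move: lim; rewrite (_ : (fun k => _) = fun=> 0); last first.
  by apply/funext => k; apply: key; rewrite invr_gt0 ltr0n.
by move=> /(cvg_unique (@norm_hausdorff _ R^o) (cvg_cst 0)).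
Qed.

Let pos_orth (p : 'rV[R]_n -> R) : cgrowth p -> (forall x, 0 <= p x) -> \int[Q]_w (r w * p (Z w)) = 0.
Proof.
move=> [cp [C [N pC]]] p0.
have C0 : 0 <= C by have := pC 0; rewrite normr0 addr0 expr1n mulr1; exact: le_trans.
(* The clamp of m - |x| to [0, 1]: a continuous cutoff equal to 1 for |x| <= m - 1 and to 0 for |x|
   >= m. *)
pose chi m (x : 'rV[R]_n) : R := (`|m%:R - `|x| | - `|m%:R - `|x| - 1| + 1) / 2.
have chi01 m x : 0 <= chi m x <= 1.
  have gen (u : R) : 0 <= (`|u| - `|u - 1| + 1) / 2 <= 1.
    by case: (ger0P u) => ?; case: (ger0P (u - 1)) => ?; apply/andP; split; lra.
  exact: gen.
have chi0 m x : m%:R <= `|x| -> chi m x = 0.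
  move=> mx; rewrite /chi (ler0_norm (_ : m%:R - `|x| <= 0)) ?subr_le0//.
  rewrite ler0_norm; last by lra.
  by rewrite opprB; lra.
have chi1 m x : 1 + `|x| <= m%:R -> chi m x = 1.
  move=> mx; rewrite /chi !ger0_norm; [lra| |]; lra.
have cchi m : continuous (chi m).
  have cu : continuous (fun x : 'rV[R]_n => m%:R - `|x| : R).
    move=> y; apply: (@continuous_comp _ _ _ (fun x : 'rV[R]_n => `|x| : R) (fun t : R => m%:R - t)).
      exact: (@norm_continuous R 'rV[R]_n).
    by apply: cvgB; [exact: cvg_cst|exact: cvg_id].
  have cn : continuous (fun t : R => `|t|) by exact: norm_continuous.
  have cn1 : continuous (fun t : R => `|t - 1|).
    move=> t; apply: (@continuous_comp _ _ _ (fun t : R => t - 1) (fun t : R => `|t|)); last exact: cn.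
    by apply: cvgB; [exact: cvg_id|exact: cvg_cst].
  have ck : continuous (fun t : R => (`|t| - `|t - 1| + 1) / 2).
    move=> t; apply: cvgM; last exact: cvg_cst.
    by apply: cvgD; [apply: cvgB; [exact: cn|exact: cn1]|exact: cvg_cst].
  by move=> x; apply: (@continuous_comp _ _ _ (fun x : 'rV[R]_n => m%:R - `|x| : R) (fun t : R => (`|t| - `|t - 1| + 1) / 2)); [exact: cu|exact: ck].
have orth m : \int[Q]_w (r w * (p (Z w) * chi m (Z w))) = 0.
  apply: (@bounded_orth (fun x => p x * chi m x) (C * (1 + m%:R) ^+ N * expR (n%:R * m%:R ^+ 2 / 2))).
  - by move=> x; exact: (cvgM (cp x) (@cchi m x)).
  - by move=> x; rewrite mulr_ge0//; case/andP: (chi01 m x).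
  move=> x; have [/chi0 ->|xm] := leP m%:R `|x|.
    by rewrite mulr0 mul0r mulr_ge0 ?expR_ge0// mulr_ge0// exprn_ge0// addr_ge0.
  have /andP[c0 c1] := chi01 m x.
  have b1 : p x * chi m x <= C * (1 + m%:R) ^+ N.
    apply: (@le_trans _ _ (p x)); first by rewrite ler_piMr.
    apply: (le_trans (ler_norm _)); apply: (le_trans (pC x)); rewrite ler_wpM2l// lerXn2r ?nnegrE ?addr_ge0//.
    by rewrite lerD2l ltW.
  apply: ler_pM => //; first by rewrite mulr_ge0.
  rewrite ler_expR ler_pM2r// sqnE.
  rewrite -[n in leRHS]card_ord mulr_natl -sumr_const; apply: ler_sum => i _.
  rewrite -[leLHS]real_normK ?num_real// lerXn2r ?nnegrE//.
  by rewrite (le_trans (rV_coord_le x i))// ltW.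
have irp : Q.-integrable setT (EFin \o (fun w => `|r w * p (Z w)|)).
  have hp : sq_integrable Q (fun w => p (Z w)).
    have := cgrowth_integrable GZ (cgrowthX 2 (conj cp (ex_intro _ C (ex_intro _ N pC)) : cgrowth p)).
    by split=> //; exact: (continuous_measurable_rV cp (proj1 GZ)).
  have i1 := sq_integrableM hr hp.
  apply: (le_integrableR _ _ i1) => [|w]; last by rewrite normr_id.
  by apply: measurableT_comp => //; apply: measurable_funM => //; exact: (continuous_measurable_rV cp (proj1 GZ)).
have lim : \int[Q]_w (r w * (p (Z w) * chi m (Z w))) @[m --> \oo] --> \int[Q]_w (r w * p (Z w)).
  apply: (cvg_Rintegral (g := fun w => `|r w * p (Z w)|)) => //.
  - move=> m; apply: measurable_funM => //; apply: measurable_funM.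
      exact: (continuous_measurable_rV cp (proj1 GZ)).
    exact: (continuous_measurable_rV (@cchi m) (proj1 GZ)).
  - by apply: measurable_funM => //; exact: (continuous_measurable_rV cp (proj1 GZ)).
  - move=> w; apply: cvgM; first exact: cvg_cst.
    rewrite -[X in _ --> X]mulr1; apply: cvgM; first exact: cvg_cst.
    apply: cvg_near_cst; exists (Num.trunc (1 + `|Z w|)).+1 => // m /= hm; apply: chi1.
    by rewrite (le_trans (ltW (truncnS_gt _)))// ler_nat.
  - move=> m w; rewrite mulrA [leLHS]normrM ler_piMr//; have /andP[? ?] := chi01 m (Z w).
    by rewrite ger0_norm.
move: lim; rewrite (_ : (fun m => _) = fun=> 0); last by apply/funext => m; exact: orth.
by move=> /(cvg_unique (@norm_hausdorff _ R^o) (cvg_cst 0)).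
Qed.

(* Gaussian kernels are averages of cosines, hence orthogonal to r, and psi is a
   limit of Gaussian mollifications of truncations of psi. *)
Lemma fourier_uniqueness psi : cgrowth psi -> \int[Q]_w (r w * psi (Z w)) = 0.
Proof.
move=> cpsi.
have ca : cgrowth (fun x => `|psi x|).
  have [c [C [N h]]] := cpsi; split; last by exists C, N => x; rewrite normr_id.
  by move=> x; apply: (@continuous_comp _ _ _ psi (fun t : R => `|t|)); [exact: c|exact: norm_continuous].
have c1 : cgrowth (fun x => `|psi x| + psi x) by exact: cgrowthD.
have c2 : cgrowth (fun x => `|psi x| - psi x) by exact: cgrowthB.
have h1 : \int[Q]_w (r w * (`|psi (Z w)| + psi (Z w))) = 0.
  by apply: (@pos_orth (fun x => `|psi x| + psi x)) => // x; have := ler_norm (- psi x); rewrite normrN; lra.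
have h2 : \int[Q]_w (r w * (`|psi (Z w)| - psi (Z w))) = 0.
  by apply: (@pos_orth (fun x => `|psi x| - psi x)) => // x; rewrite subr_ge0 ler_norm.
have isq (f : 'rV[R]_n -> R) : cgrowth f -> Q.-integrable setT (EFin \o (fun w => r w * f (Z w))).
  move=> cf; apply: (sq_integrableM hr); split; first exact: (cgrowth_measurable GZ cf).
  exact: (cgrowth_integrable GZ (cgrowthX 2 cf)).
have : \int[Q]_w (2 * (r w * psi (Z w))) = 0.
  rewrite -[RHS](subrr 0) -{1}h1 -{1}h2 -RintegralB//; [|exact: (isq _ c1)|exact: (isq _ c2)].
  by congr Rintegral; apply/funext => w; ring.
rewrite RintegralZl//; last exact: isq.
by move=> /eqP; rewrite mulf_eq0 pnatr_eq0/= => /eqP.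
Qed.

End FourierUniqueness.

(** * Approximation of a third chaos element by cubic forms *)

Section RieszFischer.
Context {R : realType} {d : measure_display} {T : measurableType d}.
Variable P : probability T R.

Lemma Rintegral_sum_integrable (I : Type) (s : seq I) (G : I -> T -> R) :
  (forall i, P.-integrable setT (EFin \o G i)) ->
  P.-integrable setT (EFin \o (fun w => \sum_(i <- s) G i w)) /\
  \int[P]_w (\sum_(i <- s) G i w) = \sum_(i <- s) \int[P]_w G i w.
Proof.
move=> iG; elim: s => [|i s [IH1 IH2]].
  rewrite (_ : (fun w => _) = fun=> 0); last by apply/funext => w; rewrite big_nil.
  split; first exact: finite_measure_integrable_cst.
  by rewrite big_nil (@Rintegral_cst_probability _ _ _ P).
rewrite (_ : (fun w => _) = fun w => G i w + \sum_(i <- s) G i w); last by apply/funext => w; rewrite big_cons.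
split; first exact: (@integrableD _ _ _ P _ _ (EFin \o G i) (EFin \o (fun w => \sum_(i <- s) G i w))).
by rewrite RintegralD// IH2 big_cons.
Qed.

(** Fatou for (u - v_j)^2. Integrability of the limit is part of the conclusion, since only
    measurability of G is assumed. *)
Lemma fatou_sq (v : nat -> T -> R) (u G : T -> R) (e : R) :
  measurable_fun setT G -> (forall j, sq_integrable P (fun w => u w - v j w)) -> measurable_fun setT u ->
  (forall j, \int[P]_w ((u w - v j w) ^+ 2) <= e) ->
  {ae P, forall w, v j w @[j --> \oo] --> G w} ->
  sq_integrable P (fun w => u w - G w) /\ \int[P]_w ((u w - G w) ^+ 2) <= e.
Proof.
move=> mG huv mu uve vG.
have mf j : measurable_fun setT (fun w => ((u w - v j w) ^+ 2)%:E).
  by apply/measurable_EFinP; apply: measurable_funX; case: (huv j).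
have f0 j w : (0 <= ((u w - v j w) ^+ 2)%:E)%E by rewrite lee_fin sqr_ge0.
have mg : measurable_fun setT (fun w => ((u w - G w) ^+ 2)%:E).
  by apply/measurable_EFinP; apply: measurable_funX; exact: measurable_funB.
have le_e : (\int[P]_w ((u w - G w) ^+ 2)%:E <= e%:E)%E.
  apply: (@le_trans _ _ (\int[P]_w limn_einf (fun j => ((u w - v j w) ^+ 2)%:E))%E).
    apply: ae_ge0_le_integral => //.
    - by move=> w _; rewrite lee_fin sqr_ge0.
    - move=> w _; rewrite limn_einf_lim; apply: lime_ge; first exact: is_cvg_einfs.
      by apply: nearW => k; apply: le_ereal_inf_tmp => _ [j _ <-].
    - rewrite (_ : (fun w => _) = fun w => (- limn_esup (fun j => - ((u w - v j w) ^+ 2)%:E))%E).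
        apply: measurableT_comp => //; apply: measurable_fun_limn_esup => j.
        exact: measurableT_comp.
      by apply/funext => w; rewrite -[in RHS]limn_einfN; congr limn_einf; apply/funext => j; exact: esym (oppeK _).
    apply: filterS vG => w vw _.
    have c : ((u w - v j w) ^+ 2)%:E @[j --> \oo] --> ((u w - G w) ^+ 2)%:E.
      apply: cvg_EFin; first by apply: nearW.
      have cb : u w - v j w @[j --> \oo] --> u w - G w by apply: cvgB => //; exact: cvg_cst.
      exact: (cvgM cb cb).
    have -> : limn_einf (fun j => ((u w - v j w) ^+ 2)%:E) = limn (fun j => ((u w - v j w) ^+ 2)%:E).
      by apply: is_cvg_limn_einfE; apply/cvg_ex; exists ((u w - G w) ^+ 2)%:E.
    by rewrite (cvg_lim _ c).
  apply: (le_trans (fatou P measurableT mf (fun j w _ => f0 j w))).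
  rewrite limn_einf_lim; apply: lime_le; first exact: is_cvg_einfs.
  apply: nearW => k; apply: (@le_trans _ _ (\int[P]_w ((u w - v k w) ^+ 2)%:E)%E).
    by apply: ereal_inf_lbound; exists k => /=.
  by rewrite -(EFin_Rintegral (proj2 (huv k))) lee_fin.
have ig : P.-integrable setT (EFin \o (fun w => (u w - G w) ^+ 2)).
  apply/integrableP; split=> //; rewrite (eq_integral (fun w => ((u w - G w) ^+ 2)%:E)).
    exact: le_lt_trans le_e (ltry _).
  by move=> w _ /=; rewrite ger0_norm ?sqr_ge0.
split; first by split=> //; exact: measurable_funB.
by rewrite -lee_fin (EFin_Rintegral ig).
Qed.

(* Almost everywhere convergence along a subsequence with summable increments,
   then Fatou. *)
Lemma riesz_fischer (u : nat -> T -> R) : (forall k, sq_integrable P (u k)) ->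
  (forall e, 0 < e -> exists N, forall k l, (N <= k)%N -> (N <= l)%N -> \int[P]_w ((u k w - u l w) ^+ 2) <= e) ->
  exists2 G, sq_integrable P G & \int[P]_w ((u k w - G w) ^+ 2) @[k --> \oo] --> (0 : R).
Proof.
move=> hu cau.
have p2 (j : nat) : 0 < 2^-1 ^+ j :> R by exact: exprn_gt0.
have /choice[nn hn] : forall j, exists N, forall k l, (N <= k)%N -> (N <= l)%N ->
    \int[P]_w ((u k w - u l w) ^+ 2) <= (2^-1 ^+ j) ^+ 2.
  by move=> j; apply: cau; exact: exprn_gt0.
(* The sum makes m nondecreasing and at least nn j; the summand j sends it to infinity. *)
pose m j := (j + \sum_(i < j.+1) nn i)%N.
have mj j : (j <= m j)%N by exact: leq_addr.
have nm j : (nn j <= m j)%N by rewrite /m big_ord_recr/= addnA leq_addl.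
have mS j : (m j <= m j.+1)%N by rewrite /m (big_ord_recr j.+1)/= addSn leqW// addnA leq_addr.
pose v j := u (m j).
pose dv j w := v j.+1 w - v j w.
have hdv j : sq_integrable P (dv j) by exact: (sq_integrableB (hu (m j.+1)) (hu (m j))).
have idv j : P.-integrable setT (EFin \o (fun w => `|dv j w|)).
  apply: (le_integrableR _ _ (sq_integrable_int (hdv j))) => [|w]; last by rewrite normr_id.
  by apply: measurableT_comp => //; case: (hdv j).
have ndv j : \int[P]_w `|dv j w| <= 2^-1 ^+ j.
  have habs : sq_integrable P (fun w => `|dv j w|).
    split; first by apply: measurableT_comp => //; case: (hdv j).
    case: (hdv j) => _; apply: eq_integrable => // w _ /=; by rewrite real_normK ?num_real.
  have := cauchy_schwarz habs (sq_integrable_cst P 1).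
  have -> : (fun w => `|dv j w| * 1) = (fun w => `|dv j w|) by apply/funext => w; rewrite mulr1.
  rewrite (_ : \int[P]_w (1 ^+ 2) = 1); last by rewrite (@Rintegral_cst_probability _ _ _ P) expr1n.
  have -> : (fun w => `|dv j w| ^+ 2) = (fun w => (u (m j.+1) w - u (m j) w) ^+ 2).
    by apply/funext => w; rewrite real_normK ?num_real.
  rewrite mulr1 => h; rewrite -(@ler_pXn2r _ 2)// ?nnegrE ?(ltW (p2 j))//; last by apply: Rintegral_ge0.
  apply: (le_trans h); apply: hn; last exact: nm.
  exact: leq_trans (nm j) (mS j).
pose A w := (\sum_(j <oo) (`|dv j w|)%:E)%E.
have mabs j : measurable_fun setT (fun w => (`|dv j w|)%:E).
  by case/integrableP: (idv j).
have A0 w : (0 <= A w)%E by apply: nneseries_ge0 => j _ _; rewrite lee_fin.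
have mA : measurable_fun setT A by apply: ge0_emeasurable_sum => //.
have geo n : \sum_(j < n) 2^-1 ^+ j <= 2 :> R.
  have -> : \sum_(j < n) 2^-1 ^+ j = 2 - 2 * 2^-1 ^+ n :> R.
    by elim: n => [|k IH]; rewrite ?big_ord0 ?big_ord_recr/= ?IH ?exprS ?expr0; field.
  by rewrite gerBl mulr_ge0// ltW.
have iA : P.-integrable setT A.
  apply/integrableP; split=> //; rewrite (eq_integral A); last by move=> w _; rewrite gee0_abs.
  rewrite integral_nneseries//; apply: (@le_lt_trans _ _ 2%:E); last exact: ltry.
  apply: lime_le; first by apply: is_cvg_nneseries => j _ _; exact: integral_ge0.
  apply: nearW => n; apply: (@le_trans _ _ (\sum_(0 <= j < n) (2^-1 ^+ j : R)%:E)%E).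
    by apply: lee_sum => j _; rewrite -(EFin_Rintegral (idv j)) lee_fin.
  by rewrite big_mkord sumEFin lee_fin.
have cv : {ae P, forall w, cvgn (fun j => v j w)}.
  apply: filterS (integrable_ae measurableT iA) => w /(_ Logic.I) Aw.
  have cs : cvgn (series (telescope (fun j => v j w))).
    apply: normed_cvg; apply: nondecreasing_is_cvgn.
      exact: (@nondecreasing_series R (fun j => `|telescope (fun j => v j w) j|) xpredT 0 (fun i _ _ => normr_ge0 _)).
    exists (fine (A w)) => _ [n _ <-]; rewrite -lee_fin fineK// /series/= -sumEFin.
    by apply: (nneseries_lim_ge n (P := xpredT) (u_ := fun j => (`|dv j w|)%:E)) => i _.
  rewrite (_ : (fun j => v j w) = fun j => v 0 w + series (telescope (fun j => v j w)) j); last first.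
    by apply/funext => j; rewrite -eq_sum_telescope.
  by apply: is_cvgD => //; exact: is_cvg_cst.
(* The upper limit gives a measurable function defined everywhere; it is the limit wherever the
   subsequence converges. *)
pose G w := fine (limn_esup (fun j => (v j w)%:E)).
have mv j : measurable_fun setT (v j) by case: (hu (m j)).
have mG : measurable_fun setT G.
  apply: (measurableT_comp (f := fine)) => //.
  by apply: measurable_fun_limn_esup => j; exact/measurable_EFinP.
have cG : {ae P, forall w, v j w @[j --> \oo] --> G w}.
  apply: filterS cv => w /cvg_ex[l vl].
  have vlE : (v j w)%:E @[j --> \oo] --> l%:E by apply: cvg_EFin => //; exact: nearW.
  suff -> : G w = l by [].
  by rewrite /G is_cvg_limn_esupE ?(cvg_lim _ vlE)//; apply/cvg_ex; exists l%:E.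
have key e : 0 < e -> exists N, forall k, (N <= k)%N ->
    sq_integrable P (fun w => u k w - G w) /\ \int[P]_w ((u k w - G w) ^+ 2) <= e.
  move=> /cau[N hN]; exists N => k Nk.
  apply: (@fatou_sq (fun j => v (j + N)%N)) => //.
  - by move=> j; exact: (sq_integrableB (hu k) (hu (m (j + N)%N))).
  - by case: (hu k).
  - by move=> j; apply: hN => //; apply: leq_trans (mj _); exact: leq_addl.
  by apply: filterS cG => w cw; exact: cvg_comp (cvg_addnr N) cw.
exists G.
  have [N hN] := key 1 ltr01; have [hk _] := hN N (leqnn N).
  have := sq_integrableB (hu N) hk; congr sq_integrable.
  by apply/funext => w; rewrite opprB addrC subrK.
apply/cvgrPdist_le => e e0; have [N hN] := key e e0; exists N => // k /= Nk.
rewrite sub0r normrN ger0_norm; first by have [] := hN k Nk.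
by apply: Rintegral_ge0 => w _; exact: sqr_ge0.
Qed.

Lemma cvg_pairing (u : nat -> T -> R) g : (forall k, sq_integrable P (u k)) -> sq_integrable P g ->
  \int[P]_w (u k w ^+ 2) @[k --> \oo] --> (0 : R) -> \int[P]_w (u k w * g w) @[k --> \oo] --> (0 : R).
Proof.
move=> hu hg cu; set c := \int[P]_w (g w ^+ 2).
have c2 : c * \int[P]_w (u k w ^+ 2) @[k --> \oo] --> (0 : R).
  by rewrite -[X in _ --> X](mulr0 c); apply: cvgM => //; exact: cvg_cst.
apply/cvgrPdist_le => e e0.
have e20 : 0 < e ^+ 2 by exact: exprn_gt0.
move/cvgrPdist_le : c2 => /(_ _ e20); apply: filterS => k.
rewrite !sub0r !normrN => h.
rewrite -(@ler_pXn2r _ 2)// ?nnegrE ?(ltW e0)// real_normK ?num_real//.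
apply: (le_trans (cauchy_schwarz (hu k) hg)); rewrite mulrC -/c.
exact: le_trans (ler_norm _) h.
Qed.

End RieszFischer.

Lemma sq_integrable_cgrowth {R : realType} d (T : measurableType d) (Q : probability T R) n
    (Z : T -> 'rV[R]_n) (GZ : gaussian_vector Q Z) f :
  cgrowth f -> sq_integrable Q (fun w => f (Z w)).
Proof.
move=> cf; split; first exact: (cgrowth_measurable GZ cf).
exact: (cgrowth_integrable GZ (cgrowthX 2 cf)).
Qed.

Section Approximation.
Context {R : realType} {d : measure_display} {T : measurableType d}.
Variable P : probability T R.

Lemma sqn_ge0_Rintegral (u : T -> R) : 0 <= \int[P]_w (u w ^+ 2).
Proof. by apply: Rintegral_ge0 => w _; exact: sqr_ge0. Qed.

Lemma approx_pairing (u : nat -> T -> R) U g : (forall k, sq_integrable P (u k)) ->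
  sq_integrable P U -> sq_integrable P g -> \int[P]_w ((u k w - U w) ^+ 2) @[k --> \oo] --> (0 : R) ->
  \int[P]_w (u k w * g w) @[k --> \oo] --> \int[P]_w (U w * g w).
Proof.
move=> hu hU hg cu.
have h := cvg_pairing (fun k => sq_integrableB (hu k) hU) hg cu.
have -> : (fun k => \int[P]_w (u k w * g w)) =
    (fun k => \int[P]_w ((u k w - U w) * g w) + \int[P]_w (U w * g w)).
  apply/funext => k; rewrite -RintegralD//; [|exact: (sq_integrableM (sq_integrableB (hu k) hU) hg)|exact: (sq_integrableM hU hg)].
  by congr Rintegral; apply/funext => w; rewrite mulrBl subrK.
by rewrite -[X in _ --> X]add0r; apply: cvgD => //; exact: cvg_cst.
Qed.

Lemma projection_le (U V f : T -> R) : sq_integrable P U -> sq_integrable P V -> sq_integrable P f ->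
  \int[P]_w ((U w - V w) * (V w - f w)) = 0 ->
  \int[P]_w ((U w - V w) ^+ 2) <= \int[P]_w ((U w - f w) ^+ 2).
Proof.
move=> hU hV hf h; have hUV := sq_integrableB hU hV; have hVf := sq_integrableB hV hf.
have i1 := proj2 hUV; have i2 := proj2 hVf; have i3 := sq_integrableM hUV hVf.
have i4 : P.-integrable setT (EFin \o (fun w => 2 * ((U w - V w) * (V w - f w)))).
  exact: (@integrableZl _ _ _ P _ _ _ (EFin \o (fun w => (U w - V w) * (V w - f w)))).
have i5 : P.-integrable setT (EFin \o (fun w => (U w - V w) ^+ 2 + 2 * ((U w - V w) * (V w - f w)))).
  exact: (@integrableD _ _ _ P _ _ (EFin \o (fun w => (U w - V w) ^+ 2)) (EFin \o (fun w => 2 * ((U w - V w) * (V w - f w))))).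
have -> : (fun w => (U w - f w) ^+ 2) =
    (fun w => (U w - V w) ^+ 2 + 2 * ((U w - V w) * (V w - f w)) + (V w - f w) ^+ 2).
  by apply/funext => w; ring.
by rewrite RintegralD// RintegralD// RintegralZl// h mulr0 addr0 lerDl sqn_ge0_Rintegral.
Qed.

End Approximation.

(** * Third Hermite tensor and polarization *)

Section HermiteTensor.
Context {R : realType}.

(** The Wick product of x_i, x_j, x_k: the monomial minus its contractions. *)
Definition hermite3 (x : nat -> R) (i j k : nat) : R :=
  x i * x j * x k - (i == j)%:R * x k - (i == k)%:R * x j - (j == k)%:R * x i.

Lemma cubic_form_hermite n (b : 'I_n -> 'I_n -> 'I_n -> R) (x : 'rV[R]_n) (y : nat -> R) :
  (forall i j k, b i j k = b j i k) -> (forall i j k, b i j k = b i k j) ->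
  (forall i : 'I_n, y i = x 0 i) ->
  6 * cubic_form b x = \sum_i \sum_j \sum_k b i j k * hermite3 y i j k.
Proof.
move=> b12 b23 yx; rewrite /cubic_form mulrBr mulrA mulfV ?mul1r ?pnatr_eq0//.
set S3 := \sum_i x 0 i * (\sum_j _); set S := \sum_i x 0 i * (\sum_j b i j j).
have dl (F : 'I_n -> R) (j : 'I_n) : \sum_(k < n) (j == k :> nat)%:R * F k = F j.
  rewrite (bigD1 j)//= eqxx mul1r big1 ?addr0// => k kj.
  by rewrite -[(j == k :> nat)]/(j == k) eq_sym (negbTE kj) mul0r.
have e1 : \sum_i \sum_j \sum_k b i j k * (x 0 i * x 0 j * x 0 k) = S3.
  apply: eq_bigr => i _; rewrite mulr_sumr; apply: eq_bigr => j _.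
  rewrite /lin_form !mulr_sumr; apply: eq_bigr => k _; ring.
have e4 : \sum_i \sum_j \sum_k b i j k * ((j == k :> nat)%:R * x 0 i) = S.
  apply: eq_bigr => i _; rewrite mulr_sumr; apply: eq_bigr => j _.
  rewrite -(dl (fun k => x 0 i * b i j k) j); apply: eq_bigr => k _; ring.
have e3 : \sum_i \sum_j \sum_k b i j k * ((i == k :> nat)%:R * x 0 j) = S.
  rewrite exchange_big/= -e4; apply: eq_bigr => j _; apply: eq_bigr => i _; apply: eq_bigr => k _.
  by rewrite b12.
have e2 : \sum_i \sum_j \sum_k b i j k * ((i == j :> nat)%:R * x 0 k) = S.
  rewrite -e3; apply: eq_bigr => i _; rewrite exchange_big/=; apply: eq_bigr => k _; apply: eq_bigr => j _.
  by rewrite b23.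
have -> : 6 * (2^-1 * S) = S + S + S by field.
rewrite -{1}e2 -{1}e3 -e4 -e1 !opprD -!sumrN -!big_split/=; apply: eq_bigr => i _.
rewrite -!sumrN -!big_split/=; apply: eq_bigr => j _; rewrite -!sumrN -!big_split/=; apply: eq_bigr => k _.
rewrite /hermite3 !yx; move: (_%:R) (_%:R) (_%:R) (b i j k) (x 0 i) (x 0 j) (x 0 k) => u1 u2 u3 c p q t; ring.
Qed.

Lemma cubic_formD n (a b : 'I_n -> 'I_n -> 'I_n -> R) (x : 'rV[R]_n) :
  (forall i j k, a i j k = a j i k) -> (forall i j k, a i j k = a i k j) ->
  (forall i j k, b i j k = b j i k) -> (forall i j k, b i j k = b i k j) ->
  cubic_form (fun i j k => a i j k + b i j k) x = cubic_form a x + cubic_form b x.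
Proof.
move=> a12 a23 b12 b23.
pose y k : R := if insub k is Some i then x 0 i else 0.
have yx (i : 'I_n) : y i = x 0 i by rewrite /y valK.
have n6 : (6 : R) != 0 by rewrite pnatr_eq0.
have h1 := cubic_form_hermite a12 a23 yx; have h2 := cubic_form_hermite b12 b23 yx.
have h3 := @cubic_form_hermite n (fun i j k => a i j k + b i j k) x y _ _ yx.
apply: (mulfI n6); rewrite [RHS]mulrDr h1 h2 h3.
- rewrite -big_split/=; apply: eq_bigr => i _; rewrite -big_split/=; apply: eq_bigr => j _; rewrite -big_split/=.
  by apply: eq_bigr => k _; rewrite mulrDl.
- by move=> i j k; rewrite a12 b12.
- by move=> i j k; rewrite a23 b23.
Qed.

(** Polarization of [ex_cubic_form2]. *)
Lemma ex_cubic_formM d (T : measurableType d) (Q : probability T R) n (Z : T -> 'rV[R]_n)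
    (GZ : gaussian_vector Q Z) (a b : 'I_n -> 'I_n -> 'I_n -> R) :
  (forall i j k, a i j k = a j i k) -> (forall i j k, a i j k = a i k j) ->
  (forall i j k, b i j k = b j i k) -> (forall i j k, b i j k = b i k j) ->
  6 * expect Q Z (fun x => cubic_form a x * cubic_form b x) = \sum_i \sum_j \sum_k a i j k * b i j k.
Proof.
move=> a12 a23 b12 b23.
have ab12 i j k : a i j k + b i j k = a j i k + b j i k by rewrite a12 b12.
have ab23 i j k : a i j k + b i j k = a i k j + b i k j by rewrite a23 b23.
have pa := cubic_form_polyfun a; have pb := cubic_form_polyfun b.
have h := ex_cubic_form2 ab12 ab23 GZ.
have ha := ex_cubic_form2 a12 a23 GZ; have hb := ex_cubic_form2 b12 b23 GZ.
have E1 : expect Q Z (fun x => cubic_form (fun i j k => a i j k + b i j k) x ^+ 2) =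
    expect Q Z (fun x => cubic_form a x ^+ 2) + 2 * expect Q Z (fun x => cubic_form a x * cubic_form b x) +
    expect Q Z (fun x => cubic_form b x ^+ 2).
  have p2 := polyfunX 2 pa; have p3 := polyfunX 2 pb; have p4 := polyfunM pa pb.
  rewrite -(exZ GZ 2 p4) -(exD GZ p2 (polyfunZ 2 p4)) -(exD GZ (polyfunD p2 (polyfunZ 2 p4)) p3).
  by apply: eq_ex => x; rewrite cubic_formD//; ring.
have E2 : \sum_i \sum_j \sum_k (a i j k + b i j k) ^+ 2 = \sum_i \sum_j \sum_k a i j k ^+ 2 +
    2 * (\sum_i \sum_j \sum_k a i j k * b i j k) + \sum_i \sum_j \sum_k b i j k ^+ 2.
  rewrite mulr_sumr -!big_split/=; apply: eq_bigr => i _; rewrite mulr_sumr -!big_split/=.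
  apply: eq_bigr => j _; rewrite mulr_sumr -!big_split/=; apply: eq_bigr => k _; ring.
move: h; rewrite E1 E2 -ha -hb; move: (expect Q Z _) (expect Q Z _) (expect Q Z _) (\sum_i _) => u v w s.
move=> h; lra.
Qed.

End HermiteTensor.

(** * Projection of F on functions of finitely many coordinates *)

Section ChaosProjection.
Context {R : realType} {d : measure_display} {Omega : measurableType d}.
Variables (P : probability Omega R) (X : nat -> {RV P >-> R}).
Hypothesis iidX : iid_standard_gaussian X.
Let GX n : gaussian_vector P (coordinates X n) := gaussian_coordinates n iidX.
Local Notation L := (@ornstein_uhlenbeck R _).

Variable F : Omega -> R.
Hypothesis hF : sq_integrable P F.
Variables (nF : nat -> nat) (f : forall k, 'rV[R]_(nF k) -> R).
Arguments f : clear implicits.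
Hypothesis sf : forall k, smooth (f k).
Hypothesis cF : \int[P]_w ((f k (coordinates X (nF k) w) - F w) ^+ 2) @[k --> \oo] --> (0 : R).
Hypothesis cLF : \int[P]_w ((L (f k) (coordinates X (nF k) w) - (- 3 * F w)) ^+ 2) @[k --> \oo] --> (0 : R).

Let hf k : sq_integrable P (fun w => f k (coordinates X (nF k) w)).
Proof. by apply: (sq_integrable_cgrowth (GX (nF k))); have [] := smooth_C1 (@sf k). Qed.
Let hLf k : sq_integrable P (fun w => L (f k) (coordinates X (nF k) w)).
Proof. exact: (sq_integrable_cgrowth (GX (nF k)) (cgrowth_OU (smooth_C2 (@sf k)))). Qed.

(** Both functions are lifted to a common number M of coordinates, where L is symmetric and commutes
    with the lifts. *)
Let pairing_OU k N (psi : 'rV[R]_N -> R) : polyfun psi ->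
  \int[P]_w (L (f k) (coordinates X (nF k) w) * psi (coordinates X N w)) =
  \int[P]_w (f k (coordinates X (nF k) w) * L psi (coordinates X N w)).
Proof.
move=> pp; set M := maxn (nF k) N.
have l1 : (nF k <= M)%N := leq_maxl _ _; have l2 : (N <= M)%N := leq_maxr _ _.
have := expect_OU_sym (GX M) (C2growth_lft l1 (smooth_C2 (@sf k))) (C2growth_lft l2 (polyfun_C2 pp)).
rewrite (OU_lft l1) (OU_lft l2).
under [in X in X = _ -> _]eq_Rintegral do rewrite (lft_coordinates l1) (lft_coordinates l2).
under [in X in _ = X -> _]eq_Rintegral do rewrite (lft_coordinates l1) (lft_coordinates l2).
by [].
Qed.

(** F is reachable only through the closure, so the eigenvalue equation is tested against
    polynomials and L is moved to the test function before passing to the limit. *)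
Lemma weak_OU N (psi : 'rV[R]_N -> R) : polyfun psi ->
  \int[P]_w (F w * (L psi (coordinates X N w) + 3 * psi (coordinates X N w))) = 0.
Proof.
move=> pp; have hp := sq_integrable_polyfun (GX N) pp.
have hLp := sq_integrable_polyfun (GX N) (polyfun_OU pp).
have c1 := approx_pairing hf hF hLp cF.
have c2 := approx_pairing hLf (sq_integrableZ (-3) hF) hp cLF.
have e : \int[P]_w (F w * L psi (coordinates X N w)) = \int[P]_w (- 3 * F w * psi (coordinates X N w)).
  apply: (cvg_unique (@norm_hausdorff _ R^o) c1); apply: cvg_trans c2.
  by apply: near_eq_cvg; apply: nearW => k; exact: pairing_OU.
have -> : (fun w => F w * (L psi (coordinates X N w) + 3 * psi (coordinates X N w))) =
    (fun w => F w * L psi (coordinates X N w) - (- 3 * F w * psi (coordinates X N w))).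
  by apply/funext => w; ring.
rewrite RintegralB//; [|exact: (sq_integrableM hF hLp)|exact: (sq_integrableM (sq_integrableZ (-3) hF) hp)].
by rewrite e subrr.
Qed.

(** With the normalisation of [cubic_form] this is the tensor of F without any factor. It does not
    refer to a number of variables, so the tensors at different levels are restrictions of it. *)
Definition chaos_coef (i j k : nat) : R := \int[P]_w (F w * hermite3 (fun n => X n w) i j k).

Lemma chaos_coef12 i j k : chaos_coef i j k = chaos_coef j i k.
Proof. by congr Rintegral; apply/funext => w; rewrite /hermite3 (eq_sym j i); ring. Qed.
Lemma chaos_coef23 i j k : chaos_coef i j k = chaos_coef i k j.
Proof. by congr Rintegral; apply/funext => w; rewrite /hermite3 (eq_sym k j); ring. Qed.

Definition tensor n : 'I_n -> 'I_n -> 'I_n -> R := fun i j k => chaos_coef i j k.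
Arguments tensor : clear implicits.

Lemma tensor12 n i j k : tensor n i j k = tensor n j i k. Proof. exact: chaos_coef12. Qed.
Lemma tensor23 n i j k : tensor n i j k = tensor n i k j. Proof. exact: chaos_coef23. Qed.

Definition chaos_proj n w := cubic_form (tensor n) (coordinates X n w).

Let pT n : polyfun (cubic_form (tensor n)) := cubic_form_polyfun (tensor n).

Lemma chaos_proj_sq n : sq_integrable P (chaos_proj n).
Proof. exact: (sq_integrable_polyfun (GX n) (pT n)). Qed.

Let hermite_sq i j k : sq_integrable P (fun w => hermite3 (fun n => X n w) i j k).
Proof.
pose N := (i + j + k).+1; pose co l (x : 'rV[R]_N) : R := if insub l is Some i then x 0 i else 0.
have pco l : polyfun (co l).
  by rewrite /co; case: insubP => [u _ _|_]; [exact: polyfun_coord|exact: polyfun_cst].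
have coE l w : (l < N)%N -> co l (coordinates X N w) = X l w by move=> lN; rewrite /co insubT mxE.
have iN : (i < N)%N by rewrite /N ltnS -addnA leq_addr.
have jN : (j < N)%N by rewrite /N ltnS addnAC leq_addl.
have kN : (k < N)%N by rewrite /N ltnS leq_addl.
have ph : polyfun (fun x => hermite3 (fun l => co l x) i j k).
  by rewrite /hermite3; apply: polyfunB; [apply: polyfunB; [apply: polyfunB|]|];
    [apply: polyfunM => //; exact: polyfunM|exact: polyfunZ..].
have := sq_integrable_polyfun (GX N) ph; congr sq_integrable; apply/funext => w.
by rewrite /hermite3 !coE.
Qed.

Lemma pairing_cubic_form n (b : 'I_n -> 'I_n -> 'I_n -> R) :
  (forall i j k, b i j k = b j i k) -> (forall i j k, b i j k = b i k j) ->
  6 * \int[P]_w (F w * cubic_form b (coordinates X n w)) = \sum_i \sum_j \sum_k tensor n i j k * b i j k.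
Proof.
move=> b12 b23; have pb := cubic_form_polyfun b.
have hb := sq_integrable_polyfun (GX n) pb.
rewrite -RintegralZl//; last exact: (sq_integrableM hF hb).
have iFh i j k : P.-integrable setT (EFin \o (fun w => F w * hermite3 (fun n => X n w) i j k)).
  exact: (sq_integrableM hF (hermite_sq i j k)).
have iG i j k : P.-integrable setT (EFin \o (fun w => b i j k * (F w * hermite3 (fun n => X n w) i j k))).
  exact: (@integrableZl _ _ _ P _ _ _ (EFin \o (fun w => F w * hermite3 (fun n => X n w) i j k))).
have -> : (fun w => 6 * (F w * cubic_form b (coordinates X n w))) =
    (fun w => \sum_i \sum_j \sum_k b i j k * (F w * hermite3 (fun n => X n w) i j k)).
  apply/funext => w; rewrite mulrCA (@cubic_form_hermite _ _ _ _ (fun n => X n w))//; last by move=> i; rewrite mxE.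
  rewrite mulr_sumr; apply: eq_bigr => i _; rewrite mulr_sumr; apply: eq_bigr => j _; rewrite mulr_sumr.
  by apply: eq_bigr => k _; rewrite mulrCA.
rewrite (proj2 (Rintegral_sum_integrable _ (fun i => proj1 (Rintegral_sum_integrable _ (fun j => proj1 (Rintegral_sum_integrable _ (fun k => iG i j k))))))).
apply: eq_bigr => i _; rewrite (proj2 (Rintegral_sum_integrable _ (fun j => proj1 (Rintegral_sum_integrable _ (fun k => iG i j k))))).
apply: eq_bigr => j _; rewrite (proj2 (Rintegral_sum_integrable _ (fun k => iG i j k))); apply: eq_bigr => k _.
by rewrite RintegralZl// mulrC.
Qed.

Let resid n w := F w - chaos_proj n w.
Let hresid n : sq_integrable P (resid n). Proof. exact: (sq_integrableB hF (chaos_proj_sq n)). Qed.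

Let resid_split n g : sq_integrable P g ->
  \int[P]_w (resid n w * g w) = \int[P]_w (F w * g w) - \int[P]_w (chaos_proj n w * g w).
Proof.
move=> hg; rewrite -RintegralB//; [|exact: (sq_integrableM hF hg)|exact: (sq_integrableM (chaos_proj_sq n) hg)].
by congr Rintegral; apply/funext => w; rewrite mulrBl.
Qed.

(** The residual inherits the weak eigenvalue equation from F and from the cubic form, and is
    orthogonal to cubic forms by the choice of the coefficients: these are the assumptions of
    [trig_orthogonal]. Thus [chaos_proj n] acts as the projection on functions of n coordinates. *)
Lemma chaos_proj_orthogonal n (psi : 'rV[R]_n -> R) : cgrowth psi ->
  \int[P]_w ((F w - chaos_proj n w) * psi (coordinates X n w)) = 0.
Proof.
apply: (fourier_uniqueness (GX n) (hresid n)) => c v.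
apply: (trig_orthogonal (GX n) (hresid n)) => [p pp|b b12 b23].
  have pLp := polyfunD (polyfun_OU pp) (polyfunZ 3 pp).
  rewrite (resid_split n (sq_integrable_polyfun (GX n) pLp)) weak_OU// sub0r; apply/eqP; rewrite oppr_eq0; apply/eqP.
  have p1 := polyfunM (pT n) (polyfun_OU pp); have p2 := polyfunM (pT n) pp.
  have := ex_OU_sym (GX n) (pT n) pp; rewrite (OU_cubic_form (@tensor12 n) (@tensor23 n)) => h.
  rewrite -[LHS]/(expect P (coordinates X n) (fun x => cubic_form (tensor n) x * (L p x + 3 * p x))).
  transitivity (expect P (coordinates X n) (fun x => cubic_form (tensor n) x * L p x + 3 * (cubic_form (tensor n) x * p x))).
    by apply: eq_ex => x; rewrite mulrDr; congr (_ + _); rewrite mulrCA.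
  rewrite (exD (GX n) p1 (polyfunZ 3 p2)) -h (exZ (GX n) 3 p2) -(exZ (GX n) 3 p2).
  rewrite -(exD (GX n) (f := fun x => - 3 * cubic_form (tensor n) x * p x) (polyfunM (polyfunZ (-3) (pT n)) pp) (polyfunZ 3 p2)).
  rewrite (@eq_ex _ _ _ P _ (coordinates X n) _ (fun=> 0)) ?ex_cst// => x; ring.
have pb := cubic_form_polyfun b.
rewrite (resid_split n (sq_integrable_polyfun (GX n) pb)).
have n6 : (6 : R) != 0 by rewrite pnatr_eq0.
apply: (mulfI n6); rewrite mulrBr mulr0 pairing_cubic_form//.
have := ex_cubic_formM (GX n) (@tensor12 n) (@tensor23 n) b12 b23; rewrite /expect /chaos_proj => ->.
exact: subrr.
Qed.

(** A projection is at least as close to F as any function of l coordinates, in particular as a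
    fixed good approximation f_k0 once l >= n_k0. *)
Lemma chaos_proj_cvg : \int[P]_w ((F w - chaos_proj l w) ^+ 2) @[l --> \oo] --> (0 : R).
Proof.
apply/cvgrPdist_le => e e0; move/cvgrPdist_le : cF => /(_ _ e0)[k0 _ /(_ k0 (leqnn _))].
rewrite !sub0r !normrN => hk; exists (nF k0) => // l /= kl.
rewrite sub0r normrN ger0_norm ?sqn_ge0_Rintegral//.
apply: le_trans (le_trans (ler_norm _) hk).
have -> : (fun w => (f k0 (coordinates X (nF k0) w) - F w) ^+ 2) =
    (fun w => (F w - lft (f k0) (coordinates X l w)) ^+ 2).
  by apply/funext => w; rewrite (lft_coordinates kl) -sqrrN opprB.
have cl : cgrowth (lft (N := l) (f k0)) by apply: cgrowth_lft; have [] := smooth_C1 (@sf k0).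
apply: (projection_le hF (chaos_proj_sq l) (sq_integrable_cgrowth (GX l) cl)).
by apply: (chaos_proj_orthogonal (psi := fun x => cubic_form (tensor l) x - lft (f k0) x)); exact: (cgrowthB (polyfun_cgrowth (pT l)) cl).
Qed.

Lemma chaos_proj_cauchy m n : \int[P]_w ((chaos_proj m w - chaos_proj n w) ^+ 2) <=
  2 * \int[P]_w ((F w - chaos_proj m w) ^+ 2) + 2 * \int[P]_w ((F w - chaos_proj n w) ^+ 2).
Proof.
have h1 := sq_integrableB (chaos_proj_sq m) hF; have h2 := sq_integrableB hF (chaos_proj_sq n).
have := sq_norm_triangle h1 h2.
have -> : (fun w => (chaos_proj m w - F w + (F w - chaos_proj n w)) ^+ 2) = (fun w => (chaos_proj m w - chaos_proj n w) ^+ 2).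
  by apply/funext => w; rewrite addrA subrK.
have -> // : (fun w => (chaos_proj m w - F w) ^+ 2) = (fun w => (F w - chaos_proj m w) ^+ 2).
by apply/funext => w; rewrite -sqrrN opprB.
Qed.

Definition chaos_partial (i n : nat) w := partial_nat i (cubic_form (tensor n)) (coordinates X n w).

Let polyfun_partial_nat i n (g : 'rV[R]_n -> R) : polyfun g -> polyfun (partial_nat i g).
Proof.
by rewrite /partial_nat => pg; case: insubP => [j _ _|_]; [exact: polyfun_partial|exact: polyfun_cst].
Qed.

Lemma chaos_partial_sq i n : sq_integrable P (chaos_partial i n).
Proof. exact: (sq_integrable_polyfun (GX n) (polyfun_partial_nat i (pT n))). Qed.

(** Lifting commutes with L, so the difference of the two projections is still an eigenfunction for
    -3 in m variables; the claim is its energy identity. *)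
Lemma chaos_partial_energy n m : (n <= m)%N ->
  \sum_(i < m) \int[P]_w ((chaos_partial i m w - chaos_partial i n w) ^+ 2) =
  3 * \int[P]_w ((chaos_proj m w - chaos_proj n w) ^+ 2).
Proof.
move=> nm; pose C1 := cubic_form (tensor m); pose C2 := lft (N := m) (cubic_form (tensor n)).
pose C x := C1 x - C2 x.
have p1 : polyfun C1 := pT m.
have p2 : polyfun C2 := polyfun_lft nm (pT n).
have pC : polyfun C := polyfunB p1 p2.
have LC : L C = fun x => -3 * C x.
  have h := OU_lin [:: true; false] (fun b : bool => if b then 1 else -1) (F := fun b : bool => if b then C1 else C2).
  have CE : C = (fun x => \sum_(b <- [:: true; false]) (if b then 1 else -1) * (if b then C1 else C2) x).
    by apply/funext => x; rewrite !big_cons big_nil /C mul1r mulN1r addr0.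
  rewrite CE h; last by case.
  apply/funext => x; rewrite !big_cons !big_nil !addr0 (OU_cubic_form (@tensor12 m) (@tensor23 m)).
  rewrite (OU_lft nm) (OU_cubic_form (@tensor12 n) (@tensor23 n)) /lft /C1 /C2 /lft.
  by move: (cubic_form _ _) (cubic_form _ _) => u v; ring.
have pe i : partial i C = fun x => partial i C1 x - lft (partial_nat i (cubic_form (tensor n))) x.
  by rewrite (partialB i (polyfun_C1 p1) (polyfun_C1 p2)) (partial_lft nm).
have := ex_OU (GX m) pC pC; rewrite LC => /(congr1 -%R); rewrite opprK => h.
transitivity (\sum_i expect P (coordinates X m) (fun x => partial i C x * partial i C x)).
  apply: eq_bigr => i _; congr Rintegral; apply/funext => w.
  by rewrite pe (lft_coordinates nm) /chaos_partial (partial_natE (cubic_form (tensor m)) i) expr2.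
rewrite -h -[- expect _ _ _]mulN1r -(exZ (GX m) (-1) (f := fun x => -3 * C x * C x)); last exact: (polyfunM (polyfunZ (-3) pC) pC).
rewrite -RintegralZl//; last exact: (proj2 (sq_integrableB (chaos_proj_sq m) (chaos_proj_sq n))).
congr Rintegral; apply/funext => w; rewrite /C /C1 /C2 (lft_coordinates nm) /chaos_proj.
by move: (cubic_form _ _) (cubic_form _ _) => u v; ring.
Qed.

Lemma chaos_partial_cauchy i m n : \int[P]_w ((chaos_partial i m w - chaos_partial i n w) ^+ 2) <=
  3 * \int[P]_w ((chaos_proj m w - chaos_proj n w) ^+ 2).
Proof.
wlog nm : m n / (n <= m)%N.
  move=> H; have [/H//|/ltnW/H] := leqP n m.
  have sw (u v : Omega -> R) : (fun w => (u w - v w) ^+ 2) = (fun w => (v w - u w) ^+ 2).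
    by apply/funext => w; rewrite -sqrrN opprB.
  by rewrite (sw (chaos_partial i n)) (sw (chaos_proj n)).
rewrite -(chaos_partial_energy nm); have [im|mi] := ltnP i m.
  rewrite (bigD1 (Ordinal im))//= lerDl; apply: sumr_ge0 => j _; exact: sqn_ge0_Rintegral.
rewrite (_ : (fun w => _) = fun=> 0); last first.
  by apply/funext => w; rewrite /chaos_partial !partial_nat0 ?(leq_trans nm)// subrr expr0n.
rewrite (@Rintegral_cst_probability _ _ _ P); apply: sumr_ge0 => j _; exact: sqn_ge0_Rintegral.
Qed.

(** [malliavinD] is selected by [xget], so the closure has to be shown inhabited: the derivatives of
    the projections form a Cauchy sequence, whose limit is a member. *)
Lemma malliavin_closure i : closure_L2 (fun n => @partial_nat R n i) X F (malliavinD X i F).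
Proof.
rewrite /malliavinD; apply: xgetPex.
have [|G hG cG] := @riesz_fischer _ _ _ P (chaos_partial i) (chaos_partial_sq i).
  (* The factor 3 of [chaos_partial_cauchy] meets the 2 + 2 of [chaos_proj_cauchy], hence e / 12. *)
  move=> e e0; have e12 : 0 < e / 12 by rewrite divr_gt0.
  move/cvgrPdist_le : chaos_proj_cvg => /(_ _ e12)[N _ hN]; exists N => k l Nk Nl.
  apply: (le_trans (chaos_partial_cauchy i k l)).
  have := chaos_proj_cauchy k l; have := hN k Nk; have := hN l Nl.
  rewrite !sub0r !normrN !ger0_norm ?sqn_ge0_Rintegral//.
  move: (\int[P]_w _) (\int[P]_w _) (\int[P]_w _) => a b c ha hb hc; lra.
exists G; split; [exact/Lfun2P|exact/Lfun2P|].
exists id, (fun k => cubic_form (tensor k)); split.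
- by move=> k; exact: polyfun_smooth (pT k).
- apply/(@cvg_L2P _ _ _ P); first by move=> k; exact: (sq_integrableB (chaos_proj_sq k) hF).
  rewrite (_ : (fun k => _) = fun l => \int[P]_w ((F w - chaos_proj l w) ^+ 2)); first exact: chaos_proj_cvg.
  by apply/funext => k; congr Rintegral; apply/funext => w; rewrite -sqrrN opprB.
- apply/(@cvg_L2P _ _ _ P) => [k|]; last exact: cG.
  exact: (sq_integrableB (chaos_partial_sq i k) hG).
Qed.

Lemma malliavin_sq i : sq_integrable P (malliavinD X i F).
Proof. by have [_ /Lfun2P] := malliavin_closure i. Qed.

(* D_i F is any element of the closure: integration by parts shows that
   chaos_partial i l is its projection on functions of l variables, at least as
   close to it as the approximating sequence of the closure. *)
Lemma malliavin_cvg i : \int[P]_w ((malliavinD X i F w - chaos_partial i l w) ^+ 2) @[l --> \oo] --> (0 : R).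
Proof.
have hG := malliavin_sq i; set G := malliavinD X i F in hG *.
have [_ _ [n' [f' [sf' cf' cg']]]] := malliavin_closure i; rewrite -/G in cg'.
have hf' k : sq_integrable P (fun w => f' k (coordinates X (n' k) w)).
  by apply: (sq_integrable_cgrowth (GX (n' k))); have [] := smooth_C1 (sf' k).
have cpf k : cgrowth (partial_nat i (f' k)) by apply: partial_nat_C1; have [] := smooth_C1 (sf' k).
have hg' k : sq_integrable P (fun w => partial_nat i (f' k) (coordinates X (n' k) w)).
  exact: (sq_integrable_cgrowth (GX (n' k)) (cpf k)).
move: cf' => /(@cvg_L2P _ _ _ P) cf'; have {}cf' := cf' (fun k => sq_integrableB (hf' k) hF).
move: cg' => /(@cvg_L2P _ _ _ P) cg'; have {}cg' := cg' (fun k => sq_integrableB (hg' k) hG).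
have orth l (phi : 'rV[R]_l -> R) : (i < l)%N -> C1growth phi ->
    \int[P]_w ((G w - chaos_partial i l w) * phi (coordinates X l w)) = 0.
  move=> il hphi; pose ol := Ordinal il.
  have [cphi _ cpp] := hphi.
  pose del (x : 'rV[R]_l) := x 0 ol * phi x - partial ol phi x.
  have cdel : cgrowth del by apply: cgrowthB => //; apply: cgrowthM => //; exact: cgrowth_coord.
  have hphi2 := sq_integrable_cgrowth (GX l) cphi; have hdel := sq_integrable_cgrowth (GX l) cdel.
  have e1 k : \int[P]_w (partial_nat i (f' k) (coordinates X (n' k) w) * phi (coordinates X l w)) =
      \int[P]_w (f' k (coordinates X (n' k) w) * del (coordinates X l w)).
    set M := maxn (n' k) l.
    have l1 : (n' k <= M)%N := leq_maxl _ _; have l2 : (l <= M)%N := leq_maxr _ _.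
    pose oM := Ordinal (leq_trans il l2).
    have := expect_partialM (GX M) oM (C1growth_lft l1 (smooth_C1 (sf' k))) (C1growth_lft l2 hphi).
    rewrite (partial_lft l1) (partial_lft l2) => h.
    transitivity (\int[P]_w (lft (partial_nat oM (f' k)) (coordinates X M w) * lft phi (coordinates X M w))).
      by congr Rintegral; apply/funext => w; rewrite (lft_coordinates l1) (lft_coordinates l2).
    rewrite h; congr Rintegral; apply/funext => w; rewrite (lft_coordinates l1) !(lft_coordinates l2).
    by rewrite /del -(partial_natE phi ol) !mxE.
  have c1 := approx_pairing hg' hG hphi2 cg'.
  have c2 := approx_pairing hf' hF hdel cf'.
  have e2 : \int[P]_w (G w * phi (coordinates X l w)) = \int[P]_w (F w * del (coordinates X l w)).
    apply: (cvg_unique (@norm_hausdorff _ R^o) c1); apply: cvg_trans c2.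
    by apply: near_eq_cvg; apply: nearW => k; exact: esym (e1 k).
  have e3 := chaos_proj_orthogonal (n := l) cdel.
  have e4 := expect_partialM (GX l) ol (polyfun_C1 (pT l)) hphi.
  have e5 : \int[P]_w (chaos_partial i l w * phi (coordinates X l w)) = \int[P]_w (chaos_proj l w * del (coordinates X l w)).
    transitivity (\int[P]_w (partial ol (cubic_form (tensor l)) (coordinates X l w) * phi (coordinates X l w))).
      by congr Rintegral; apply/funext => w; rewrite /chaos_partial -(partial_natE _ ol).
    by rewrite e4.
  have spl (u v g : Omega -> R) : sq_integrable P u -> sq_integrable P v -> sq_integrable P g ->
      \int[P]_w ((u w - v w) * g w) = \int[P]_w (u w * g w) - \int[P]_w (v w * g w).
    move=> hu hv hg; rewrite -RintegralB//; [|exact: (sq_integrableM hu hg)|exact: (sq_integrableM hv hg)].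
    by congr Rintegral; apply/funext => w; rewrite mulrBl.
  move: e3; rewrite (spl _ _ _ hF (chaos_proj_sq l) hdel) (spl _ _ _ hG (chaos_partial_sq i l) hphi2).
  by rewrite e2 e5.
apply/cvgrPdist_le => e e0; move/cvgrPdist_le : cg' => /(_ _ e0)[k0 _ /(_ k0 (leqnn _))].
rewrite !sub0r !normrN => hk; exists (maxn i.+1 (n' k0)) => // l /=; rewrite geq_max => /andP[il kl].
rewrite sub0r normrN ger0_norm ?sqn_ge0_Rintegral//.
apply: le_trans (le_trans (ler_norm _) hk).
have -> : (fun w => (partial_nat i (f' k0) (coordinates X (n' k0) w) - G w) ^+ 2) =
    (fun w => (G w - lft (partial_nat i (f' k0)) (coordinates X l w)) ^+ 2).
  by apply/funext => w; rewrite (lft_coordinates kl) -sqrrN opprB.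
have spf : C1growth (partial_nat i (f' k0)).
  rewrite /partial_nat; case: insubP => [j _ _|_]; last exact: C1growth_cst.
  exact/smooth_C1/smooth_partial.
have cl : C1growth (lft (N := l) (partial_nat i (f' k0))) := C1growth_lft kl spf.
have [ccl _ _] := cl.
apply: (projection_le hG (chaos_partial_sq i l) (sq_integrable_cgrowth (GX l) ccl)).
apply: (orth l (fun x => partial_nat i (cubic_form (tensor l)) x - lft (partial_nat i (f' k0)) x) il).
exact: (C1growthB (polyfun_C1 (polyfun_partial_nat i (pT l))) cl).
Qed.

Lemma chaos_proj_pythagoras n :
  \int[P]_w ((F w - chaos_proj n w) ^+ 2) = \int[P]_w (F w ^+ 2) - \int[P]_w (chaos_proj n w ^+ 2).
Proof.
have hp := chaos_proj_sq n.
have h := chaos_proj_orthogonal (n := n) (polyfun_cgrowth (pT n)).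
have i1 := sq_integrableM (sq_integrableB hF hp) hp.
have i2 : P.-integrable setT (EFin \o (fun w => 2 * ((F w - chaos_proj n w) * chaos_proj n w))).
  exact: (@integrableZl _ _ _ P _ _ _ (EFin \o (fun w => (F w - chaos_proj n w) * chaos_proj n w))).
have i3 := proj2 hp; have i4 := proj2 (sq_integrableB hF hp).
have i5 : P.-integrable setT (EFin \o (fun w => (F w - chaos_proj n w) ^+ 2 + 2 * ((F w - chaos_proj n w) * chaos_proj n w))).
  exact: (@integrableD _ _ _ P _ _ (EFin \o (fun w => (F w - chaos_proj n w) ^+ 2)) (EFin \o (fun w => 2 * ((F w - chaos_proj n w) * chaos_proj n w)))).
have -> : (fun w => F w ^+ 2) = (fun w => (F w - chaos_proj n w) ^+ 2 + 2 * ((F w - chaos_proj n w) * chaos_proj n w) + chaos_proj n w ^+ 2).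
  by apply/funext => w; ring.
by rewrite RintegralD// RintegralD// RintegralZl// h mulr0 addr0 addrK.
Qed.

Hypothesis F1 : \int[P]_w (F w ^+ 2) = 1.

Lemma chaos_proj_energy_le n : \int[P]_w (chaos_proj n w ^+ 2) <= 1.
Proof. by rewrite -subr_ge0 -F1 -chaos_proj_pythagoras sqn_ge0_Rintegral. Qed.

Lemma chaos_partial_sum_energy n : \sum_(i < n) \int[P]_w (chaos_partial i n w ^+ 2) <= 3.
Proof.
have := chaos_energy (GX n) (chaos_cubic_form (@tensor12 n) (@tensor23 n)).
rewrite (_ : \sum_i _ = \sum_(i < n) \int[P]_w (chaos_partial i n w ^+ 2)) => [->|].
  by rewrite -[leRHS]mulr1 ler_wpM2l// chaos_proj_energy_le.
by apply: eq_bigr => i _; congr Rintegral; apply/funext => w; rewrite /chaos_partial partial_natE.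
Qed.

Hypothesis F4 : P.-integrable setT (EFin \o (fun w => F w ^+ 4)).

(* x^4 <= y^4 + 4 x^3 (x - y) by convexity, and the error is absorbed by Young's
   inequality and the uniform bound on the sixth moments. *)
Lemma chaos_proj_fourth_le (e : R) : 0 < e -> exists l0, forall l, (l0 <= l)%N ->
  \int[P]_w (chaos_proj l w ^+ 4) <= \int[P]_w (F w ^+ 4) + e.
Proof.
(* K is the hypercontractive bound on the sixth moment at order 3, with 2 as a strict upper bound of
   the second moment. *)
move=> e0; pose K : R := (2 * 3)%:R ^+ (3 * 3) * 2 ^+ 3.
have K0 : 0 < K by rewrite mulr_gt0 ?exprn_gt0// ltr0n.
(* al and be split the error evenly: al K = e/2 and (4 / al) be = e/2. *)
pose al : R := e / (2 * K); have al0 : 0 < al by rewrite divr_gt0// mulr_gt0.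
pose be : R := e * al / 8; have be0 : 0 < be by rewrite divr_gt0// mulr_gt0.
move/cvgrPdist_le : chaos_proj_cvg => /(_ _ be0)[l0 _ hl0]; exists l0 => l ll0.
have := hl0 l ll0; rewrite sub0r normrN ger0_norm ?sqn_ge0_Rintegral// => hd.
have ch := chaos_cubic_form (@tensor12 l) (@tensor23 l).
have e2 : expect P (coordinates X l) (fun x => cubic_form (tensor l) x ^+ 2) < 2.
  by apply: le_lt_trans (chaos_proj_energy_le l) _; rewrite ltr1n.
have h6 : \int[P]_w (chaos_proj l w ^+ 6) <= K by exact: (hypercontractivity (GX l) 2 ch e2).
have ip k : P.-integrable setT (EFin \o (fun w => chaos_proj l w ^+ k)).
  exact: (cgrowth_integrable (GX l) (polyfun_cgrowth (polyfunX k (pT l)))).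
have id2 := proj2 (sq_integrableB hF (chaos_proj_sq l)).
have i1 : P.-integrable setT (EFin \o (fun w => al * chaos_proj l w ^+ 6)).
  exact: (@integrableZl _ _ _ P _ _ _ (EFin \o (fun w => chaos_proj l w ^+ 6))).
have i2 : P.-integrable setT (EFin \o (fun w => (4 / al) * (F w - chaos_proj l w) ^+ 2)).
  exact: (@integrableZl _ _ _ P _ _ _ (EFin \o (fun w => (F w - chaos_proj l w) ^+ 2))).
have i3 : P.-integrable setT (EFin \o (fun w => al * chaos_proj l w ^+ 6 + (4 / al) * (F w - chaos_proj l w) ^+ 2)).
  exact: (@integrableD _ _ _ P _ _ (EFin \o (fun w => al * chaos_proj l w ^+ 6)) (EFin \o (fun w => (4 / al) * (F w - chaos_proj l w) ^+ 2))).
have i4 : P.-integrable setT (EFin \o (fun w => F w ^+ 4 + (al * chaos_proj l w ^+ 6 + (4 / al) * (F w - chaos_proj l w) ^+ 2))).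
  exact: (@integrableD _ _ _ P _ _ (EFin \o (fun w => F w ^+ 4)) (EFin \o (fun w => al * chaos_proj l w ^+ 6 + (4 / al) * (F w - chaos_proj l w) ^+ 2))).
have pw (x y : R) : x ^+ 4 <= y ^+ 4 + (al * x ^+ 6 + 4 / al * (y - x) ^+ 2).
  have c : x ^+ 4 + 4 * x ^+ 3 * (y - x) <= y ^+ 4.
    rewrite -subr_ge0 (_ : _ - _ = (y - x) ^+ 2 * ((y + x) ^+ 2 + 2 * x ^+ 2)); last by ring.
    by rewrite mulr_ge0 ?sqr_ge0// addr_ge0 ?sqr_ge0// mulr_ge0 ?sqr_ge0.
  have s : 0 <= al^-1 * (al * x ^+ 3 + 2 * (y - x)) ^+ 2 by rewrite mulr_ge0 ?invr_ge0 ?sqr_ge0 ?(ltW al0).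
  have : al^-1 * (al * x ^+ 3 + 2 * (y - x)) ^+ 2 = al * x ^+ 6 + 4 * x ^+ 3 * (y - x) + 4 / al * (y - x) ^+ 2.
    by field; rewrite gt_eqF.
  move=> s2; rewrite s2 in s; lra.
apply: (@le_trans _ _ (\int[P]_w (F w ^+ 4 + (al * chaos_proj l w ^+ 6 + (4 / al) * (F w - chaos_proj l w) ^+ 2)))).
  by apply: le_Rintegral => //; exact: ip.
have i6 := ip 6; rewrite RintegralD// RintegralD// !RintegralZl//.
rewrite lerD2l; apply: (@le_trans _ _ (al * K + 4 / al * be)).
  apply: lerD; first by rewrite ler_wpM2l// ltW.
  by rewrite ler_wpM2l// divr_ge0// ltW.
have gen (u v : R) : u != 0 -> v != 0 -> u / (2 * v) * v + 4 / (u / (2 * v)) * (u * (u / (2 * v)) / 8) = u.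
  by move=> u0 v0; field; rewrite u0 v0.
by rewrite /be /al gen// gt_eqF.
Qed.

(** Each contraction with a unit vector has squared norm O(1/N) while the tensor itself has squared
    norm at least 5; by [frobenius_le_rank] a contraction of maximal rank must then have rank of
    order N. *)
Lemma chaos_rank_large N : (0 < N)%N -> \int[P]_w (F w ^+ 4) < 3 + (8 * N%:R ^+ 2)^-1 ->
  exists m (g : 'rV[R]_m), (N <= \rank (contraction (tensor m) g))%N.
Proof.
move=> N0 hF4; set eta := (8 * N%:R ^+ 2)^-1 in hF4.
have Nr : 1 <= N%:R :> R by rewrite ler1n.
have Np : 0 < N%:R :> R by rewrite ltr0n.
have eta0 : 0 < eta by rewrite invr_gt0 mulr_gt0// exprn_gt0.
have etaN : 8 * eta * N%:R ^+ 2 = 1 by rewrite mulrAC mulfV// mulf_neq0// expf_neq0// gt_eqF.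
have eta8 : eta <= 8^-1.
  by rewrite lef_pV2 ?posrE ?mulr_gt0 ?exprn_gt0// ler_peMr// exprn_ege1.
have [l1 hl1] := chaos_proj_fourth_le eta0.
move/cvgrPdist_le : chaos_proj_cvg => /(_ _ eta0)[l2 _ hl2].
set m := maxn l1 l2; exists m.
have h4 := hl1 m (leq_maxl _ _); have := hl2 m (leq_maxr _ _).
rewrite sub0r normrN ger0_norm ?sqn_ge0_Rintegral// chaos_proj_pythagoras F1 => h2.
have [g hg] := max_rank_contraction (tensor m); exists g.
have ch := chaos_cubic_form (@tensor12 m) (@tensor23 m).
pose s2 := \int[P]_w (chaos_proj m w ^+ 2).
have s2a : s2 <= 1 := chaos_proj_energy_le m.
(* With E S^2 >= 1 - eta and E S^4 <= 3 + 2 eta, the fourth moment bound gives u^2 <= 3 eta = 3 / (8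
   N^2) <= (5 / (8 N))^2; [ex_directional2] then doubles u. *)
pose K : R := 5 / (4 * N%:R).
have unit_bound (v : 'rV[R]_m) : sqn v = 1 -> \sum_j \sum_k (contraction (tensor m) v j k) ^+ 2 <= K.
  move=> v1; rewrite -(ex_directional2 (@tensor12 m) (@tensor23 m) (GX m)).
  have v1' : \sum_i v 0 i ^+ 2 = 1 by rewrite -sqnE.
  have := fourth_moment_bound (GX m) ch v1'.
  set u := expect _ _ _.
  have u0 : 0 <= u by apply: Rintegral_ge0 => w _; exact: sqr_ge0.
  rewrite -/(expect _ _ _) => h.
  have h' : 8 * u ^+ 2 <= 3 * (3 + 2 * eta) - 9 * s2 ^+ 2.
    apply: (le_trans h); rewrite lerD2r ler_wpM2l//; apply: (le_trans h4); lra.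
  have s2b : 1 - eta <= s2 by rewrite lerBlDr addrC -lerBlDr.
  have h'' : u ^+ 2 <= 3 * eta by nra.
  have : u <= 5 / (8 * N%:R).
    rewrite -(@ler_pXn2r _ 2)// ?nnegrE ?divr_ge0// ?mulr_ge0// ?ler0n//.
    apply: (le_trans h''); rewrite expr_div_n ler_pdivlMr ?exprn_gt0 ?mulr_gt0// exprMn.
    have -> : 3 * eta * (8 ^+ 2 * N%:R ^+ 2) = 24 * (8 * eta * N%:R ^+ 2) by ring.
    by rewrite etaN mulr1 -natrX ler_nat.
  rewrite /K => hu; apply: (@le_trans _ _ (2 * (5 / (8 * N%:R)))); first by rewrite ler_wpM2l.
  by rewrite le_eqVlt; apply/orP; left; apply/eqP; field; rewrite gt_eqF.
have bound (v : 'rV[R]_m) : \sum_j \sum_k (contraction (tensor m) v j k) ^+ 2 <= K * sqn v.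
  have [v0|vn] := eqVneq (sqn v) 0.
    have -> : v = 0 := sqn_eq0 v0.
    rewrite big1; first by rewrite mulr_ge0 ?sqn_ge0// divr_ge0// mulr_ge0.
    move=> j _; rewrite big1// => k _; rewrite mxE big1 ?expr0n// => i _; by rewrite mxE mul0r.
  have vp : 0 < sqn v by rewrite lt_neqAle eq_sym vn sqn_ge0.
  pose c := (Num.sqrt (sqn v))^-1.
  have c2 : c ^+ 2 * sqn v = 1 by rewrite exprVn sqr_sqrtr ?sqn_ge0// mulVf.
  have c20 : 0 < c ^+ 2 by rewrite exprn_gt0// invr_gt0 sqrtr_gt0.
  have := unit_bound (c *: v); rewrite sqnE.
  under eq_bigr do rewrite mxE exprMn.
  rewrite -mulr_sumr -sqnE c2 => /(_ erefl).
  have -> : \sum_j \sum_k contraction (tensor m) (c *: v) j k ^+ 2 = c ^+ 2 * \sum_j \sum_k contraction (tensor m) v j k ^+ 2.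
    rewrite mulr_sumr; apply: eq_bigr => j _; rewrite mulr_sumr; apply: eq_bigr => k _.
    by rewrite -exprMn; congr (_ ^+ 2); rewrite !mxE mulr_sumr; apply: eq_bigr => i _; rewrite mxE mulrA.
  move=> h; rewrite -(ler_pM2l c20) (le_trans h)// mulrCA c2 mulr1 lexx//.
have := frobenius_le_rank (@tensor12 m) (@tensor23 m) bound hg.
rewrite -(ex_cubic_form2 (@tensor12 m) (@tensor23 m) (GX m)).
rewrite -[expect _ _ _]/s2 => h; rewrite -(ler_nat R).
(* The squared norm of the tensor is 6 E S^2, so the rank inequality becomes 5 <= 5 rank / (2 N); in
   fact the rank is at least 2 N. *)
have h5 : 5 <= 6 * s2.
  have gen (a b : R) : 1 - a <= b -> b <= 8^-1 -> 5 <= 6 * a by move=> ? ?; lra.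
  exact: (gen s2 eta h2 eta8).
have : 5 <= 2 * K * (\rank (contraction (tensor m) g))%:R by exact: le_trans h.
rewrite /K; move: ((\rank (contraction (tensor m) g))%:R : R) => rk.
have -> : 2 * (5 / (4 * N%:R)) * rk = 5 * (rk / (2 * N%:R)) by field; rewrite gt_eqF.
rewrite -{1}[5]mulr1 ler_pM2l// ler_pdivlMr ?mulr_gt0// mul1r => h7.
by apply: le_trans h7; rewrite ler_peMl ?ltW// ltr1n.
Qed.

(** C is chosen before l: the two minors used at level l have the value dlt read off the tensor at
    level m, because the coefficients do not depend on the level. *)
Lemma chaos_small_ball N m (g : 'rV[R]_m) : (4 <= N)%N -> (N <= \rank (contraction (tensor m) g))%N ->
  exists2 C, 0 <= C & forall l z, (m <= l)%N -> 0 < z -> z <= 1 ->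
    (P [set w | (\sum_(i < m) chaos_partial i l w ^+ 2 <= z ^+ (8 * N))%R] <= (C * z ^+ (6 * N - 15))%:E)%E.
Proof.
move=> N4 /rank_minor[I [J dn]]; set dlt := \det _ in dn.
pose kap := 1 + sqn g.
have kap1 : 1 <= kap by rewrite lerDl sqn_ge0.
exists (expR ((1 + sqn g) / 2) * (expR (N%:R / 2) / `|dlt| + 2 * N%:R * kap + (N%:R ^+ N / `|dlt| + 1))).
  rewrite mulr_ge0 ?expR_ge0// !addr_ge0 ?divr_ge0 ?expR_ge0 ?exprn_ge0//.
  by rewrite mulr_ge0// (le_trans _ kap1).
move=> l z ml z0 z1; pose wl := widen_ord ml.
pose A (i : 'I_m) : 'M[R]_l := \matrix_(j, k) tensor l (wl i) j k.
pose c (i : 'I_m) : R := - (2^-1 * \sum_j tensor l (wl i) j j).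
pose gn k : R := if insub k is Some i then g 0 i else 0.
have gnE (i : 'I_m) : gn i = g 0 i by rewrite /gn valK.
have gn0 k : (m <= k)%N -> gn k = 0 by move=> mk; rewrite /gn insubF// ltnNge mk.
pose e : 'rV[R]_l := \row_k gn k.
have AT i : (A i)^T = A i by apply/matrixP => j k; rewrite !mxE; exact: tensor23.
have ee : sqn e = sqn g.
  rewrite !sqnE; transitivity (\sum_(i < l) gn i ^+ 2); first by apply: eq_bigr => i _; rewrite mxE.
  rewrite (sum_lft ml (G := fun k => gn k ^+ 2)); first by apply: eq_bigr => i _; rewrite gnE.
  by move=> k /gn0 ->; rewrite expr0n.
have ek : sqn e <= kap ^+ 2.
  by rewrite ee /kap; have := sqn_ge0 g; move: (sqn g) => s s0; nra.
have d1 : \det (mxsub (wl \o I) (wl \o J) (\sum_i g 0 i *: A i)) = dlt.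
  congr (\det _); apply/matrixP => i j; rewrite !mxE summxE; apply: eq_bigr => k _.
  by rewrite !mxE.
(* e is g padded by zeros. Symmetry in the first two indices identifies the rows e A_i with those of
   the contraction by g, so one minor serves for both determinants. *)
have d2 : \det (mxsub I (wl \o J) (\matrix_(i, j) (e *m A i) 0 j)) = dlt.
  congr (\det _); apply/matrixP => i j; rewrite !mxE.
  transitivity (\sum_(k < l) gn k * chaos_coef (I i) k (J j)).
    by apply: eq_bigr => k _; rewrite !mxE.
  rewrite (sum_lft ml (G := fun k => gn k * chaos_coef (I i) k (J j))); last first.
    by move=> k /gn0 ->; rewrite mul0r.
  by apply: eq_bigr => k _; rewrite gnE chaos_coef12.
have d1n : \det (mxsub (wl \o I) (wl \o J) (\sum_i g 0 i *: A i)) != 0 by rewrite d1.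
have d2n : \det (mxsub I (wl \o J) (\matrix_(i, j) (e *m A i) 0 j)) != 0 by rewrite d2.
have := small_ball (GX l) (GX (m + 1)) c AT N4 d1n d2n kap1 ek z0 z1.
rewrite /small_ball_cst d1 d2.
have -> // : [set w | \sum_i quadf (A i) (c i) (coordinates X l w) ^+ 2 <= z ^+ (8 * N)] =
  [set w | \sum_(i < m) chaos_partial i l w ^+ 2 <= z ^+ (8 * N)].
apply/seteqP; split=> w /=; congr (_ <= _); apply: eq_bigr => i _; congr (_ ^+ 2);
  by rewrite /chaos_partial -[nat_of_ord i]/(nat_of_ord (wl i)) partial_natE
    (partial_cubic_form (@tensor12 l) (@tensor23 l)) (quad_formE (@tensor23 l)).
Qed.

(** Markov's inequality for the moment of order p + 1 of the full sum over i < l. The constant is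
    free of m and l thanks to [moment_sum_sqr] and the energy bound 3. *)
Lemma chaos_partial_tail p m l (t : R) : (0 < l)%N -> 0 < t ->
  (P [set w | (t < \sum_(i < m) chaos_partial i l w ^+ 2)%R] <=
    ((2 * p.+1)%:R ^+ (2 * p.+1) * 4 ^+ p.+1 * (t^-1) ^+ p.+1)%:E)%E.
Proof.
move=> l0 t0; set K := _ * 4 ^+ p.+1.
pose Sl w := \sum_(i < l) chaos_partial i l w ^+ 2.
have le_S w : \sum_(i < m) chaos_partial i l w ^+ 2 <= Sl w.
  rewrite /Sl; have z k : (l <= k)%N -> chaos_partial k l w ^+ 2 = 0.
    by move=> lk; rewrite /chaos_partial partial_nat0// expr0n.
  have [ml|/ltnW lm] := leqP m l.
    rewrite (big_ord_widen l (fun i => chaos_partial i l w ^+ 2) ml) [leRHS](bigID (fun i : 'I_l => (i < m)%N))/=.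
    by rewrite lerDl sumr_ge0// => i _; exact: sqr_ge0.
  by rewrite (sum_lft lm (G := fun i => chaos_partial i l w ^+ 2)).
have pq i : polyfun (quad_form (tensor l) i) := quad_form_polyfun (tensor l) i.
have SE w : Sl w = \sum_i quad_form (tensor l) i (coordinates X l w) ^+ 2.
  apply: eq_bigr => i _; congr (_ ^+ 2).
  by rewrite /chaos_partial partial_natE (partial_cubic_form (@tensor12 l) (@tensor23 l)).
(* The term 1/l makes the bounds strict and costs 1 in total, so the energies add up to at most 3 +
   1. *)
pose en i := expect P (coordinates X l) (fun x => quad_form (tensor l) i x ^+ 2) + l%:R^-1.
have lp : 0 < l%:R^-1 :> R by rewrite invr_gt0 ltr0n.
have hen i : expect P (coordinates X l) (fun x => quad_form (tensor l) i x ^+ 2) < en i by rewrite ltrDl.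
have hs : \sum_i en i <= 4.
  rewrite big_split/= sumr_const card_ord -(mulr_natr l%:R^-1 l) mulVf ?pnatr_eq0 -?lt0n//.
  have -> : (4 : R) = 3 + 1 by ring.
  rewrite lerD2r; apply: le_trans (chaos_partial_sum_energy l); rewrite le_eqVlt; apply/orP; left; apply/eqP.
  apply: eq_bigr => i _; congr Rintegral; apply/funext => w; congr (_ ^+ 2).
  by rewrite /chaos_partial partial_natE (partial_cubic_form (@tensor12 l) (@tensor23 l)).
have := moment_sum_sqr (GX l) p l0 (fun i => chaos_quad_form (@tensor23 l) i) hen hs.
rewrite -/K => hmom.
have pS : polyfun (fun x => (\sum_i quad_form (tensor l) i x ^+ 2) ^+ p.+1).
  by apply: polyfunX; apply: polyfun_sum => i _; exact: polyfunX.
have iS := cgrowth_integrable (GX l) (polyfun_cgrowth pS).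
have iSt : P.-integrable setT (EFin \o (fun w => t^-1 ^+ p.+1 * (\sum_i quad_form (tensor l) i (coordinates X l w) ^+ 2) ^+ p.+1)).
  exact: (@integrableZl _ _ _ P _ _ _ (EFin \o (fun w => (\sum_i quad_form (tensor l) i (coordinates X l w) ^+ 2) ^+ p.+1))).
have S0 w : 0 <= Sl w by apply: sumr_ge0 => i _; exact: sqr_ge0.
have ti0 : 0 <= t^-1 by rewrite invr_ge0 ltW.
apply: (@le_trans _ _ (\int[P]_w (t^-1 ^+ p.+1 * (\sum_i quad_form (tensor l) i (coordinates X l w) ^+ 2) ^+ p.+1))%:E).
  apply: (probability_le_Rintegral _ iSt).
  - rewrite (_ : [set w | _] = (fun w => \sum_(i < m) chaos_partial i l w ^+ 2) @^-1` [set` `]t, +oo[]); last first.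
      by apply/seteqP; split=> w /=; rewrite in_itv/= andbT.
    rewrite -[X in measurable X]setTI; apply: (_ : measurable_fun setT _) => //.
    by apply: measurable_sum => i; apply: measurable_funX; case: (chaos_partial_sq i l).
  - by move=> w; rewrite mulr_ge0 ?exprn_ge0// -SE.
  - move=> w /= tw; rewrite -SE -exprMn exprn_ege1// mulrC ler_pdivlMr// mul1r.
    by rewrite (le_trans (ltW tw)).
by rewrite RintegralZl// lee_fin mulrC ler_wpM2r// exprn_ge0.
Qed.

End ChaosProjection.

(** * From tail bounds to integrability *)

Lemma geometric_sum_le {R : realType} (q : R) n : 0 <= q -> q < 1 -> \sum_(k < n) q ^+ k <= (1 - q)^-1.
Proof.
move=> q0 q1; have q1' : 0 < 1 - q by rewrite subr_gt0.
rewrite -[leRHS]mul1r ler_pdivlMr//.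
have -> : (\sum_(k < n) q ^+ k) * (1 - q) = 1 - q ^+ n.
  elim: n => [|n IH]; first by rewrite big_ord0 mul0r expr0 subrr.
  by rewrite big_ord_recr/= mulrDl IH exprS; ring.
by rewrite gerBl exprn_ge0.
Qed.

Section Tails.
Context {R : realType} {d : measure_display} {T : measurableType d}.
Variable P : probability T R.

(** Y is at most A plus the sum over k of A b^(k+1) on the layer Y > A b^k. The expectation of this
    sum is a geometric series of ratio b delta. *)
Lemma integrable_of_tails (Y : T -> \bar R) (A b C delta : R) :
  measurable_fun setT Y -> (forall w, 0 <= Y w)%E -> 0 < A -> 1 <= b -> 0 <= C -> 0 <= delta -> b * delta < 1 ->
  (forall k, (P [set w | (A * b ^+ k)%:E < Y w] <= (C * delta ^+ k)%:E)%E) ->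
  P.-integrable setT Y.
Proof.
move=> mY Y0 A0 b1 C0 d0 bd tail.
have b0 : 0 <= b by exact: le_trans b1.
pose Ek k := [set w | ((A * b ^+ k)%:E < Y w)%E].
have mE k : measurable (Ek k) by rewrite -[Ek k]setTI; exact: emeasurable_fun_o_infty.
pose g k w : \bar R := (A * b ^+ k.+1 * \1_(Ek k) w)%:E.
have g0 k w : (0 <= g k w)%E by rewrite lee_fin mulr_ge0// mulr_ge0 ?exprn_ge0// ltW.
have mg k : measurable_fun setT (g k).
  by apply/measurable_EFinP; apply: measurable_funM => //; exact: measurable_indic.
pose S w := (\sum_(k <oo) g k w)%E.
have S0 w : (0 <= S w)%E by apply: nneseries_ge0.
have mS : measurable_fun setT S by apply: ge0_emeasurable_sum.
have Sn n w : (\sum_(0 <= k < n) g k w <= S w)%E.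
  by apply: (nneseries_lim_ge n (P := xpredT) (u_ := fun k => g k w)) => i _.
have YS w : (Y w <= A%:E + S w)%E.
  have [h|h] := pselect (exists k, (Y w <= (A * b ^+ k)%:E)%E).
    case: (ex_minnP h) => -[|k] hk mk.
      by rewrite expr0 mulr1 in hk; apply: (le_trans hk); rewrite leeDl.
    apply: (le_trans hk); apply: (@le_trans _ _ (S w)); last by rewrite leeDr// lee_fin ltW.
    apply: le_trans (Sn k.+1 w); rewrite big_nat_recr//=.
    have -> : g k w = (A * b ^+ k.+1)%:E.
      rewrite /g indicE mem_set ?mulr1// /Ek/= ltNge; apply/negP => /mk; by rewrite ltnn.
    by rewrite leeDr// sume_ge0.
  (* If Y exceeds every level, all layers contribute at least A each and the series is infinite.
     This also covers b = 1. *)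
  suff -> : S w = +oo%E by rewrite addey ?leey.
  apply/eqyP => r r0; pose n := (Num.trunc (r / A)).+1.
  apply: le_trans (Sn n w); rewrite /g sumEFin lee_fin.
  apply: (@le_trans _ _ (\sum_(0 <= k < n) A)).
    rewrite sumr_const_nat subn0 -mulr_natr mulrC -ler_pdivrMr//.
    exact: ltW (truncnS_gt _).
  apply: ler_sum => k _; rewrite indicE mem_set; last by rewrite /Ek/= ltNge; apply/negP => hk; apply: h; exists k.
  by rewrite mulr1 ler_peMr ?(ltW A0)// exprn_ege1.
have q0 : 0 <= b * delta by exact: mulr_ge0.
apply/integrableP; split=> //; rewrite (eq_integral Y); last by move=> w _; rewrite gee0_abs.
apply: (@le_lt_trans _ _ (\int[P]_w (A%:E + S w))%E).
  have mAS : measurable_fun setT (fun w => A%:E + S w)%E by exact: emeasurable_funD.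
  have AS0 w : (0 <= A%:E + S w)%E by rewrite adde_ge0// lee_fin ltW.
  by apply: ge0_le_integral.
rewrite ge0_integralD//; last by move=> w _; rewrite lee_fin ltW.
rewrite integral_cst// [X in (_ * X)%E]probability_setT mule1 integral_nneseries//.
apply: (@le_lt_trans _ _ (A + A * b * C * (1 - b * delta)^-1)%:E); last exact: ltry.
rewrite EFinD leeD2l//; apply: lime_le; first by apply: is_cvg_nneseries => k _ _; exact: integral_ge0.
apply: nearW => n; apply: (@le_trans _ _ (\sum_(0 <= k < n) (A * b * C * (b * delta) ^+ k)%:E)%E).
  apply: lee_sum => k _; rewrite /g.
  under eq_integral do rewrite EFinM.
  have mI : measurable_fun setT (fun w => (\1_(Ek k) w : R)%:E).
    by apply/measurable_EFinP; exact: measurable_indic.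
  have c0 : (0 <= (A * b ^+ k.+1)%:E)%E by rewrite lee_fin mulr_ge0 ?exprn_ge0// ltW.
  rewrite ge0_integralZl//.
  rewrite integral_indic// setIT.
  apply: (@le_trans _ _ ((A * b ^+ k.+1)%:E * (C * delta ^+ k)%:E)%E).
    by rewrite lee_pmul2l ?tail// lte_fin mulr_gt0// exprn_gt0// (lt_le_trans ltr01).
  by rewrite -EFinM lee_fin exprS exprMn le_eqVlt; apply/orP; left; apply/eqP; ring.
rewrite sumEFin lee_fin -mulr_sumr big_mkord ler_wpM2l ?mulr_ge0 ?(ltW A0)//.
exact: geometric_sum_le.
Qed.

(** D is contained in the union of E_l and of the event W_l >= t, whose probability vanishes as l
    grows by Markov's inequality. This transfers bounds uniform in l to the limit objects. *)
Lemma probability_limit_le (D : set T) (E : nat -> set T) (W : nat -> T -> R) (t c : R) (l0 : nat) :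
  0 < t -> measurable D -> (forall l, measurable (E l)) ->
  (forall l, P.-integrable setT (EFin \o W l)) -> (forall l w, 0 <= W l w) ->
  \int[P]_w W l w @[l --> \oo] --> (0 : R) ->
  (forall l w, D w -> W l w < t -> E l w) -> (forall l, (l0 <= l)%N -> (P (E l) <= c%:E)%E) ->
  (P D <= c%:E)%E.
Proof.
move=> t0 mD mE iW W0 cW DE PE; apply/lee_addgt0Pr => e e0.
have et0 : 0 < e * t by exact: mulr_gt0.
move/cvgrPdist_le : cW => /(_ _ et0)[l1 _ hl1].
set l := maxn l0 l1; have := hl1 l (leq_maxr _ _); rewrite sub0r normrN => hl.
pose B := [set w | t <= W l w].
have mW : measurable_fun setT (W l) by have /measurable_int/measurable_EFinP := iW l.
have mB : measurable B.
  rewrite (_ : B = (W l) @^-1` [set` `[t, +oo[]); last by apply/seteqP; split=> w /=; rewrite in_itv/= andbT.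
  by rewrite -[X in measurable X]setTI; exact: mW.
have iWt : P.-integrable setT (EFin \o (fun w => t^-1 * W l w)).
  exact: (@integrableZl _ _ _ P _ _ _ (EFin \o W l)).
have PB : (P B <= e%:E)%E.
  apply: (le_trans (probability_le_Rintegral mB iWt _ _)).
  - by move=> w; rewrite mulr_ge0// invr_ge0 ltW.
  - by move=> w Bw; rewrite mulrC ler_pdivlMr// mul1r.
  rewrite RintegralZl// lee_fin mulrC ler_pdivrMr//; exact: le_trans (ler_norm _) hl.
apply: (@le_trans _ _ (P (E l `|` B))).
  apply: le_measure; rewrite ?inE//; first exact: measurableU.
  move=> w Dw; have [Wt|Wt] := ltP (W l w) t; first by left; exact: DE.
  by right.
apply: (le_trans (measureU2 _ _ _)) => //.
by apply: leeD => //; apply: PE; exact: leq_maxl.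
Qed.

Lemma lte_inve (r : R) (z : \bar R) : 0 <= r -> (0 <= z)%E -> (r%:E < z^-1)%E = (z < (r%:E)^-1)%E.
Proof.
move=> r0; case: z => [z| |]//.
  rewrite lee_fin => z0; rewrite !inver; case: (eqVneq z 0) => [->|zn]; case: (eqVneq r 0) => [->|rn].
  - by rewrite !ltry.
  - by rewrite ltry lte_fin invr_gt0 lt_neqAle eq_sym rn r0.
  - by rewrite ltry lte_fin invr_gt0 lt_neqAle eq_sym zn z0.
  - have zp : 0 < z by rewrite lt_neqAle eq_sym zn.
    have rp : 0 < r by rewrite lt_neqAle eq_sym rn.
    by rewrite !lte_fin -[r in LHS]invrK ltf_pV2 ?posrE ?invr_gt0.
by rewrite invey lte_fin ltNge r0/= => _; case: (r%:E^-1)%E.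
Qed.

Lemma measurable_inv_power (Y : T -> \bar R) theta : measurable_fun setT Y ->
  (forall w, 0 <= Y w)%E -> measurable_fun setT (fun w => inv_power (Y w) theta).
Proof.
move=> mY Y0; rewrite /inv_power; case: leP => t0; first exact: (measurableT_comp (measurable_poweR _)).
pose Z w := (Y w `^ theta)%E.
have mZ : measurable_fun setT Z := measurableT_comp (measurable_poweR theta) mY.
have Z0 w : (0 <= Z w)%E by exact: poweR_ge0.
rewrite -[X in measurable_fun _ X]/(fun w => (Z w)^-1%E).
apply: (measurability _ (ErealGenOInfty.measurableE R)) => _ [_ [r ->] <-].
rewrite setTI; have [r0|r0] := ltP r 0.
  rewrite (_ : _ @^-1` _ = setT)//; apply/seteqP; split=> w //= _; rewrite in_itv/= andbT.
  by apply: (@lt_le_trans _ _ 0%E); rewrite ?lte_fin// inve_ge0.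
rewrite (_ : _ @^-1` _ = [set w | (Z w < (r%:E)^-1)%E]).
  by rewrite -[X in measurable X]setTI; exact: emeasurable_fun_infty_o.
by apply/seteqP; split=> w /=; rewrite in_itv/= andbT lte_inve.
Qed.

Lemma inv_power_le_pos (x : \bar R) (t theta : R) : 0 < t -> 0 < theta -> (t%:E <= x)%E ->
  (inv_power x theta <= ((t `^ theta)^-1)%:E)%E.
Proof.
move=> t0 th0 tx; rewrite /inv_power (lt_geF th0).
have tp : 0 < t `^ theta by exact: powR_gt0.
have x0 : (0 <= x)%E by apply: le_trans tx; rewrite lee_fin ltW.
rewrite leNgt; apply/negP; rewrite lte_inve ?invr_ge0 ?(ltW tp) ?poweR_ge0// inver invr_eq0 (gt_eqF tp) invrK.
apply/negP; rewrite -leNgt -poweR_EFin; apply: gt0_ler_poweR => //; first exact: ltW.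
- by rewrite in_itv/= leey andbT lee_fin ltW.
- by rewrite in_itv/= leey andbT.
Qed.

Lemma inv_power_le_neg (x : \bar R) (t theta : R) : 0 <= t -> theta <= 0 -> (0 <= x)%E -> (x <= t%:E)%E ->
  (inv_power x theta <= (t `^ (- theta))%:E)%E.
Proof.
move=> t0 th0 x0 xt; rewrite /inv_power th0 -poweR_EFin; apply: gt0_ler_poweR => //; first by rewrite oppr_ge0.
- by rewrite in_itv/= leey andbT.
- by rewrite in_itv/= leey andbT lee_fin.
Qed.

Lemma inv_power_ge0 (x : \bar R) (theta : R) : (0 <= x)%E -> (0 <= inv_power x theta)%E.
Proof. by move=> x0; rewrite /inv_power; case: ifP => _; rewrite ?inve_ge0 poweR_ge0. Qed.

End Tails.

Lemma powR2_lt {R : realType} (a b : R) : a < b -> 2 `^ a < 2 `^ b.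
Proof. by move=> ab; rewrite /powR pnatr_eq0/= ltr_expR ltr_pM2r// ln_gt0// ltr1n. Qed.

(** The element of the closure is -k F only almost surely, which L^2 distances do not see. *)
Lemma wiener_chaos_approx {R : realType} d (Omega : measurableType d) (P : probability Omega R)
    (X : nat -> {RV P >-> R}) k F : iid_standard_gaussian X -> wiener_chaos X k F ->
  sq_integrable P F /\ exists (nF : nat -> nat) (f : forall j, 'rV[R]_(nF j) -> R),
    [/\ forall j, smooth (f j),
      \int[P]_w ((f j (coordinates X (nF j) w) - F w) ^+ 2) @[j --> \oo] --> (0 : R) &
      \int[P]_w ((ornstein_uhlenbeck (f j) (coordinates X (nF j) w) - (- k%:R * F w)) ^+ 2) @[j --> \oo] --> (0 : R)].
Proof.
move=> iid [G [/Lfun2P hF /Lfun2P hG [nF [f [sf c1 c2]]]] ae]; split=> //.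
have GX n := gaussian_coordinates (X := X) n iid.
have hf j : sq_integrable P (fun w => f j (coordinates X (nF j) w)).
  by apply: (sq_integrable_cgrowth (GX (nF j))); have [] := smooth_C1 (sf j).
have hLf j : sq_integrable P (fun w => ornstein_uhlenbeck (f j) (coordinates X (nF j) w)).
  exact: (sq_integrable_cgrowth (GX (nF j)) (cgrowth_OU (smooth_C2 (sf j)))).
exists nF, f; split=> //.
  by move: c1 => /(@cvg_L2P _ _ _ P) c1; exact: (c1 (fun j => sq_integrableB (hf j) hF)).
move: c2 => /(@cvg_L2P _ _ _ P) c2; have {}c2 := c2 (fun j => sq_integrableB (hLf j) hG).
rewrite (_ : (fun j => _) = fun j => \int[P]_w ((ornstein_uhlenbeck (f j) (coordinates X (nF j) w) - G w) ^+ 2)) //.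
apply/funext => j; congr fine; apply: ae_eq_integral => //.
- by apply/measurable_EFinP; apply: measurable_funX; case: (sq_integrableB (hLf j) (sq_integrableZ (- k%:R) hF)).
- by apply/measurable_EFinP; apply: measurable_funX; case: (sq_integrableB (hLf j) hG).
apply: filterS ae => w h _; congr (((_ - _) ^+ 2)%:E).
by apply/eqP; rewrite mulNr eq_sym -subr_eq0 opprK h.
Qed.

(** * Integrability of the powers of Gamma *)

Section GammaIntegrability.
Context {R : realType} {d : measure_display} {Omega : measurableType d}.
Variables (P : probability Omega R) (X : nat -> {RV P >-> R}).
Hypothesis iidX : iid_standard_gaussian X.
Variable F : Omega -> R.
Hypothesis hF : sq_integrable P F.
Variables (nF : nat -> nat) (f : forall k, 'rV[R]_(nF k) -> R).
Arguments f : clear implicits.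
Hypothesis sf : forall k, smooth (f k).
Hypothesis cF : \int[P]_w ((f k (coordinates X (nF k) w) - F w) ^+ 2) @[k --> \oo] --> (0 : R).
Hypothesis cLF : \int[P]_w ((ornstein_uhlenbeck (f k) (coordinates X (nF k) w) - (- 3 * F w)) ^+ 2) @[k --> \oo] --> (0 : R).
Hypothesis F1 : \int[P]_w (F w ^+ 2) = 1.

Let D i := malliavinD X i F.
Let hD i : sq_integrable P (D i) := malliavin_sq iidX hF sf cF cLF i.
Let cD i := malliavin_cvg iidX hF sf cF cLF i.
Let hV i l : sq_integrable P (chaos_partial X F i l) := chaos_partial_sq iidX F i l.

Definition Gamma_trunc m w := \sum_(i < m) malliavinD X i F w ^+ 2.
Let W m l w := \sum_(i < m) (D i w - chaos_partial X F i l w) ^+ 2.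

Let mGm m : measurable_fun setT (Gamma_trunc m).
Proof. by apply: measurable_sum => i; apply: measurable_funX; case: (hD i). Qed.

Let W0 m l w : 0 <= W m l w. Proof. by apply: sumr_ge0 => i _; exact: sqr_ge0. Qed.

Let iW m l : P.-integrable setT (EFin \o W m l) /\
  \int[P]_w W m l w = \sum_(i < m) \int[P]_w ((D i w - chaos_partial X F i l w) ^+ 2).
Proof.
exact: (Rintegral_sum_integrable _ (G := fun (i : 'I_m) w => (D i w - chaos_partial X F i l w) ^+ 2) (fun i => proj2 (sq_integrableB (hD i) (hV i l)))).
Qed.

Let cW m : \int[P]_w W m l w @[l --> \oo] --> (0 : R).
Proof.
rewrite (_ : (fun l => _) = fun l => \sum_(i < m) \int[P]_w ((D i w - chaos_partial X F i l w) ^+ 2)); last first.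
  by apply/funext => l; case: (iW m l).
elim: m => [|m IH].
  rewrite (_ : (fun l => _) = fun=> 0); first exact: cvg_cst.
  by apply/funext => l; rewrite big_ord0.
rewrite (_ : (fun l => _) = fun l => \sum_(i < m) \int[P]_w ((D i w - chaos_partial X F i l w) ^+ 2) +
    \int[P]_w ((D m w - chaos_partial X F m l w) ^+ 2)); last by apply/funext => l; rewrite big_ord_recr.
by rewrite -[X in _ --> X](addr0 (0 : R)); exact: (cvgD IH (cD m)).
Qed.

Let mV m l : measurable_fun setT (fun w => \sum_(i < m) chaos_partial X F i l w ^+ 2).
Proof. by apply: measurable_sum => i; apply: measurable_funX; case: (hV i l). Qed.

Let V_le m l w : \sum_(i < m) chaos_partial X F i l w ^+ 2 <= 2 * Gamma_trunc m w + 2 * W m l w.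
Proof.
rewrite /Gamma_trunc /W !mulr_sumr -big_split/=; apply: ler_sum => i _; rewrite -/(D i w).
have := sqr_ge0 (2 * D i w - chaos_partial X F i l w); move: (D i w) (chaos_partial _ _ _ _ _) => u v; nra.
Qed.

Let G_le m l w : Gamma_trunc m w <= 2 * (\sum_(i < m) chaos_partial X F i l w ^+ 2) + 2 * W m l w.
Proof.
rewrite /Gamma_trunc /W !mulr_sumr -big_split/=; apply: ler_sum => i _; rewrite -/(D i w).
have := sqr_ge0 (2 * chaos_partial X F i l w - D i w); move: (D i w) (chaos_partial _ _ _ _ _) => u v; nra.
Qed.

Let G0 w : (0 <= Gamma X F w)%E.
Proof. by apply: nneseries_ge0 => i _ _; rewrite lee_fin sqr_ge0. Qed.

Let mGamma : measurable_fun setT (Gamma X F).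
Proof.
apply: ge0_emeasurable_sum => [i w _ _|i _]; first by rewrite lee_fin sqr_ge0.
by apply/measurable_EFinP; apply: measurable_funX; case: (hD i).
Qed.

Let Gm_le m w : ((Gamma_trunc m w)%:E <= Gamma X F w)%E.
Proof.
rewrite /Gamma_trunc -sumEFin -(big_mkord xpredT (fun i => (malliavinD X i F w ^+ 2)%:E)).
by apply: (nneseries_lim_ge m (P := xpredT) (u_ := fun i => (malliavinD X i F w ^+ 2)%:E)) => i _ _; rewrite lee_fin sqr_ge0.
Qed.

Let mY theta : measurable_fun setT (fun w => inv_power (Gamma X F w) theta) := measurable_inv_power theta mGamma G0.
Let Y0 theta w : (0 <= inv_power (Gamma X F w) theta)%E := inv_power_ge0 theta (G0 w).

(** If the approximate sum is at most t and the error W is below t, then [G_le] bounds the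
    truncation by 4 t. The bound on the approximations requires l >= 1. *)
Lemma Gamma_trunc_tail p m (t : R) : 0 < t ->
  (P [set w | (4 * t < Gamma_trunc m w)%R] <= ((2 * p.+1)%:R ^+ (2 * p.+1) * 4 ^+ p.+1 * (t^-1) ^+ p.+1)%:E)%E.
Proof.
move=> t0.
apply: (@probability_limit_le _ _ _ P _ (fun l => [set w | t < \sum_(i < m) chaos_partial X F i l w ^+ 2]) (W m) t _ 1) => //.
- rewrite (_ : [set w | _] = (Gamma_trunc m) @^-1` [set` `]4 * t, +oo[]); last first.
    by apply/seteqP; split=> w /=; rewrite in_itv/= andbT.
  by rewrite -[X in measurable X]setTI; exact: mGm.
- move=> l; rewrite (_ : [set w | _] = (fun w => \sum_(i < m) chaos_partial X F i l w ^+ 2) @^-1` [set` `]t, +oo[]); last first.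
    by apply/seteqP; split=> w /=; rewrite in_itv/= andbT.
  by rewrite -[X in measurable X]setTI; exact: mV.
- by move=> l; case: (iW m l).
- move=> l w /= h1 h2; have := G_le m l w; move: h1 h2.
  by move: (Gamma_trunc m w) (W m l w) (\sum_(i < m) _) => a b c h1 h2 h3; lra.
- by move=> l l0; exact: (chaos_partial_tail iidX hF sf cF cLF F1 p m l0 t0).
Qed.

(** The bound for truncations is uniform in m, so it passes to the increasing union of the
    events. *)
Lemma Gamma_tail p (t : R) : 0 < t ->
  (P [set w | ((4 * t)%:E < Gamma X F w)%E] <= ((2 * p.+1)%:R ^+ (2 * p.+1) * 4 ^+ p.+1 * (t^-1) ^+ p.+1)%:E)%E.
Proof.
move=> t0; set K := (X in (_ <= X)%E).
pose A m := [set w | 4 * t < Gamma_trunc m w].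
have mA m : measurable (A m).
  rewrite (_ : A m = (Gamma_trunc m) @^-1` [set` `]4 * t, +oo[]); last first.
    by apply/seteqP; split=> w /=; rewrite in_itv/= andbT.
  by rewrite -[X in measurable X]setTI; exact: mGm.
have ndA : nondecreasing_seq A.
  apply/nondecreasing_seqP => m; apply/subsetPset => w; rewrite /A/= => h; apply: (lt_le_trans h).
  by rewrite /Gamma_trunc big_ord_recr/= lerDl sqr_ge0.
have mU : measurable (\bigcup_m A m) by exact: bigcup_measurable.
apply: (@le_trans _ _ (P (\bigcup_m A m))).
  apply: le_measure; rewrite ?inE//.
    by rewrite -[X in measurable X]setTI; exact: emeasurable_fun_o_infty.
  move=> w /= h; apply: contrapT => nA; move: h; apply/negP; rewrite -leNgt.
  apply: lime_le; first by apply: is_cvg_nneseries => i _ _; rewrite lee_fin sqr_ge0.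
  apply: nearW => m; rewrite big_mkord sumEFin lee_fin leNgt; apply/negP => h; apply: nA.
  by exists m.
have c := @nondecreasing_cvg_mu _ _ _ P A mA mU ndA.
rewrite -(cvg_lim _ c)//; apply: lime_le; first by apply/cvg_ex; exists (P (\bigcup_m A m)).
by apply: nearW => m; exact: Gamma_trunc_tail.
Qed.

Lemma integrable_Gamma_neg theta : theta <= 0 ->
  P.-integrable setT (fun w => inv_power (Gamma X F w) theta).
Proof.
move=> th0; pose s := - theta; have s0 : 0 <= s by rewrite oppr_ge0.
(* With p + 1 > s, the tail at height 4 2^k decays like 2^(-(p+1) k), faster than the values 2^(s k)
   grow. *)
pose p := Num.trunc s; have sp : s < p.+1%:R := truncnS_gt _.
have pX (x : R) k : 0 <= x -> (x ^+ k) `^ s = (x `^ s) ^+ k.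
  by move=> x0; elim: k => [|k IH]; rewrite ?expr0 ?powR1// !exprS powRM ?exprn_ge0// IH.
apply: (@integrable_of_tails _ _ _ P _ (4 `^ s) (2 `^ s) ((2 * p.+1)%:R ^+ (2 * p.+1) * 4 ^+ p.+1) (2^-1 ^+ p.+1)) => //.
- by rewrite -[leLHS](powRr0 2) ler_powR// ler1n.
- by rewrite exprVn -powR_mulrn// ltr_pdivrMr ?powR_gt0// mul1r powR2_lt.
move=> k; have t0 : 0 < 2 ^+ k :> R by exact: exprn_gt0.
apply: le_trans (le_trans (Gamma_tail p t0) _); last first.
  by rewrite lee_fin -exprVn -!exprM (mulnC p.+1).
apply: le_measure; rewrite ?inE.
- by rewrite -[X in measurable X]setTI; exact: emeasurable_fun_o_infty.
- by rewrite -[X in measurable X]setTI; exact: emeasurable_fun_o_infty.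
move=> w /= h; rewrite ltNge; apply/negP => h2; move: h; apply/negP; rewrite -leNgt.
have t40 : 0 <= 4 * 2 ^+ k :> R by rewrite mulr_ge0// ltW.
by apply: (le_trans (inv_power_le_neg t40 th0 (G0 w) h2)); rewrite -/s powRM ?(ltW t0)// pX.
Qed.

(** Sampling the small ball estimate at z = 2^(-k) gives b delta = 2^(8 N theta - (6 N - 15)), which
    is below 1 exactly when 15 < N (6 - 8 theta). *)
Lemma integrable_Gamma_pos theta N : 0 < theta -> (4 <= N)%N -> 15 < N%:R * (6 - 8 * theta) ->
  P.-integrable setT (EFin \o (fun w => F w ^+ 4)) -> \int[P]_w (F w ^+ 4) < 3 + (8 * N%:R ^+ 2)^-1 ->
  P.-integrable setT (fun w => inv_power (Gamma X F w) theta).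
Proof.
move=> th0 N4 Nth F4 hF4.
have N0 : (0 < N)%N by exact: leq_trans N4.
have [m [g hg]] := chaos_rank_large iidX hF sf cF cLF F1 F4 N0 hF4.
have [C C0 hC] := chaos_small_ball iidX N4 hg.
have pX (x : R) k : 0 <= x -> (x ^+ k) `^ theta = (x `^ theta) ^+ k.
  by move=> x0; elim: k => [|k IH]; rewrite ?expr0 ?powR1// !exprS powRM ?exprn_ge0// IH.
pose q : R := 2^-1 ^+ (8 * N); have q0 : 0 < q by exact: exprn_gt0.
have N15 : (15 <= 6 * N)%N by apply: leq_trans (_ : 6 * 4 <= _)%N; rewrite // leq_mul2l.
have qE : q `^ theta = 2 `^ (- ((8 * N)%:R * theta)).
  by rewrite /q -powR_mulrn// -powRrM -powR_inv1// -powRrM mulN1r.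
have dE : 2^-1 ^+ (6 * N - 15) = 2 `^ (- (6 * N - 15)%:R) :> R.
  by rewrite -powR_mulrn// -powR_inv1// -powRrM mulN1r.
apply: (@integrable_of_tails _ _ _ P _ ((4^-1 `^ theta)^-1) ((q `^ theta)^-1) C (2^-1 ^+ (6 * N - 15))) => //.
- rewrite qE powRN invrK -[leLHS](powRr0 2) ler_powR ?ler1n// mulr_ge0// ltW//.
- rewrite qE dE mulrC ltr_pdivrMr ?powR_gt0// mul1r powR2_lt// ltrN2.
  rewrite natrB// !natrM; move: Nth; move: (N%:R : R) => u Nth; lra.
move=> k; pose z : R := 2^-1 ^+ k; have z0 : 0 < z by exact: exprn_gt0.
have z1 : z <= 1 by apply: exprn_ile1 => //; rewrite invf_le1// ler1n.
have zq : z ^+ (8 * N) = q ^+ k by rewrite /z /q -!exprM mulnC.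
(* The factor 1/4 makes 2 t + 2 t = q^k, matching the two terms of [V_le]. *)
pose t : R := 4^-1 * q ^+ k; have t0 : 0 < t by rewrite mulr_gt0// exprn_gt0.
have tE : (t `^ theta)^-1 = (4^-1 `^ theta)^-1 * (q `^ theta)^-1 ^+ k.
  by rewrite /t powRM ?exprn_ge0 ?(ltW q0)// pX ?(ltW q0)// invfM exprVn.
have -> : C * (2^-1 ^+ (6 * N - 15)) ^+ k = C * z ^+ (6 * N - 15) by rewrite /z -!exprM mulnC.
apply: (@probability_limit_le _ _ _ P _ (fun l => [set w | \sum_(i < m) chaos_partial X F i l w ^+ 2 <= z ^+ (8 * N)]) (W m) t _ m) => //.
- by rewrite -[X in measurable X]setTI; exact: emeasurable_fun_o_infty.
- move=> l; rewrite (_ : [set w | _] = (fun w => \sum_(i < m) chaos_partial X F i l w ^+ 2) @^-1` [set` `]-oo, z ^+ (8 * N)]]); last first.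
    by apply/seteqP; split=> w /=; rewrite in_itv.
  by rewrite -[X in measurable X]setTI; exact: mV.
- by move=> l; case: (iW m l).
- move=> l w /= h1 h2.
  have h3 : Gamma_trunc m w < t.
    rewrite ltNge; apply/negP => h3; move: h1; apply/negP; rewrite -leNgt -tE.
    by apply: inv_power_le_pos => //; apply: le_trans (Gm_le m w); rewrite lee_fin.
  have := V_le m l w; rewrite zq; move: h3 h2; rewrite /t.
  by move: (Gamma_trunc m w) (W m l w) (\sum_(i < m) _) (q ^+ k) => a b c e h3 h2 h4; lra.
- by move=> l ml; exact: hC.
Qed.

End GammaIntegrability.

Theorem theorem3 (R : realType) (theta : R) (htheta : theta < 3 / 4) :
  exists2 eps : R, 0 < eps &
    forall (d : measure_display) (Omega : measurableType d)
      (P : probability Omega R) (X : nat -> {RV P >-> R}),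
      iid_standard_gaussian X -> generates_sigma_algebra X ->
      forall F : Omega -> R, wiener_chaos X 3 F ->
        'E_P[fun w => (F w ^+ 2)%R]%E = 1%E ->
        (kappa4 P F < eps%:E)%E ->
        P.-integrable [set: Omega] (fun w => inv_power (Gamma X F w) theta).
Proof.
have p0 : 0 < 6 - 8 * theta by lra.
(* As theta < 3/4, the gap 6 - 8 theta is positive and a large N absorbs the loss of 15 in the
   exponent; N >= 4 is required by [small_ball]. *)
pose N := maxn 4 (Num.trunc (15 / (6 - 8 * theta))).+1.
have N4 : (4 <= N)%N by exact: leq_maxl.
have Nth : 15 < N%:R * (6 - 8 * theta).
  rewrite -ltr_pdivrMr//; apply: (lt_le_trans (truncnS_gt _)).
  by rewrite ler_nat leq_maxr.
have N0 : 0 < N%:R :> R by rewrite ltr0n (leq_trans _ N4).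
(* The threshold under which [chaos_rank_large] produces a contraction of rank at least N; it
   depends on theta only through N. *)
exists ((8 * N%:R ^+ 2)^-1); first by rewrite invr_gt0 mulr_gt0// exprn_gt0.
move=> d Omega P X iid _ F chF EF2 EF4.
have [hF [nF [f [sf cF cLF]]]] := wiener_chaos_approx iid chF.
have F1 : \int[P]_w (F w ^+ 2) = 1.
  by move: EF2; rewrite unlock -(EFin_Rintegral (proj2 hF)) => -[].
have [th0|th0] := leP theta 0; first exact: (integrable_Gamma_neg iid hF sf cF cLF F1 th0).
have mF4 : measurable_fun setT (fun w => F w ^+ 4) by apply: measurable_funX; case: hF.
have F40 w : 0 <= F w ^+ 4 by rewrite (exprM _ 2 2) sqr_ge0.
have EF4' : (\int[P]_w (F w ^+ 4)%:E < (3 + (8 * N%:R ^+ 2)^-1)%:E)%E.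
  by move: EF4; rewrite /kappa4 unlock lteBlDr// -EFinD addrC.
have F4 : P.-integrable setT (EFin \o (fun w => F w ^+ 4)).
  apply/integrableP; split; first exact/measurable_EFinP.
  rewrite (eq_integral (fun w => (F w ^+ 4)%:E)); first exact: lt_trans EF4' (ltry _).
  by move=> w _ /=; rewrite ger0_norm.
apply: (integrable_Gamma_pos iid hF sf cF cLF F1 th0 N4 Nth F4).
by rewrite -lte_fin (EFin_Rintegral F4).
Qed.
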